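(* Let $X$ be a smooth connected complex variety, let $Y,Z\subset X$ be proper closed subschemes with $Y$ non-empty, and let $\beta\in\mathbb{Q}_+$. Then $$\mathrm{lct}(X,Y;\beta\cdot Z)=\min_C\Big\{\frac{\mathrm{codim}(C)+\beta\cdot\mathrm{ord}_C(Z)}{\mathrm{ord}_C(Y)}\Big\},$$ where $C$ runs over the irreducible cylinders in $X_\infty$ which do not dominate $X$; in fact, it is enough to let $C$ run only over the irreducible components of $\mathrm{Cont}^p(Y)$, for $p\ge1$ (i.e. the minimum over these is the same).
   Context: All varieties are over $\mathbb{C}$ and all points are $\mathbb{C}$-valued; $d=\dim X$; $\mathbb{Q}_+$ denotes the non-negative rationals. $X_m=\mathrm{Hom}(\mathrm{Spec}\,\mathbb{C}[t]/(t^{m+1}),X)$ is a smooth variety of dimension $d(m+1)$; $X_\infty=\varprojlim X_m=\mathrm{Hom}(\mathrm{Spec}\,\mathbb{C}[[t]],X)$ with the inverse limit of the Zariski topologies; $\psi_m:X_\infty\to X_m$ is truncation. A cylinder in $X_\infty$ is a set $C=\psi_m^{-1}(S)$ for some $m$ and some constructible $S\subseteq X_m$; $\mathrm{codim}(C)=(m+1)d-\dim S$; $C$ is irreducible iff $S$ is, and its irreducible components are the inverse images of those of $S$. $C$ dominates $X$ if $\psi_0(C)$ is dense in $X$. For $\gamma\in X_\infty$ and a closed subscheme $Y$ with ideal $\mathfrak{a}$, the pull-back of $\mathfrak{a}$ by $\gamma$ is $(t^e)$ and $\mathrm{ord}_\gamma(Y)=e$ ($=\infty$ if the pull-back is zero).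 $\mathrm{Cont}^p(Y)=\{\gamma\in X_\infty:\mathrm{ord}_\gamma(Y)=p\}$. For an irreducible cylinder $C$, $\mathrm{ord}_C(Y)$ is the constant (finite) value of $\mathrm{ord}_\gamma(Y)$ for $\gamma$ in a suitable non-empty open subcylinder of $C$. If $\mathrm{ord}_C(Y)=0$, the quotient in the claim is interpreted as $+\infty$. Generalized log canonical threshold: let $\mathfrak{a},\mathfrak{b}$ be the ideals of $Y,Z$, and let $\mu:X'\to X$ be a log resolution of $Y\cup Z$, i.e. $\mu$ is projective and birational, $X'$ is smooth, and there is a simple normal crossing divisor $\sum_iE_i$ on $X'$ with $\mathfrak{a}\cdot\mathcal{O}_{X'}=\mathcal{O}_{X'}(-\sum r_iE_i)$, $\mathfrak{b}\cdot\mathcal{O}_{X'}=\mathcal{O}_{X'}(-\sum s_iE_i)$, $K_{X'/X}=\sum k_iE_i$ ($K_{X'/X}$ is the relative canonical divisor, defined by $\det d\mu$). Then $\mathrm{lct}(X,Y;\beta\cdot Z)$ is the largest $\alpha\in\mathbb{Q}_+$ such that $k_i+1\ge\alpha r_i-\beta s_i$ for all $i$, i.e. $\min_i\frac{k_i+1+\beta s_i}{r_i}$ over $i$ with $r_i>0$; this is independent of the log resolution. *)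

(* Defs.v *)
From HB Require Import structures.
From mathcomp Require Import all_boot all_order all_algebra.
From mathcomp Require Import boolp classical_sets topology reals constructive_ereal.
From mathcomp Require Import complex.
From mathcomp Require mpoly.

Set Implicit Arguments.
Unset Strict Implicit.
Unset Printing Implicit Defensive.
Import Order.TTheory GRing.Theory Num.Theory.
Local Open Scope classical_set_scope.
Local Open Scope ring_scope.

Definition irreducible (T : topologicalType) (A : set T) : Prop :=
  A !=set0 /\ forall F G : set T, closed F -> closed G ->
    A `<=` F `|` G -> A `<=` F \/ A `<=` G.

Definition irreducible_component (T : topologicalType) (D A : set T) : Prop :=
  [/\ irreducible A, A `<=` D &
      forall B, irreducible B -> A `<=` B -> B `<=` D -> B = A].

Definition constructible (T : topologicalType) (S : set T) : Prop :=
  exists (n : nat) (U F : 'I_n -> set T),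
    (forall i, open (U i) /\ closed (F i)) /\ S = \bigcup_i (U i `&` F i).

Definition rel_closed (T : topologicalType) (S A : set T) : Prop :=
  A `<=` S /\ closure A `&` S `<=` A.

Definition irred_chain (T : topologicalType) (S : set T) (n : nat)
    (Z : nat -> set T) : Prop :=
  (forall i, (i <= n)%N -> irreducible (Z i) /\ rel_closed S (Z i)) /\
  (forall i, (i < n)%N -> Z i `<` Z i.+1).

(* The maximum of P; the default 0 is only taken when there is no maximum. *)
Definition max_nat (P : set nat) : nat :=
  xget 0%N [set n | P n /\ forall k, P k -> (k <= n)%N].

Definition krull_dim (T : topologicalType) (S : set T) : nat :=
  max_nat [set n | exists Z, irred_chain S n Z].

(* The irreducible closed sets through x correspond to the prime ideals of the
   local ring at x, so this is the Krull dimension of that ring. *)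
Definition dim_at (T : topologicalType) (x : T) : nat :=
  max_nat [set n | exists Z, irred_chain setT n Z /\ Z 0%N x].

(* A space with a sheaf of K-valued functions, as in Serre's definition of an
   algebraic variety; all points are K-rational.  The sheaf is recorded by its
   germs: [regular x f] means that f is a regular function on some
   neighbourhood of x.  The values of f away from x are irrelevant, so a section
   on an open U is any f with [regular x f] for all x in U. *)
Record fspace (K : closedFieldType) := FSpace {
  fs_space :> topologicalType ;
  regular : fs_space -> (fs_space -> K) -> Prop }.

Section Varieties.
Variable K : closedFieldType.

Definition affine (n : nat) : Type := 'I_n -> K.
HB.instance Definition _ n := gen_eqMixin (affine n).
HB.instance Definition _ n := gen_choiceMixin (affine n).
HB.instance Definition _ n := isSubBaseTopological.Build (affine n)
  [set V | exists P : mpoly.mpoly n K, V = [set a | mpoly.meval a P != 0]] id.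

Definition affine_space (n : nat) : fspace K :=
  @FSpace K (affine n) (fun a h => exists P Q : mpoly.mpoly n K,
    mpoly.meval a Q != 0 /\
    \forall b \near a, h b = mpoly.meval b P / mpoly.meval b Q).

Definition regular_on (X : fspace K) (U : set X) (f : X -> K) : Prop :=
  forall x, U x -> regular x f.

Definition morphism_on (X Y : fspace K) (U : set X) (f : X -> Y) : Prop :=
  forall x, U x -> {for x, continuous f} /\
    forall h, regular (f x) h -> regular x (h \o f).

(* f restricts to a closed immersion of the open U into the open W. *)
Definition closed_immersion (X Y : fspace K) (U : set X) (W : set Y)
    (f : X -> Y) : Prop :=
  [/\ [/\ open U, open W & forall x, U x -> W (f x)],
      forall x y, U x -> U y -> f x = f y -> x = y,
      forall x, U x -> {for x, continuous f},
      forall A, rel_closed U A -> rel_closed W (f @` A) &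
      forall x g, U x -> (regular x g <->
        exists2 h, regular (f x) h & \forall y \near x, g y = h (f y))].

Definition affine_open (X : fspace K) (U : set X) : Prop :=
  exists (n : nat) (f : X -> affine_space n), closed_immersion U setT f.

(* The diagonal is closed for the Zariski topology of X * X, whose basic open
   sets inside U * V are given by sum_i a_i(u) b_i(v) != 0. *)
Definition separated_fspace (X : fspace K) : Prop :=
  forall x y : X, x <> y ->
    exists (U V : set X) (n : nat) (a b : 'I_n -> X -> K),
      [/\ [/\ open U, U x, open V & V y],
          forall i, regular_on U (a i) /\ regular_on V (b i),
          forall z, U z -> V z -> \sum_i a i z * b i z = 0 &
          \sum_i a i x * b i y != 0].

Record variety := Variety {
  var_fspace :> fspace K ;
  var_cover : exists (n : nat) (U : 'I_n -> set var_fspace),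
    (forall i, affine_open (U i)) /\ forall x, exists i, U i x ;
  var_separated : separated_fspace var_fspace }.

(* The (germ-saturated) ideal of the local ring at x generated by G. *)
Definition germ_span (X : fspace K) (x : X) (G : set (X -> K)) : set (X -> K) :=
  [set g | exists (n : nat) (a f : 'I_n -> X -> K),
    (forall i, regular x (a i) /\ G (f i)) /\
    \forall y \near x, g y = \sum_i a i y * f i y].

(* A closed subscheme: a coherent ideal sheaf, given by its stalks. *)
Record subscheme (X : fspace K) := Subscheme {
  ideal : X -> set (X -> K) ;
  ideal_coherent : forall x : X, exists (n : nat) (f : 'I_n -> X -> K),
    \forall y \near x, (forall i, regular y (f i)) /\
                       ideal y = germ_span y (range f) }.

Definition zero_locus (X : fspace K) (Y : subscheme X) : set X :=
  [set x | forall f, ideal Y x f -> f x = 0].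

(* Y <> X as schemes (X being reduced): the ideal sheaf is not zero. *)
Definition proper_subscheme (X : fspace K) (Y : subscheme X) : Prop :=
  exists (x : X) f, ideal Y x f /\ ~ \forall y \near x, f y = 0.

(* A regular system of parameters at x, i.e. local coordinates centred at x. *)
Definition parameters (X : fspace K) (x : X) (d : nat) (z : 'I_d -> X -> K) :
    Prop :=
  [/\ d = dim_at x, forall i, regular x (z i) /\ z i x = 0 &
      forall f, regular x f -> f x = 0 -> germ_span x (range z) f].

Definition smooth (X : fspace K) : Prop :=
  forall x : X, exists (d : nat) (z : 'I_d -> X -> K), parameters x z.


Record pspace (X : fspace K) (n : nat) := PSpace {
  pbase : X ;
  pline : {vspace 'rV[K]_n.+1} ;
  pline_dim1 : \dim pline = 1%N }.

Section PSpaceTopology.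
Variables (X : fspace K) (n : nat).

(* Homogeneous coordinates, for an unspecified choice of generator. *)
Definition pcoord (p : pspace X n) (i : 'I_n.+1) : K := vpick (pline p) 0 i.

(* Homogeneous forms of degree e with coefficients in the regular functions
   on U. *)
Definition form_on (U : set X) (e : nat) (P : X -> mpoly.mpoly n.+1 K) : Prop :=
  forall x, U x -> forall m,
    (mpoly.mcoeff m (P x) != 0 -> mpoly.mdeg m = e) /\
    regular x (fun y => mpoly.mcoeff m (P y)).

Definition form_eval (P : X -> mpoly.mpoly n.+1 K) (p : pspace X n) : K :=
  mpoly.meval (pcoord p) (P (pbase p)).

HB.instance Definition _ := gen_eqMixin (pspace X n).
HB.instance Definition _ := gen_choiceMixin (pspace X n).
HB.instance Definition _ := isSubBaseTopological.Build (pspace X n)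
  [set V | exists U e P, [/\ open U, form_on U e P &
     V = [set p | U (pbase p) /\ form_eval P p != 0]]] id.

Definition proj_space : fspace K :=
  @FSpace K (pspace X n) (fun p h => exists U e P Q,
    [/\ [/\ open U, U (pbase p), form_on U e P & form_on U e Q],
        form_eval Q p != 0 &
        \forall q \near p, h q = form_eval P q / form_eval Q q]).

End PSpaceTopology.

(* An invertible sheaf, presented (through a set-theoretic trivialisation of its
   fibres) as a sheaf of K-valued functions, locally free on a nowhere zero
   function u; [sec x] is the set of germs of sections at x. *)
Definition invertible_sheaf (X : fspace K) (sec : X -> set (X -> K)) : Prop :=
  forall x : X, exists u : X -> K, \forall y \near x,
    u y != 0 /\ forall s, sec y s <-> regular y (fun w => s w / u w).

(* Projectivity in the sense of EGA: some invertible sheaf on X' defines,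
   locally over X, a closed immersion into a projective space over X.  (A closed
   immersion into P^n_X globally would be too restrictive when X is not
   quasi-projective.) *)
Definition projective_morphism (X' X : fspace K) (mu : X' -> X) : Prop :=
  morphism_on setT mu /\
  exists2 sec : X' -> set (X' -> K), invertible_sheaf sec &
    forall x : X, exists (U : set X) (n : nat) (s : 'I_n.+1 -> X' -> K)
        (f : X' -> proj_space X n),
      [/\ open U /\ U x,
          forall y, U (mu y) -> forall i, sec y (s i),
          forall y, U (mu y) ->
            pbase (f y) = mu y /\ pline (f y) = <[\row_i s i y]>%VS &
          closed_immersion (Y := proj_space X n)
            (mu @^-1` U) [set p | U (pbase p)] f].

Definition birational_morphism (X' X : fspace K) (mu : X' -> X) : Prop :=
  morphism_on setT mu /\
  exists (U : set X) (V : set X') (nu : X -> X'),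
    [/\ [/\ open U, dense U, open V & dense V],
        forall x, U x -> V (nu x) /\ mu (nu x) = x,
        forall y, V y -> U (mu y) /\ nu (mu y) = y &
        morphism_on U nu].


(* h generates the ideal of D at x; away from D this makes h a unit. *)
Definition local_equation (X : fspace K) (x : X) (D : set X) (h : X -> K) :
    Prop :=
  regular x h /\ forall g, regular x g ->
    ((\forall y \near x, D y -> g y = 0) <-> germ_span x [set h] g).

Definition snc_divisor (X : fspace K) (N : nat) (E : 'I_N -> set X) : Prop :=
  (forall i, closed (E i) /\ irreducible (E i)) /\
  forall x : X, exists (d : nat) (z : 'I_d -> X -> K) (j : 'I_N -> 'I_d),
    [/\ parameters x z,
        forall i i', E i x -> E i' x -> j i = j i' -> i = i' &
        forall i, E i x -> local_equation x (E i) (z (j i))].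

(* The stalk at x of O(- sum_i r_i E_i). *)
Definition divisor_ideal (X : fspace K) (N : nat) (E : 'I_N -> set X)
    (r : 'I_N -> nat) (x : X) : set (X -> K) :=
  [set g | exists2 h : 'I_N -> X -> K,
    forall i, local_equation x (E i) (h i) &
    germ_span x [set fun y => \prod_i h i y ^+ r i] g].

Definition pullback_ideal (X' X : fspace K) (mu : X' -> X) (Y : subscheme X)
    (x' : X') : set (X' -> K) :=
  germ_span x' [set f \o mu | f in ideal Y (mu x')].

(* A K-derivation of the local ring at x, acting on representatives. *)
Record derivation_at (X : fspace K) (x : X) (D : (X -> K) -> (X -> K)) :
    Prop := DerivationAt {
  der_regular : forall f, regular x f -> regular x (D f) ;
  der_germ : forall f g, regular x f -> (\forall y \near x, f y = g y) ->
    \forall y \near x, D f y = D g y ;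
  der_cst : forall c : K, \forall y \near x, D (fun=> c) y = 0 ;
  der_add : forall f g, regular x f -> regular x g ->
    \forall y \near x, D (fun w => f w + g w) y = D f y + D g y ;
  der_mul : forall f g, regular x f -> regular x g ->
    \forall y \near x, D (fun w => f w * g w) y = f y * D g y + g y * D f y }.

(* K_{X'/X} = sum_i k_i E_i: near every x', the ideal of sum_i k_i E_i is
   generated by the Jacobian determinant of mu, computed with the coordinate
   derivations D i = d/dz_i at x' and coordinates w at mu x'. *)
Definition relative_canonical (X' X : fspace K) (mu : X' -> X) (N : nat)
    (E : 'I_N -> set X') (k : 'I_N -> nat) : Prop :=
  forall x' : X', exists (d : nat) (z : 'I_d -> X' -> K) (w : 'I_d -> X -> K)
      (D : 'I_d -> (X' -> K) -> (X' -> K)),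
    [/\ parameters x' z, parameters (mu x') w,
        forall i, derivation_at x' (D i),
        forall i j, \forall y \near x', D i (z j) y = (i == j)%:R &
        divisor_ideal E k x' =
          germ_span x' [set fun y => \det (\matrix_(i, j) D i (w j \o mu) y)]].

Definition log_resolution (X' X : variety) (mu : X' -> X) (Y Z : subscheme X)
    (N : nat) (E : 'I_N -> set X') (r s k : 'I_N -> nat) : Prop :=
  [/\ [/\ smooth X', projective_morphism mu & birational_morphism mu],
      snc_divisor E,
      forall x', pullback_ideal mu Y x' = divisor_ideal E r x',
      forall x', pullback_ideal mu Z x' = divisor_ideal E s x' &
      relative_canonical mu E k].

(* alpha = lct(X, Y; beta Z), computed on a log resolution. *)
Definition is_lct (X : variety) (Y Z : subscheme X) (beta alpha : rat) : Prop :=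
  exists (X' : variety) (mu : X' -> X) (N : nat) (E : 'I_N -> set X')
      (r s k : 'I_N -> nat), log_resolution mu Y Z E r s k /\
    let admissible := [set a : rat | 0 <= a /\
      forall i, a * (r i)%:R - beta * (s i)%:R <= (k i)%:R + 1] in
    admissible alpha /\ forall a, admissible a -> a <= alpha.


(* phi f k is the coefficient of t^k in the image of f under a local
   K-homomorphism from the local ring at x to K[[t]], or to K[t]/(t^(m+1)) when
   lvl is [k <= m].  A morphism from the spectrum of a local ring to X is a
   point together with such a homomorphism.  [phi] is normalised to 0 where it
   is meaningless, so that arcs and jets are determined by their coefficients.
*)
Record local_hom (X : fspace K) (lvl : pred nat) (x : X)
    (phi : (X -> K) -> nat -> K) : Prop := LocalHom {
  lh_default : forall f k, ~ (regular x f /\ lvl k) -> phi f k = 0 ;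
  lh_germ : forall f g k, regular x f -> (\forall y \near x, f y = g y) ->
    phi f k = phi g k ;
  lh_local : forall f, regular x f -> phi f 0%N = f x ;
  lh_cst : forall (c : K) k, lvl k -> phi (fun=> c) k = c *+ (k == 0%N) ;
  lh_add : forall f g k, regular x f -> regular x g -> lvl k ->
    phi (fun y => f y + g y) k = phi f k + phi g k ;
  lh_mul : forall f g k, regular x f -> regular x g -> lvl k ->
    phi (fun y => f y * g y) k = \sum_(i < k.+1) phi f i * phi g (k - i)%N }.

Section JetsArcs.
Variable X : fspace K.

Record jet (m : nat) := Jet {
  jet_center : X ;
  jet_coef : (X -> K) -> nat -> K ;
  jet_hom : local_hom (fun k => (k <= m)%N) jet_center jet_coef }.

Record formal_arc := Arc {
  arc_center : X ;
  arc_coef : (X -> K) -> nat -> K ;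
  arc_hom : local_hom xpredT arc_center arc_coef }.

(* The regular functions on the jets over U: polynomials in the coefficients
   of the regular functions on U. *)
Inductive jet_function (m : nat) (U : set X) : (jet m -> K) -> Prop :=
| jf_cst c : jet_function U (fun=> c)
| jf_coef f k : regular_on U f -> jet_function U (fun j => jet_coef j f k)
| jf_add F G : jet_function U F -> jet_function U G ->
    jet_function U (fun j => F j + G j)
| jf_mul F G : jet_function U F -> jet_function U G ->
    jet_function U (fun j => F j * G j).

(* The Zariski topology of the m-th jet scheme. *)
HB.instance Definition _ m := gen_eqMixin (jet m).
HB.instance Definition _ m := gen_choiceMixin (jet m).
HB.instance Definition _ m := isSubBaseTopological.Build (jet m)
  [set V | exists U F, [/\ open U, jet_function U F &
     V = [set j | U (jet_center j) /\ F j != 0]]] id.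

Lemma truncate_hom (m : nat) (g : formal_arc) :
  local_hom (fun k => (k <= m)%N) (arc_center g)
    (fun f k => if (k <= m)%N then arc_coef g f k else 0).
Proof.
case: g => x phi [dflt germ loc cst add mul] /=; split.
- move=> f k H; case: ifP => // km; apply: dflt => -[rf _]; exact: H.
- by move=> f h k rf fh; case: ifP => // _; exact: germ.
- exact: loc.
- by move=> c k ->; rewrite cst.
- by move=> f h k rf rh ->; rewrite add.
- move=> f h k rf rh km; rewrite km mul //; apply: eq_bigr => i _.
  by rewrite (leq_trans _ km) 1?(leq_trans (leq_subr _ _) km) // -ltnS.
Qed.

Definition truncate (m : nat) (g : formal_arc) : jet m := Jet (truncate_hom m g).

(* The inverse limit of the Zariski topologies. *)
HB.instance Definition _ := gen_eqMixin formal_arc.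
HB.instance Definition _ := gen_choiceMixin formal_arc.
HB.instance Definition _ := isSubBaseTopological.Build formal_arc
  [set V | exists m (W : set (jet m)), open W /\ V = truncate m @^-1` W] id.

Definition cylinder (C : set formal_arc) : Prop :=
  exists (m : nat) (S : set (jet m)), constructible S /\ C = truncate m @^-1` S.

(* The value does not depend on the presentation of C. *)
Definition codim (C : set formal_arc) : int :=
  xget 0 [set c : int | exists (m : nat) (S : set (jet m)),
    [/\ constructible S, C = truncate m @^-1` S &
        c = (m.+1 * krull_dim [set: X])%:Z - (krull_dim S)%:Z]].

(* The 0-th truncation of an arc amounts to its centre. *)
Definition dominates (C : set formal_arc) : Prop := dense (arc_center @` C).

(* The pull-back of the ideal of Y by g is (t^e). *)
Definition arc_order (g : formal_arc) (Y : subscheme X) (e : nat) : Prop :=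
  (forall f k, ideal Y (arc_center g) f -> (k < e)%N -> arc_coef g f k = 0) /\
  exists2 f, ideal Y (arc_center g) f & arc_coef g f e != 0.

Definition contact_locus (p : nat) (Y : subscheme X) : set formal_arc :=
  [set g | arc_order g Y p].

Definition cylinder_order (C : set formal_arc) (Y : subscheme X) : nat :=
  xget 0%N [set e | exists W : set formal_arc,
    [/\ open W, cylinder (C `&` W), C `&` W !=set0 &
        forall g, (C `&` W) g -> arc_order g Y e]].

Definition contact_ratio (Y Z : subscheme X) (beta : rat) (C : set formal_arc) :
    \bar rat :=
  if cylinder_order C Y == 0%N then +oo%E
  else (((codim C)%:~R + beta * (cylinder_order C Z)%:R)
          / (cylinder_order C Y)%:R)%:E.

End JetsArcs.
End Varieties.

Definition is_minimum (A : set (\bar rat)) (v : \bar rat) : Prop :=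
  A v /\ forall w, A w -> (v <= w)%E.

(* Main.v *)
(** Let [mu : X' -> X] be the log resolution.

    Lower bound.  Let [C = psi_m^-1(S)] be an irreducible cylinder.  Since [mu]
    is projective and birational, the arcs of a dense part of [C] lift to [X'];
    if [nu_i] is the contact order of the lifts with [E_i], then
    [ord_C(Y) = sum_i nu_i r_i] and [ord_C(Z) = sum_i nu_i s_i].  A chain of
    irreducible closed subsets of [S] of length [n] provides [n] algebraically
    independent functions on the lifts, hence, in characteristic zero, [n]
    independent tangent vectors at some lift [q].  Such a vector is a derivation
    into [K[[t]]] along [q] whose values on the equation of [E_i] are divisible
    by [t^nu_i], and its effect on the coordinates of [X] is given by the
    Jacobian matrix of [mu] along [q], whose determinant has order
    [sum_i nu_i k_i].  These vectors thus lie in a space of dimension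
    [(m+1)d - sum_i nu_i (k_i+1)], so that
    [codim(C) >= sum_i nu_i (k_i+1) >= alpha ord_C(Y) - beta ord_C(Z)].

    Equality.  Maximality of [alpha] gives an [i] with [r_i > 0] and
    [k_i + 1 + beta s_i = alpha r_i].  The arcs on [X'] that cross [E_i]
    transversally at a general point have images with contact orders [r_i] and
    [s_i], and the same Jacobian computation shows that these images form a
    family of codimension at most [k_i + 1]; the component of [Cont^(r_i)(Y)]
    containing them attains the minimum. *)

From HB Require Import structures.
From mathcomp Require Import all_boot all_order all_algebra.
From mathcomp Require Import boolp classical_sets filter topology reals constructive_ereal.
From mathcomp Require Import complex perm.
From mathcomp Require mpoly.
From mathcomp Require Import finmap ring lra zify.
Require Import Defs.
Import -(notations) mpoly.
Set Implicit Arguments.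
Unset Strict Implicit.
Unset Printing Implicit Defensive.
Set Bullet Behavior "Strict Subproofs".
Import Order.TTheory GRing.Theory Num.Theory.
Local Open Scope classical_set_scope.
Local Open Scope ring_scope.

(** * Towers of polynomial rings and evaluations *)

(** A dimension is a value of [max_nat] on chain lengths, which is 0 by default when these are
    unbounded, so chains are bounded before any dimension is used. For the equality the passage from
    chains to functions is reversed: general level sets of independent functions cut out a flag
    ([irreducible_flag]), whose images form a chain of jets of [X]. Characteristic zero enters a
    second time through the chain rule along an arc, a recursion with division by [k]: arcs in a
    chart are given freely by the series of the coordinates. That parameters at a point are
    coordinates near it is derived from a chain of maximal length, whose last member fills a
    neighbourhood by Taylor expansion and Krull's intersection theorem. The rank estimate for the
    Jacobian matrix requires a modulus [t^(M+1)] with [M+1] at least [sum_i nu_i (k_i+1)], which the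
    level [m] of a cylinder need not reach. The level is therefore raised by some [e], which adds
    [d*e] free coefficients to the independent functions and the same number to the bound. *)

Section Tower.
Variables (K : numClosedFieldType) (T : Type).
Implicit Types (R : comNzRingType) (t : T -> K).

(** The coordinate ring of the points [T] is [R] modulo the null elements. It is handled only
    through [R] and the evaluations, so that adjoining a function is always the passage to
    [{poly R}]. *)
Definition null R (ev : T -> {rmorphism R -> K}) (a : R) := forall p, ev p a = 0.

Definition evX R (ev : T -> {rmorphism R -> K}) t (p : T) : {rmorphism {poly R} -> K} :=
  (horner_eval (t p) \o map_poly (ev p))%FUN.

Lemma evXE R (ev : T -> {rmorphism R -> K}) t p (q : {poly R}) : evX ev t p q = (map_poly (ev p) q).[t p].
Proof. by []. Qed.

Lemma evXC R (ev : T -> {rmorphism R -> K}) t p a : evX ev t p a%:P = ev p a.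
Proof. by rewrite evXE map_polyC hornerC. Qed.

Lemma evXX R (ev : T -> {rmorphism R -> K}) t p : evX ev t p 'X = t p.
Proof. by rewrite evXE map_polyX hornerX. Qed.

Lemma evX_null_coef R (ev : T -> {rmorphism R -> K}) t (q : {poly R}) :
  (forall i, null ev q`_i) -> null (evX ev t) q.
Proof.
move=> h p; rewrite evXE (_ : map_poly _ q = 0) ?horner0 //.
by apply/polyP => i; rewrite coef_map coef0; exact: h.
Qed.

Definition prime_ev R (ev : T -> {rmorphism R -> K}) :=
  forall a b, null ev (a * b) -> null ev a \/ null ev b.

Lemma nullD R (ev : T -> {rmorphism R -> K}) a b : null ev a -> null ev b -> null ev (a + b).
Proof. by move=> ha hb p; rewrite rmorphD ha hb addr0. Qed.
Lemma nullN R (ev : T -> {rmorphism R -> K}) a : null ev a -> null ev (- a).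
Proof. by move=> ha p; rewrite rmorphN ha oppr0. Qed.
Lemma nullM R (ev : T -> {rmorphism R -> K}) a b : null ev a -> null ev (b * a).
Proof. by move=> ha p; rewrite rmorphM ha mulr0. Qed.

Lemma prime_evX R (ev : T -> {rmorphism R -> K}) a n :
  prime_ev ev -> null ev (a ^+ n) -> (0 < n)%N -> null ev a.
Proof.
move=> pr; elim: n => // -[|n] IH; first by rewrite expr1.
by rewrite exprS => /pr[//|/IH]; exact.
Qed.

(** Repeated cancellation of leading terms after scaling by the leading coefficient of [P]. The
    bound on [S] is what allows [hom_step] to compare a quotient with a polynomial of minimal
    degree. *)
Lemma pseudo_div R (P q : {poly R}) : P != 0 -> exists k S r,
  [/\ lead_coef P ^+ k *: q = S * P + r, (size r < size P)%N &
      (size S <= (size q - size P).+1)%N].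
Proof.
move=> P0; have [n] := ubnP (size q); elim: n q => // n IH q.
rewrite ltnS => sq; have [lt|le] := ltnP (size q) (size P).
  by exists 0%N, 0, q; rewrite expr0 scale1r mul0r add0r size_poly0.
have sP : (0 < size P)%N by rewrite size_poly_gt0.
pose q' := lead_coef P *: q - lead_coef q *: ('X^(size q - size P) * P).
have sq' : (size q' < size q)%N.
  have sq0 : (0 < size q)%N by exact: leq_trans le.
  rewrite -(prednK sq0) ltnS; apply/leq_sizeP => j.
  rewrite leq_eqVlt => /orP[/eqP <-|lj].
    rewrite coefB !coefZ coefXnM (_ : ((size q).-1 < size q - size P)%N = false); last by apply/negbTE; lia.
    rewrite (_ : ((size q).-1 - (size q - size P))%N = (size P).-1);
      last by clear -le sP; lia.
    by rewrite -!lead_coefE mulrC subrr.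
  rewrite coefB !coefZ coefXnM; case: ifP => _.
    by rewrite nth_default ?mulr0 ?mulr0 ?subr0 // -(prednK sq0).
  have jq : (size q <= j)%N by rewrite -(prednK sq0).
  rewrite !nth_default ?mulr0 ?mulr0 ?subr0 //.
  by rewrite leq_subRL ?subnK // (leq_trans (leq_subr _ _)).
have [k [S [r [e lr lS]]]] := IH q' (leq_trans sq' sq).
exists k.+1, (S + lead_coef P ^+ k *: (lead_coef q *: 'X^(size q - size P))), r.
split=> //.
  by rewrite mulrDl addrAC -e exprSr -scalerA /q' scalerBr -!scalerAl subrK.
apply: leq_trans (size_polyD _ _) _; rewrite geq_max; apply/andP; split.
  by apply: leq_trans lS _; rewrite ltnS leq_sub2r // ltnW.
apply: leq_trans (size_scale_leq _ _) _; apply: leq_trans (size_scale_leq _ _) _.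
by rewrite size_polyXn.
Qed.

(** A null polynomial of least size with some non-null coefficient plays the part of the minimal
    polynomial of [t]. Its leading coefficient is not null: otherwise removing the leading term
    would give a smaller one. *)
Lemma transcendental_or_minimal R (ev : T -> {rmorphism R -> K}) t :
  (forall q : {poly R}, null (evX ev t) q -> forall i, null ev q`_i) \/
  exists P : {poly R}, [/\ null (evX ev t) P, ~ null ev (lead_coef P) &
    forall q : {poly R}, null (evX ev t) q -> (size q < size P)%N -> forall i, null ev q`_i].
Proof.
have [h|] := pselect (forall q : {poly R}, null (evX ev t) q -> forall i, null ev q`_i); first by left.
move=> /existsNP[q0 /not_implyP[nq0 /existsNP[i0 ni0]]]; right.
pose bad n := `[< exists q : {poly R}, [/\ null (evX ev t) q, size q = n & exists i, ~ null ev q`_i] >].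
have ex : exists n, bad n by exists (size q0); apply/asboolP; exists q0; split=> //; exists i0.
case: (ex_minnP ex) => n /asboolP[P [nP sP [i ni]]] minn.
have Pmin q : null (evX ev t) q -> (size q < size P)%N -> forall i, null ev q`_i.
  move=> nq lq j; apply: (@contrapT (null _ _)) => nj.
  suff /minn : bad (size q) by rewrite leqNgt -sP lq.
  by apply/asboolP; exists q; split=> //; exists j.
exists P; split=> // nl; apply: (ni).
have P0 : P != 0.
  by apply: contra_notN ni => /eqP->; rewrite coef0 => p; rewrite rmorph0.
pose q := P - lead_coef P *: 'X^((size P).-1).
have nq : null (evX ev t) q.
  apply: nullD => //; apply: nullN; apply: evX_null_coef => j p.
  by rewrite coefZ rmorphM nl mul0r.
have lq : (size q < size P)%N.
  rewrite -(prednK (n := size P)) ?size_poly_gt0 // ltnS.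
  apply/leq_sizeP => j; rewrite leq_eqVlt => /orP[/eqP <-|lj].
    by rewrite coefB coefZ coefXn eqxx mulr1 -lead_coefE subrr.
  rewrite coefB coefZ coefXn gtn_eqF // mulr0 subr0 nth_default //.
  by rewrite -(prednK (n := size P)) ?size_poly_gt0.
have [->|ne] := eqVneq i (size P).-1; first exact: nl.
by have := Pmin q nq lq i; rewrite /q coefB coefZ coefXn (negbTE ne) mulr0 subr0.
Qed.

End Tower.

(** * Extending derivations and homomorphisms by one function *)

Section Extension.
Variables (K : numClosedFieldType) (T : Type).
Implicit Types (R : comNzRingType) (t : T -> K).

(** A family of tangent vectors, one at each point; [null_der0] makes them derivations of the
    coordinate ring. *)
Record null_der R (ev : T -> {rmorphism R -> K}) (D : T -> R -> K) : Prop := NullDer {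
  null_derD : forall p a b, D p (a + b) = D p a + D p b ;
  null_derM : forall p a b, D p (a * b) = ev p a * D p b + ev p b * D p a ;
  null_der0 : forall p a, null ev a -> D p a = 0 }.

Section DerX.
Variables (R : comNzRingType) (ev : T -> {rmorphism R -> K}) (D : T -> R -> K).
Hypothesis hD : null_der ev D.

Let D0 p : D p 0 = 0.
Proof. by apply: (null_der0 hD) => q; rewrite rmorph0. Qed.

Let Dsum p I (r : seq I) (F : I -> R) : D p (\sum_(i <- r) F i) = \sum_(i <- r) D p (F i).
Proof. by elim: r => [|i r IH]; rewrite ?big_nil ?D0 // !big_cons (null_derD hD) IH. Qed.

Definition der_coef p (q : {poly R}) : {poly K} := map_poly (D p) q.

Let der_coefE p q i : (der_coef p q)`_i = D p q`_i.
Proof. by rewrite /der_coef coef_map_id0. Qed.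

(** The derivation along evaluation at [p] that is [s p * D p] on constants and takes the value
    [e p] at the variable. The factor [s] clears the denominator that an algebraic [t] imposes. *)
Definition derX t (s e : T -> K) p (q : {poly R}) : K :=
  s p * (der_coef p q).[t p] + e p * evX ev t p q^`().

Lemma der_coefM p (a b : {poly R}) : der_coef p (a * b) =
  map_poly (ev p) a * der_coef p b + map_poly (ev p) b * der_coef p a.
Proof.
apply/polyP => i; rewrite coefD !der_coefE (mulrC (map_poly (ev p) b)) !coefM Dsum -big_split /=.
apply: eq_bigr => j _; rewrite (null_derM hD) !der_coefE !coef_map /=.
by congr (_ + _); rewrite mulrC.
Qed.

Lemma derX_D t s e p a b : derX t s e p (a + b) = derX t s e p a + derX t s e p b.
Proof.
rewrite /derX (_ : der_coef p (a + b) = der_coef p a + der_coef p b).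
  by rewrite derivD rmorphD hornerD; ring.
by apply/polyP => i; rewrite coefD !der_coefE coefD (null_derD hD).
Qed.

Lemma derX_M t s e p a b :
  derX t s e p (a * b) = evX ev t p a * derX t s e p b + evX ev t p b * derX t s e p a.
Proof.
rewrite /derX der_coefM derivM !rmorphD !rmorphM hornerD !hornerM -!evXE; ring.
Qed.

Lemma derX_null_der t s e :
  (forall q, null (evX ev t) q -> forall p, derX t s e p q = 0) ->
  null_der (evX ev t) (derX t s e).
Proof. by move=> h; split=> [p a b|p a b|p a /h //]; [exact: derX_D|exact: derX_M]. Qed.

Lemma derX_null_coef t s e p (q : {poly R}) : (forall i, null ev q`_i) -> derX t s e p q = 0.
Proof.
move=> h; rewrite /derX (_ : der_coef p q = 0); last first.
  by apply/polyP => i; rewrite der_coefE coef0 (null_der0 hD).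
rewrite horner0 mulr0 add0r evX_null_coef ?mulr0 // => i p'.
by rewrite coef_deriv rmorphMn /= h mul0rn.
Qed.

Lemma derXC t s e p a : derX t s e p a%:P = s p * D p a.
Proof.
rewrite /derX derivC rmorph0 mulr0 addr0; congr (_ * _).
rewrite (_ : der_coef p a%:P = (D p a)%:P) ?hornerC //.
by apply/polyP => i; rewrite der_coefE !coefC; case: ifP.
Qed.

End DerX.

Section Step.
Variables (R : comNzRingType) (ev : T -> {rmorphism R -> K}) (t : T -> K).
Hypothesis pr : prime_ev (evX ev t).
Hypothesis n1 : ~ null ev 1.

Lemma evX_prime_base : prime_ev ev.
Proof.
move=> a b ab; have /pr[h|h] : null (evX ev t) (a%:P * b%:P).
- by move=> p; rewrite -polyCM evXC.
- by left=> p; have := h p; rewrite evXC.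
- by right=> p; have := h p; rewrite evXC.
Qed.

Lemma null_reduce (P q : {poly R}) k S (r : {poly R}) : null (evX ev t) P ->
  (forall q : {poly R}, null (evX ev t) q -> (size q < size P)%N -> forall i, null ev q`_i) ->
  lead_coef P ^+ k *: q = S * P + r -> (size r < size P)%N ->
  null (evX ev t) q -> forall i, null ev r`_i.
Proof.
move=> nP Pmin e lr nq; apply: Pmin => // p.
have -> : r = lead_coef P ^+ k *: q - S * P by rewrite e addrC addKr.
by rewrite -mul_polyC rmorphB !rmorphM nq nP !mulr0 subr0.
Qed.

(** A transcendental [t] may be given derivative 0. For an algebraic [t], applying the derivation to
    the relation [P] forces the derivative of [t], with denominator [P'] at [t]; by minimality of
    [P], and in characteristic zero, this denominator is not null. *)
Lemma derivation_step (I : Type) (D : I -> T -> R -> K) :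
  (forall i, null_der ev (D i)) ->
  exists (s : {poly R}) (D' : I -> T -> {poly R} -> K),
  [/\ ~ null (evX ev t) s, forall i, null_der (evX ev t) (D' i) &
      forall i p a, D' i p a%:P = evX ev t p s * D i p a].
Proof.
move=> hD; have [tr|[P [nP nl Pmin]]] := transcendental_or_minimal ev t.
  { exists 1, (fun i => derX ev (D i) t (fun=> 1) (fun=> 0)); split; last by move=> i p a; rewrite derXC // rmorph1.
  - by move=> h; apply: n1 => p; have := h p; rewrite !rmorph1.
  - by move=> i; apply: derX_null_der => // q nq p; apply: derX_null_coef => //; exact: tr. }
have P0 : P != 0.
  by apply: contra_notN nl => /eqP-> p; rewrite lead_coef0 rmorph0.
have sP : (1 < size P)%N.
  rewrite ltnNge; apply: contra_notN nl => /size1_polyC e p.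
  by have := nP p; rewrite e evXC lead_coefC.
have nP' : ~ null (evX ev t) P^`().
  move=> /Pmin h; apply: nl => p; have := h _ (size P).-2 p.
  rewrite lt_size_deriv // coef_deriv rmorphMn /= => /(_ isT)/eqP.
  have -> : (size P).-2.+1 = (size P).-1 by rewrite prednK // -subn1 subn_gt0.
  rewrite mulrn_eq0 -lead_coefE => /orP[|/eqP//].
  by rewrite -subn1 subn_eq0 leqNgt sP.
set c := lead_coef P.
have nc : ~ null (evX ev t) c%:P by move=> h; apply: nl => p; have := h p; rewrite evXC.
(* The extra factor [c] makes the new derivation vanish at the points where the leading coefficient
   does: pseudo-division by [P] gives no information there. *)
pose s := c%:P * P^`().
pose e i p : K := - ev p c * (der_coef (D i) p P).[t p].
exists s, (fun i => derX ev (D i) t (evX ev t ^~ s) (e i)); split.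
- by move=> /pr[].
- move=> i; apply: derX_null_der => // q nq p.
  have [k [S [r [eq lr _]]]] := pseudo_div q P0.
  have nr := null_reduce nP Pmin eq lr nq.
  have [c0|c0] := eqVneq (ev p c) 0.
    by rewrite /derX /s /e rmorphM evXC c0 oppr0 !mul0r add0r.
  have := congr1 (derX ev (D i) t (evX ev t ^~ s) (e i) p) eq.
  rewrite -mul_polyC derX_D // !derX_M // nq nP mul0r mul0r !addr0.
  have -> : derX ev (D i) t (evX ev t ^~ s) (e i) p r = 0 by exact: derX_null_coef.
  rewrite addr0.
  have -> : derX ev (D i) t (evX ev t ^~ s) (e i) p P = 0.
    by rewrite /derX /s /e rmorphM evXC; ring.
  rewrite mulr0 => /eqP; rewrite mulf_eq0 evXC rmorphXn expf_eq0 (negbTE c0) andbF /=.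
  by move/eqP.
- by move=> i p a; rewrite derXC.
Qed.

(** Extension of points, as in Chevalley's theorem. In the transcendental case [a] is a coefficient
    of [b] and almost every value of the variable will do. In the algebraic case the variable is
    sent to a root of [P], and [a] contains a non-null constant of the ideal of [P] and [b], so that
    [b] cannot vanish at the root. *)
Lemma hom_step (b : {poly R}) : ~ null (evX ev t) b ->
  exists a : R, ~ null ev a /\ forall phi : {rmorphism R -> K},
    (forall c, null ev c -> phi c = 0) -> phi a != 0 ->
    exists phi' : {rmorphism {poly R} -> K},
      [/\ forall c, phi' c%:P = phi c, forall c, null (evX ev t) c -> phi' c = 0 &
          phi' b != 0].
Proof.
move=> nb; have [tr|[P [nP nl Pmin]]] := transcendental_or_minimal ev t.
  { have [i ni] : exists i, ~ null ev b`_i.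
    by apply/existsNP => h; apply: nb; exact: evX_null_coef.
  exists b`_i; split=> // phi kphi phi0.
  have b0 : map_poly phi b != 0.
    by apply: contraNneq phi0 => /polyP/(_ i); rewrite coef_map coef0 /= => ->.
  have [x xb] : exists x, ~~ root (map_poly phi b) x.
    pose rs := mkseq (fun i => i%:R : K) (size (map_poly phi b)).
    have : ~~ all (root (map_poly phi b)) rs.
      apply/negP => h; have := max_poly_roots b0 h.
      rewrite size_mkseq ltnn => /(_ _)/negP; apply=> //.
      by rewrite map_inj_uniq ?iota_uniq // => u v /eqP; rewrite eqr_nat => /eqP.
    by rewrite -has_predC => /hasP[x _ /= hx]; exists x.
  exists (horner_eval x \o map_poly phi)%FUN; split=> //.
  - by move=> c; rewrite /= map_polyC /horner_eval hornerC.
  - move=> c nc; rewrite /= (_ : map_poly phi c = 0) ?rmorph0 //.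
    by apply/polyP => j; rewrite coef_map coef0; apply: kphi; exact: tr. }
have P0 : P != 0.
  by apply: contra_notN nl => /eqP-> p; rewrite lead_coef0 rmorph0.
have sP : (1 < size P)%N.
  rewrite ltnNge; apply: contra_notN nl => /size1_polyC e p.
  by have := nP p; rewrite e evXC lead_coefC.
(* The ideal generated by [P] and [b], up to null coefficients. Its non-null element [Q] of least
   size replaces the greatest common divisor. *)
pose J (q : {poly R}) := (exists u v : {poly R}, null (evX ev t) (q - (u * P + v * b)) /\
   forall i, null ev (q - (u * P + v * b))`_i).
pose bad n := `[< exists q : {poly R}, [/\ J q, size q = n & exists i, ~ null ev q`_i] >].
have JP : J P.
  by exists 1, 0; rewrite mul1r mul0r addr0 subrr; split=> [p|i p]; rewrite ?coef0 rmorph0.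
have ex : exists n, bad n.
  by exists (size P); apply/asboolP; exists P; split=> //; exists (size P).-1.
case: (ex_minnP ex) => n /asboolP[Q [JQ sQ [i ni]]] minn.
have Qmin (q : {poly R}) : J q -> (size q < size Q)%N -> forall i, null ev q`_i.
  move=> nq lq j; apply: (@contrapT (null _ _)) => nj.
  suff /minn : bad (size q) by rewrite leqNgt -sQ lq.
  by apply/asboolP; exists q; split=> //; exists j.
have Q0 : Q != 0 by apply: contra_notN ni => /eqP-> p; rewrite coef0 rmorph0.
have JM a q : J q -> J (a * q).
  move=> [u [v [h1 h2]]]; exists (a * u), (a * v).
  have -> : a * q - (a * u * P + a * v * b) = a * (q - (u * P + v * b)) by ring.
  split; first exact: nullM.
  move=> j; rewrite coefM => p; rewrite rmorph_sum big1 // => l _.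
  by rewrite rmorphM h2 mulr0.
have JB q1 q2 : J q1 -> J q2 -> J (q1 - q2).
  move=> [u [v [h1 h2]]] [u' [v' [h1' h2']]]; exists (u - u'), (v - v').
  have -> : q1 - q2 - ((u - u') * P + (v - v') * b) =
     (q1 - (u * P + v * b)) - (q2 - (u' * P + v' * b)) by ring.
  split; first by apply: nullD => //; apply: nullN.
  by move=> j; rewrite coefB; apply: nullD => //; apply: nullN.
have Qred (q : {poly R}) : J q -> exists k (S : {poly R}), (forall j, null ev (lead_coef Q ^+ k *: q - S * Q)`_j) /\
     (size S <= (size q - size Q).+1)%N.
  move=> Jq; have [k [S [r [e lr lS]]]] := pseudo_div q Q0.
  exists k, S; split=> //; rewrite (_ : _ - _ = r); last by rewrite e addrC addKr.
  apply: Qmin => //; rewrite (_ : r = (lead_coef Q ^+ k)%:P * q - S * Q).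
    by apply: JB; apply: JM.
  by rewrite mul_polyC e addrC addKr.
have nlQ : ~ null ev (lead_coef Q).
  move=> nlQ; apply: ni.
  have [->|ne] := eqVneq i (size Q).-1; first exact: nlQ.
  have -> : Q`_i = (Q - lead_coef Q *: 'X^((size Q).-1))`_i.
    by rewrite coefB coefZ coefXn (negbTE ne) mulr0 subr0.
  apply: Qmin.
    apply: (JB) => //; exists 0, 0; rewrite !mul0r addr0 subr0.
    have h j : null ev (lead_coef Q *: 'X^((size Q).-1))`_j.
      by move=> p; rewrite coefZ rmorphM nlQ mul0r.
    by split => //; exact: evX_null_coef.
  rewrite -(prednK (n := size Q)) ?size_poly_gt0 // ltnS.
  apply/leq_sizeP => j; rewrite leq_eqVlt => /orP[/eqP <-|lj].
    by rewrite coefB coefZ coefXn eqxx mulr1 -lead_coefE subrr.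
  rewrite coefB coefZ coefXn gtn_eqF // mulr0 subr0 nth_default //.
  by rewrite -(prednK (n := size Q)) ?size_poly_gt0.
have nXn a k : ~ null ev a -> ~ null ev (a ^+ k).
  move=> na; case: k => [|k]; first by rewrite expr0.
  by move=> /(prime_evX evX_prime_base)-/(_ isT).
have nXC a : ~ null ev a -> ~ null (evX ev t) a%:P.
  by move=> na h; apply: na => p; have := h p; rewrite evXC.
have bQ : ~ null (evX ev t) Q.
  move=> nQ; have [|k [S [h _]]] := Qred b.
    by exists 0, 1; rewrite mul0r mul1r add0r subrr; split=> [p|j p]; rewrite ?coef0 rmorph0.
  have : null (evX ev t) ((lead_coef Q ^+ k)%:P * b).
    have -> : (lead_coef Q ^+ k)%:P * b = (lead_coef Q ^+ k *: b - S * Q) + S * Q.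
      by rewrite subrK mul_polyC.
    by apply: nullD; [exact: evX_null_coef|exact: nullM].
  by move=> /pr[/nXC|//]; apply; exact: nXn.
(* Were [Q] of positive degree, [P] would be [S * Q] up to scaling and null terms, with [S] shorter
   than [P]; primality makes [S] null, against the minimality of [P]. *)
have sQ1 : (size Q <= 1)%N.
  rewrite leqNgt; apply/negP => lQ.
  have [k [S [h lS]]] := Qred P JP.
  have /pr[nS|//] : null (evX ev t) (S * Q).
    have -> : S * Q = (lead_coef Q ^+ k)%:P * P - (lead_coef Q ^+ k *: P - S * Q).
      by rewrite mul_polyC opprB addrC subrK.
    by apply: nullD; [exact: nullM|apply: nullN; exact: evX_null_coef].
  have {}lS : (size S < size P)%N.
    by apply: leq_ltn_trans lS _; move: lQ sP; clear; case: (size Q) (size P) => [|[|a]] [|[|b]] //=; lia.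
  have {}nS := Pmin _ nS lS.
  have /evX_prime_base[] : null ev (lead_coef Q ^+ k * lead_coef P); last by [].
    have -> : lead_coef Q ^+ k * lead_coef P =
      (lead_coef Q ^+ k *: P - S * Q)`_(size P).-1 + (S * Q)`_(size P).-1.
      by rewrite coefB subrK coefZ.
    apply: nullD => //; rewrite coefM => p; rewrite rmorph_sum big1 // => l _.
    by rewrite rmorphM nS mul0r.
  exact: nXn.
have Qa : Q = (Q`_0)%:P by exact: size1_polyC.
have na : ~ null ev Q`_0.
  by move=> h; apply: bQ => p; rewrite Qa evXC.
exists (lead_coef P * Q`_0); split.
  by move=> /evX_prime_base[].
move=> phi kphi; rewrite rmorphM mulf_eq0 negb_or => /andP[phic phia].
have [x /rootP xP] : exists x, root (map_poly phi P) x.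
  apply/closed_rootP; rewrite size_map_poly_id0 //.
  by apply: contraTneq sP => ->.
pose phi' : {rmorphism {poly R} -> K} := (horner_eval x \o map_poly phi)%FUN.
have phi'C c : phi' c%:P = phi c by rewrite /= map_polyC /horner_eval hornerC.
have phi'n (c : {poly R}) : (forall i, null ev c`_i) -> phi' c = 0.
  move=> nc; rewrite /= (_ : map_poly phi c = 0) ?rmorph0 //.
  by apply/polyP => j; rewrite coef_map coef0; exact: kphi.
have phi'P : phi' P = 0 by [].
have phi'0 c : null (evX ev t) c -> phi' c = 0.
  move=> nc; have [k [S [r [e lr _]]]] := pseudo_div c P0.
  have nr := null_reduce nP Pmin e lr nc.
  have := congr1 phi' e; rewrite -mul_polyC rmorphD !rmorphM phi'P mulr0 add0r.
  rewrite (phi'n _ nr) phi'C rmorphXn => /eqP.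
  by rewrite mulf_eq0 expf_eq0 (negbTE phic) andbF /= => /eqP.
exists phi'; split=> //.
have [u [v [_ h]]] := JQ.
have /eqP := phi'n _ h.
rewrite rmorphB rmorphD !rmorphM phi'P mulr0 add0r subr_eq0 Qa phi'C => /eqP e.
by apply: contraNneq phia => e0; rewrite e e0 mulr0.
Qed.

End Step.
End Extension.

Section TowerExists.
Variables (K : numClosedFieldType) (T : Type) (dom : set (T -> K)).
Hypothesis domD : forall f g, dom f -> dom g -> dom (fun p => f p + g p).
Hypothesis domM : forall f g, dom f -> dom g -> dom (fun p => f p * g p).
Hypothesis dom_prime : forall f g, dom f -> dom g -> (forall p, f p * g p = 0) ->
  (forall p, f p = 0) \/ (forall p, g p = 0).
Hypothesis inhT : inhabited T.

Lemma not_null1 (R : comNzRingType) (ev : T -> {rmorphism R -> K}) : ~ null ev 1.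
Proof. by case: inhT => p /(_ p)/eqP; rewrite rmorph1 oner_eq0. Qed.

Lemma dom_evX (R : comNzRingType) (ev : T -> {rmorphism R -> K}) t :
  (forall a, dom (fun p => ev p a)) -> dom t -> forall q, dom (fun p => evX ev t p q).
Proof.
move=> hR ht; apply: poly_ind => [|q c IH].
  by rewrite (_ : (fun p => _) = (fun p => ev p 0)) //; apply/funext => p; rewrite !rmorph0.
rewrite (_ : (fun p => _) = (fun p => evX ev t p q * t p + ev p c)).
  by apply: domD => //; apply: domM.
by apply/funext => p; rewrite rmorphD rmorphM evXX evXC.
Qed.

Lemma dom_prime_ev (R : comNzRingType) (ev : T -> {rmorphism R -> K}) :
  (forall a, dom (fun p => ev p a)) -> prime_ev ev.
Proof.
by move=> h a b ab; apply: dom_prime => // p; rewrite -rmorphM; exact: ab.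
Qed.

(* The ring [R] is the polynomial ring [R0[X_0, .., X_(n-1)]], evaluated at the functions [x]. *)
Lemma tower (R0 : comNzRingType) (ev0 : T -> {rmorphism R0 -> K}) (x : nat -> T -> K) n :
  (forall a, dom (fun p => ev0 p a)) -> (forall l, (l < n)%N -> dom (x l)) ->
  exists (R : comNzRingType) (ev : T -> {rmorphism R -> K}) (io : {rmorphism R0 -> R})
    (X : nat -> R),
  [/\ (forall p a, ev p (io a) = ev0 p a) /\
      (forall l, (l < n)%N -> forall p, ev p (X l) = x l p),
      forall a, dom (fun p => ev p a),
      forall (I : Type) (D : I -> T -> R0 -> K), (forall i, null_der ev0 (D i)) ->
        exists (s : R) (D' : I -> T -> R -> K),
        [/\ ~ null ev s, forall i, null_der ev (D' i) &
            forall i p a, D' i p (io a) = ev p s * D i p a] &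
      forall b : R, ~ null ev b -> exists a : R0, ~ null ev0 a /\
        forall phi0 : {rmorphism R0 -> K}, (forall c, null ev0 c -> phi0 c = 0) ->
        phi0 a != 0 -> exists phi : {rmorphism R -> K},
          [/\ forall c, phi (io c) = phi0 c, forall c, null ev c -> phi c = 0 & phi b != 0]].
Proof.
move=> dR0; elim: n => [|n IH] dx.
  { exists R0, ev0, idfun, (fun=> 0); split=> //.
  - move=> I D hD; exists 1, D; split=> //; first exact: not_null1.
    by move=> i p a; rewrite rmorph1 mul1r.
  - by move=> b nb; exists b; split=> // phi k b0; exists phi. }
have [l ln|R [ev [io [X [[h1 h2] h3 h4 h5]]]]] := IH; first by apply: dx; rewrite ltnW.
have dX := dom_evX h3 (dx n (ltnSn n)).
exists {poly R}, (evX ev (x n)), (polyC \o io)%FUN,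
  (fun l => if (l < n)%N then (X l)%:P else 'X).
have pX := dom_prime_ev dX; have n1 : ~ null ev 1 := @not_null1 _ ev.
split=> //.
- split=> [p a|l]; first by rewrite evXC.
  rewrite ltnS leq_eqVlt => /orP[/eqP->|ln] p; first by rewrite ltnn evXX.
  by rewrite ln evXC h2.
- move=> I D /h4[s [D' [ns hD' e]]].
  have [s' [D'' [ns' hD'' e']]] := derivation_step pX n1 hD'.
  exists (s' * s%:P), D''; split=> //.
    by move=> /pX[//|h]; apply: ns => p; have := h p; rewrite evXC.
  by move=> i p a; rewrite e' e rmorphM evXC mulrA.
- move=> b /(hom_step pX n1)[a [na ha]].
  have [a0 [na0 ha0]] := h5 a na.
  exists a0; split=> // phi0 k0 /(ha0 _ k0)[phi [e1 e2 e3]].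
  have [phi' [e1' e2' e3']] := ha phi e2 e3.
  by exists phi'; split=> // c; rewrite /= e1' e1.
Qed.

End TowerExists.

Section PolynomialRing.
Variable K : comNzRingType.

Lemma mnm_subxx n (m : multinom n) : mnm_sub m m = mnm0.
Proof. by apply/mnmP => i; rewrite !mnmE subnn. Qed.

Lemma mpoly_ring_ind N (Q : mpoly N K -> Prop) :
  (forall c, Q (mpolyC N c)) -> (forall l, Q (mpolyX K (mnm1 l))) ->
  (forall a b, Q a -> Q b -> Q (a + b)) -> (forall a b, Q a -> Q b -> Q (a * b)) ->
  forall P, Q P.
Proof.
move=> QC QX QD QM P; rewrite (mpolyE P).
elim/big_ind: _ => [|//|m _]; first by rewrite -(mpolyC0 N K).
rewrite -mul_mpolyC; apply: (QM) => //; rewrite mpolyXE_id.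
elim/big_ind: _ => [|a b|l _]; [by rewrite -mpolyC1|exact: QM|].
elim: (m l) => [|e IH]; first by rewrite expr0 -mpolyC1.
by rewrite exprS; exact: QM.
Qed.

Lemma mmap_add N (R : comNzRingType) (i : {rmorphism K -> R}) (X : 'I_N -> R) (a b : mpoly N K) :
  mmap i X (a + b) = mmap i X a + mmap i X b.
Proof. exact: (rmorphD (mmap i X)). Qed.

Lemma mmap_mul N (R : comNzRingType) (i : {rmorphism K -> R}) (X : 'I_N -> R) (a b : mpoly N K) :
  mmap i X (a * b) = mmap i X a * mmap i X b.
Proof. exact: (rmorphM (mmap i X)). Qed.

Lemma meval_rmorph N (R : comNzRingType) (phi : {rmorphism R -> K}) (i : {rmorphism K -> R})
    (X : 'I_N -> R) (P : mpoly N K) :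
  (forall c, phi (i c) = c) -> phi (mmap i X P) = meval (fun l => phi (X l)) P.
Proof.
move=> h; elim/mpoly_ring_ind: P => [c|l|a b IHa IHb|a b IHa IHb].
- by rewrite mmapC h mevalC.
- by rewrite mmapX mmap1U mevalXU.
- by rewrite (mmap_add i X a b) rmorphD mevalD IHa IHb.
- by rewrite (mmap_mul i X a b) rmorphM mevalM IHa IHb.
Qed.

Lemma derivation_mmap N (R : comNzRingType) (phi : {rmorphism R -> K}) (i : {rmorphism K -> R})
    (X : 'I_N -> R) (D : R -> K) (P : mpoly N K) :
  (forall c, phi (i c) = c) -> (forall c, D (i c) = 0) ->
  (forall a b, D (a + b) = D a + D b) ->
  (forall a b, D (a * b) = phi a * D b + phi b * D a) ->
  D (mmap i X P) = \sum_l meval (fun l => phi (X l)) (mderiv l P) * D (X l).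
Proof.
move=> h D0 DD DM; elim/mpoly_ring_ind: P => [c|l|a b IHa IHb|a b IHa IHb].
- by rewrite mmapC D0 big1 // => l _; rewrite mderivC meval0 mul0r.
- rewrite mmapX mmap1U (bigD1 l) //= big1 ?addr0.
    by rewrite mderivX mnm1E eqxx scale1r mnm_subxx mpolyX0 meval1 mul1r.
  by move=> j jl; rewrite mderivX mnm1E eq_sym (negbTE jl) scale0r meval0 mul0r.
- rewrite (mmap_add i X a b) DD IHa IHb -big_split; apply: eq_bigr => l _ /=.
  by rewrite mderivD mevalD mulrDl.
- rewrite (mmap_mul i X a b) DM IHa IHb !mulr_sumr -big_split; apply: eq_bigr => l _ /=.
  rewrite mderivM mevalD !mevalM !meval_rmorph //; ring.
Qed.

End PolynomialRing.

Section Polynomials.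
Variable K : numClosedFieldType.

Lemma mpoly_closed_ind N (Q : mpoly N K -> Prop) :
  (forall c, Q (mpolyC N c)) -> (forall l, Q (mpolyX K (mnm1 l))) ->
  (forall a b, Q a -> Q b -> Q (a + b)) -> (forall a b, Q a -> Q b -> Q (a * b)) ->
  forall P, Q P.
Proof. exact: mpoly_ring_ind. Qed.

(** The vanishing ideal of [F] is prime, so the Zariski closure of [F] is irreducible; [F] itself
    may be any set of points. *)
Definition poly_prime N (F : set ('I_N -> K)) := F !=set0 /\
  forall P Q : mpoly N K, (forall p, F p -> meval p (P * Q) = 0) ->
    (forall p, F p -> meval p P = 0) \/ (forall p, F p -> meval p Q = 0).

Definition alg_indep (U : Type) (F : set U) r (g : 'I_r -> U -> K) :=
  forall H : mpoly r K, (forall p, F p -> meval (g ^~ p) H = 0) -> H = 0.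

Section Prime.
Variables (N : nat) (F : set ('I_N -> K)).
Hypothesis prF : poly_prime F.

Let T := {p | F p}.
Let dom : set (T -> K) := [set f | exists P : mpoly N K, forall p, f p = meval (sval p) P].
Let x (l : nat) (p : T) : K := oapp (sval p) 0 (insub l : option 'I_N).

(** By independence only 0 is null in the polynomial ring on the [G], so [mderiv i] is a derivation
    to start from; the coordinates of the ambient space are adjoined one after the other. *)
Lemma prime_tower r (G : 'I_r -> mpoly N K) :
  alg_indep F (fun j p => meval p (G j)) ->
  exists (R : comNzRingType) (ev : T -> {rmorphism R -> K}) (io : {rmorphism mpoly r K -> R})
    (X : 'I_N -> R),
  [/\ (forall p a, ev p (io a) = meval (fun j => meval (sval p) (G j)) a) /\
      (forall l p, ev p (X l) = sval p l),
      prime_ev ev,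
      exists (s : R) (D : 'I_r -> T -> R -> K),
        [/\ ~ null ev s, forall i, null_der ev (D i) &
            forall i p a, D i p (io a) = ev p s * meval (fun j => meval (sval p) (G j)) (mderiv i a)] &
      forall b : R, ~ null ev b -> exists a : mpoly r K, a <> 0 /\
        forall c : 'I_r -> K, meval c a != 0 -> exists phi : {rmorphism R -> K},
          [/\ forall q, phi (io q) = meval c q, forall c, null ev c -> phi c = 0 & phi b != 0]].
Proof.
move=> ind; case: (prF) => -[p0 Fp0] pr.
pose ev0 (p : T) : {rmorphism mpoly r K -> K} := meval (fun j => meval (sval p) (G j)).
have null0 a : null ev0 a -> a = 0.
  by move=> h; apply: ind => p Fp; have := h (exist _ p Fp).
have [|||//||l lN|R [ev [io [X [[h1 h2] h3 h4 h5]]]]] := @tower K T dom _ _ _ _ _ ev0 x N.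
- by move=> f g [P hP] [Q hQ]; exists (P + Q) => p; rewrite mevalD hP hQ.
- by move=> f g [P hP] [Q hQ]; exists (P * Q) => p; rewrite mevalM hP hQ.
- move=> f g [P hP] [Q hQ] h; have [p Fp||] := pr P Q.
  + by rewrite mevalM -(hP (exist _ p Fp)) -(hQ (exist _ p Fp)).
  + by move=> h'; left=> -[p Fp]; rewrite hP /= h'.
  + by move=> h'; right=> -[p Fp]; rewrite hQ /= h'.
- by constructor; exists p0.
- move=> a; rewrite /ev0 /=; elim/mpoly_closed_ind: a => [c|j|a b [P hP] [Q hQ]|a b [P hP] [Q hQ]].
  + by exists (mpolyC N c) => p; rewrite !mevalC.
  + by exists (G j) => p; rewrite mevalXU.
  + by exists (P + Q) => p; rewrite !mevalD hP hQ.
  + by exists (P * Q) => p; rewrite !mevalM hP hQ.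
- by exists (mpolyX K (mnm1 (Ordinal lN))) => p; rewrite mevalXU /x insubT.
- exists R, ev, io, (fun l => X (val l)); split.
  + split=> // l p; rewrite h2 ?ltn_ord // /x.
  by have -> : insub (val l) = Some l by exact: valK.
  + apply: (dom_prime_ev (dom := dom)) => // f g [P hP] [Q hQ] h; have [p Fp||] := pr P Q.
    * by rewrite mevalM -(hP (exist _ p Fp)) -(hQ (exist _ p Fp)).
    * by move=> h'; left=> -[p Fp]; rewrite hP /= h'.
    * by move=> h'; right=> -[p Fp]; rewrite hQ /= h'.
  + have [|s [D [ns hD e]]] := h4 'I_r (fun i p a => ev0 p (mderiv i a)).
    { move=> i; split=> [p a b|p a b|p a /null0 ->].
      * by rewrite mderivD rmorphD.
      * by rewrite mderivM rmorphD !rmorphM addrC; congr (_ + _); rewrite mulrC.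
      * by rewrite mderiv0 rmorph0. }
    by exists s, D.
  + move=> b /h5[a [na ha]]; exists a; split.
    by move=> a0; apply: na => p; rewrite a0 rmorph0.
  move=> c ca; have [|//|phi [e1 e2 e3]] := ha (meval c).
    by move=> q /null0->; rewrite rmorph0.
  by exists phi.
Qed.

(* Generic smoothness in characteristic 0: [G] is a submersion somewhere on [F]. *)
Lemma tangent_frame r (G : 'I_r -> mpoly N K) :
  alg_indep F (fun j p => meval p (G j)) ->
  exists p (v : 'I_r -> 'I_N -> K), [/\ F p,
    forall i P, (forall q, F q -> meval q P = 0) ->
      \sum_l meval p (mderiv l P) * v i l = 0 &
    forall i j, \sum_l meval p (mderiv l (G j)) * v i l = (i == j)%:R].
Proof.
move=> /prime_tower[R [ev [io [X [[h1 h2] pr [s [D [ns hD e]]] _]]]]].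
have [p /eqP sp] : exists p, ev p s <> 0 by exact/existsNP.
pose ic : {rmorphism K -> R} := (io \o @mpolyC r K)%FUN.
have eic q c : ev q (ic c) = c by rewrite /= h1 mevalC.
have evm q P : ev q (mmap ic X P) = meval (sval q) P.
  by rewrite meval_rmorph //; apply: meval_eq => l; rewrite h2.
have Dm i P : D i p (mmap ic X P) = \sum_l meval (sval p) (mderiv l P) * D i p (X l).
  { rewrite (derivation_mmap (phi := ev p)) //.
  - by apply: eq_bigr => l _; congr (_ * _); apply: meval_eq => l'; rewrite h2.
  - by move=> c; rewrite /= e mderivC meval0 mulr0.
  - exact: (null_derD (hD i)).
  - exact: (null_derM (hD i)). }
exists (sval p), (fun i l => D i p (X l) / ev p s); split; first exact: (svalP p).
  move=> i P nP; under eq_bigr do rewrite mulrA.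
  rewrite -mulr_suml -Dm (null_der0 (hD i)) ?mul0r // => q.
  by rewrite evm nP //; exact: (svalP q).
move=> i j; under eq_bigr do rewrite mulrA.
rewrite -mulr_suml -Dm.
have -> : mmap ic X (G j) = (mmap ic X (G j) - io (mpolyX K (mnm1 j))) + io (mpolyX K (mnm1 j)).
  by rewrite subrK.
rewrite (null_derD (hD i)) (null_der0 (hD i)) ?add0r; last first.
  by move=> q; rewrite rmorphB /= evm h1 mevalXU subrr.
rewrite e mderivX mnm1E eq_sym; case: eqP => [->|_].
  by rewrite scale1r mnm_subxx mpolyX0 meval1 mulr1 divff.
by rewrite scale0r meval0 mulr0 mul0r.
Qed.

(** The tower lifts evaluation at a general [c] to all coordinates. The resulting point kills the
    ideal of [F], so it is only known to lie in the closure of [F]; the non-vanishing of [b] serves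
    to bring it back into [F]. *)
Lemma lift_point r (G : 'I_r -> mpoly N K) (b : mpoly N K) :
  alg_indep F (fun j p => meval p (G j)) -> ~ (forall p, F p -> meval p b = 0) ->
  exists a : mpoly r K, a <> 0 /\ forall c, meval c a != 0 ->
    exists p, [/\ forall P, (forall q, F q -> meval q P = 0) -> meval p P = 0,
                 forall j, meval p (G j) = c j & meval p b != 0].
Proof.
move=> /prime_tower[R [ev [io [X [[h1 h2] pr _ hom]]]]] nb.
pose ic : {rmorphism K -> R} := (io \o @mpolyC r K)%FUN.
have eic q c : ev q (ic c) = c by rewrite /= h1 mevalC.
have evm q P : ev q (mmap ic X P) = meval (sval q) P.
  by rewrite meval_rmorph //; apply: meval_eq => l; rewrite h2.
have [|a [a0 ha]] := hom (mmap ic X b).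
  by move=> h; apply: nb => p Fp; have := h (exist _ p Fp); rewrite evm.
exists a; split=> // c /ha[phi [e1 e2 e3]].
have pm P : phi (mmap ic X P) = meval (fun l => phi (X l)) P.
  by rewrite meval_rmorph // => d; rewrite /= e1 mevalC.
exists (fun l => phi (X l)); split.
- by move=> P nP; rewrite -pm e2 // => q; rewrite evm nP //; exact: (svalP q).
- move=> j; rewrite -pm; apply/eqP; rewrite -subr_eq0; apply/eqP.
  have <- : phi (io (mpolyX K (mnm1 j))) = c j by rewrite e1 mevalXU.
  by rewrite -rmorphB e2 // => q; rewrite rmorphB /= evm h1 mevalXU subrr.
- by rewrite -pm.
Qed.

End Prime.
End Polynomials.

(** * Algebraic independence and Zariski closed sets *)

Section Noetherian.

Lemma minimal_element (T : Type) (R : T -> T -> Prop) (A : set T) : A !=set0 ->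
  (forall f : nat -> T, (forall n, A (f n)) -> exists n, ~ R (f n.+1) (f n)) ->
  exists2 x, A x & forall y, A y -> ~ R y x.
Proof.
move=> [x0 Ax0] dc; apply: contrapT => h.
have step (x : {x | A x}) : exists y : {x | A x}, R (sval y) (sval x).
  apply: contrapT => hx; apply: h; exists (sval x); first exact: (svalP x).
  by move=> y Ay Ryx; apply: hx; exists (exist _ y Ay).
have [g hg] := choice step.
pose f n := iter n g (exist _ x0 Ax0).
have [n] := dc (fun n => sval (f n)) (fun n => svalP (f n)).
by apply; rewrite /f iterS; exact: hg.
Qed.

Implicit Types R S : comNzRingType.

Definition span R (P : nat -> R) n (x : R) :=
  exists c : nat -> R, x = \sum_(i < n) c i * P i.

Lemma span_gen R (P : nat -> R) n i : (i < n)%N -> span P n (P i).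
Proof.
move=> ln; exists (fun j => (j == i)%:R); rewrite (bigD1 (Ordinal ln)) //= eqxx mul1r.
rewrite big1 ?addr0 // => j ji.
by rewrite (_ : (val j == i) = false) ?mul0r //; apply: contraNF ji => /eqP e; apply/eqP/val_inj.
Qed.

Lemma span0 R (P : nat -> R) n : span P n 0.
Proof. by exists (fun=> 0); rewrite big1 // => i _; rewrite mul0r. Qed.

Lemma spanD R (P : nat -> R) n x y : span P n x -> span P n y -> span P n (x + y).
Proof.
move=> [c ->] [d ->]; exists (fun i => c i + d i).
by rewrite -big_split; apply: eq_bigr => i _; rewrite mulrDl.
Qed.

Lemma spanM R (P : nat -> R) n a x : span P n x -> span P n (a * x).
Proof.
by move=> [c ->]; exists (fun i => a * c i); rewrite mulr_sumr; apply: eq_bigr => i _; rewrite mulrA.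
Qed.

Lemma span_trans R (P Q : nat -> R) m n x :
  (forall i, (i < n)%N -> span P m (Q i)) -> span Q n x -> span P m x.
Proof.
move=> h [c ->]; elim/big_ind: _ => [|a b|i _]; [exact: span0|exact: spanD|].
by apply: spanM; exact: h.
Qed.

Lemma span_mono R (P : nat -> R) m n x : (m <= n)%N -> span P m x -> span P n x.
Proof. by move=> mn; apply: span_trans => i im; apply: span_gen; exact: leq_trans mn. Qed.

(** The ascending chain condition for the ideals generated by the initial segments of a sequence. It
    is contradicted by producing a sequence none of whose terms depends on the earlier ones. *)
Definition noetherian R := forall P : nat -> R, exists n, span P n (P n).

Lemma noetherian_surj R S (f : {rmorphism R -> S}) :
  (forall y, exists x, f x = y) -> noetherian R -> noetherian S.
Proof.
move=> sf nR P; have [g hg] := choice sf.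
have [n [c e]] := nR (fun i => g (P i)); exists n, (fun i => f (c i)).
by rewrite -[LHS]hg e rmorph_sum; apply: eq_bigr => i _; rewrite rmorphM hg.
Qed.

(** Choose [f n] of least degree in the ideal of the [P m] outside the span of the earlier choices.
    A relation between the leading coefficients then yields an element of smaller degree outside
    that span. *)
Lemma noetherian_poly R : noetherian R -> noetherian {poly R}.
Proof.
move=> nR P; apply: contrapT => bad.
pose I x := exists m, span P m x.
have pick (s : seq {poly R}) : exists x : {poly R}, (forall i, (i < size s)%N -> I s`_i) ->
   [/\ I x, ~ span (nth 0 s) (size s) x &
    forall y : {poly R}, I y -> ~ span (nth 0 s) (size s) y -> (size x <= size y)%N].
  { have [hs|hs] := pselect (forall i, (i < size s)%N -> I s`_i); last by exists 0 => /hs.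
  have [m hm] : exists m, forall i, (i < size s)%N -> span P m s`_i.
    elim: (size s) hs => [|k IH] hs; first by exists 0%N.
    have [i ik|m hm] := IH; first by apply: hs; rewrite ltnS ltnW.
    have [m' hm'] := hs k (ltnSn k); exists (maxn m m') => i.
    rewrite ltnS leq_eqVlt => /orP[/eqP->|/hm]; last by apply: span_mono; exact: leq_maxl.
    by apply: span_mono hm'; exact: leq_maxr.
  pose A (x : {poly R}) := I x /\ ~ span (nth 0 s) (size s) x.
  have [|f|x [Ix nx] mx] := @minimal_element {poly R} (fun x y => (size x < size y)%N) A.
  - exists (P m); split; first by exists m.+1; exact: span_gen.
    by move=> h; apply: bad; exists m; apply: span_trans h.
  - move=> _; apply: contrapT => h.
    have {}h n : (size (f n.+1) < size (f n))%N by apply: contrapT => hn; apply: h; exists n.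
    have k n : (size (f n) + n <= size (f 0%N))%N.
      elim: n => [|n IH]; first by rewrite addn0.
      by apply: leq_trans IH; rewrite addnS -addSn leq_add2r; exact: h.
    by have := k (size (f 0%N)).+1; rewrite leqNgt ltn_addl.
  - by exists x => _; split=> // y Iy ny; rewrite leqNgt; apply/negP; exact: mx. }
have [g hg] := choice pick.
pose F := fix F n := if n is m.+1 then rcons (F m) (g (F m)) else [::].
pose f n := g (F n).
have sF n : size (F n) = n by elim: n => //= n IH; rewrite size_rcons IH.
have nF n i : (i < n)%N -> (F n)`_i = f i.
  elim: n => // n IH; rewrite ltnS /= nth_rcons sF leq_eqVlt => /orP[/eqP->|lt].
    by rewrite ltnn eqxx.
  by rewrite lt IH.
have spF n x : span (nth 0 (F n)) (size (F n)) x <-> span f n x.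
  rewrite sF; split; apply: span_trans => i ln; last by rewrite -(nF n) //; exact: span_gen.
  by rewrite nF //; exact: span_gen.
have If n : [/\ I (f n), ~ span f n (f n) &
    forall y : {poly R}, I y -> ~ span f n y -> (size (f n) <= size y)%N].
  elim/ltn_ind: n => n IH; have [|h1 h2 h3] := hg (F n).
    by move=> i; rewrite sF => ln; rewrite nF //; have [] := IH i ln.
  split=> //; first by move/spF.
  by move=> y Iy ny; apply: h3 => // /spF.
have [n [c e]] := nR (fun i => lead_coef (f i)).
have [In nn minn] := If n.
have le i : (i < n)%N -> (size (f i) <= size (f n))%N.
  by move=> ln; have [_ _] := If i; apply=> // /(span_mono (ltnW ln)).
pose y := f n - \sum_(i < n) (c i *: 'X^(size (f n) - size (f i))) * f i.
have f0 : f n != 0 by apply: contra_notN nn => /eqP->; exact: span0.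
have ny : ~ span f n y.
  move=> hy; apply: nn; rewrite -(subrK (\sum_(i < n) (c i *: 'X^(size (f n) - size (f i))) * f i) (f n)).
  by apply: spanD => //; exists (fun i => c i *: 'X^(size (f n) - size (f i))).
have Iy : I y.
  have [m hm] : exists m, forall i, (i < n.+1)%N -> span P m (f i).
    elim: n.+1 => [|k [m hm]]; first by exists 0%N.
    have [[m' hm'] _ _] := If k; exists (maxn m m') => i.
    rewrite ltnS leq_eqVlt => /orP[/eqP->|/hm]; last by apply: span_mono; exact: leq_maxl.
    by apply: span_mono hm'; exact: leq_maxr.
  exists m; apply: spanD; first exact: hm.
  rewrite -mulN1r; apply: spanM; elim/big_ind: _ => [|a b|i _]; [exact: span0|exact: spanD|].
  by apply: spanM; apply: hm; rewrite ltnS ltnW.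
have := minn y Iy ny; rewrite leqNgt => /negP; apply.
rewrite -(prednK (n := size (f n))) ?size_poly_gt0 // ltnS; apply/leq_sizeP => j.
have tail i : (i < n)%N -> ((c i *: 'X^(size (f n) - size (f i))) * f i)`_j =
    c i * (if (j < size (f n) - size (f i))%N then 0 else (f i)`_(j - (size (f n) - size (f i)))).
  by move=> ln; rewrite -scalerAl coefZ coefXnM.
have fi0 i : (i < n)%N -> (0 < size (f i))%N.
  move=> ln; rewrite size_poly_gt0; have [_ h _] := If i.
  by apply: contra_notN h => /eqP->; exact: span0.
rewrite leq_eqVlt => /orP[/eqP <-|lj].
  rewrite coefB coef_sum -lead_coefE e -sumrB big1 // => i _.
  rewrite -scalerAl coefZ coefXnM.
  have l1 := le i (ltn_ord i); have l2 := fi0 i (ltn_ord i).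
  case: ifP => [|_].
    by move: l1 l2; clear; case: (size (f i)) (size (f n)) => [|a] [|b] //=; rewrite subSS; lia.
  rewrite (_ : ((size (f n)).-1 - (size (f n) - size (f i)))%N = (size (f i)).-1) ?subrr //.
  by move: l1 l2; clear; case: (size (f i)) (size (f n)) => [|a] [|b] //=; rewrite subSS; lia.
rewrite coefB coef_sum nth_default ?sub0r ?big1 ?oppr0 //.
  move=> i _; rewrite -scalerAl coefZ coefXnM; case: ifP => _; first by rewrite mulr0.
  rewrite nth_default ?mulr0 // leq_subRL ?subnK ?le //.
    by apply: leq_trans lj; rewrite leqSpred.
  by apply: leq_trans (leq_subr _ _) _; apply: leq_trans lj; rewrite leqSpred.
by apply: leq_trans lj; rewrite leqSpred.
Qed.

Definition mpoly_of_poly N (K : comNzRingType) : {rmorphism {poly mpoly N K} -> mpoly N.+1 K} :=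
  (horner_eval (mpolyX K (mnm1 ord_max)) \o map_poly (@mwiden N K))%FUN.

Lemma mpoly_of_polyC N (K : comNzRingType) (p : mpoly N K) : mpoly_of_poly N K p%:P = mwiden p.
Proof. by rewrite /mpoly_of_poly /= /horner_eval map_polyC hornerC. Qed.

Lemma mpoly_of_polyX N (K : comNzRingType) :
  mpoly_of_poly N K 'X = mpolyX K (mnm1 ord_max).
Proof. by rewrite /mpoly_of_poly /= /horner_eval map_polyX hornerX. Qed.

Lemma mpoly_of_poly_surj N (K : comNzRingType) (p : mpoly N.+1 K) : exists q, mpoly_of_poly N K q = p.
Proof.
elim/mpoly_ring_ind: p => [c|l|a b [p <-] [q <-]|a b [p <-] [q <-]].
- by exists (mpolyC N c)%:P; rewrite mpoly_of_polyC mwidenC.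
- have [j ->|->] := unliftP ord_max l; last by exists 'X; rewrite mpoly_of_polyX.
  exists (mpolyX K (mnm1 j))%:P; rewrite mpoly_of_polyC mwidenX mnmwiden1.
  by congr (mpolyX _ (mnm1 _)); apply/val_inj; rewrite /= /bump leqNgt ltn_ord.
- by exists (p + q); rewrite rmorphD.
- by exists (p * q); rewrite rmorphM.
Qed.

Lemma noetherian_mpoly (K : fieldType) N : noetherian (mpoly N K).
Proof.
elim: N => [|N IH].
  apply: (@noetherian_surj K _ (@mpolyC 0 K)) => [p|P].
    exists (mcoeff mnm0 p); apply/mpolyP => m; have -> : m = mnm0 by apply/mnmP; case.
    by rewrite mcoeffC eqxx mulr1.
  have [P0|P0] := eqVneq (P 0%N) 0.
    by exists 0%N; exists (fun=> 0); rewrite big_ord0.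
  by exists 1%N, (fun=> P 1%N / P 0%N); rewrite big_ord1 divfK.
apply: (@noetherian_surj {poly mpoly N K} _ (mpoly_of_poly N K)); last exact: noetherian_poly.
exact: mpoly_of_poly_surj.
Qed.
End Noetherian.

Section Independence.
Variable K : numClosedFieldType.

Lemma poly_nonroot (q : {poly K}) : q != 0 -> exists x, q.[x] != 0.
Proof.
move=> q0; pose rs := mkseq (fun i => i%:R : K) (size q).
have : ~~ all (root q) rs.
  apply/negP => h; have := max_poly_roots q0 h.
  rewrite size_mkseq ltnn => /(_ _)/negP; apply=> //.
  by rewrite map_inj_uniq ?iota_uniq // => u v /eqP; rewrite eqr_nat => /eqP.
by rewrite -has_predC => /hasP[x _ /= hx]; exists x.
Qed.

Lemma mpoly0_const (H : mpoly 0 K) : exists c, H = mpolyC 0 c.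
Proof.
exists (mcoeff mnm0 H); apply/mpolyP => m; have -> : m = mnm0 by apply/mnmP; case.
by rewrite mcoeffC eqxx mulr1.
Qed.

Lemma meval_mwiden n (v : 'I_n.+1 -> K) (p : mpoly n K) :
  meval v (mwiden p) = meval (fun j => v (lift ord_max j)) p.
Proof.
elim/mpoly_closed_ind: p => [c|l|a b IHa IHb|a b IHa IHb].
- by rewrite mwidenC !mevalC.
- rewrite mwidenX mnmwiden1 !mevalXU; congr v.
  by apply/val_inj; rewrite /= /bump leqNgt ltn_ord.
- by rewrite mwidenD !mevalD IHa IHb.
- by rewrite mwidenM !mevalM IHa IHb.
Qed.

Lemma meval_of_poly n (v : 'I_n.+1 -> K) (q : {poly mpoly n K}) :
  meval v (mpoly_of_poly n K q) =
  (map_poly (meval (fun j => v (lift ord_max j))) q).[v ord_max].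
Proof.
elim/poly_ind: q => [|q c IH]; first by rewrite !rmorph0 horner0 ?meval0.
rewrite rmorphD rmorphM mpoly_of_polyX mpoly_of_polyC mevalD mevalM IH mevalXU meval_mwiden.
by rewrite rmorphD rmorphM /= map_polyX map_polyC hornerD hornerMX hornerC.
Qed.

Lemma meval_eq0 n (H : mpoly n K) : (forall v, meval v H = 0) -> H = 0.
Proof.
elim: n H => [|n IH] H hH.
  have [c e] := mpoly0_const H; move: (hH (fun=> 0)); rewrite e mevalC => ->.
  by rewrite mpolyC0.
have [q e] := mpoly_of_poly_surj H; rewrite -e; suff -> : q = 0 by rewrite rmorph0.
apply/polyP => i; rewrite coef0; apply: IH => v.
have : map_poly (meval v) q = 0.
  apply/eqP; apply: contraT => /poly_nonroot[x]; apply: contraNT => _.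
  pose w i := if unlift ord_max i is Some j then v j else x.
  have := hH w; rewrite -e meval_of_poly /w unlift_none => /eqP; apply: etrans.
  congr (_.[_] == 0); apply: eq_map_poly => p; apply: meval_eq => j.
  by rewrite liftK.
by move=> /polyP/(_ i); rewrite coef_map coef0.
Qed.

(** A relation is read as a polynomial in the last function. That function vanishes on [S n], so the
    constant coefficient is a relation there and is zero by induction; primality on [S n.+1] cancels
    the remaining factor [F n]. The class [A] of functions is abstract because both points and arcs
    are used. *)
Lemma chain_indep (U : Type) (A : set (U -> K)) (F : nat -> U -> K) (S : nat -> set U) n :
  (forall c, A (fun=> c)) -> (forall f g, A f -> A g -> A (fun p => f p + g p)) ->
  (forall f g, A f -> A g -> A (fun p => f p * g p)) ->
  (forall i f g, (i <= n)%N -> A f -> A g -> (forall p, S i p -> f p * g p = 0) ->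
     (forall p, S i p -> f p = 0) \/ (forall p, S i p -> g p = 0)) ->
  S 0%N !=set0 -> (forall i, (i < n)%N -> S i `<=` S i.+1) ->
  (forall i, (i < n)%N -> A (F i)) ->
  (forall i, (i < n)%N -> forall p, S i p -> F i p = 0) ->
  (forall i, (i < n)%N -> exists2 p, S i.+1 p & F i p != 0) ->
  alg_indep (S n) (fun j : 'I_n => F j).
Proof.
move=> AC AD AM; elim: n => [|n IH] pr [p0 Sp0] sub AF F0 F1.
  move=> H hH; have [c e] := mpoly0_const H.
  by move: (hH p0 Sp0); rewrite e mevalC => ->; rewrite mpolyC0.
have {}IH : alg_indep (S n) (fun j : 'I_n => F j).
  apply: IH; first (by move=> i f g ln; apply: pr; rewrite (leq_trans ln));
   first (by exists p0); by move=> i ln; do ?[apply: sub|apply: AF|apply: F0|apply: F1]; rewrite ltnS ltnW.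
pose ev p := meval (fun j : 'I_n => F j p).
pose evq (q : {poly mpoly n K}) p := (map_poly (ev p) q).[F n p].
have evqS q c p : evq (q * 'X + c%:P) p = evq q p * F n p + ev p c.
  by rewrite /evq rmorphD rmorphM /= map_polyX map_polyC hornerD hornerMX hornerC.
have Aev c : A (fun p => ev p c).
  { elim/mpoly_closed_ind: c => [c|l|a b IHa IHb|a b IHa IHb].
  - by rewrite (_ : (fun p => _) = fun=> c) //; apply/funext => p; rewrite /ev mevalC.
  - rewrite (_ : (fun p => _) = F l); first by apply: AF; rewrite ltnW // ltnS.
    by apply/funext => p; rewrite /ev mevalXU.
  - by rewrite (_ : (fun p => _) = fun p => ev p a + ev p b); [exact: AD|];
      apply/funext => p; rewrite /ev mevalD.
  - by rewrite (_ : (fun p => _) = fun p => ev p a * ev p b); [exact: AM|];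
      apply/funext => p; rewrite /ev mevalM. }
have Aevq q : A (evq q).
  elim/poly_ind: q => [|q c IHq].
    by rewrite (_ : evq 0 = fun=> 0) //; apply/funext => p; rewrite /evq rmorph0 horner0.
  rewrite (_ : evq _ = fun p => evq q p * F n p + ev p c); last by apply/funext => p; rewrite evqS.
  by apply: AD => //; apply: AM => //; exact: AF.
have q0 (q : {poly mpoly n K}) : (forall p, S n.+1 p -> evq q p = 0) -> q = 0.
  elim/poly_ind: q => [//|q c IHq] h.
  have c0 : c = 0.
    apply: IH => p Sp; have := h p (sub n (ltnSn n) p Sp).
    by rewrite evqS (F0 n) // mulr0 add0r.
  rewrite c0 addr0 in h *; rewrite IHq ?mul0r // => p Sp.
  have hm p' : S n.+1 p' -> evq q p' * F n p' = 0.
    move=> Sp'; rewrite -(h p' Sp').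
    by have := evqS q 0 p'; rewrite polyC0 addr0 /ev meval0 addr0 => ->.
  have [h'|h'] := pr n.+1 (evq q) (F n) (leqnn _) (Aevq q) (AF n (ltnSn n)) hm; first exact: h'.
  by have [p1 Sp1 /eqP[]] := F1 n (ltnSn n); exact: h'.
move=> H hH; have [q e] := mpoly_of_poly_surj H; rewrite -e (q0 q) ?rmorph0 // => p Sp.
have := hH p Sp; rewrite -e meval_of_poly => <-; rewrite /evq; congr (_.[_]).
apply: eq_map_poly => c; apply: meval_eq => j.
by rewrite /= /bump leqNgt ltn_ord.
Qed.

Lemma mderiv0_const n (H : mpoly n K) : (forall j, mderiv j H = 0) -> H = mpolyC n (mcoeff mnm0 H).
Proof.
move=> h; apply/mpolyP => m; rewrite mcoeffC.
have [->|m0] := eqVneq m mnm0; first by rewrite mulr1.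
rewrite mulr0; have [j mj] : exists j, (0 < m j)%N.
  apply: contrapT => nj; case/eqP: m0; apply/mnmP => j; rewrite mnm0E.
  by apply/eqP; rewrite -leqn0 leqNgt; apply/negP => mj; apply: nj; exists j.
have := congr1 (mcoeff (mnm_sub m (mnm1 j))) (h j).
rewrite mcoeff_deriv mcoeff0 submK; last by apply/mnm_lepP => i; rewrite mnm1E; case: eqP => [<-|].
by move/eqP; rewrite mulrn_eq0 /= => /eqP.
Qed.

Lemma mderiv_degree n (H : mpoly n K) d j :
  (forall m, mcoeff m H != 0 -> (mdeg m <= d.+1)%N) ->
  forall m, mcoeff m (mderiv j H) != 0 -> (mdeg m <= d)%N.
Proof.
move=> h m; rewrite mcoeff_deriv mulrn_eq0 /= => /h.
by rewrite mdegD mdeg1 addn1.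
Qed.

(* The Jacobian criterion: [w p] is the matrix of derivatives of [g] along vectors at [p]. *)
Lemma indep_of_tangents (U : Type) (S : set U) r (g : 'I_r -> U -> K) (w : U -> 'M[K]_r) :
  S !=set0 ->
  (forall H : mpoly r K, (forall p, S p -> meval (g ^~ p) H = 0) -> forall p, S p ->
     forall i, \sum_j meval (g ^~ p) (mderiv j H) * w p i j = 0) ->
  (forall H : mpoly r K, (forall p, S p -> \det (w p) != 0 -> meval (g ^~ p) H = 0) ->
     forall p, S p -> meval (g ^~ p) H = 0) ->
  alg_indep S g.
Proof.
move=> [p0 Sp0] tan dense.
(* Induction on the degree of a relation: its derivatives along the vectors vanish, so where [w p]
   is invertible all its partial derivatives do. These are relations of smaller degree, hence zero,
   and the relation is a constant. *)
suff main d (H : mpoly r K) : (forall m, mcoeff m H != 0 -> (mdeg m <= d)%N) ->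
    (forall p, S p -> meval (g ^~ p) H = 0) -> H = 0.
  move=> H; apply: (main (msize H)) => m; rewrite -mcoeff_msupp => /msize_mdeg_lt; exact: ltnW.
have cst0 c : (forall p, S p -> meval (g ^~ p) (mpolyC r c) = 0) -> c = 0.
  by move=> h; have := h p0 Sp0; rewrite mevalC.
elim: d H => [|d IH] H dH hH.
  have e : H = mpolyC r (mcoeff mnm0 H).
    apply/mpolyP => m; rewrite mcoeffC; have [->|m0] := eqVneq m mnm0; first by rewrite mulr1.
    by rewrite mulr0; apply/eqP; apply: contraTT m0 => /dH; rewrite leqn0 mdeg_eq0 negbK.
  by rewrite e (cst0 (mcoeff mnm0 H)) ?mpolyC0 // -e.
have e : H = mpolyC r (mcoeff mnm0 H).
  apply: mderiv0_const => j; apply: IH; first exact: mderiv_degree.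
  apply: dense => p Sp dp.
  have : (\row_j meval (g ^~ p) (mderiv j H)) *m (w p)^T = 0.
    apply/rowP => i; rewrite !mxE -[RHS](tan H hH p Sp i).
    by apply: eq_bigr => k _; rewrite !mxE.
  move/(congr1 (mulmx^~ (invmx (w p)^T))); rewrite mul0mx mulmxK ?unitmx_tr ?unitmxE ?unitfE //.
  by move=> /rowP/(_ j); rewrite !mxE.
by rewrite e (cst0 (mcoeff mnm0 H)) ?mpolyC0 // -e.
Qed.

End Independence.

Section ZeroSets.
Variables (K : numClosedFieldType) (N : nat).
Local Notation A := (mpoly N K).
Implicit Types (F G : set ('I_N -> K)) (I J : set A).

Definition zclosed F G := G `<=` F /\
  forall p, F p -> (forall P : A, (forall q, G q -> meval q P = 0) -> meval p P = 0) -> G p.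

(** Along a strictly decreasing sequence, polynomials that separate each set from the next would
    violate noetherianity: a combination of the earlier ones vanishes on the current set. *)
Lemma zclosed_minimal F (C : set (set ('I_N -> K))) : C !=set0 -> (forall G, C G -> zclosed F G) ->
  exists2 G, C G & forall G', C G' -> G' `<=` G -> G' = G.
Proof.
move=> C0 Cz; pose R G' G := G' `<=` G /\ exists2 p, G p & ~ G' p.
have [f Cf|G CG mG] := @minimal_element _ R C C0.
- apply: contrapT => h.
  have {}h n : R (f n.+1) (f n) by apply: contrapT => hn; apply: h; exists n.
  have sep n : exists P : A, (forall q, f n.+1 q -> meval q P = 0) /\
      exists2 p, f n p & meval p P != 0.
    have [sub [p fp np]] := h n; have [s1 s2] := Cz _ (Cf n.+1).
    apply: contrapT => hP; apply: np; apply: s2; first by have [s _] := Cz _ (Cf n); exact: s.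
    move=> P nP; apply/eqP; apply: contrapT => /negP Pp; apply: hP.
    by exists P; split=> //; exists p.
  have [P hP] := choice sep.
  have mono i n : (i <= n)%N -> f n `<=` f i.
    elim: n => [|n IH]; first by rewrite leqn0 => /eqP->.
    rewrite leq_eqVlt => /orP[/eqP->//|]; rewrite ltnS => /IH h'.
    by apply: subset_trans h'; have [] := h n.
  have [n [c e]] := @noetherian_mpoly K N P.
  have [_ [p fp /eqP[]]] := hP n; rewrite e rmorph_sum big1 // => i _.
  rewrite rmorphM /= (_ : meval p (P i) = 0) ?mulr0 //.
  by have [h1 _] := hP i; apply: h1; apply: mono fp.
- exists G => // G' CG' sub; apply/seteqP; split=> // p Gp; apply: contrapT => np.
  by apply: (mG G' CG'); split=> //; exists p.
Qed.

Definition zopen_in F (b : A) := (forall p, F p -> meval p b != 0) /\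
  forall p, (forall P : A, (forall q, F q -> meval q P = 0) -> meval p P = 0) ->
    meval p b != 0 -> F p.

(** If [P * Q] vanishes on [F] and neither factor does, the zero sets of the factors in [F] are
    smaller closed sets, so each carries a relation; the product of the two relations holds on
    [F]. *)
Lemma poly_prime_minimal r (g : 'I_r -> A) F0 F :
  zclosed F0 F -> alg_indep F (fun j p => meval p (g j)) ->
  (forall G, zclosed F0 G -> alg_indep G (fun j p => meval p (g j)) -> G `<=` F -> G = F) ->
  poly_prime F.
Proof.
move=> [FF0 zF] ind mF; split.
  apply: contrapT => /set0P/negP; rewrite negbK => /eqP e.
  have /eqP : (1 : mpoly r K) = 0 by apply: ind => p; rewrite e.
  by rewrite oner_eq0.
move=> P Q PQ; pose FP := [set p | F p /\ meval p P = 0].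
pose FQ := [set p | F p /\ meval p Q = 0].
have zFP : zclosed F0 FP.
  split=> [p [/FF0]//|p Fp h]; split; last by apply: h => q [].
  by apply: zF => // R hR; apply: h => q [/hR].
have zFQ : zclosed F0 FQ.
  split=> [p [/FF0]//|p Fp h]; split; last by apply: h => q [].
  by apply: zF => // R hR; apply: h => q [/hR].
have [iP|nP] := pselect (alg_indep FP (fun j p => meval p (g j))).
  by left=> p; rewrite -(mF FP) // => [[]//|q []].
have [iQ|nQ] := pselect (alg_indep FQ (fun j p => meval p (g j))).
  by right=> p; rewrite -(mF FQ) // => [[]//|q []].
exfalso; move/existsNP: nP => [H1 /not_implyP[h1 H10]].
move/existsNP: nQ => [H2 /not_implyP[h2 H20]].
have /eqP : H1 * H2 = 0.
  apply: ind => p Fp; rewrite mevalM.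
  have /eqP := PQ p Fp; rewrite mevalM mulf_eq0 => /orP[]/eqP e.
    by rewrite h1 ?mul0r.
  by rewrite h2 ?mulr0.
by rewrite mulf_eq0 => /orP[]/eqP.
Qed.

(** Cut with general level sets of the [g j], one function at a time, and replace each section by a
    minimal closed subset on which the remaining functions stay independent, which is irreducible.
    [lift_point] shows that a general section is large enough, and [b] keeps its points in [F]. *)
Lemma irreducible_flag r (g : 'I_r -> A) F b : poly_prime F -> zopen_in F b ->
  alg_indep F (fun j p => meval p (g j)) ->
  exists T : nat -> set ('I_N -> K), [/\ T 0%N = F,
    forall j, (j <= r)%N -> poly_prime (T j) /\ T j `<=` F,
    forall j, (j < r)%N -> T j.+1 `<=` T j &
    forall j : 'I_r, exists c, (forall p, T j.+1 p -> meval p (g j) = c) /\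
      exists2 p, T j p & meval p (g j) != c].
Proof.
elim: r g F => [|r IH] g F prF [bF oF] ind.
  by exists (fun=> F); split=> [|j _|j|[]] //; split.
have [p0 Fp0] := prF.1.
have [|a [a0 ha]] := lift_point prF (b := b) ind.
  by move=> h; have := bF p0 Fp0; rewrite h ?eqxx.
have [c ac] : exists c, meval c a != 0.
  apply: contrapT => h; apply: a0; apply: meval_eq0 => v; apply/eqP; apply: contrapT => /negP hv.
  by apply: h; exists v.
pose g' (j : 'I_r) := g (lift ord0 j).
pose X (j : 'I_r.+1) : mpoly r K :=
  if unlift ord0 j is Some j' then mpolyX K (mnm1 j') else mpolyC r (c ord0).
pose cons (c' : 'I_r -> K) (j : 'I_r.+1) := if unlift ord0 j is Some j' then c' j' else c ord0.
(* [a] with its first variable fixed at [c ord0]; it is not zero because [a] does not vanish at [c].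
   Any relation on [Fc] times [a'] vanishes identically, since a value with [a'] non-zero is taken
   on [Fc]. *)
pose a' : mpoly r K := mmap (@mpolyC r K) X a.
have ea' c' : meval c' a' = meval (cons c') a.
  rewrite /a' (meval_rmorph (phi := meval c')) /=; last by move=> d; rewrite mevalC.
  by apply: meval_eq => j; rewrite /X /cons; case: unliftP => [j' _|_]; rewrite ?mevalXU ?mevalC.
have a'0 : a' != 0.
  apply: contraNneq ac => e; have := ea' (fun j => c (lift ord0 j)); rewrite e meval0 => e'.
  apply/eqP; rewrite [RHS]e'; apply: meval_eq => j; rewrite /cons.
  by case: unliftP => [j' ->|->].
pose Fc := [set p | F p /\ meval p (g ord0) = c ord0].
pose C := [set G | zclosed F G /\ G `<=` Fc /\ alg_indep G (fun j p => meval p (g' j))].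
have C0 : C Fc.
  split; last split=> //.
    split=> [p []//|p Fp h]; split=> //; apply/eqP; rewrite -subr_eq0 -(mevalC p (c ord0)) -mevalB.
    by apply/eqP; apply: h => q [Fq e]; rewrite mevalB mevalC e subrr.
  move=> H hH; apply/eqP; have /eqP : H * a' = 0.
    apply: meval_eq0 => v; rewrite mevalM ea'.
    have [->|nz] := eqVneq (meval (cons v) a) 0; first by rewrite mulr0.
    have [p [kp gp bp]] := ha _ nz.
    have Fp : Fc p by split; [exact: oF|rewrite gp /cons unlift_none].
    have -> : meval v H = meval (fun j => meval p (g' j)) H.
      by apply: meval_eq => j; rewrite /g' gp /cons liftK.
    by rewrite hH ?mul0r.
  by rewrite mulf_eq0 (negbTE a'0) orbF.
have [||G [zG [GFc iG]] mG] := @zclosed_minimal F C; [by exists Fc|by move=> G []|].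
have GF : G `<=` F by move=> p /GFc[].
have prG : poly_prime G.
  apply: (poly_prime_minimal (F0 := F) zG iG) => G' zG' iG' sub.
  by apply: mG => //; split=> //; split=> //; exact: subset_trans GFc.
have oG : zopen_in G b.
  split=> [p /GF/bF//|p kp bp]; apply: (zG.2) => //; apply: oF => // P hP.
  by apply: kp => q /GF/hP.
have [T [T0 T1 T2 T3]] := IH g' G prG oG iG.
exists (fun j => if j is j'.+1 then T j' else F); split=> //.
- case=> [|j] lj; first by split.
  have [h1 h2] := T1 j lj; split=> //; exact: subset_trans GF.
- by case=> [|j] lj; [rewrite T0|exact: T2].
- move=> j; have [j' ->|->] := unliftP ord0 j; first exact: T3.
  exists (c ord0); split=> [p|]; first by rewrite /= T0 => /GFc[].
  apply: contrapT => h.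
  have /eqP : mpolyX K (mnm1 (@ord0 r)) - mpolyC _ (c ord0) = 0.
    apply: ind => p Fp; rewrite mevalB mevalXU mevalC; apply/eqP; rewrite subr_eq0.
    by apply: contrapT => /negP np; apply: h; exists p.
  move=> /eqP/(congr1 (meval (fun=> c ord0 + 1))); rewrite mevalB mevalXU mevalC meval0.
  by rewrite addrC addKr => /eqP; rewrite oner_eq0.
Qed.

End ZeroSets.

(** * Krull's intersection theorem *)

Section KrullIntersection.
Variables (K : numClosedFieldType) (N : nat) (c : 'I_N -> K).
Local Notation A := (mpoly N K).
Implicit Types (I J : set A) (P Q : A).

Definition mcoord (l : 'I_N) : A := mpolyX K (mnm1 l) - mpolyC N (c l).

Lemma meval_mcoord l : meval c (mcoord l) = 0.
Proof. by rewrite /mcoord mevalB mevalXU mevalC subrr. Qed.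

Lemma mpoly_taylor1 P : exists p : 'I_N -> A,
  P = mpolyC N (meval c P) + \sum_l mcoord l * p l /\
  forall l, meval c (p l) = meval c (mderiv l P).
Proof.
elim/mpoly_closed_ind: P => [d|l|a b [p [ea ha]] [q [eb hb]]|a b [p [ea ha]] [q [eb hb]]].
- exists (fun=> 0); split=> [|l]; last by rewrite mderivC !meval0.
  by rewrite mevalC big1 ?addr0 // => l _; rewrite mulr0.
- exists (fun j => (l == j)%:R); split=> [|j].
    rewrite (bigD1 l) //= eqxx mulr1 big1 ?addr0 ?mevalXU /mcoord; first by rewrite addrC subrK.
    by move=> j /negbTE; rewrite eq_sym => ->; rewrite mulr0.
  rewrite mderivX mnm1E; case: eqP => [->|_]; last by rewrite scale0r !meval0.
  by rewrite scale1r mnm_subxx mpolyX0.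
- exists (fun l => p l + q l); split=> [|l]; last by rewrite mderivD !mevalD ha hb.
  rewrite mevalD mpolyCD [in LHS]ea [in LHS]eb addrACA; congr (_ + _).
  by rewrite -big_split; apply: eq_bigr => l _; rewrite mulrDr.
- exists (fun l => p l * b + mpolyC N (meval c a) * q l); split=> [|l]; last first.
    by rewrite mevalD !mevalM mevalC ha hb mderivM mevalD !mevalM.
  rewrite mevalM mpolyCM.
  have -> : \sum_l mcoord l * (p l * b + mpolyC N (meval c a) * q l) =
    (\sum_l mcoord l * p l) * b + mpolyC N (meval c a) * \sum_l mcoord l * q l.
    rewrite mulr_suml mulr_sumr -big_split; apply: eq_bigr => l _ /=.
    by rewrite mulrDr mulrA [mpolyC _ _ * (_ * _)]mulrCA.
  set sp := \sum_l mcoord l * p l in ea *; set sq := \sum_l mcoord l * q l in eb *.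
  set ca := mpolyC N (meval c a) in ea *; set cb := mpolyC N (meval c b) in eb *.
  by rewrite eb ea; ring.
Qed.

Record ideal_set I : Prop := IdealSet {
  ideal_set0 : I 0 ;
  ideal_setD : forall x y, I x -> I y -> I (x + y) ;
  ideal_setM : forall a x, I x -> I (a * x) }.

(** The [e]-th power of the maximal ideal at [c], unfolded one factor at a time. *)
Fixpoint mpow e P : Prop :=
  if e is e'.+1 then exists p : 'I_N -> A, P = \sum_l mcoord l * p l /\ forall l, mpow e' (p l)
  else True.

Lemma mpow_ideal e : ideal_set (mpow e).
Proof.
elim: e => [|e IH]; first by split.
split=> [|x y [p [-> hp]] [q [-> hq]]|a x [p [-> hp]]].
- exists (fun=> 0); split=> [|l]; last exact: (ideal_set0 IH).
  by rewrite big1 // => l _; rewrite mulr0.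
- exists (fun l => p l + q l); split=> [|l]; last exact: (ideal_setD IH (hp l) (hq l)).
  by rewrite -big_split; apply: eq_bigr => l _; rewrite mulrDr.
- exists (fun l => a * p l); split=> [|l]; last exact: (ideal_setM IH _ (hp l)).
  by rewrite mulr_sumr; apply: eq_bigr => l _; rewrite mulrCA.
Qed.

Lemma mpow1 P : meval c P = 0 -> mpow 1 P.
Proof.
have [p [e _]] := mpoly_taylor1 P => P0; exists p; split=> //.
by rewrite {1}e P0 mpolyC0 add0r.
Qed.

Lemma mpowM e P Q : meval c P = 0 -> mpow e Q -> mpow e.+1 (P * Q).
Proof.
move=> /mpow1[p [-> _]] hQ; exists (fun l => p l * Q); split=> [|l]; last exact: (ideal_setM (mpow_ideal e)).
by rewrite mulr_suml; apply: eq_bigr => l _; rewrite mulrA.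
Qed.

(** Divide [J] by one coordinate at a time: the ideal quotient of [J] by [mcoord l] contains a
    smaller power of that coordinate. *)
Lemma mpow_sub J (n : 'I_N -> nat) s : ideal_set J -> (forall l, J (mcoord l ^+ n l)) ->
  (\sum_l n l < s)%N -> mpow s `<=` J.
Proof.
elim: s J n => [//|s IH] J n hJ hn ln P [p [-> hp]].
elim/big_ind: _ => [|a b|l _]; [exact: ideal_set0|exact: ideal_setD|].
have [nl|nl] := posnP (n l).
  by have := hn l; rewrite nl expr0 -[_ * _]mulr1; exact: (ideal_setM hJ).
apply: (IH [set x | J (mcoord l * x)] (fun j => n j - (j == l))%N) => //.
- split=> [|x y hx hy|a x hx] /=; first by rewrite mulr0; exact: ideal_set0.
    by rewrite mulrDr; exact: (ideal_setD hJ).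
  by rewrite mulrCA; exact: (ideal_setM hJ).
- move=> j /=; case: eqP => [->|_]; last by rewrite subn0; exact: (ideal_setM hJ).
  by rewrite -exprS subn1 prednK.
- rewrite -ltnS; apply: leq_ltn_trans ln; rewrite (bigD1 l) //= eqxx [X in (_ <= X)%N](bigD1 l) //=.
  rewrite -addSn subn1 prednK // leq_add2l; apply: leq_sum => j /negbTE ->.
  by rewrite subn0.
- exact: hp.
Qed.

(** Take [J] maximal among the ideals that contain [Mf] and meet [Lf] only there. Such a [J]
    contains a power of the maximal ideal at [c], hence [f] itself, so [f] is in [Mf]:
    [f = m * f + i] with [m] vanishing at [c], and [Q] is [1 - m]. *)
Lemma krull_intersection I f : ideal_set I ->
  (forall e, exists Q P, [/\ meval c Q != 0, mpow e P & I (Q * f - P)]) ->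
  exists2 Q, meval c Q != 0 & I (Q * f).
Proof.
move=> hI hf.
have IN x : I x -> I (- x) by rewrite -mulN1r; exact: (ideal_setM hI).
have hf1 e : exists2 P, mpow e P & I (f - P).
  have [Q [P [q0 hP hQ]]] := hf e; set q := meval c Q in q0.
  (* [Q] is a unit modulo the maximal ideal; [u] lies in that ideal and the geometric series in [u]
     inverts [Q] up to [u ^+ e]. *)
  pose u := 1 - mpolyC N q^-1 * Q.
  have u0 : meval c u = 0 by rewrite mevalB meval1 mevalM mevalC -/q mulVf ?subrr.
  have hu : mpow e (u ^+ e * f).
    elim: e {hP} => [//|e IHe]; rewrite exprS -mulrA; exact: mpowM.
  pose s := \sum_(i < e) u ^+ i.
  have es : 1 - u ^+ e = mpolyC N q^-1 * Q * s.
    by rewrite -opprB subrX1 -mulNr opprB /u opprB addrC subrK.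
  exists (u ^+ e * f + mpolyC N q^-1 * s * P).
    by apply: (ideal_setD (mpow_ideal e)) => //; exact: (ideal_setM (mpow_ideal e)).
  have -> : f - (u ^+ e * f + mpolyC N q^-1 * s * P) =
    (1 - u ^+ e) * f - mpolyC N q^-1 * s * P by ring.
  rewrite es (_ : _ - _ = mpolyC N q^-1 * s * (Q * f - P)); last by ring.
  exact: (ideal_setM hI).
pose Mf : set A := [set x | exists m i, [/\ meval c m = 0, I i & x = m * f + i]].
pose Lf : set A := [set x | exists m i, I i /\ x = m * f + i].
have hMf : ideal_set Mf.
  { split=> [|x y [m [i [m0 hi ->]]] [m' [i' [m'0 hi' ->]]]|a x [m [i [m0 hi ->]]]].
  - by exists 0, 0; rewrite meval0 mul0r addr0; split=> //; exact: ideal_set0.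
  - exists (m + m'), (i + i'); split; first by rewrite mevalD m0 m'0 addr0.
      exact: (ideal_setD hI).
    by rewrite mulrDl addrACA.
  - exists (a * m), (a * i); split; first by rewrite mevalM m0 mulr0.
      exact: (ideal_setM hI).
    by rewrite mulrDr mulrA. }
have noeth (C : set (set A)) : C !=set0 -> (forall J, C J -> ideal_set J) ->
   exists2 J, C J & forall J', C J' -> J `<=` J' -> J' `<=` J.
  { move=> C0 Ci; pose R (J' J : set A) := J `<=` J' /\ exists2 x, J' x & ~ J x.
  have [g Cg|J CJ mJ] := @minimal_element _ R C C0.
  - apply: contrapT => h.
    have {}h n : R (g n.+1) (g n) by apply: contrapT => hn; apply: h; exists n.
    have [P hP] := choice (fun n => let: conj _ (ex_intro2 x a b) := h n in
      ex_intro (fun x => g n.+1 x /\ ~ g n x) x (conj a b)).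
    have mono i n : (i <= n)%N -> g i `<=` g n.
      elim: n => [|n IH]; first by rewrite leqn0 => /eqP->.
      rewrite leq_eqVlt => /orP[/eqP->//|]; rewrite ltnS => /IH h'.
      by apply: subset_trans h' _; have [] := h n.
    have [n [d e]] := @noetherian_mpoly K N P.
    have [_ []] := hP n; rewrite e; have hg := Ci _ (Cg n).
    elim/big_ind: _ => [|a b|i _]; [exact: ideal_set0|exact: ideal_setD|].
    by apply: (ideal_setM hg); apply: (mono i.+1) => //; have [] := hP i.
  - exists J => // J' CJ' sub x J'x; apply: contrapT => nx.
    by apply: (mJ J' CJ'); split=> //; exists x. }
pose C : set (set A) := [set J | [/\ ideal_set J, Mf `<=` J & J `&` Lf `<=` Mf]].
have [||J [hJ MJ JL] mJ] := noeth C; [|by move=> J []|].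
  by exists Mf; split=> // x [].
(* The ideal quotients of [J] by the powers of the coordinate become stationary. Adding the
   corresponding power to [J] then keeps the intersection condition, so by maximality it already
   belongs to [J]. *)
have root l : exists n, J (mcoord l ^+ n).
  {  pose Jn n : set A := [set x | J (mcoord l ^+ n * x)].
  have hJn J' : [set Jn n | n in setT] J' -> ideal_set J'.
    { move=> [n _ <-]; split=> [|x y hx hy|a x hx]; rewrite /Jn /=.
    - by rewrite mulr0; exact: ideal_set0.
    - by rewrite mulrDr; exact: (ideal_setD hJ).
    - by rewrite mulrCA; exact: (ideal_setM hJ). }
  have [||_ [n _ <-] mn] := noeth [set Jn n | n in setT]; [|exact: hJn|].
    by exists (Jn 0%N); exists 0%N.
  have sub : Jn n.+1 `<=` Jn n.
    apply: mn; first by exists n.+1.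
    by move=> x hx; rewrite /Jn /= exprS -mulrA; exact: (ideal_setM hJ).
  exists n; pose J' : set A := [set x | exists j a, J j /\ x = j + a * mcoord l ^+ n].
  apply: (mJ J').
  - split.
    + split=> [|x y [j [a [hj ->]]] [j' [a' [hj' ->]]]|b x [j [a [hj ->]]]].
      * by exists 0, 0; rewrite mul0r addr0; split=> //; exact: ideal_set0.
      * exists (j + j'), (a + a'); split; first exact: (ideal_setD hJ).
        by rewrite mulrDl addrACA.
      * exists (b * j), (b * a); split; first exact: (ideal_setM hJ).
        by rewrite mulrDr mulrA.
    + by move=> x /MJ hx; exists x, 0; rewrite mul0r addr0.
    + move=> x [[j [a [hj ex]]] [m [i [hi ex']]]].
      have hx : J (mcoord l * x).
        apply: MJ; exists (mcoord l * m), (mcoord l * i).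
        split; first by rewrite mevalM meval_mcoord mul0r.
          exact: (ideal_setM hI).
        by rewrite ex' mulrDr mulrA.
      have : Jn n.+1 a.
        rewrite /Jn /= (_ : _ * a = mcoord l * x + (- mcoord l) * j).
          by apply: (ideal_setD hJ) => //; exact: (ideal_setM hJ).
        by rewrite ex exprS; ring.
      move=> /sub ha; apply: JL; split; last by exists m, i.
      by rewrite ex; apply: (ideal_setD hJ) => //; rewrite mulrC.
  - by move=> x hx; exists x, 0; rewrite mul0r addr0.
  - by exists 0, 1; rewrite mul1r add0r; split=> //; exact: ideal_set0. }
have [n hn] := choice root.
have [P hP hfP] := hf1 (\sum_l n l).+1.
have Jf : J f.
  rewrite -(subrK P f); apply: (ideal_setD hJ); last exact: (mpow_sub hJ hn (ltnSn _)).
  by apply: MJ; exists 0, (f - P); rewrite meval0 mul0r add0r.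
have [m [i [m0 hi e]]] : Mf f.
  by apply: JL; split=> //; exists 1, 0; rewrite mul1r addr0; split=> //; exact: ideal_set0.
exists (1 - m); first by rewrite mevalB meval1 m0 subr0 oner_eq0.
by rewrite mulrBl mul1r {1}e addrAC subrr add0r.
Qed.

End KrullIntersection.

(** * Affine coordinates *)

Section Subbase.
Variables (T : choiceType) (I : pointedType) (D : set I) (b : I -> set T).

(** Used with [good O] saying that [O] contains a neighbourhood of [a] of some prescribed kind; only
    subbasic sets then have to be examined. *)
Lemma subbase_ind (good : set T -> Prop) (a : T) : good setT ->
  (forall i, D i -> b i a -> good (b i)) ->
  (forall A B, good A -> good B -> good (A `&` B)) ->
  (forall A B, A `<=` B -> good A -> good B) ->
  forall O, [set \bigcup_(A in D') id A | D' in subset^~ (finI_from D b)] O -> O a -> good O.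
Proof.
move=> gT gb gI gS O [D' sD <-] [A D'A /= Aa].
apply: (gS A); first by move=> x Ax; exists A.
have [F sF e] := sD _ D'A; rewrite -{}e in Aa *.
have {}sF (i : I) : i \in enum_fset F -> D i by move=> /sF/set_mem.
have {}Aa (i : I) : i \in enum_fset F -> b i a by move=> iF; exact: Aa.
apply: (gS (\bigcap_(i in [set i | i \in enum_fset F]) b i)); first by [].
elim: (enum_fset F) sF Aa => [|i s IH] sF Aa.
  by apply: gS gT => x _ j.
apply: (gS (b i `&` \bigcap_(i in [set i | i \in s]) b i)).
  by move=> x [bx hx] j /=; rewrite inE => /orP[/eqP->//|/hx].
apply: gI; first by apply: gb; [apply: sF|apply: Aa]; rewrite mem_head.
by apply: IH => j js; [apply: sF|apply: Aa]; rewrite inE js orbT.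
Qed.

Lemma subbase_open i : D i -> [set \bigcup_(A in D') id A | D' in subset^~ (finI_from D b)] (b i).
Proof.
move=> Di; exists [set b i]; last by rewrite bigcup_set1.
move=> _ ->; exists [fset i]%fset; first by move=> j; rewrite inE => /eqP->; exact: mem_set.
by apply/seteqP; split=> x h; [apply: h; rewrite /= inE|move=> j; rewrite /= inE => /eqP->].
Qed.
End Subbase.

Section AffineCoordinates.
Variable K : numClosedFieldType.

Lemma affine_nbhs N (O : set (affine K N)) a : open O -> O a ->
  exists P : mpoly N K, meval a P != 0 /\ forall b, meval b P != 0 -> O b.
Proof.
move=> oO Oa.
apply: (subbase_ind (good := fun O => exists P : mpoly N K, meval a P != 0 /\
  forall b, meval b P != 0 -> O b)) oO Oa.
- by exists 1; rewrite meval1 oner_eq0.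
- by move=> i [P ->] Pa; exists P.
- move=> A B [P [Pa hP]] [Q [Qa hQ]]; exists (P * Q); rewrite mevalM mulf_neq0 //; split=> // c.
  by rewrite mevalM mulf_eq0 negb_or => /andP[/hP ? /hQ].
- by move=> A B AB [P [Pa hP]]; exists P; split=> // c /hP/AB.
Qed.

Lemma affine_openD N (P : mpoly N K) : open [set a : affine K N | meval a P != 0].
Proof. by apply: subbase_open; exists P. Qed.

Variable X : variety K.

(** What a closed immersion of [U] into affine space gives in terms of polynomials. [ac_closed] says
    that the image is closed and is the source of new points of [X]. *)
Record aff_coord (U : set X) N (x : X -> 'I_N -> K) : Prop := AffCoord {
  ac_open : open U ;
  ac_inj : forall y z, U y -> U z -> x y = x z -> y = z ;
  ac_reg : forall y g, U y -> (regular y g <-> exists P Q : mpoly N K,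
    meval (x y) Q != 0 /\ \forall z \near y, g z = meval (x z) P / meval (x z) Q) ;
  ac_nbhs : forall y O, U y -> open O -> O y -> exists P : mpoly N K,
    meval (x y) P != 0 /\ forall z, U z -> meval (x z) P != 0 -> O z ;
  ac_openD : forall P : mpoly N K, open [set y | U y /\ meval (x y) P != 0] ;
  ac_closed : forall v : 'I_N -> K,
    (forall P : mpoly N K, (forall y, U y -> meval (x y) P = 0) -> meval v P = 0) ->
    exists2 y, U y & x y = v }.

Lemma affine_open_coord U : affine_open U -> exists N (x : X -> 'I_N -> K), aff_coord U x.
Proof.
move=> [N [x [[oU _ _] inj cont cl reg]]]; exists N, x.
have oD P : open [set y | U y /\ meval (x y) P != 0].
  rewrite openE => y [Uy Py]; have : nbhs (x y) [set a : affine K N | meval a P != 0].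
    by apply: open_nbhs_nbhs; split; [exact: affine_openD|].
  move=> /(cont y Uy) h; have h' : nbhs y U by apply: open_nbhs_nbhs.
  by rewrite /interior; near=> z; split; near: z.
split=> //.
- move=> y g Uy; rewrite reg //; split=> [[h [P [Q [Q0 e]]] e']|[P [Q [Q0 e]]]].
    exists P, Q; split=> //.
    have {}e : \forall z \near y, h (x z) = meval (x z) P / meval (x z) Q by exact: (cont y Uy _ e).
    by near=> z; rewrite (near e' z) // (near e z).
  exists (fun a : affine K N => meval a P / meval a Q); first by exists P, Q; split=> //; near=> z.
  exact: e.
- move=> y O Uy oO Oy.
  have [] := cl (U `\` O).
    split=> [z [] //|z [clz Uz]]; split=> // Oz.
    have [|w [[_ nOw] Ow]] := clz O; first by apply: open_nbhs_nbhs.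
    by [].
  move=> _ clA.
  have [||P [P0 hP]] := @affine_nbhs N (~` closure (x @` (U `\` O))) (x y).
  + by apply: closed_openC; exact: closed_closure.
  + move=> h; have [|z [Uz nOz] e] := clA (x y); first by split.
    by apply: nOz; rewrite (inj z y).
  + exists P; split=> // z Uz /hP h; apply: contrapT => nOz; apply: h.
    by apply: subset_closure; exists z.
- move=> v hv; have [] := cl U; first by split=> // z [].
  move=> _ clA; apply: contrapT => h.
  have [||P [P0 hP]] := @affine_nbhs N (~` closure (x @` U)) v.
  + by apply: closed_openC; exact: closed_closure.
  + by move=> h'; have [|y Uy e] := clA v; [split|apply: h; exists y].
  + move: P0; rewrite hv ?eqxx // => y Uy; apply/eqP; apply: contrapT => /negP /hP; apply.
    by apply: subset_closure; exists y.
Unshelve. all: by end_near. Qed.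

Lemma affine_coord_at (y : X) : exists U N (x : X -> 'I_N -> K), aff_coord U x /\ U y.
Proof.
have [n [U [aU cU]]] := var_cover X; have [i Uiy] := cU y.
by have [N [x hx]] := affine_open_coord (aU i); exists (U i), N, x.
Qed.

Lemma ac_near U N (x : X -> 'I_N -> K) (P : mpoly N K) y : aff_coord U x -> U y ->
  meval (x y) P != 0 -> \forall z \near y, U z /\ meval (x z) P != 0.
Proof. by move=> hx Uy Py; apply: open_nbhs_nbhs; split; [exact: (ac_openD hx)|]. Qed.

Lemma ac_near_set U N (x : X -> 'I_N -> K) (A : set X) y : aff_coord U x -> U y ->
  nbhs y A -> exists P : mpoly N K, meval (x y) P != 0 /\
     forall z, U z -> meval (x z) P != 0 -> A z.
Proof.
move=> hx Uy; rewrite nbhsE => -[B [oB By] BA].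
by have [P [P0 hP]] := ac_nbhs hx Uy oB By; exists P; split=> // z Uz /(hP z Uz)/BA.
Qed.

Lemma regular_germ (y : X) f g : regular y f -> (\forall z \near y, f z = g z) -> regular y g.
Proof.
have [U [N [x [hx Uy]]]] := affine_coord_at y.
move=> /(ac_reg hx _ Uy)[P [Q [Q0 e]]] e'; apply/(ac_reg hx _ Uy); exists P, Q; split=> //.
by near=> z; rewrite -(near e' z) // (near e z).
Unshelve. all: by end_near. Qed.

Lemma regular_cst (y : X) c : regular y (fun=> c).
Proof.
have [U [N [x [hx Uy]]]] := affine_coord_at y.
apply/(ac_reg hx _ Uy); exists (mpolyC N c), 1; rewrite meval1 oner_eq0; split=> //.
by near=> z; rewrite mevalC meval1 divr1.
Unshelve. all: by end_near. Qed.

Lemma regular_add (y : X) f g : regular y f -> regular y g -> regular y (fun z => f z + g z).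
Proof.
have [U [N [x [hx Uy]]]] := affine_coord_at y.
move=> /(ac_reg hx _ Uy)[P [Q [Q0 e]]] /(ac_reg hx _ Uy)[P' [Q' [Q'0 e']]].
apply/(ac_reg hx _ Uy); exists (P * Q' + P' * Q), (Q * Q'); rewrite mevalM mulf_neq0 //; split=> //.
have h := ac_near hx Uy Q0; have h' := ac_near hx Uy Q'0.
near=> z; rewrite (near e z) // (near e' z) // mevalD !mevalM.
have [_ q0] : U z /\ meval (x z) Q != 0 by near: z.
have [_ q'0] : U z /\ meval (x z) Q' != 0 by near: z.
by rewrite addf_div.
Unshelve. all: by end_near. Qed.

Lemma regular_mul (y : X) f g : regular y f -> regular y g -> regular y (fun z => f z * g z).
Proof.
have [U [N [x [hx Uy]]]] := affine_coord_at y.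
move=> /(ac_reg hx _ Uy)[P [Q [Q0 e]]] /(ac_reg hx _ Uy)[P' [Q' [Q'0 e']]].
apply/(ac_reg hx _ Uy); exists (P * P'), (Q * Q'); rewrite mevalM mulf_neq0 //; split=> //.
by near=> z; rewrite (near e z) // (near e' z) // !mevalM mulf_div.
Unshelve. all: by end_near. Qed.

Lemma regular_opp (y : X) f : regular y f -> regular y (fun z => - f z).
Proof.
move=> rf; have := regular_mul (regular_cst y (-1)) rf; congr (regular y _).
by apply/funext => z; rewrite mulN1r.
Qed.

Lemma regular_sub (y : X) f g : regular y f -> regular y g -> regular y (fun z => f z - g z).
Proof. by move=> rf rg; apply: regular_add => //; exact: regular_opp. Qed.

Lemma regular_sum (y : X) (I : Type) (r : seq I) (P : pred I) (f : I -> X -> K) :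
  (forall i, P i -> regular y (f i)) -> regular y (fun z => \sum_(i <- r | P i) f i z).
Proof.
move=> h; elim: r => [|i r IH].
  by rewrite (_ : (fun z => _) = fun=> 0); [exact: regular_cst|apply/funext => z; rewrite big_nil].
have [Pi|Pi] := boolP (P i).
  rewrite (_ : (fun z => _) = fun z => f i z + \sum_(i <- r | P i) f i z).
    by apply: regular_add => //; exact: h.
  by apply/funext => z; rewrite big_cons Pi.
rewrite (_ : (fun z => _) = fun z => \sum_(i <- r | P i) f i z) //.
by apply/funext => z; rewrite big_cons (negbTE Pi).
Qed.

Lemma regular_prod (y : X) (I : Type) (r : seq I) (P : pred I) (f : I -> X -> K) :
  (forall i, P i -> regular y (f i)) -> regular y (fun z => \prod_(i <- r | P i) f i z).
Proof.
move=> h; elim: r => [|i r IH].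
  by rewrite (_ : (fun z => _) = fun=> 1); [exact: regular_cst|apply/funext => z; rewrite big_nil].
have [Pi|Pi] := boolP (P i).
  rewrite (_ : (fun z => _) = fun z => f i z * \prod_(i <- r | P i) f i z).
    by apply: regular_mul => //; exact: h.
  by apply/funext => z; rewrite big_cons Pi.
rewrite (_ : (fun z => _) = fun z => \prod_(i <- r | P i) f i z) //.
by apply/funext => z; rewrite big_cons (negbTE Pi).
Qed.

Lemma regular_exp (y : X) f n : regular y f -> regular y (fun z => f z ^+ n).
Proof.
move=> rf; elim: n => [|n IH].
  by rewrite (_ : (fun z => _) = fun=> 1); [exact: regular_cst|apply/funext => z; rewrite expr0].
by rewrite (_ : (fun z => _) = fun z => f z * f z ^+ n);
  [exact: regular_mul|apply/funext => z; rewrite exprS].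
Qed.

Lemma regular_det (y : X) n (f : X -> 'M[K]_n) :
  (forall i j, regular y (fun z => f z i j)) -> regular y (fun z => \det (f z)).
Proof.
move=> h; rewrite /determinant; apply: regular_sum => s _; apply: regular_mul.
  exact: regular_cst.
by apply: regular_prod => i _; exact: h.
Qed.

Lemma regular_neq0 (y : X) f : regular y f -> f y != 0 -> \forall z \near y, f z != 0.
Proof.
have [U [N [x [hx Uy]]]] := affine_coord_at y.
move=> /(ac_reg hx _ Uy)[P [Q [Q0 e]]]; rewrite (nbhs_singleton e) mulf_eq0 negb_or => /andP[P0 _].
have h := ac_near hx Uy P0; have h' := ac_near hx Uy Q0.
near=> z; rewrite (near e z) // mulf_neq0 ?invr_eq0 //.
  by have [] : U z /\ meval (x z) P != 0 by near: z.
by have [] : U z /\ meval (x z) Q != 0 by near: z.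
Unshelve. all: by end_near. Qed.

Lemma regular_inv (y : X) f : regular y f -> f y != 0 -> regular y (fun z => (f z)^-1).
Proof.
have [U [N [x [hx Uy]]]] := affine_coord_at y.
move=> /(ac_reg hx _ Uy)[P [Q [Q0 e]]]; rewrite (nbhs_singleton e) mulf_eq0 negb_or => /andP[P0 _].
apply/(ac_reg hx _ Uy); exists Q, P; split=> //.
by near=> z; rewrite (near e z) // invf_div.
Unshelve. all: by end_near. Qed.

Lemma regular_near (y : X) f : regular y f -> \forall z \near y, regular z f.
Proof.
have [U [N [x [hx Uy]]]] := affine_coord_at y.
move=> /(ac_reg hx _ Uy)[P [Q [Q0 e]]]; have h := ac_near hx Uy Q0.
have {}e := near_join e.
near=> z; have [Uz Qz] : U z /\ meval (x z) Q != 0 by near: z.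
apply/(ac_reg hx _ Uz); exists P, Q; split=> //.
by near: z; exact: e.
Unshelve. all: by end_near. Qed.

Lemma regular_poly U N (x : X -> 'I_N -> K) (P : mpoly N K) y : aff_coord U x -> U y ->
  regular y (fun z => meval (x z) P).
Proof.
move=> hx Uy; apply/(ac_reg hx _ Uy); exists P, 1; rewrite meval1 oner_eq0; split=> //.
by near=> z; rewrite meval1 divr1.
Unshelve. all: by end_near. Qed.

Lemma regular_coord U N (x : X -> 'I_N -> K) l y : aff_coord U x -> U y ->
  regular y (fun z => x z l).
Proof.
move=> hx Uy; have := regular_poly (mpolyX K (mnm1 l)) hx Uy; congr (regular y _).
by apply/funext => z; rewrite mevalXU.
Qed.

End AffineCoordinates.

(** * Local coordinates on smooth varieties *)

Section Irreducible.
Variable T : topologicalType.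
Implicit Types (A B O : set T).

Lemma irreducible_meet A O1 O2 : irreducible A -> open O1 -> open O2 ->
  A `&` O1 !=set0 -> A `&` O2 !=set0 -> A `&` (O1 `&` O2) !=set0.
Proof.
move=> [_ irr] o1 o2 [a [Aa Oa]] [b [Ab Ob]]; apply: contrapT => h.
have [|||sub|sub] := irr (~` O1) (~` O2).
- exact: open_closedC.
- exact: open_closedC.
- move=> x Ax; have [O1x|] := pselect (O1 x); last by left.
  by right=> O2x; apply: h; exists x.
- by apply: (sub a).
- by apply: (sub b).
Qed.

Lemma irreducibleP A : A !=set0 ->
  (forall O1 O2, open O1 -> open O2 -> A `&` O1 !=set0 -> A `&` O2 !=set0 ->
     A `&` (O1 `&` O2) !=set0) -> irreducible A.
Proof.
move=> A0 h; split=> // F G cF cG AFG; apply: contrapT => /not_orP[nF nG].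
have ex H : ~ (A `<=` H) -> A `&` ~` H !=set0.
  move=> nH; apply: contrapT => h'; apply: nH => x Ax; apply: contrapT => nx.
  by apply: h'; exists x.
have [x [Ax [nFx nGx]]] := h _ _ (closed_openC cF) (closed_openC cG) (ex _ nF) (ex _ nG).
by case: (AFG x Ax).
Qed.

Lemma irreducible_setI_open A O : irreducible A -> open O -> A `&` O !=set0 -> irreducible (A `&` O).
Proof.
move=> irr oO AO; apply: irreducibleP => // O1 O2 o1 o2 [a [[Aa Oa] h1]] [b [[Ab Ob] h2]].
have [||||x [Ax [[_ x1] [Ox x2]]]] := @irreducible_meet A (O `&` O1) (O `&` O2) irr.
- exact: openI.
- exact: openI.
- by exists a.
- by exists b.
- by exists x.
Qed.

Lemma irreducible_closure A : irreducible A -> irreducible (closure A).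
Proof.
move=> irr; apply: irreducibleP.
  by have [[a Aa] _] := irr; exists a; exact: subset_closure.
have meet O : open O -> closure A `&` O !=set0 -> A `&` O !=set0.
  by move=> oO [x [cx Ox]]; apply: cx; apply: open_nbhs_nbhs.
move=> O1 O2 o1 o2 /(meet _ o1) m1 /(meet _ o2) m2.
have [x [Ax Ox]] := irreducible_meet irr o1 o2 m1 m2.
by exists x; split=> //; exact: subset_closure.
Qed.

Lemma irreducible_set1 (x : T) : irreducible [set x].
Proof.
apply: irreducibleP; first by exists x.
by move=> O1 O2 _ _ [_ [-> h1]] [_ [-> h2]]; exists x.
Qed.

Lemma irreducible_subclosure A B : irreducible A -> A `<=` B -> B `<=` closure A -> irreducible B.
Proof.
move=> irr AB Bc; apply: irreducibleP; first by have [[a Aa] _] := irr; exists a; apply: AB.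
have meet O : open O -> B `&` O !=set0 -> A `&` O !=set0.
  by move=> oO [x [/Bc cx Ox]]; apply: cx; apply: open_nbhs_nbhs.
move=> O1 O2 o1 o2 /(meet _ o1) m1 /(meet _ o2) m2.
have [x [Ax Ox]] := irreducible_meet irr o1 o2 m1 m2.
by exists x; split=> //; exact: AB.
Qed.

Lemma irreducible_dense A O : irreducible A -> open O -> A `&` O !=set0 -> A `<=` closure (A `&` O).
Proof.
move=> irr oO AO x Ax W; rewrite nbhsE => -[V [oV Vx] VW].
have [y [Ay [Oy Vy]]] := irreducible_meet irr oO oV AO (ex_intro _ x (conj Ax Vx)).
by exists y; split=> //; exact: VW.
Qed.

End Irreducible.

Lemma irreducible_image (T U : topologicalType) (f : T -> U) (A : set T) :
  irreducible A -> (forall x, A x -> {for x, continuous f}) -> irreducible (f @` A).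
Proof.
move=> irr cf; apply: irreducibleP; first by have [[a Aa] _] := irr; exists (f a); exists a.
have ex O : open O -> f @` A `&` O !=set0 ->
    exists2 V, open V & A `&` V !=set0 /\ forall x, A x -> V x -> O (f x).
  move=> oO [_ [[a Aa <-] Oa]].
  exists (\bigcup_(x in [set x | A x /\ O (f x)]) (f @^-1` O)^°).
    by apply: bigcup_open => x _; exact: open_interior.
  split; last by move=> x Ax [y _ /interior_subset].
  by exists a; split=> //; exists a => //; apply: cf => //; apply: open_nbhs_nbhs.
move=> O1 O2 o1 o2 /(ex _ o1)[V1 oV1 [m1 h1]] /(ex _ o2)[V2 oV2 [m2 h2]].
have [x [Ax [x1 x2]]] := irreducible_meet irr oV1 oV2 m1 m2.
by exists (f x); split; [exists x|split; [exact: h1|exact: h2]].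
Qed.

Lemma max_natP (P : set nat) B : P !=set0 -> (forall n, P n -> (n <= B)%N) ->
  P (max_nat P) /\ forall n, P n -> (n <= max_nat P)%N.
Proof.
move=> [n0 Pn0] hB; rewrite /max_nat.
have ex : exists n, [set n | P n /\ forall k, P k -> (k <= n)%N] n.
  have ex0 : exists n, `[< P n >] by exists n0; apply/asboolP.
  have bd n : `[< P n >] -> (n <= B)%N by move/asboolP; exact: hB.
  case: (ex_maxnP ex0 bd) => n /asboolP Pn hn; exists n; split=> // k Pk.
  by apply: hn; apply/asboolP.
by case: ex => n hn; have := xgetI 0%N hn.
Qed.

(** * Tangent vectors in affine coordinates *)

Section TangentFunctional.
Variables (K : numClosedFieldType) (X : variety K) (U : set X) (N : nat) (x : X -> 'I_N -> K).
Hypothesis hx : aff_coord U x.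

Lemma regular_setD_open (O : set X) f : open O -> (forall y, O y -> regular y f) ->
  open [set y | O y /\ f y != 0].
Proof.
move=> oO rf; rewrite openE => y [Oy fy]; rewrite /interior /=.
have h := regular_neq0 (rf y Oy) fy.
have h' : nbhs y O by apply: open_nbhs_nbhs.
by near=> z; split; near: z.
Unshelve. all: by end_near. Qed.

Lemma irreducible_domain (Z O : set X) f g : irreducible Z -> open O ->
  (forall y, O y -> regular y f) -> (forall y, O y -> regular y g) ->
  (forall y, Z y -> O y -> f y * g y = 0) ->
  (forall y, Z y -> O y -> f y = 0) \/ (forall y, Z y -> O y -> g y = 0).
Proof.
move=> irr oO rf rg fg; apply: contrapT => /not_orP[/existsNP[y /not_implyP[Zy /not_implyP[Oy fy]]]].
move=> /existsNP[z /not_implyP[Zz /not_implyP[Oz gz]]].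
have [||p [Zp [[Op fp] [_ gp]]]] := irreducible_meet irr (regular_setD_open oO rf)
  (regular_setD_open oO rg).
- by exists y; split=> //; split=> //; apply/eqP.
- by exists z; split=> //; split=> //; apply/eqP.
- by have /eqP := fg p Zp Op; rewrite mulf_eq0 (negbTE fp) (negbTE gp).
Qed.

Lemma irreducible_identity (Z O V : set X) f : irreducible Z -> open O -> open V ->
  (forall y, O y -> regular y f) -> Z `&` V !=set0 ->
  (forall y, Z y -> O y -> V y -> f y = 0) -> forall y, Z y -> O y -> f y = 0.
Proof.
move=> irr oO oV rf ZV f0 y Zy Oy; apply/eqP; apply: contrapT => /negP fy.
have [|z [Zz [Vz [Oz fz]]]] := irreducible_meet irr oV (regular_setD_open oO rf) ZV.
  by exists y.
by move: fz; rewrite f0 ?eqxx.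
Qed.

Definition dirder (v : 'I_N -> K) (P : mpoly N K) (y : X) : K :=
  \sum_l v l * meval (x y) (mderiv l P).

Definition qdirder v (P Q : mpoly N K) y : K :=
  (dirder v P y * meval (x y) Q - meval (x y) P * dirder v Q y) / meval (x y) Q ^+ 2.

Definition rep y f (P Q : mpoly N K) :=
  meval (x y) Q != 0 /\ \forall z \near y, f z = meval (x z) P / meval (x z) Q.

(** The quotient rule for some fraction representing [f] near [y]; for a tangent vector the choice
    is immaterial by [derE]. *)
Definition der (v : 'I_N -> K) (y : X) (f : X -> K) : K :=
  xget 0 [set c | exists P Q, rep y f P Q /\ c = qdirder v P Q y].

Definition tangent (y : X) (v : 'I_N -> K) :=
  forall P : mpoly N K, (\forall z \near y, meval (x z) P = 0) -> dirder v P y = 0.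

Lemma dirderC v c y : dirder v (mpolyC N c) y = 0.
Proof. by rewrite /dirder big1 // => l _; rewrite mderivC meval0 mulr0. Qed.

Lemma dirderD v P Q y : dirder v (P + Q) y = dirder v P y + dirder v Q y.
Proof. by rewrite -big_split; apply: eq_bigr => l _; rewrite mderivD mevalD mulrDr. Qed.

Lemma dirderB v P Q y : dirder v (P - Q) y = dirder v P y - dirder v Q y.
Proof. by rewrite -sumrB; apply: eq_bigr => l _; rewrite mderivB mevalB mulrBr. Qed.

Lemma dirderM v P Q y : dirder v (P * Q) y =
  dirder v P y * meval (x y) Q + meval (x y) P * dirder v Q y.
Proof.
rewrite /dirder mulr_suml mulr_sumr -big_split; apply: eq_bigr => l _ /=.
by rewrite mderivM mevalD !mevalM; ring.
Qed.

Lemma dirderX v l y : dirder v (mpolyX K (mnm1 l)) y = v l.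
Proof.
rewrite /dirder (bigD1 l) //= mderivX mnm1E eqxx scale1r mnm_subxx mpolyX0 meval1 mulr1.
rewrite big1 ?addr0 // => j jl; rewrite mderivX mnm1E eq_sym (negbTE jl) scale0r meval0 mulr0 //.
Qed.

Lemma qdirderE v P Q y f : meval (x y) Q != 0 -> f = meval (x y) P / meval (x y) Q ->
  qdirder v P Q y = (dirder v P y - f * dirder v Q y) / meval (x y) Q.
Proof. by move=> Q0 ->; rewrite /qdirder; field. Qed.

Lemma derE v y f P Q : U y -> tangent y v -> rep y f P Q -> der v y f = qdirder v P Q y.
Proof.
move=> Uy tv [Q0 e]; rewrite /der; case: xgetP => [_ _ [P' [Q' [[Q'0 e'] ->]]]|/(_ (qdirder v P Q y))]; last first.
  by case; exists P, Q.
have : dirder v (P * Q' - P' * Q) y = 0.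
  apply: tv; have h := ac_near hx Uy Q0; have h' := ac_near hx Uy Q'0.
  near=> z; have [_ q0] : U z /\ meval (x z) Q != 0 by near: z.
  have [_ q'0] : U z /\ meval (x z) Q' != 0 by near: z.
  have ez : f z = meval (x z) P / meval (x z) Q by near: z.
  have e'z : f z = meval (x z) P' / meval (x z) Q' by near: z.
  by rewrite mevalB !mevalM; apply/eqP; rewrite subr_eq0 -eqr_div // -ez -e'z.
have eP := nbhs_singleton e; have eP' := nbhs_singleton e'.
rewrite (qdirderE _ Q0 eP) (qdirderE _ Q'0 eP') dirderB !dirderM.
have -> : meval (x y) P = f y * meval (x y) Q by rewrite eP divfK.
have -> : meval (x y) P' = f y * meval (x y) Q' by rewrite eP' divfK.
set q := meval _ Q in Q0 *; set q' := meval _ Q' in Q'0 *; move=> h.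
apply/eqP; rewrite eqr_div // -subr_eq0; apply/eqP; rewrite -[RHS]oppr0 -[in RHS]h; ring.
Unshelve. all: by end_near. Qed.

Lemma regular_rep y f : U y -> regular y f -> exists P Q, rep y f P Q.
Proof. by move=> Uy /(ac_reg hx _ Uy)[P [Q [Q0 e]]]; exists P, Q. Qed.

Lemma der_germ_eq v y f g : U y -> tangent y v -> regular y f -> (\forall z \near y, f z = g z) ->
  der v y f = der v y g.
Proof.
move=> Uy tv rf e; have [P [Q [Q0 h]]] := regular_rep Uy rf.
rewrite (derE Uy tv (conj Q0 h)) (derE (f := g) Uy tv (P := P) (Q := Q)) //; split=> //.
by near=> z; rewrite -(near e z) // (near h z).
Unshelve. all: by end_near. Qed.

Lemma der_cst v y c : U y -> tangent y v -> der v y (fun=> c) = 0.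
Proof.
move=> Uy tv; have r : rep y (fun=> c) (mpolyC N c) 1.
  by split; [rewrite meval1 oner_eq0|near=> z; rewrite mevalC meval1 divr1].
rewrite (derE Uy tv r) /qdirder dirderC -(mpolyC1 N K) dirderC !mevalC; ring.
Unshelve. all: by end_near. Qed.

Lemma der_add v y f g : U y -> tangent y v -> regular y f -> regular y g ->
  der v y (fun z => f z + g z) = der v y f + der v y g.
Proof.
move=> Uy tv rf rg; have [P [Q [Q0 e]]] := regular_rep Uy rf; have [P' [Q' [Q'0 e']]] := regular_rep Uy rg.
have r : rep y (fun z => f z + g z) (P * Q' + P' * Q) (Q * Q').
  split; first by rewrite mevalM mulf_neq0.
  have h := ac_near hx Uy Q0; have h' := ac_near hx Uy Q'0.
  near=> z; rewrite (near e z) // (near e' z) // mevalD !mevalM.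
  have [_ q0] : U z /\ meval (x z) Q != 0 by near: z.
  have [_ q'0] : U z /\ meval (x z) Q' != 0 by near: z.
  by rewrite addf_div.
rewrite (derE Uy tv r) (derE Uy tv (conj Q0 e)) (derE Uy tv (conj Q'0 e')) /qdirder.
rewrite dirderD !dirderM mevalD !mevalM; field.
by rewrite Q0 Q'0.
Unshelve. all: by end_near. Qed.

Lemma der_mul v y f g : U y -> tangent y v -> regular y f -> regular y g ->
  der v y (fun z => f z * g z) = f y * der v y g + g y * der v y f.
Proof.
move=> Uy tv rf rg; have [P [Q [Q0 e]]] := regular_rep Uy rf; have [P' [Q' [Q'0 e']]] := regular_rep Uy rg.
have r : rep y (fun z => f z * g z) (P * P') (Q * Q').
  split; first by rewrite mevalM mulf_neq0.
  by near=> z; rewrite (near e z) // (near e' z) // !mevalM mulf_div.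
rewrite (derE Uy tv r) (derE Uy tv (conj Q0 e)) (derE Uy tv (conj Q'0 e')) /qdirder.
rewrite (nbhs_singleton e) (nbhs_singleton e') !dirderM !mevalM; field.
by rewrite Q0 Q'0.
Unshelve. all: by end_near. Qed.

Lemma der_poly v y P : U y -> tangent y v -> der v y (fun z => meval (x z) P) = dirder v P y.
Proof.
move=> Uy tv; have r : rep y (fun z => meval (x z) P) P 1.
  by split; [rewrite meval1 oner_eq0|near=> z; rewrite meval1 divr1].
by rewrite (derE Uy tv r) /qdirder -(mpolyC1 N K) dirderC !mevalC mulr0 subr0 expr1n mulr1 divr1.
Unshelve. all: by end_near. Qed.

Lemma der_coord v y l : U y -> tangent y v -> der v y (fun z => x z l) = v l.
Proof.
move=> Uy tv; rewrite -(dirderX v l y) -der_poly //; congr der.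
by apply/funext => z; rewrite mevalXU.
Qed.

Lemma der_sum v y (I : Type) (r : seq I) (f : I -> X -> K) : U y -> tangent y v ->
  (forall i, regular y (f i)) -> der v y (fun z => \sum_(i <- r) f i z) = \sum_(i <- r) der v y (f i).
Proof.
move=> Uy tv rf; elim: r => [|i r IH].
  rewrite big_nil (_ : (fun z => _) = fun=> 0) ?der_cst //.
  by apply/funext => z; rewrite big_nil.
rewrite big_cons -IH -der_add //; last exact: regular_sum.
by congr der; apply/funext => z; rewrite big_cons.
Qed.

End TangentFunctional.

Section ChainFrame.
Variables (K : numClosedFieldType) (X : variety K) (U : set X) (N : nat) (x : X -> 'I_N -> K).
Hypothesis hx : aff_coord U x.

Lemma rel_closed_setT_open (T : topologicalType) (A : set T) : rel_closed setT A -> open (~` A).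
Proof.
move=> [_ cA]; suff -> : A = closure A by apply: closed_openC; exact: closed_closure.
by apply/seteqP; split=> [y|y cy]; [exact: subset_closure|apply: cA].
Qed.

Lemma poly_separation (A : set X) y : open (~` A) -> U y -> ~ A y ->
  exists P : mpoly N K, meval (x y) P != 0 /\ forall z, A z -> U z -> meval (x z) P = 0.
Proof.
move=> oA Uy nA; have [P [P0 hP]] := ac_nbhs hx Uy oA nA; exists P; split=> // z Az Uz.
by apply/eqP; apply: contrapT => /negP /(hP z Uz).
Qed.

Lemma poly_prime_coord (Z O : set X) : irreducible Z -> open O -> O `<=` U -> Z `&` O !=set0 ->
  poly_prime (x @` (Z `&` O)).
Proof.
move=> irr oO OU [p0 [Zp0 Op0]]; split; first by exists (x p0); exists p0.
have rP P y : O y -> regular y (fun z => meval (x z) P) by move=> /OU Uy; exact: (regular_poly P hx Uy).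
move=> P Q h; have [|hP|hQ] := irreducible_domain irr oO (rP P) (rP Q).
- by move=> y Zy Oy; rewrite -mevalM; apply: h; exists y.
- by left=> _ [y [Zy Oy] <-]; exact: hP.
- by right=> _ [y [Zy Oy] <-]; exact: hQ.
Qed.

(** Polynomials that vanish on one member of the chain but not on the next are independent on the
    last member, so they admit dual tangent vectors somewhere on it. Where this happens cannot be
    prescribed; [b] at least makes the place general. *)
Lemma chain_frame (Z : nat -> set X) n y0 (O : set X) (b : mpoly N K) :
  irred_chain setT n Z -> Z 0%N y0 -> open O -> O y0 -> O `<=` U ->
  (exists p, [/\ Z n p, O p & meval (x p) b != 0]) ->
  exists p (v : 'I_n -> 'I_N -> K) (G : 'I_n -> mpoly N K),
  [/\ Z n p /\ O p, meval (x p) b != 0,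
      forall i P, (forall q, Z n q -> O q -> meval (x q) P = 0) -> dirder x (v i) P p = 0 &
      forall i j, dirder x (v i) (G j) p = (i == j)%:R].
Proof.
move=> [hZ ltZ] Z0 oO Oy0 OU [p1 [Zp1 Op1 bp1]].
have rP P y : O y -> regular y (fun z => meval (x z) P) by move=> /OU Uy; exact: (regular_poly P hx Uy).
have subZ i j : (i <= j)%N -> (j <= n)%N -> Z i `<=` Z j.
  elim: j => [|j IH]; first by rewrite leqn0 => /eqP-> _ z.
  rewrite leq_eqVlt => /orP[/eqP-> _ z //|]; rewrite ltnS => ij jn z /(IH ij (ltnW jn)) Zz.
  by have [h _] := ltZ j jn; exact: h.
have ZO i : (i <= n)%N -> (Z i `&` O) y0 by move=> le; split=> //; exact: (subZ 0%N i (leq0n i) le _ Z0).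
have exP i : exists P : mpoly N K, (i < n)%N -> (forall q, Z i q -> O q -> meval (x q) P = 0) /\
    exists q, [/\ Z i.+1 q, O q & meval (x q) P != 0].
  have [lt|] := boolP (i < n)%N; last by exists 0.
  have [irr cl] := hZ i (ltnW lt); have [irr' _] := hZ i.+1 lt.
  have oZ := rel_closed_setT_open cl.
  have [q [Zq [Oq nZq]]] : Z i.+1 `&` (O `&` ~` Z i) !=set0.
    apply: (irreducible_meet irr' oO oZ); first (by exists y0; apply: ZO; exact: lt).
    have [_ /existsNP[q /not_implyP[Zq nq]]] := ltZ i lt; by exists q.
  have [P [P0 hP]] := poly_separation oZ (OU _ Oq) nZq; exists P => _; split; last by exists q.
  by move=> z Zz /OU; exact: hP.
have [P hP] := choice exP.
pose A : set (X -> K) := [set f | exists Q : mpoly N K, f = fun z => meval (x z) Q].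
have ind : alg_indep (Z n `&` O) (fun (j : 'I_n) y => meval (x y) (P j)).
  { apply: (@chain_indep K X A (fun i y => meval (x y) (P i)) (fun i => Z i `&` O) n).
  - by move=> c; exists (mpolyC N c); apply/funext => z; rewrite mevalC.
  - by move=> _ _ [P1 ->] [P2 ->]; exists (P1 + P2); apply/funext => z; rewrite mevalD.
  - by move=> _ _ [P1 ->] [P2 ->]; exists (P1 * P2); apply/funext => z; rewrite mevalM.
  - move=> i _ _ ln [P1 ->] [P2 ->] h; have [irr _] := hZ i ln.
    have [|h'|h'] := irreducible_domain irr oO (rP P1) (rP P2).
    + by move=> y Zy Oy; apply: h.
    + by left=> y [Zy Oy]; exact: h'.
    + by right=> y [Zy Oy]; exact: h'.
  - by exists y0; exact: ZO.
  - by move=> i ln z [Zz Oz]; split=> //; exact: (subZ i i.+1 (leqnSn i) ln _ Zz).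
  - by move=> i _; exists (P i).
  - by move=> i ln z [Zz Oz]; have [h _] := hP i ln; exact: h.
  - by move=> i ln; have [_ [q [Zq Oq Pq]]] := hP i ln; exists q. }
have [irrn _] := hZ n (leqnn n).
pose O' := [set y | O y /\ meval (x y) b != 0].
have oO' : open O' := regular_setD_open oO (rP b).
have O'U : O' `<=` U by move=> y [/OU].
have pr := poly_prime_coord irrn oO' O'U (ex_intro _ p1 (conj Zp1 (conj Op1 bp1))).
have [|_ [v [[p [Zp [Op bp]] <-] tan dual]]] := tangent_frame pr (G := fun j : 'I_n => P j).
  { move=> H hH; apply: ind => p [Zp Op].
  pose h y := meval (fun j : 'I_n => meval (x y) (P j)) H.
  have rh y : O y -> regular y h.
    { move=> Oy; rewrite /h; elim/mpoly_closed_ind: (H) => [c|l|a a' IH IH'|a a' IH IH'].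
    - by rewrite (_ : (fun z => _) = fun=> c);
        [exact: regular_cst|apply/funext => z; rewrite mevalC].
    - by rewrite (_ : (fun z => _) = fun z => meval (x z) (P l));
        [exact: rP|apply/funext => z; rewrite mevalXU].
    - by rewrite (_ : (fun z => _) = fun z => meval (fun j : 'I_n => meval (x z) (P j)) a +
        meval (fun j : 'I_n => meval (x z) (P j)) a');
        [exact: regular_add|apply/funext => z; rewrite mevalD].
    - by rewrite (_ : (fun z => _) = fun z => meval (fun j : 'I_n => meval (x z) (P j)) a *
        meval (fun j : 'I_n => meval (x z) (P j)) a');
        [exact: regular_mul|apply/funext => z; rewrite mevalM]. }
  have [|h0|h0] := irreducible_domain irrn oO rh (rP b).
  - move=> y Zy Oy; have [->|by0] := eqVneq (meval (x y) b) 0; first by rewrite mulr0.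
    by rewrite /h hH ?mul0r //; exists y.
  - exact: h0.
  - by move: bp1; rewrite h0 ?eqxx. }
exists p, v, (fun j : 'I_n => P j); split=> //.
- move=> i Q hQ; rewrite /dirder -[RHS](tan i Q); last by move=> _ [q [Zq [Oq _]] <-]; exact: hQ.
  by apply: eq_bigr => l _; rewrite mulrC.
- move=> i j; rewrite -(dual i j) /dirder.
  by apply: eq_bigr => l _; rewrite mulrC.
Qed.

End ChainFrame.

(** Etale coordinates: the [D i] are the partial derivatives, and at every point of [O], not only at
    a chosen one, the differences [w j z - w j y] generate the maximal ideal. *)
Record chart (K : numClosedFieldType) (X : variety K) (O : set X) d (w : 'I_d -> X -> K)
    (D : 'I_d -> (X -> K) -> X -> K) : Prop := Chart {
  ch_open : open O ;
  ch_irr : irreducible O ;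
  ch_reg : forall y i, O y -> regular y (w i) ;
  ch_der : forall y i, O y -> derivation_at y (D i) ;
  ch_dual : forall y i j, O y -> D i (w j) y = (i == j)%:R ;
  ch_par : forall y f, O y -> regular y f -> f y = 0 ->
    exists2 a : 'I_d -> X -> K, forall j, regular y (a j) &
      \forall z \near y, f z = \sum_j a j z * (w j z - w j y) }.

Lemma germ_span_range (K : numClosedFieldType) (X : variety K) (y : X) d (w : 'I_d -> X -> K) g :
  germ_span y (range w) g <-> exists2 a : 'I_d -> X -> K, forall j, regular y (a j) &
      \forall z \near y, g z = \sum_j a j z * w j z.
Proof.
split=> [[n [a [f [h e]]]]|[a ra e]]; last by exists d, a, w; split=> // i; split=> //; exists i.
have /choice[j hj] : forall i, exists j, w j = f i by move=> i; have [_ [j _ <-]] := h i; exists j.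
exists (fun k z => \sum_(i < n | j i == k) a i z).
  by move=> k; apply: regular_sum => i _; have [] := h i.
near=> z; rewrite (near e z) // (partition_big j xpredT) //=; apply: eq_bigr => k _.
by rewrite mulr_suml; apply: eq_bigr => i /eqP <-; rewrite hj.
Unshelve. all: by end_near. Qed.

(** * From parameters at a point to coordinates near it *)

Section ChartAt.
Variables (K : numClosedFieldType) (X : variety K) (x0 : X) (U : set X) (N : nat).
Variables (x : X -> 'I_N -> K) (d : nat) (z : 'I_d -> X -> K).
Variables (a : 'I_N -> 'I_d -> X -> K) (AP AQ : 'I_N -> 'I_d -> mpoly N K).
Hypothesis hx : aff_coord U x.

Definition qd p (P Q : mpoly N K) y : K :=
  (meval (x y) (mderiv p P) * meval (x y) Q - meval (x y) P * meval (x y) (mderiv p Q)) /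
  meval (x y) Q ^+ 2.

Lemma qdirder_qd v P Q y : qdirder x v P Q y = \sum_p v p * qd p P Q y.
Proof.
rewrite /qdirder /dirder mulr_suml mulr_sumr -sumrB mulr_suml; apply: eq_bigr => p _.
by rewrite /qd; ring.
Qed.

(** Differentiating [x_l = x_l(x0) + sum_j a_lj z_j] gives [dx * Mx = dz * Ax] for row vectors. At
    [x0] the [z_j] vanish and [Mx] is the identity, so nearby [dx = dz * Bx]. *)
Definition Mx y : 'M[K]_N :=
  \matrix_(p, l) ((p == l)%:R - \sum_j z j y * qd p (AP l j) (AQ l j) y).
Definition Ax y : 'M[K]_(d, N) := \matrix_(j, l) a l j y.
Definition Bx y : 'M[K]_(d, N) := (\det (Mx y))^-1 *: (Ax y *m \adj (Mx y)).

Record good (y : X) : Prop := Good {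
  goodU : U y ;
  good_z : forall j, regular y (z j) ;
  good_a : forall l j, rep x y (a l j) (AP l j) (AQ l j) ;
  good_e : forall l, \forall w \near y, x w l = x x0 l + \sum_j a l j w * z j w ;
  good_det : \det (Mx y) != 0 }.

Lemma good_reg_a y l j : good y -> regular y (a l j).
Proof. by case=> Uy _ ha _ _; apply/(ac_reg hx _ Uy); exists (AP l j), (AQ l j); exact: ha. Qed.

Lemma tangent_row y v : good y -> tangent x y v ->
  \row_l v l = (\row_j der x v y (z j)) *m Bx y.
Proof.
move=> gy tv; have Uy := goodU gy.
have key : (\row_l v l) *m Mx y = (\row_j der x v y (z j)) *m Ax y.
  apply/rowP => l; rewrite !mxE.
  have e : v l = \sum_j (a l j y * der x v y (z j) + z j y * der x v y (a l j)).
    rewrite -(der_coord hx (v := v) l Uy tv).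
    rewrite (der_germ_eq hx Uy tv (regular_coord l hx Uy) (good_e gy l)).
    have rs j : regular y (fun w => a l j w * z j w).
      by apply: regular_mul; [exact: good_reg_a|exact: good_z].
    rewrite (der_add hx) //; [|exact: regular_cst|exact: regular_sum].
    rewrite (der_cst hx) // add0r (der_sum hx) //; apply: eq_bigr => j _.
    by rewrite (der_mul hx) //; [exact: good_reg_a|exact: good_z].
  transitivity (v l - \sum_j z j y * der x v y (a l j)); last first.
    rewrite {1}e big_split /= addrK; apply: eq_bigr => j _.
    by rewrite !mxE mulrC.
  under eq_bigr do rewrite !mxE mulrBr.
  rewrite sumrB (bigD1 l) //= eqxx mulr1 big1 ?addr0; last first.
    by move=> p /negbTE ->; rewrite mulr0.
  congr (_ - _); under eq_bigr do rewrite mulr_sumr.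
  rewrite exchange_big; apply: eq_bigr => j _ /=.
  rewrite (derE hx Uy tv (good_a gy l j)) qdirder_qd mulr_sumr.
  by apply: eq_bigr => p _; rewrite mulrCA.
move/(congr1 (mulmx^~ (\adj (Mx y)))): key; rewrite -!mulmxA mul_mx_adj mul_mx_scalar => e.
by rewrite /Bx -scalemxAr -e scalerA mulVf ?scale1r // good_det.
Qed.

Lemma qd_regular p P Q y : U y -> meval (x y) Q != 0 -> regular y (qd p P Q).
Proof.
move=> Uy Q0; apply: regular_mul.
  by apply: regular_sub; apply: regular_mul; exact: (regular_poly _ hx Uy).
by apply: regular_inv; [apply: regular_exp; exact: (regular_poly _ hx Uy)|rewrite expf_neq0].
Qed.

Lemma Mx_regular y p l : good y -> regular y (fun w => Mx w p l).
Proof.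
move=> gy; rewrite (_ : (fun w => _) =
  fun w => (p == l)%:R - \sum_j z j w * qd p (AP l j) (AQ l j) w); last first.
  by apply/funext => w; rewrite mxE.
apply: regular_sub; first exact: regular_cst.
apply: regular_sum => j _; apply: regular_mul; first exact: good_z.
by apply: qd_regular; [exact: goodU|have [] := good_a gy l j].
Qed.

Lemma adj_regular (n : nat) (f : X -> 'M[K]_n) y :
  (forall i j, regular y (fun w => f w i j)) -> forall i j, regular y (fun w => (\adj (f w)) i j).
Proof.
move=> h i j; rewrite (_ : (fun w => _) = fun w => (-1) ^+ (j + i) * \det (row' j (col' i (f w)))).
  apply: regular_mul; first exact: regular_cst.
  apply: regular_det => k l; rewrite (_ : (fun w => _) = fun w => f w (lift j k) (lift i l)) //.
  by apply/funext => w; rewrite !mxE.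
by apply/funext => w; rewrite mxE.
Qed.

Lemma scaled_adj_regular (n m : nat) (f : X -> 'M[K]_n) (g : X -> 'M[K]_(m, n)) y :
  (forall i j, regular y (fun w => f w i j)) -> (forall i j, regular y (fun w => g w i j)) ->
  \det (f y) != 0 ->
  forall i j, regular y (fun w => ((\det (f w))^-1 *: (g w *m \adj (f w))) i j).
Proof.
move=> hf hg f0 i j; rewrite (_ : (fun w => _) = fun w => (\det (f w))^-1 *
    \sum_k g w i k * (\adj (f w)) k j).
  apply: regular_mul; first by apply: regular_inv => //; exact: regular_det.
  by apply: regular_sum => k _; apply: regular_mul => //; exact: adj_regular.
by apply/funext => w; rewrite mxE mxE.
Qed.

Lemma Bx_regular y j l : good y -> regular y (fun w => Bx w j l).
Proof.
move=> gy; apply: scaled_adj_regular; [by move=> *; exact: Mx_regular| |exact: good_det].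
by move=> i k; rewrite (_ : (fun w => _) = a k i);
  [exact: good_reg_a|apply/funext => w; rewrite mxE].
Qed.

Lemma qdirder_regular y (v : X -> 'I_N -> K) P Q : U y -> (forall l, regular y (v ^~ l)) ->
  meval (x y) Q != 0 -> regular y (fun w => qdirder x (v w) P Q w).
Proof.
move=> Uy rv Q0; rewrite (_ : (fun w => _) = fun w => \sum_p v w p * qd p P Q w).
  by apply: regular_sum => p _; apply: regular_mul => //; exact: qd_regular.
by apply/funext => w; rewrite qdirder_qd.
Qed.

(** The computation behind [Mx] with differences in place of differentials: [a_lj w - a_lj y] is a
    combination of the [x_p w - x_p y] whose coefficients at [y] are the partial derivatives, so the
    matrix [M'] equals [Mx] at [y] and is invertible near it. *)
Lemma good_par y f : good y -> regular y f -> f y = 0 ->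
  exists2 b : 'I_d -> X -> K, forall j, regular y (b j) &
      \forall w \near y, f w = \sum_j b j w * (z j w - z j y).
Proof.
move=> gy rf f0; have Uy := goodU gy.
have tay P : meval (x y) P = 0 -> exists p : 'I_N -> mpoly N K,
    (forall w, meval (x w) P = \sum_l (x w l - x y l) * meval (x w) (p l)) /\
    forall l, meval (x y) (p l) = meval (x y) (mderiv l P).
  move=> P0; have [p [e h]] := mpoly_taylor1 (x y) P; exists p; split=> // w.
  rewrite {1}e mevalD mevalC P0 add0r rmorph_sum; apply: eq_bigr => l _.
  by rewrite rmorphM /= /mcoord mevalB mevalXU mevalC.
have exb l j : exists b : 'I_N -> X -> K, [/\ forall p, regular y (b p),
   forall p, b p y = qd p (AP l j) (AQ l j) y &
   \forall w \near y, a l j w - a l j y = \sum_p (x w p - x y p) * b p w].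
  { have [Q0 e] := good_a gy l j.
  set P := AP l j in e *; set Q := AQ l j in Q0 e *.
  have [|r [er hr]] := tay (P * mpolyC N (meval (x y) Q) - mpolyC N (meval (x y) P) * Q).
    by rewrite mevalB !mevalM !mevalC; ring.
  exists (fun p w => meval (x w) (r p) / (meval (x w) Q * meval (x y) Q)); split.
  - move=> p; apply: regular_mul; first exact: (regular_poly _ hx Uy).
    apply: regular_inv; last by rewrite mulf_neq0.
    by apply: regular_mul; [exact: (regular_poly _ hx Uy)|exact: regular_cst].
  - move=> p; rewrite hr mderivB !mderivM !mderivC mevalB !mevalD !mevalM !mevalC ?meval0 /qd.
    by rewrite expr2; congr (_ / _); ring.
  - have h := ac_near hx Uy Q0; have ey := nbhs_singleton e.
    near=> w; rewrite (near e w) // ey.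
    have [_ q0] : U w /\ meval (x w) Q != 0 by near: w.
    under eq_bigr do rewrite mulrA.
    rewrite -mulr_suml -er mevalB !mevalM !mevalC; field.
    by rewrite q0 Q0. }
have /choice[b0 hb0] : forall lj : 'I_N * 'I_d, exists b : 'I_N -> X -> K,
   [/\ forall p, regular y (b p), forall p, b p y = qd p (AP lj.1 lj.2) (AQ lj.1 lj.2) y &
   \forall w \near y, a lj.1 lj.2 w - a lj.1 lj.2 y = \sum_p (x w p - x y p) * b p w].
  by move=> [l j]; exact: exb.
pose M' w : 'M[K]_N := \matrix_(p, l) ((p == l)%:R - \sum_j z j y * b0 (l, j) p w).
have M'reg p l : regular y (fun w => M' w p l).
  rewrite (_ : (fun w => _) = fun w => (p == l)%:R - \sum_j z j y * b0 (l, j) p w).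
    apply: regular_sub; first exact: regular_cst.
    apply: regular_sum => j _; apply: regular_mul; first exact: regular_cst.
    by have [] := hb0 (l, j).
  by apply/funext => w; rewrite mxE.
have M'y : M' y = Mx y.
  apply/matrixP => p l; rewrite !mxE; congr (_ - _); apply: eq_bigr => j _.
  by have [_ -> _] := hb0 (l, j).
have detM' : \det (M' y) != 0 by rewrite M'y good_det.
pose c w : 'M[K]_(d, N) := (\det (M' w))^-1 *: (Ax w *m \adj (M' w)).
have creg j l : regular y (fun w => c w j l).
  apply: scaled_adj_regular => // i k; rewrite (_ : (fun w => _) = a k i).
    exact: good_reg_a.
  by apply/funext => w; rewrite mxE.
have [P [Q [Q0 e]]] := regular_rep hx Uy rf.
have P0 : meval (x y) P = 0.
  by move: f0; rewrite (nbhs_singleton e) => /eqP; rewrite mulf_eq0 invr_eq0 (negbTE Q0) orbF => /eqP.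
have [p [ep _]] := tay P P0.
exists (fun j w => \sum_l c w j l * meval (x w) (p l) / meval (x w) Q).
  move=> j; apply: regular_sum => l _; apply: regular_mul.
    by apply: regular_mul => //; exact: (regular_poly _ hx Uy).
  by apply: regular_inv => //; exact: (regular_poly _ hx Uy).
have dn := regular_neq0 (regular_det M'reg) detM'.
have en : \forall w \near y, forall l, x w l = x x0 l + \sum_j a l j w * z j w.
  by apply: filter_forall => l; exact: good_e.
have hn : \forall w \near y, forall lj : 'I_N * 'I_d,
   a lj.1 lj.2 w - a lj.1 lj.2 y = \sum_p (x w p - x y p) * b0 lj p w.
  by apply: filter_forall => lj; have [] := hb0 lj.
near=> w; have ew : forall l, x w l = x x0 l + \sum_j a l j w * z j w by near: w.
have hw : forall lj : 'I_N * 'I_d,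
   a lj.1 lj.2 w - a lj.1 lj.2 y = \sum_p (x w p - x y p) * b0 lj p w by near: w.
have dw : \det (M' w) != 0 by near: w.
have key : (\row_l (x w l - x y l)) *m M' w = (\row_j (z j w - z j y)) *m Ax w.
  apply/rowP => l; rewrite !mxE.
  have ey := nbhs_singleton (good_e gy l).
  transitivity (x w l - x y l - \sum_j z j y * (a l j w - a l j y)); last first.
    rewrite ew ey opprD addrACA subrr add0r -!sumrB; apply: eq_bigr => j _.
    by rewrite !mxE; ring.
  under eq_bigr do rewrite !mxE mulrBr.
  rewrite sumrB (bigD1 l) //= eqxx mulr1 big1 ?addr0; last first.
    by move=> q /negbTE ->; rewrite mulr0.
  congr (_ - _); under eq_bigr do rewrite mulr_sumr.
  rewrite exchange_big; apply: eq_bigr => j _ /=.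
  by rewrite (hw (l, j)) mulr_sumr; apply: eq_bigr => q _; rewrite mulrCA.
have {}key : \row_l (x w l - x y l) = (\row_j (z j w - z j y)) *m c w.
  move/(congr1 (mulmx^~ (\adj (M' w)))): key; rewrite -!mulmxA mul_mx_adj mul_mx_scalar => ek.
  by rewrite /c -scalemxAr -ek scalerA mulVf ?scale1r.
rewrite (near e w) // ep; under [RHS]eq_bigr do rewrite mulr_suml.
rewrite exchange_big mulr_suml; apply: eq_bigr => l _ /=.
have /rowP/(_ l) := key; rewrite !mxE => ->.
rewrite !mulr_suml; apply: eq_bigr => j _; rewrite !mxE; ring.
Unshelve. all: by end_near. Qed.

End ChartAt.

Lemma near_open (T : topologicalType) (x : T) (P : set T) : (\forall y \near x, P y) ->
  exists V, [/\ open V, V x & forall y, V y -> P y].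
Proof. by rewrite /prop_near1 nbhsE => -[V [oV Vx] VP]; exists V. Qed.

Section ChartExists.
Variables (K : numClosedFieldType) (X : variety K) (x0 : X) (U : set X) (N : nat).
Variables (x : X -> 'I_N -> K) (d : nat) (z : 'I_d -> X -> K).
Variables (a : 'I_N -> 'I_d -> X -> K) (AP AQ : 'I_N -> 'I_d -> mpoly N K) (O : set X).
Hypotheses (hx : aff_coord U x) (Ux0 : U x0) (par : parameters x0 z).
Hypotheses (oO : open O) (Ox0 : O x0) (gO : forall y, O y -> good x0 U x z a AP AQ y).

Local Notation Bx := (Bx x z a AP AQ).

Let OU : O `<=` U. Proof. by move=> y /gO/goodU. Qed.

Let rP P y : O y -> regular y (fun w => meval (x w) P).
Proof. by move=> /OU Uy; exact: (regular_poly P hx Uy). Qed.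

Lemma tangent_of_irreducible (Z : set X) y v : irreducible Z -> Z y -> O y ->
  (forall P : mpoly N K, (forall q, Z q -> O q -> meval (x q) P = 0) -> dirder x v P y = 0) ->
  tangent x y v.
Proof.
move=> irr Zy Oy h P /near_open[V [oV Vy hV]]; apply: h.
by apply: (irreducible_identity irr oO oV (rP P)); [exists y|move=> w _ _ /hV].
Qed.

Lemma frame_matrix (Z : set X) n p (v : 'I_n -> 'I_N -> K) : irreducible Z -> Z p -> O p ->
  (forall i P, (forall q, Z q -> O q -> meval (x q) P = 0) -> dirder x (v i) P p = 0) ->
  \matrix_(i, l) v i l = (\matrix_(i, j) der x (v i) p (z j)) *m Bx p.
Proof.
move=> irr Zp Op h; apply/row_matrixP => i.
have := tangent_row hx (gO Op) (tangent_of_irreducible irr Zp Op (h i)).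
rewrite row_mul => e; rewrite (_ : row i _ = \row_l v i l); last first.
  by apply/rowP => l; rewrite !mxE.
by rewrite e; congr (_ *m _); apply/rowP => l; rewrite !mxE.
Qed.

Lemma dirder_sum (I : finType) (c : I -> K) (v : I -> 'I_N -> K) P p :
  dirder x (fun l => \sum_i c i * v i l) P p = \sum_i c i * dirder x (v i) P p.
Proof.
rewrite /dirder; under [RHS]eq_bigr do rewrite mulr_sumr.
rewrite exchange_big; apply: eq_bigr => l _ /=.
by rewrite mulr_suml; apply: eq_bigr => i _; rewrite mulrA.
Qed.

(** The [n] dual vectors are determined by the derivatives of the [d] parameters, so the identity of
    size [n] factors through dimension [d]. *)
Lemma chain_le n Z : irred_chain setT n Z -> Z 0%N x0 -> (n <= d)%N.
Proof.
move=> hZ Z0; have [irr _] := hZ.1 n (leqnn n).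
have [|p [v [G [[Zp Op] _ tan dual]]]] := chain_frame (b := 1) hx hZ Z0 oO Ox0 OU.
  exists x0; split=> //; last by rewrite meval1 oner_eq0.
  have sub m : (m <= n)%N -> Z m x0.
    by elim: m => // m IH lm; have [h _] := hZ.2 m lm; apply: h; apply: IH; exact: ltnW.
  exact: sub.
have e := frame_matrix irr Zp Op tan.
pose G' : 'M[K]_(N, n) := \matrix_(l, j) meval (x p) (mderiv l (G j)).
have : (\matrix_(i, l) v i l) *m G' = 1%:M.
  by apply/matrixP => i j; rewrite !mxE -(dual i j) /dirder; apply: eq_bigr => l _; rewrite !mxE.
rewrite e -mulmxA => /(congr1 (@mxrank _ _ _)); rewrite mxrank1 => <-.
exact: leq_trans (mxrankM_maxl _ _) (rank_leq_col _).
Qed.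

(** [parameters] only equates [d] with a value of [max_nat]; [chain_le] bounds the lengths, so the
    value is a maximum and some chain attains it. *)
Lemma exists_max_chain : exists Z, irred_chain setT d Z /\ Z 0%N x0.
Proof.
have [ed _ _] := par.
have [|n [Z [hZ Z0]]|h _] := @max_natP [set n | exists Z, irred_chain setT n Z /\ Z 0%N x0] d.
- exists 0%N, (fun=> closure [set x0]); split; last exact: subset_closure.
  split=> // i _; split; first exact/irreducible_closure/irreducible_set1.
  by split=> // w []; rewrite -(closure_id _).1 //; exact: closed_closure.
- exact: chain_le hZ Z0.
- by rewrite ed.
Qed.

Section MaxChain.
Variable Zs : nat -> set X.
Hypotheses (hZ : irred_chain setT d Zs) (Z0 : Zs 0%N x0).
Let Z := Zs d.

Let irrZ : irreducible Z. Proof. by have [] := hZ.1 d (leqnn d). Qed.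
Let clZ : open (~` Z). Proof. by apply: rel_closed_setT_open; have [] := hZ.1 d (leqnn d). Qed.
Let Zx0 : Z x0.
Proof.
have sub m : (m <= d)%N -> Zs m x0.
  by elim: m => // m IH lm; have [h _] := hZ.2 m lm; apply: h; apply: IH; exact: ltnW.
exact: sub.
Qed.

Let nullZ (P : mpoly N K) := forall q, Z q -> O q -> meval (x q) P = 0.

(** A chain of length [d] gives a square, invertible matrix [W] of derivatives, so at a general
    point the rows of [Bx] are combinations of tangent vectors and dual to the parameters. *)
Lemma generic_frame y1 b : Z y1 -> O y1 -> meval (x y1) b != 0 -> exists p,
  [/\ Z p /\ O p, meval (x p) b != 0,
      forall j P, nullZ P -> dirder x (Bx p j) P p = 0 &
      forall i j, der x (Bx p j) p (z i) = (j == i)%:R].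
Proof.
move=> Zy Oy by1.
have [|p [v [G [[Zp Op] bp tan dual]]]] := chain_frame (b := b) hx hZ Z0 oO Ox0 OU.
  by exists y1.
exists p; have e := frame_matrix irrZ Zp Op tan.
pose G' : 'M[K]_(N, d) := \matrix_(l, j) meval (x p) (mderiv l (G j)).
have VG : (\matrix_(i, l) v i l) *m G' = 1%:M.
  by apply/matrixP => i j; rewrite !mxE -(dual i j) /dirder; apply: eq_bigr => l _; rewrite !mxE.
set W := \matrix_(i, j) der x (v i) p (z j) in e.
have WBG : W *m (Bx p *m G') = 1%:M by rewrite mulmxA -e.
have uW : W \in unitmx by exact: (mulmx1_unit WBG).1.
have BGW : Bx p *m G' *m W = 1%:M by exact: mulmx1C WBG.
have tB j P : nullZ P -> dirder x (Bx p j) P p = 0.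
  move=> nP; rewrite (_ : (Bx p j : 'I_N -> K) = fun l => \sum_i invmx W j i * v i l).
    by rewrite dirder_sum big1 // => i _; rewrite tan ?mulr0.
  apply/funext => l; rewrite -[Bx p](mulKmx uW) -e mxE.
  by apply: eq_bigr => i _; rewrite mxE.
split=> // i j.
have tj := tangent_row hx (gO Op) (tangent_of_irreducible irrZ Zp Op (tB j)).
have : (\row_i der x (Bx p j) p (z i) - delta_mx 0 j) *m Bx p = 0.
  rewrite mulmxBl -tj -rowE; apply/eqP; rewrite subr_eq0; apply/eqP/rowP => l.
  by rewrite !mxE.
move/(congr1 (mulmx^~ (G' *m W))); rewrite mul0mx -mulmxA (mulmxA (Bx p)) BGW mulmx1.
move=> /rowP/(_ i)/eqP; rewrite !mxE subr_eq0 /= => /eqP->.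
by rewrite eq_sym.
Qed.

(** Transfers identities from the general points of [generic_frame] to every point of [Z] in [O]: a
    regular function that is non-zero at [y1] is non-zero on a principal open set, where
    [generic_frame] finds such a point. *)
Lemma generic_vanish y1 (R : X -> K) : Z y1 -> O y1 -> regular y1 R ->
  (\forall p \near y1, Z p -> O p -> (forall j P, nullZ P -> dirder x (Bx p j) P p = 0) ->
      (forall i j, der x (Bx p j) p (z i) = (j == i)%:R) -> R p = 0) -> R y1 = 0.
Proof.
move=> Zy Oy rR h; apply/eqP; apply: contrapT => /negP Ry.
have h' := regular_neq0 rR Ry.
have [b [b1 hb]] := ac_near_set hx (OU Oy) (filterI h h').
have [p [[Zp Op] bp t1 t2]] := generic_frame Zy Oy b1.
have [hp] := hb p (OU Op) bp.
by rewrite hp // eqxx.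
Qed.

Lemma Bx_null y j P : Z y -> O y -> nullZ P -> dirder x (Bx y j) P y = 0.
Proof.
move=> Zy Oy nP; apply: (generic_vanish (R := fun y => dirder x (Bx y j) P y) Zy Oy).
  apply: regular_sum => l _; apply: regular_mul; first exact: (Bx_regular hx _ _ (gO Oy)).
  exact: rP.
by near=> p => _ _ h _; exact: h.
Unshelve. all: by end_near. Qed.

Lemma Bx_tangent y j : Z y -> O y -> tangent x y (Bx y j).
Proof. by move=> Zy Oy; apply: (tangent_of_irreducible irrZ) => // P; exact: Bx_null. Qed.

Lemma Bx_dual y i j : Z y -> O y -> der x (Bx y j) y (z i) = (j == i)%:R.
Proof.
move=> Zy Oy; have [P [Q [Q0 e]]] := regular_rep hx (OU Oy) (good_z (gO Oy) i).
rewrite (derE hx (OU Oy) (Bx_tangent j Zy Oy) (conj Q0 e)).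
apply/eqP; rewrite -subr_eq0; apply/eqP.
apply: (generic_vanish (R := fun y => qdirder x (Bx y j) P Q y - (j == i)%:R) Zy Oy).
  apply: regular_sub; last exact: regular_cst.
  by apply: (qdirder_regular (v := fun w => Bx w j) hx P (OU Oy)) => // l; exact: (Bx_regular hx _ _ (gO Oy)).
have h := ac_near hx (OU Oy) Q0; have {}e := near_join e.
near=> p => Zp Op hp dp.
have [_ Qp] : U p /\ meval (x p) Q != 0 by near: p.
have ep : \forall w \near p, z i w = meval (x w) P / meval (x w) Q by near: p; exact: e.
rewrite -(derE hx (OU Op) (Bx_tangent j Zp Op) (conj Qp ep)) dp subrr //.
Unshelve. all: by end_near. Qed.

Definition chart_der (j : 'I_d) (f : X -> K) (y : X) : K := der x (Bx y j) y f.

Lemma chart_der_regular j f y : Z y -> O y -> regular y f -> exists2 g, regular y g &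
  \forall w \near y, Z w -> O w -> chart_der j f w = g w.
Proof.
move=> Zy Oy rf; have [P [Q [Q0 e]]] := regular_rep hx (OU Oy) rf.
exists (fun w => qdirder x (Bx w j) P Q w).
  by apply: (qdirder_regular (v := fun w => Bx w j) hx P (OU Oy)) => // l; exact: (Bx_regular hx _ _ (gO Oy)).
have h := ac_near hx (OU Oy) Q0; have {}e := near_join e.
near=> p => Zp Op.
have [_ Qp] : U p /\ meval (x p) Q != 0 by near: p.
have ep : \forall w \near p, f w = meval (x w) P / meval (x w) Q by near: p; exact: e.
by rewrite /chart_der (derE hx (OU Op) (Bx_tangent j Zp Op) (conj Qp ep)).
Unshelve. all: by end_near. Qed.

Lemma chart_der_null j f : regular x0 f -> (\forall w \near x0, Z w -> f w = 0) ->
  \forall w \near x0, Z w -> chart_der j f w = 0.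
Proof.
move=> rf f0; have [P [Q [Q0 e]]] := regular_rep hx Ux0 rf.
have nP : nullZ P.
  have : \forall w \near x0, Z w -> meval (x w) P = 0.
    have h := ac_near hx Ux0 Q0.
    near=> p => Zp; have [_ Qp] : U p /\ meval (x p) Q != 0 by near: p.
    have : f p = 0 by apply: (near f0 p).
    have -> : f p = meval (x p) P / meval (x p) Q by near: p.
    by move/eqP; rewrite mulf_eq0 invr_eq0 (negbTE Qp) orbF => /eqP.
  move=> /near_open[V [oV Vx hV]].
  by apply: (irreducible_identity irrZ oO oV (rP P)); [exists x0|move=> w Zw _ /hV; exact].
have h := ac_near hx Ux0 Q0; have {}e := near_join e.
have hO : nbhs x0 O by apply: open_nbhs_nbhs.
near=> p => Zp; have Op : O p by near: p.
have [_ Qp] : U p /\ meval (x p) Q != 0 by near: p.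
have ep : \forall w \near p, f w = meval (x w) P / meval (x w) Q by near: p; exact: e.
rewrite /chart_der (derE hx (OU Op) (Bx_tangent j Zp Op) (conj Qp ep)) /qdirder.
by rewrite Bx_null // nP // !mul0r subrr mul0r.
Unshelve. all: by end_near. Qed.

End MaxChain.
End ChartExists.

(** * Taylor expansions at a smooth point *)

Section Taylor.
Variables (K : numClosedFieldType) (X : variety K) (x0 : X) (U : set X) (N : nat).
Variables (x : X -> 'I_N -> K) (d : nat) (z : 'I_d -> X -> K).
Hypotheses (hx : aff_coord U x) (Ux0 : U x0) (par : parameters x0 z).

(** Germs in the [e]-th power of the maximal ideal at [x0], the analogue of [mpow] for regular
    functions. *)
Fixpoint zpow e (f : X -> K) : Prop :=
  if e is e'.+1 then exists b : 'I_d -> X -> K, (forall j, zpow e' (b j)) /\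
     \forall w \near x0, f w = \sum_j z j w * b j w
  else regular x0 f.

Let rz j : regular x0 (z j). Proof. by have [_ h _] := par; have [] := h j. Qed.
Let z0 j : z j x0 = 0. Proof. by have [_ h _] := par; have [] := h j. Qed.

Lemma zpow_regular e f : zpow e f -> regular x0 f.
Proof.
elim: e f => [//|e IH] f [b [hb ef]].
apply: (regular_germ (f := fun w => \sum_j z j w * b j w)); last by near=> w; rewrite (near ef w).
by apply: regular_sum => j _; apply: regular_mul => //; exact/IH/hb.
Unshelve. all: by end_near. Qed.

Lemma zpow_add e f g : zpow e f -> zpow e g -> zpow e (fun w => f w + g w).
Proof.
elim: e f g => [|e IH] f g; first exact: regular_add.
move=> [b [hb ef]] [b' [hb' eg]]; exists (fun j w => b j w + b' j w); split; first by move=> j; apply: IH; [exact: hb|exact: hb'].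
near=> w; rewrite (near ef w) // (near eg w) // -big_split; apply: eq_bigr => j _.
by rewrite mulrDr.
Unshelve. all: by end_near. Qed.

Lemma zpow_sum e (b : 'I_d -> X -> K) : (forall j, zpow e (b j)) ->
  zpow e.+1 (fun w => \sum_j z j w * b j w).
Proof. by move=> hb; exists b; split=> //; near=> w. Unshelve. all: by end_near. Qed.

Lemma zpow_at0 e f : zpow e.+1 f -> f x0 = 0.
Proof.
by move=> [b [_ e0]]; rewrite (nbhs_singleton e0) big1 // => j _; rewrite z0 mul0r.
Qed.

Lemma zpow_decomp e f : regular x0 f -> exists (Q : mpoly d K) g,
  [/\ forall m, (e <= mdeg m)%N -> mcoeff m Q = 0, zpow e g &
      \forall w \near x0, f w = meval (z ^~ w) Q + g w].
Proof.
elim: e f => [|e IH] f rf.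
  exists 0, f; split=> // [m _|]; first by rewrite mcoeff0.
  by near=> w; rewrite meval0 add0r.
have [_ _ hp] := par.
have rf' : regular x0 (fun w => f w - f x0) by apply: regular_sub => //; exact: regular_cst.
have /germ_span_range[b rb eb] := hp _ rf' (subrr _).
have /choice[Q /choice[g hQ]] : forall j, exists (Q : mpoly d K) g,
    [/\ forall m, (e <= mdeg m)%N -> mcoeff m Q = 0, zpow e g &
      \forall w \near x0, b j w = meval (z ^~ w) Q + g w] by move=> j; exact: IH.
exists (mpolyC d (f x0) + \sum_j Q j * mpolyX K (mnm1 j)), (fun w => \sum_j z j w * g j w).
split.
- move=> m em; rewrite mcoeffD mcoeffC raddf_sum /= big1 ?addr0 => [|j _].
    by case: eqP em => [->|]; rewrite ?mdeg0 ?mulr0.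
  apply/eqP; apply: contraT; rewrite -mcoeff_msupp (perm_mem (msuppMX _ _)) => /mapP[m' m'Q e'].
  have [h _ _] := hQ j; move: m'Q; rewrite mcoeff_msupp h ?eqxx //.
  by move: em; rewrite e' mdegD mdeg1 add1n.
- by apply: zpow_sum => j; have [] := hQ j.
- have hn : \forall w \near x0, forall j, b j w = meval (z ^~ w) (Q j) + g j w.
    by apply: filter_forall => j; have [] := hQ j.
  near=> w; have hw : forall j, b j w = meval (z ^~ w) (Q j) + g j w by near: w.
  have ew : f w - f x0 = \sum_j b j w * z j w by near: w.
  rewrite mevalD mevalC -addrA; apply/eqP; rewrite addrC -subr_eq ew; apply/eqP.
  rewrite rmorph_sum -big_split; apply: eq_bigr => j _ /=.
  by rewrite mevalM mevalXU hw mulrDl [g j w * _]mulrC.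
Unshelve. all: by end_near. Qed.

Lemma zpow_frac e f : zpow e f -> exists P Q, rep x x0 f P Q /\ mpow (x x0) e P.
Proof.
elim: e f => [|e IH] f.
  by move=> /(regular_rep hx Ux0)[P [Q h]]; exists P, Q.
move=> [b [hb eb]].
suff [P [Q [[Q0 h] hP]]] : exists P Q, rep x x0 (fun w => \sum_j z j w * b j w) P Q /\
    mpow (x x0) e.+1 P.
  by exists P, Q; split=> //; split=> //; near=> w; rewrite (near eb w) // (near h w).
have idl := mpow_ideal (x x0) e.+1.
elim: (index_enum _) => [|j r [P [Q [[Q0 h] hP]]]].
  exists 0, 1; split; last exact: (ideal_set0 idl).
  split; first by rewrite meval1 oner_eq0.
  by near=> w; rewrite big_nil meval0 mul0r.
have [P' [Q' [[Q'0 h'] hP']]] := IH _ (hb j).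
have [Pz [Qz [Qz0 hz]]] := regular_rep hx Ux0 (rz j).
have Pz0 : meval (x x0) Pz = 0.
  by have := nbhs_singleton hz; rewrite z0 => /esym/eqP; rewrite mulf_eq0 invr_eq0 (negbTE Qz0) orbF => /eqP.
exists (Pz * P' * Q + P * (Qz * Q')), (Qz * Q' * Q); split; last first.
  apply: (ideal_setD idl); first by rewrite mulrC; apply: (ideal_setM idl); exact: mpowM.
  by rewrite mulrC; exact: (ideal_setM idl).
split; first by rewrite !mevalM !mulf_neq0.
have n1 := ac_near hx Ux0 Q0; have n2 := ac_near hx Ux0 Q'0; have n3 := ac_near hx Ux0 Qz0.
near=> w; rewrite big_cons (near h w) // (near h' w) // (near hz w) //.
have [_ q1] : U w /\ meval (x w) Q != 0 by near: w.
have [_ q2] : U w /\ meval (x w) Q' != 0 by near: w.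
have [_ q3] : U w /\ meval (x w) Qz != 0 by near: w.
rewrite mevalD !mevalM; field.
by rewrite q1 q2 q3.
Unshelve. all: by end_near. Qed.

(** Krull's theorem is available for polynomials; [zpow_frac] rewrites membership in the powers of
    the maximal ideal of the local ring for numerators, the denominators being units at [x0]. *)
Lemma zpow_zero (P0 : mpoly N K) : (forall e, zpow e (fun w => meval (x w) P0)) ->
  \forall w \near x0, meval (x w) P0 = 0.
Proof.
move=> h; pose I : set (mpoly N K) := [set P | \forall w \near x0, meval (x w) P = 0].
have hI : ideal_set I.
  { split=> [|P Q hP hQ|Q P hP]; rewrite /I /=.
  - by near=> w; rewrite meval0.
  - by near=> w; rewrite mevalD (near hP w) // (near hQ w) // addr0.
  - by near=> w; rewrite mevalM (near hP w) // mulr0. }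
have [e|Q Q0 IQ] := krull_intersection (c := x x0) (f := P0) hI.
  have [P [Q [[Q0 hq] hP]]] := zpow_frac (h e); exists Q, P; split=> //.
  have n := ac_near hx Ux0 Q0; rewrite /I /=.
  near=> w; have [_ q] : U w /\ meval (x w) Q != 0 by near: w.
  by rewrite mevalB mevalM (near hq w) // mulrC divfK // subrr.
have n := ac_near hx Ux0 Q0.
near=> w; have [_ q] : U w /\ meval (x w) Q != 0 by near: w.
have : meval (x w) (Q * P0) = 0 by near: w.
by rewrite mevalM => /eqP; rewrite mulf_eq0 (negbTE q) => /eqP.
Unshelve. all: by end_near. Qed.

Lemma der_meval v y n (g : 'I_n -> X -> K) (Q : mpoly n K) : U y -> tangent x y v ->
  (forall j, regular y (g j)) ->
  regular y (fun w => meval (g ^~ w) Q) /\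
  der x v y (fun w => meval (g ^~ w) Q) = \sum_j meval (g ^~ y) (mderiv j Q) * der x v y (g j).
Proof.
move=> Uy tv rg; elim/mpoly_closed_ind: Q => [c|l|p q [rp IHp] [rq IHq]|p q [rp IHp] [rq IHq]].
- rewrite (_ : (fun w => _) = fun=> c); last by apply/funext => w; rewrite mevalC.
  split; first exact: regular_cst.
  by rewrite (der_cst hx) // big1 // => j _; rewrite mderivC meval0 mul0r.
- rewrite (_ : (fun w => _) = g l); last by apply/funext => w; rewrite mevalXU.
  split=> //; rewrite (bigD1 l) //= big1 ?addr0 => [|j jl].
    by rewrite mderivX mnm1E eqxx scale1r mnm_subxx mpolyX0 meval1 mul1r.
  by rewrite mderivX mnm1E eq_sym (negbTE jl) scale0r meval0 mul0r.
- rewrite (_ : (fun w => _) = fun w => meval (g ^~ w) p + meval (g ^~ w) q); last first.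
    by apply/funext => w; rewrite mevalD.
  split; first exact: regular_add.
  rewrite (der_add hx) // IHp IHq -big_split; apply: eq_bigr => j _ /=.
  by rewrite mderivD mevalD mulrDl.
- rewrite (_ : (fun w => _) = fun w => meval (g ^~ w) p * meval (g ^~ w) q); last first.
    by apply/funext => w; rewrite mevalM.
  split; first exact: regular_mul.
  rewrite (der_mul hx) // IHp IHq !mulr_sumr -big_split; apply: eq_bigr => j _ /=.
  by rewrite mderivM mevalD !mevalM; ring.
Qed.

Variables (a : 'I_N -> 'I_d -> X -> K) (AP AQ : 'I_N -> 'I_d -> mpoly N K) (O : set X).
Hypotheses (oO : open O) (Ox0 : O x0) (gO : forall y, O y -> good x0 U x z a AP AQ y).
Variable Zs : nat -> set X.
Hypotheses (hZ : irred_chain setT d Zs) (Z0 : Zs 0%N x0).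
Let Z := Zs d.
Local Notation Bx := (Bx x z a AP AQ).
Local Notation D := (chart_der x z a AP AQ).
Let OU : O `<=` U. Proof. by move=> y /gO/goodU. Qed.

Let irrZ : irreducible Z. Proof. by have [] := hZ.1 d (leqnn d). Qed.
Let clZ : open (~` Z). Proof. by apply: rel_closed_setT_open; have [] := hZ.1 d (leqnn d). Qed.
Let Zx0 : Z x0.
Proof.
have sub m : (m <= d)%N -> Zs m x0.
  by elim: m => // m IH lm; have [h _] := hZ.2 m lm; apply: h; apply: IH; exact: ltnW.
exact: sub.
Qed.
Let nO : \forall w \near x0, O w. Proof. exact: open_nbhs_nbhs. Qed.
Let tB w j : Z w -> O w -> tangent x w (Bx w j).
Proof. exact: (Bx_tangent hx oO Ox0 gO hZ Z0). Qed.

(** The product rule lowers the order by one. It is available along [Z] only, where the rows of [Bx]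
    are known to be tangent. *)
Lemma der_zpow e f j : zpow e.+1 f -> exists g, zpow e g /\
  \forall w \near x0, Z w -> D j f w = g w.
Proof.
elim: e f => [|e IH] f hf.
  have [g rg e] := chart_der_regular hx oO Ox0 gO hZ Z0 j Zx0 Ox0 (zpow_regular hf).
  by exists g; split=> //; near=> w => Zw; apply: (near e w) => //; near: w.
have [b [hb0 eb]] := hf; have {hb0}hb i : zpow e.+1 (b i) := hb0 i.
have /choice[g hg] : forall i, exists g, zpow e g /\
    \forall w \near x0, Z w -> D j (b i) w = g w by move=> i; exact: IH.
exists (fun w => b j w + \sum_i z i w * g i w); split.
  by apply: zpow_add => //; apply: zpow_sum => i; have [] := hg i.
have ng : \forall w \near x0, forall i, Z w -> D j (b i) w = g i w.
  by apply: filter_forall => i; have [] := hg i.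
have nb : \forall w \near x0, forall i, regular w (b i).
  by apply: filter_forall => i; exact: regular_near (zpow_regular (hb i)).
have nf := regular_near (zpow_regular hf); have {}eb := near_join eb.
near=> w => Zw; have Ow : O w by near: w.
have Uw := OU Ow; have tw := tB j Zw Ow.
have ew : \forall u \near w, f u = \sum_i z i u * b i u by near: w; exact: eb.
have rb : forall i, regular w (b i) by near: w.
have gw : forall i, Z w -> D j (b i) w = g i w by near: w.
have rz' i : regular w (z i) := good_z (gO Ow) i.
rewrite /chart_der (der_germ_eq hx Uw tw _ ew); last by near: w.
rewrite (der_sum hx) // => [|i]; last exact: regular_mul.
have -> : b j w = \sum_i b i w * (j == i)%:R.
  by rewrite (bigD1 j) //= eqxx mulr1 big1 ?addr0 // => i /negbTE; rewrite eq_sym => ->; rewrite mulr0.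
rewrite -big_split; apply: eq_bigr => i _ /=.
rewrite (der_mul hx) // -gw // addrC; congr (_ + _); congr (_ * _).
exact: (Bx_dual hx oO Ox0 gO hZ Z0).
Unshelve. all: by end_near. Qed.

(** Differentiating with respect to each parameter reduces [e], so the partial derivatives of [Q]
    are zero; the constant that remains is the value at [x0]. *)
Lemma taylor_unique e (Q : mpoly d K) g : (forall m, (e <= mdeg m)%N -> mcoeff m Q = 0) ->
  zpow e g -> (\forall w \near x0, Z w -> meval (z ^~ w) Q + g w = 0) -> Q = 0.
Proof.
elim: e Q g => [|e IH] Q g hQ hg hz; first by apply/mpolyP => m; rewrite hQ // mcoeff0.
have Qc : Q = mpolyC d (mcoeff mnm0 Q).
  apply: mderiv0_const => j; have [g' [hg' eg']] := der_zpow j hg.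
  apply: (IH _ g') => //.
    by move=> m em; rewrite mcoeff_deriv hQ ?mul0rn // mdegD mdeg1 addn1.
  have [rQ _] := der_meval Q Ux0 (tB j Zx0 Ox0) (fun i => rz i).
  have rg := zpow_regular hg.
  have h := chart_der_null hx Ux0 oO Ox0 gO hZ Z0 j (regular_add rQ rg) hz.
  have nr := regular_near rg.
  near=> w => Zw; have Ow : O w by near: w.
  have [rQw dQ] := der_meval Q (OU Ow) (tB j Zw Ow) (good_z (gO Ow)).
  have : D j (fun w => meval (z ^~ w) Q + g w) w = 0 by apply: (near h w).
  rewrite /chart_der (der_add hx (OU Ow) (tB j Zw Ow)) //; last by near: w.
  rewrite dQ => <-; congr (_ + _); last by rewrite -(near eg' w).
  rewrite (bigD1 j) //= (Bx_dual hx oO Ox0 gO hZ Z0) // eqxx mulr1 big1 ?addr0 // => i ij.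
  by rewrite (Bx_dual hx oO Ox0 gO hZ Z0) // eq_sym (negbTE ij) mulr0.
have := nbhs_singleton hz Zx0; rewrite (zpow_at0 hg) addr0 Qc mevalC => ->.
by rewrite mpolyC0.
Unshelve. all: by end_near. Qed.

(** A polynomial vanishing on [Z] has zero Taylor polynomials of all orders, so it vanishes near
    [x0] by Krull's theorem. The neighbourhood depends on the polynomial; the minimal closed set [G]
    makes one choice serve all of them. *)
Lemma near_in_chain : \forall w \near x0, Z w.
Proof.
have zero P : (forall q, Z q -> U q -> meval (x q) P = 0) -> \forall w \near x0, meval (x w) P = 0.
  move=> hP; apply: zpow_zero => e.
  have [Q [g [hQ hg h]]] := zpow_decomp e (regular_poly P hx Ux0).
  have nU : \forall w \near x0, U w by apply: open_nbhs_nbhs; split=> //; exact: (ac_open hx).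
  have Q0 : Q = 0.
    apply: (taylor_unique hQ hg); near=> w => Zw; rewrite -(near h w) // hP //.
    by near: w.
  case: e g hg h {hQ} => [|e] g hg h; first exact: (regular_poly P hx Ux0).
  have [b [hb eb]] := hg; exists b; split=> //.
  by near=> w; rewrite (near h w) // Q0 meval0 add0r (near eb w).
pose F := x @` U.
pose C := [set G | zclosed F G /\ \forall w \near x0, G (x w)].
have nU : \forall w \near x0, U w by apply: open_nbhs_nbhs; split=> //; exact: (ac_open hx).
have [||G [zG nG] mG] := @zclosed_minimal K N F C; [|by move=> G []|].
  by exists F; split; [split|near=> w; exists w => //; near: w].
near=> w; have Uw : U w by near: w.
apply: contrapT => nZ; have [P [Pw hP]] := poly_separation hx clZ Uw nZ.
have /seteqP[_ sub] : [set v | G v /\ meval v P = 0] = G.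
  apply: mG; last by move=> v [].
  split; last first.
    have h := zero P hP; near=> y; split; first by near: y.
    by near: y.
  split; first by move=> v [/(zG.1)].
  move=> v Fv h; split; last by apply: h => q [].
  by apply: (zG.2) => // R hR; apply: h => q [/hR].
have [_ /eqP] : G (x w) /\ meval (x w) P = 0 by apply: sub; near: w.
by rewrite (negbTE Pw).
Unshelve. all: by end_near. Qed.

Lemma chart_of_chain : exists V, V x0 /\ chart V z D.
Proof.
pose V := [set y | Z y /\ O y]^°.
have hV y : V y -> Z y /\ O y by move=> /interior_subset.
have Vx0 : V x0 by rewrite /V /interior /=; near=> w; split; near: w; [exact: near_in_chain|exact: nO].
have oV : open V by exact: open_interior.
have nV y : V y -> \forall w \near y, Z w /\ O w by move=> Vy.
exists V; split=> //; split=> //.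
- rewrite (_ : V = Z `&` V); last by apply/seteqP; split=> [y Vy|y []//]; split=> //; have [] := hV y Vy.
  by apply: irreducible_setI_open => //; exists x0.
- by move=> y i /hV[_ /gO/good_z].
- move=> y j Vy; have [Zy Oy] := hV y Vy; split.
  + move=> f rf; have [g rg e] := chart_der_regular hx oO Ox0 gO hZ Z0 j Zy Oy rf.
    apply: (regular_germ rg); have n := nV y Vy; near=> w.
    by have [Zw Ow] : Z w /\ O w by [near: w]; rewrite -(near e w).
  + move=> f g rf e; have n := nV y Vy; have r := regular_near rf; have {}e := near_join e; near=> w.
    have [Zw Ow] : Z w /\ O w by near: w.
    have rw : regular w f by near: w.
    apply: (der_germ_eq hx (OU Ow) (tB j Zw Ow) rw).
    by near: w; exact: e.
  + move=> c; have n := nV y Vy; near=> w.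
    have [Zw Ow] : Z w /\ O w by near: w.
    exact: (der_cst hx _ (OU Ow) (tB j Zw Ow)).
  + move=> f g rf rg; have n := nV y Vy; have r := regular_near rf; have r' := regular_near rg; near=> w.
    have [Zw Ow] : Z w /\ O w by near: w.
    by apply: (der_add hx (OU Ow) (tB j Zw Ow)); near: w.
  + move=> f g rf rg; have n := nV y Vy; have r := regular_near rf; have r' := regular_near rg; near=> w.
    have [Zw Ow] : Z w /\ O w by near: w.
    by apply: (der_mul hx (OU Ow) (tB j Zw Ow)); near: w.
- move=> y i j /hV[Zy Oy]; exact: (Bx_dual hx oO Ox0 gO hZ Z0).
- by move=> y f /hV[Zy Oy] rf f0; have [b] := good_par hx (gO Oy) rf f0; exists b.
Unshelve. all: by end_near. Qed.

End Taylor.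

Section SmoothChart.
Variables (K : numClosedFieldType) (X : variety K).

Lemma parameters_good (x0 : X) d (z : 'I_d -> X -> K) U N (x : X -> 'I_N -> K) :
  aff_coord U x -> U x0 -> parameters x0 z ->
  exists a AP AQ O, [/\ open O, O x0 & forall y, O y -> good x0 U x z a AP AQ y].
Proof.
move=> hx Ux0 [_ hz hp].
have rz j : regular x0 (z j) by have [] := hz j.
have /choice[a ha] : forall l, exists a : 'I_d -> X -> K, (forall j, regular x0 (a j)) /\
    \forall w \near x0, x w l - x x0 l = \sum_j a j w * z j w.
  move=> l; have rl : regular x0 (fun w => x w l - x x0 l).
    by apply: regular_sub; [exact: (regular_coord _ hx Ux0)|exact: regular_cst].
  by have /germ_span_range[a ra e] := hp _ rl (subrr _); exists a.
have /choice[PQ hPQ] : forall lj : 'I_N * 'I_d, exists PQ : mpoly N K * mpoly N K,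
    rep x x0 (a lj.1 lj.2) PQ.1 PQ.2.
  move=> [l j]; have [ra _] := ha l; have [P [Q h]] := regular_rep hx Ux0 (ra j).
  by exists (P, Q).
pose AP l j := (PQ (l, j)).1; pose AQ l j := (PQ (l, j)).2.
have he l : \forall w \near x0, x w l = x x0 l + \sum_j a l j w * z j w.
  by have [_ e] := ha l; near=> w; rewrite -(near e w) // addrC subrK.
have g0 : good x0 U x z a AP AQ x0.
  split=> //; first by move=> l j; exact: (hPQ (l, j)).
  rewrite (_ : Mx x z AP AQ x0 = 1%:M) ?det1 ?oner_eq0 //.
  apply/matrixP => p l; rewrite !mxE big1 ?subr0 // => j _.
  by have [_ ->] := hz j; rewrite mul0r.
suff /near_open[O [oO Ox hO]] : \forall w \near x0, good x0 U x z a AP AQ w.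
  by exists a, AP, AQ, O.
have n1 : \forall w \near x0, U w by apply: open_nbhs_nbhs; split=> //; exact: (ac_open hx).
have n2 : \forall w \near x0, forall j, regular w (z j).
  by apply: filter_forall => j; exact: regular_near.
have n3 : \forall w \near x0, forall lj : 'I_N * 'I_d, rep x w (a lj.1 lj.2) (PQ lj).1 (PQ lj).2.
  apply: filter_forall => lj; have [Q0 e] := hPQ lj; have h := ac_near hx Ux0 Q0.
  have {}e := near_join e; near=> w; split; last by near: w; exact: e.
  by have [] : U w /\ meval (x w) (PQ lj).2 != 0 by near: w.
have n4 : \forall w \near x0, forall l, \forall u \near w, x u l = x x0 l + \sum_j a l j u * z j u.
  by apply: filter_forall => l; exact: near_join (he l).
have n5 : \forall w \near x0, \det (Mx x z AP AQ w) != 0.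
  apply: (regular_neq0 (f := fun w => \det (Mx x z AP AQ w))); last exact: (good_det g0).
  by apply: regular_det => i j; exact: (Mx_regular hx _ _ g0).
near=> w; split.
- by near: w.
- by near: w.
- have h : forall lj : 'I_N * 'I_d, rep x w (a lj.1 lj.2) (PQ lj).1 (PQ lj).2 by near: w.
  by move=> l j; exact: (h (l, j)).
- by near: w.
- by near: w.
Unshelve. all: by end_near. Qed.

Theorem smooth_chart (x0 : X) d (z : 'I_d -> X -> K) : parameters x0 z ->
  exists V D, V x0 /\ chart V z D.
Proof.
move=> par; have [U [N [x [hx Ux0]]]] := affine_coord_at x0.
have [a [AP [AQ [O [oO Ox0 gO]]]]] := parameters_good hx Ux0 par.
have [Zs [hZ Z0]] := exists_max_chain hx par oO Ox0 gO.
have [V hV] := chart_of_chain hx Ux0 par oO Ox0 gO hZ Z0.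
by exists V; eexists; exact: hV.
Qed.

Lemma smooth_chain_le (x0 : X) d (z : 'I_d -> X -> K) n Z : parameters x0 z ->
  irred_chain setT n Z -> Z 0%N x0 -> (n <= d)%N.
Proof.
move=> par; have [U [N [x [hx Ux0]]]] := affine_coord_at x0.
have [a [AP [AQ [O [oO Ox0 gO]]]]] := parameters_good hx Ux0 par.
exact: (chain_le hx oO Ox0 gO).
Qed.

Lemma smooth_max_chain (x0 : X) d (z : 'I_d -> X -> K) : parameters x0 z ->
  exists Z, irred_chain setT d Z /\ Z 0%N x0.
Proof.
move=> par; have [U [N [x [hx Ux0]]]] := affine_coord_at x0.
have [a [AP [AQ [O [oO Ox0 gO]]]]] := parameters_good hx Ux0 par.
exact: (exists_max_chain hx par oO Ox0 gO).
Qed.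

Section Derivation.
Variables (y : X) (D : (X -> K) -> X -> K).
Hypothesis hD : derivation_at y D.

Lemma derivation_cst c : D (fun=> c) y = 0.
Proof. exact: (nbhs_singleton (Defs.der_cst hD c)). Qed.

Lemma derivation_germ f g : regular y f -> (\forall w \near y, f w = g w) -> D f y = D g y.
Proof. by move=> rf e; exact: (nbhs_singleton (der_germ hD rf e)). Qed.

Lemma derivation_add f g : regular y f -> regular y g -> D (fun w => f w + g w) y = D f y + D g y.
Proof. by move=> rf rg; exact: (nbhs_singleton (Defs.der_add hD rf rg)). Qed.

Lemma derivation_mul f g : regular y f -> regular y g ->
  D (fun w => f w * g w) y = f y * D g y + g y * D f y.
Proof. by move=> rf rg; exact: (nbhs_singleton (Defs.der_mul hD rf rg)). Qed.

Lemma derivation_sub_cst f c : regular y f -> D (fun w => f w - c) y = D f y.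
Proof.
by move=> rf; rewrite derivation_add ?derivation_cst ?addr0 //; exact: regular_cst.
Qed.

Lemma derivation_sum (I : Type) (r : seq I) (f : I -> X -> K) : (forall i, regular y (f i)) ->
  D (fun w => \sum_(i <- r) f i w) y = \sum_(i <- r) D (f i) y.
Proof.
move=> rf; elim: r => [|i r IH].
  rewrite big_nil (_ : (fun w => _) = fun=> 0) ?derivation_cst //.
  by apply/funext => w; rewrite big_nil.
rewrite big_cons -IH -derivation_add //; last exact: regular_sum.
by congr (D _ y); apply/funext => w; rewrite big_cons.
Qed.

Lemma derivation_span d (w : 'I_d -> X -> K) (b : 'I_d -> X -> K) f :
  regular y f -> (forall j, regular y (w j)) -> (forall j, regular y (b j)) ->
  (\forall u \near y, f u = \sum_j b j u * (w j u - w j y)) ->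
  D f y = \sum_j b j y * D (w j) y.
Proof.
move=> rf rw rb e; rewrite (derivation_germ rf e).
have rs j : regular y (fun u => w j u - w j y) by apply: regular_sub => //; exact: regular_cst.
rewrite derivation_sum => [|j]; last exact: regular_mul.
apply: eq_bigr => j _; rewrite derivation_mul // subrr mul0r addr0.
by rewrite derivation_sub_cst.
Qed.
End Derivation.

(** At a common point the Jacobian matrices between the two coordinate systems have product the
    identity of size [d], which has rank at most [d']. *)
Lemma chart_dim_le O O' d d' (w : 'I_d -> X -> K) (w' : 'I_d' -> X -> K) D D' y :
  chart O w D -> chart O' w' D' -> O y -> O' y -> (d <= d')%N.
Proof.
move=> h h' Oy O'y.
have /choice[b hb] : forall i, exists b : 'I_d' -> X -> K, (forall j, regular y (b j)) /\
    \forall u \near y, w i u - w i y = \sum_j b j u * (w' j u - w' j y).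
  move=> i; have rw : regular y (fun u => w i u - w i y).
    by apply: regular_sub; [exact: (ch_reg h)|exact: regular_cst].
  by have [b rb e] := ch_par h' O'y rw (subrr _); exists b.
pose A := \matrix_(i, j) b i j y; pose B := \matrix_(j, k) D k (w' j) y.
have : A *m B = 1%:M.
  apply/matrixP => i k; rewrite !mxE eq_sym -(ch_dual h k i Oy).
  have dk := ch_der h k Oy; have [rb e] := hb i.
  have rw : regular y (w i) := ch_reg h i Oy.
  rewrite -(derivation_sub_cst dk (w i y) rw) (derivation_span dk _ (fun j => ch_reg h' j O'y) rb e).
    by apply: eq_bigr => j _; rewrite !mxE.
  by apply: regular_sub => //; exact: regular_cst.
move/(congr1 (@mxrank _ _ _)); rewrite mxrank1 => <-.
exact: leq_trans (mxrankM_maxl _ _) (rank_leq_col _).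
Qed.

(** A chart is irreducible, so an open set is dense in each chart that it meets; its closure is
    therefore open, and connectedness makes it everything. *)
Lemma connected_irreducible : smooth X -> connected [set: X] -> [set: X] !=set0 ->
  irreducible [set: X].
Proof.
move=> sm con ne; apply: irreducibleP => // O1 O2 o1 o2 [a [_ O1a]] [b [_ O2b]].
have clE : closure O1 = setT.
  apply: con; [|exists (closure O1); last by rewrite setTI|
                exists (closure O1); [exact: closed_closure|by rewrite setTI]].
    by exists a; exact: subset_closure.
  rewrite openE => y cy; have [d [z par]] := sm y; have [V [D [Vy hV]]] := smooth_chart par.
  have nV : nbhs y V by apply: open_nbhs_nbhs; split=> //; exact: (ch_open hV).
  have VO : V `&` O1 !=set0 by have [p [O1p Vp]] := cy V nV; exists p.
  rewrite /interior /=; apply: filterS nV => p /(irreducible_dense (ch_irr hV) o1 VO).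
  by apply: closure_subset => q [].
have [p [O1p O2p]] : O1 `&` O2 !=set0.
  have cb : closure O1 b by rewrite clE.
  by apply: cb; apply: open_nbhs_nbhs.
by exists p.
Qed.

Lemma chart_parameters_dim x0 d (z : 'I_d -> X -> K) O d' (w : 'I_d' -> X -> K) D :
  irreducible [set: X] -> parameters x0 z -> chart O w D -> d = d'.
Proof.
move=> irr par h; have [V [D' [Vx hV]]] := smooth_chart par.
have [||p [_ [Vp Op]]] := irreducible_meet irr (ch_open hV) (ch_open h).
    by exists x0.
  by have [[p Op] _] := ch_irr h; exists p.
by apply/eqP; rewrite eqn_leq (chart_dim_le hV h Vp Op) (chart_dim_le h hV Op Vp).
Qed.

(** The number of parameters is the same at all points and bounds all chains, which makes
    [krull_dim] a true maximum. *)
Lemma krull_dim_smooth x0 d (z : 'I_d -> X -> K) : smooth X -> irreducible [set: X] ->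
  parameters x0 z -> krull_dim [set: X] = d.
Proof.
move=> sm irr par; have [V [D [Vx hV]]] := smooth_chart par.
have bd n : [set n | exists Z, irred_chain [set: X] n Z] n -> (n <= d)%N.
  move=> [Z hZ]; have [irr0 _] := hZ.1 0%N (leq0n n); have [[y Zy] _] := irr0.
  have [d' [z' par']] := sm y.
  by rewrite -(chart_parameters_dim irr par' hV); exact: smooth_chain_le par' hZ Zy.
have [Z [hZ _]] := smooth_max_chain par.
have ex : [set n | exists Z, irred_chain [set: X] n Z] d by exists Z.
have [h1 h2] := max_natP (ex_intro _ d ex) bd.
by apply/eqP; rewrite eqn_leq; apply/andP; split; [exact: bd h1|exact: h2].
Qed.

End SmoothChart.

(** * Power series *)

(** Formal power series as coefficient functions, so that the coefficients of jets and arcs are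
    series without conversion. *)
Definition pser (K : Type) : Type := nat -> K.

Section PowerSeries.
Variable K : fieldType.
Implicit Types (a b c : pser K).

HB.instance Definition _ := gen_eqMixin (pser K).
HB.instance Definition _ := gen_choiceMixin (pser K).

Definition pser_zero : pser K := fun=> 0.
Definition pser_opp a : pser K := fun k => - a k.
Definition pser_add a b : pser K := fun k => a k + b k.
Definition pser_one : pser K := fun k => (k == 0%N)%:R.
Definition pser_mul a b : pser K := fun k => \sum_(i < k.+1) a i * b (k - i)%N.

Lemma pser_addA : associative pser_add.
Proof. by move=> a b c; apply/funext => k; rewrite /pser_add addrA. Qed.
Lemma pser_addC : commutative pser_add.
Proof. by move=> a b; apply/funext => k; rewrite /pser_add addrC. Qed.
Lemma pser_add0 : left_id pser_zero pser_add.
Proof. by move=> a; apply/funext => k; rewrite /pser_add add0r. Qed.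
Lemma pser_addN : left_inverse pser_zero pser_opp pser_add.
Proof. by move=> a; apply/funext => k; rewrite /pser_add addNr. Qed.

HB.instance Definition _ := GRing.isZmodule.Build (pser K) pser_addA pser_addC pser_add0 pser_addN.

Definition ptrunc n a : {poly K} := \poly_(i < n) a i.

Lemma ptrunc_coef n a k : (k < n)%N -> (ptrunc n a)`_k = a k.
Proof. by move=> kn; rewrite coef_poly kn. Qed.

(** Each coefficient of a product involves finitely many others, so ring identities are inherited
    from polynomials. *)
Lemma pser_mul_coef a b (p q : {poly K}) k : (forall i, (i <= k)%N -> a i = p`_i) ->
  (forall i, (i <= k)%N -> b i = q`_i) -> pser_mul a b k = (p * q)`_k.
Proof.
move=> ha hb; rewrite coefM; apply: eq_bigr => i _.
by rewrite ha -1?ltnS // hb // leq_subr.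
Qed.

Lemma pser_mulA : associative pser_mul.
Proof.
move=> a b c; apply/funext => k.
have t a' i : (i <= k)%N -> a' i = (ptrunc k.+1 a')`_i by move=> ik; rewrite ptrunc_coef.
rewrite (@pser_mul_coef _ _ (ptrunc k.+1 a) (ptrunc k.+1 b * ptrunc k.+1 c)); [|exact: t|].
  rewrite mulrA; apply/esym/pser_mul_coef => [i ik|i ik]; last exact: t.
  by apply: pser_mul_coef => j ji; apply: t; exact: leq_trans ik.
by move=> i ik; apply: pser_mul_coef => j ji; apply: t; exact: leq_trans ik.
Qed.

Lemma pser_mulC : commutative pser_mul.
Proof.
move=> a b; apply/funext => k.
have t a' i : (i <= k)%N -> a' i = (ptrunc k.+1 a')`_i by move=> ik; rewrite ptrunc_coef.
by rewrite (pser_mul_coef (t a) (t b)) mulrC -(pser_mul_coef (t b) (t a)).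
Qed.

Lemma pser_mul1 : left_id pser_one pser_mul.
Proof.
move=> a; apply/funext => k; rewrite /pser_mul big_ord_recl subn0 /pser_one eqxx mul1r.
by rewrite big1 ?addr0 // => i _; rewrite mul0r.
Qed.

Lemma pser_mulDl : left_distributive pser_mul +%R.
Proof.
move=> a b c; apply/funext => k; rewrite /pser_mul /GRing.add /= /pser_add -big_split.
by apply: eq_bigr => i _; rewrite mulrDl.
Qed.

Lemma pser_one_neq0 : pser_one != 0.
Proof. by apply/eqP => /(congr1 (@^~ 0%N))/eqP; rewrite /pser_one eqxx oner_eq0. Qed.

HB.instance Definition _ := GRing.Zmodule_isComNzRing.Build (pser K)
  pser_mulA pser_mulC pser_mul1 pser_mulDl pser_one_neq0.

Lemma pserD a b k : (a + b) k = a k + b k. Proof. by []. Qed.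
Lemma pserN a k : (- a) k = - a k. Proof. by []. Qed.
Lemma pserB a b k : (a - b) k = a k - b k. Proof. by []. Qed.
Lemma pserM a b k : (a * b) k = \sum_(i < k.+1) a i * b (k - i)%N. Proof. by []. Qed.
Lemma pser0 k : (0 : pser K) k = 0. Proof. by []. Qed.
Lemma pserM0 a b : (a * b) 0%N = a 0%N * b 0%N. Proof. by rewrite pserM big_ord1. Qed.

Lemma pser_sum (I : Type) (r : seq I) (P : pred I) (F : I -> pser K) k :
  (\sum_(i <- r | P i) F i) k = \sum_(i <- r | P i) F i k.
Proof. by elim/big_rec2: _ => // i x y _ <-. Qed.

Definition pcst (u : K) : pser K := fun k => u *+ (k == 0%N).

Lemma pcstM (u : K) a k : (pcst u * a) k = u * a k.
Proof.
rewrite pserM big_ord_recl subn0 /pcst eqxx mulr1n big1 ?addr0 // => i _.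
by rewrite mulr0n mul0r.
Qed.

Definition peq M a b := forall k, (k < M)%N -> a k = b k.

Lemma peq_sym M a b : peq M a b -> peq M b a. Proof. by move=> h k /h. Qed.
Lemma peq_trans M a b c : peq M a b -> peq M b c -> peq M a c.
Proof. by move=> h h' k kM; rewrite h // h'. Qed.
Lemma peqD M a b a' b' : peq M a b -> peq M a' b' -> peq M (a + a') (b + b').
Proof. by move=> h h' k kM; rewrite !pserD h // h'. Qed.
Lemma peqN M a b : peq M a b -> peq M (- a) (- b).
Proof. by move=> h k kM; rewrite !pserN h. Qed.
Lemma peqB M a b a' b' : peq M a b -> peq M a' b' -> peq M (a - a') (b - b').
Proof. by move=> h h'; apply: peqD => //; exact: peqN. Qed.
Lemma peqM M a b a' b' : peq M a b -> peq M a' b' -> peq M (a * a') (b * b').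
Proof.
move=> h h' k kM; rewrite !pserM; apply: eq_bigr => i _; rewrite h ?h' //.
  by apply: leq_ltn_trans kM; exact: leq_subr.
by apply: leq_ltn_trans kM; rewrite -ltnS.
Qed.
Lemma peq_sum M (I : Type) (r : seq I) (P : pred I) (F G : I -> pser K) :
  (forall i, P i -> peq M (F i) (G i)) -> peq M (\sum_(i <- r | P i) F i) (\sum_(i <- r | P i) G i).
Proof. by move=> h k kM; rewrite !pser_sum; apply: eq_bigr => i Pi; exact: h. Qed.
Lemma peq_sum0 M (I : Type) (r : seq I) (P : pred I) (F : I -> pser K) :
  (forall i, P i -> peq M (F i) 0) -> peq M (\sum_(i <- r | P i) F i) 0.
Proof. by move=> h k kM; rewrite pser_sum big1 // => i Pi; rewrite h. Qed.
Lemma peq_le M M' a b : (M <= M')%N -> peq M' a b -> peq M a b.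
Proof. by move=> le h k kM; apply: h; exact: leq_trans le. Qed.

Lemma peq0_mul m n a b : peq m a 0 -> peq n b 0 -> peq (m + n) (a * b) 0.
Proof.
move=> ha hb k kM; rewrite pserM big1 // => i _.
have [im|mi] := ltnP i m; first by rewrite ha // mul0r.
rewrite hb ?mulr0 // ltn_subLR -1?ltnS //; apply: leq_trans kM _.
by rewrite leq_add2r.
Qed.

Definition pderiv a : pser K := fun k => a k.+1 *+ k.+1.

Lemma pderivM a b : pderiv (a * b) = a * pderiv b + b * pderiv a.
Proof.
apply/funext => k; rewrite pserD.
have t a' i : (i <= k.+1)%N -> a' i = (ptrunc k.+2 a')`_i by move=> ik; rewrite ptrunc_coef.
have td a' i : (i <= k)%N -> pderiv a' i = ((ptrunc k.+2 a')^`())`_i.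
  by move=> ik; rewrite coef_deriv /pderiv (t a').
have t' a' i : (i <= k)%N -> a' i = (ptrunc k.+2 a')`_i by move=> ik; apply: t; exact: leqW.
have e1 : (a * b) k.+1 = (ptrunc k.+2 a * ptrunc k.+2 b)`_k.+1 := pser_mul_coef (t a) (t b).
have e2 : (a * pderiv b) k = (ptrunc k.+2 a * (ptrunc k.+2 b)^`())`_k := pser_mul_coef (t' a) (td b).
have e3 : (b * pderiv a) k = (ptrunc k.+2 b * (ptrunc k.+2 a)^`())`_k := pser_mul_coef (t' b) (td a).
by rewrite e2 e3 /pderiv e1 -coef_deriv derivM coefD addrC; congr (_ + _); rewrite mulrC.
Qed.

Definition pshift n a : pser K := fun k => a (k + n)%N.

End PowerSeries.

(** * Homomorphisms and derivations into truncated power series *)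

Section Homs.
Variables (K : numClosedFieldType) (X : variety K).
Implicit Types (y : X) (f g : X -> K) (ga E : (X -> K) -> pser K).

(** A homomorphism modulo [t^M]; jets, arcs and the approximations [arcn] are all of this kind. *)
Record mhom y M ga : Prop := MHom {
  mh_germ : forall f g, regular y f -> (\forall w \near y, f w = g w) -> peq M (ga f) (ga g) ;
  mh_loc : forall f, regular y f -> (0 < M)%N -> ga f 0%N = f y ;
  mh_cst : forall c, peq M (ga (fun=> c)) (pcst c) ;
  mh_add : forall f g, regular y f -> regular y g ->
    peq M (ga (fun w => f w + g w)) (ga f + ga g) ;
  mh_mul : forall f g, regular y f -> regular y g ->
    peq M (ga (fun w => f w * g w)) (ga f * ga g) }.

Record mder y M ga E : Prop := MDer {
  md_germ : forall f g, regular y f -> (\forall w \near y, f w = g w) -> peq M (E f) (E g) ;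
  md_cst : forall c, peq M (E (fun=> c)) 0 ;
  md_add : forall f g, regular y f -> regular y g ->
    peq M (E (fun w => f w + g w)) (E f + E g) ;
  md_mul : forall f g, regular y f -> regular y g ->
    peq M (E (fun w => f w * g w)) (ga f * E g + ga g * E f) }.

Lemma local_hom_mhom y (phi : (X -> K) -> nat -> K) M lvl : local_hom lvl y phi ->
  (forall k, (k < M)%N -> lvl k) -> mhom y M phi.
Proof.
move=> [_ germ loc cst add mul] hl; split.
- by move=> f g rf e k kM; exact: germ.
- by move=> f rf _; exact: loc.
- by move=> c k kM; rewrite cst //; exact: hl.
- by move=> f g rf rg k kM; rewrite add //; exact: hl.
- by move=> f g rf rg k kM; rewrite mul //; exact: hl.
Qed.

Definition arc_ser (g : formal_arc X) (f : X -> K) : pser K := arc_coef g f.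

Lemma arc_mhom (g : formal_arc X) M : mhom (arc_center g) M (arc_ser g).
Proof. by apply: local_hom_mhom (arc_hom g) _. Qed.

Lemma jet_mhom m (j : jet X m) : mhom (jet_center j) m.+1 (jet_coef j).
Proof. by apply: local_hom_mhom (jet_hom j) _. Qed.

Lemma mhom_le y M M' ga : (M <= M')%N -> mhom y M' ga -> mhom y M ga.
Proof.
move=> le [germ loc cst add mul]; split.
- by move=> f g rf e; exact: peq_le le (germ f g rf e).
- by move=> f rf M0; apply: loc => //; exact: leq_trans le.
- by move=> c; exact: peq_le le (cst c).
- by move=> f g rf rg; exact: peq_le le (add f g rf rg).
- by move=> f g rf rg; exact: peq_le le (mul f g rf rg).
Qed.

Lemma mhom_sum y M ga (I : Type) (r : seq I) (f : I -> X -> K) : mhom y M ga ->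
  (forall i, regular y (f i)) -> peq M (ga (fun w => \sum_(i <- r) f i w)) (\sum_(i <- r) ga (f i)).
Proof.
move=> h rf; elim: r => [|i r IH].
  rewrite big_nil (_ : (fun w => _) = fun=> 0); last by apply/funext => w; rewrite big_nil.
  by apply: peq_trans (mh_cst h 0) _ => k _; rewrite /pcst mul0rn.
rewrite big_cons (_ : (fun w => _) = fun w => f i w + \sum_(i <- r) f i w); last first.
  by apply/funext => w; rewrite big_cons.
apply: peq_trans (mh_add h (rf i) _) _; first exact: regular_sum.
exact: peqD.
Qed.

Lemma mhom_prod y M ga (I : Type) (r : seq I) (f : I -> X -> K) : mhom y M ga ->
  (forall i, regular y (f i)) -> peq M (ga (fun w => \prod_(i <- r) f i w)) (\prod_(i <- r) ga (f i)).
Proof.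
move=> h rf; elim: r => [|i r IH].
  rewrite big_nil (_ : (fun w => _) = fun=> 1); last by apply/funext => w; rewrite big_nil.
  by apply: peq_trans (mh_cst h 1) _.
rewrite big_cons (_ : (fun w => _) = fun w => f i w * \prod_(i <- r) f i w); last first.
  by apply/funext => w; rewrite big_cons.
apply: peq_trans (mh_mul h (rf i) _) _; first exact: regular_prod.
exact: peqM.
Qed.

Lemma mder_sum y M ga E (I : Type) (r : seq I) (f : I -> X -> K) : mder y M ga E ->
  (forall i, regular y (f i)) -> peq M (E (fun w => \sum_(i <- r) f i w)) (\sum_(i <- r) E (f i)).
Proof.
move=> h rf; elim: r => [|i r IH].
  rewrite big_nil (_ : (fun w => _) = fun=> 0); last by apply/funext => w; rewrite big_nil.
  exact: (md_cst h 0).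
rewrite big_cons (_ : (fun w => _) = fun w => f i w + \sum_(i <- r) f i w); last first.
  by apply/funext => w; rewrite big_cons.
apply: peq_trans (md_add h (rf i) _) _; first exact: regular_sum.
exact: peqD.
Qed.

Lemma mder_sub_cst y M ga E f c : mder y M ga E -> regular y f ->
  peq M (E (fun w => f w - c)) (E f).
Proof.
move=> h rf; apply: peq_trans (md_add h rf (regular_cst _ _)) _.
by rewrite -[X in peq _ _ X]addr0; apply: peqD => //; exact: (md_cst h).
Qed.

Variables (O : set X) (d : nat) (w : 'I_d -> X -> K) (D : 'I_d -> (X -> K) -> X -> K).
Hypothesis hC : chart O w D.

Lemma chart_der_reg y i f : O y -> regular y f -> regular y (D i f).
Proof. by move=> Oy; exact: (der_regular (ch_der hC i Oy)). Qed.

Lemma chart_near y : O y -> \forall u \near y, O u.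
Proof. by move=> Oy; apply: open_nbhs_nbhs; split=> //; exact: (ch_open hC). Qed.

Lemma chart_dual_near y i j : O y -> \forall u \near y, D i (w j) u = (i == j)%:R.
Proof. by move=> Oy; have h := chart_near Oy; near=> u; apply: (ch_dual hC); near: u.
Unshelve. all: by end_near. Qed.

(** The difference [F] of the two sides is a derivation that kills the coordinates. Writing
    [g - g y] in terms of the [w j - w j y], whose series are divisible by [t], raises by one the
    order to which all values of [F] vanish. *)
Lemma mder_chart y M ga E f : O y -> mhom y M ga -> mder y M ga E -> regular y f ->
  peq M (E f) (\sum_j ga (D j f) * E (w j)).
Proof.
move=> Oy hg hE rf0.
have rw j : regular y (w j) := ch_reg hC j Oy.
pose F f := E f - \sum_j ga (D j f) * E (w j).
have rD j f' : regular y f' -> regular y (D j f') by exact: chart_der_reg.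
have hF : mder y M ga F.
  { split=> [g h rg e|c|g h rg rh|g h rg rh].
  - apply: peqB; first exact: (md_germ hE).
    apply: peq_sum => j _; apply: peqM => //; apply: (mh_germ hg); first exact: rD.
    exact: (der_germ (ch_der hC j Oy)).
  - rewrite -[X in peq _ _ X](subr0 0); apply: peqB; first exact: (md_cst hE).
    apply: peq_sum0 => j _.
    rewrite -[X in peq _ _ X](mul0r (E (w j))); apply: peqM => //.
    have /(mh_germ hg) h := Defs.der_cst (ch_der hC j Oy) c.
    apply: peq_trans (h _) _; first exact/rD/regular_cst.
    by apply: peq_trans (mh_cst hg 0) _ => k _; rewrite /pcst mul0rn.
  - have -> : F g + F h = (E g + E h) - \sum_j (ga (D j g) + ga (D j h)) * E (w j).
      rewrite /F; under [in RHS]eq_bigr do rewrite mulrDl.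
      by rewrite big_split /= opprD addrACA.
    apply: peqB; first exact: (md_add hE).
    apply: peq_sum => j _; apply: peqM => //.
    have e := Defs.der_add (ch_der hC j Oy) rg rh.
    apply: peq_trans (mh_germ hg _ e) _; first by apply: rD; exact: regular_add.
    by apply: (mh_add hg); exact: rD.
  - have -> : ga g * F h + ga h * F g = (ga g * E h + ga h * E g) -
        \sum_j (ga g * ga (D j h) + ga h * ga (D j g)) * E (w j).
      rewrite /F !mulrBr !mulr_sumr addrACA -opprD -big_split; congr (_ - _).
      by apply: eq_bigr => j _; rewrite mulrDl !mulrA.
    apply: peqB; first exact: (md_mul hE).
    apply: peq_sum => j _; apply: peqM => //.
    have e := Defs.der_mul (ch_der hC j Oy) rg rh.
    apply: peq_trans (mh_germ hg _ e) _; first by apply: rD; exact: regular_mul.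
    have r1 := regular_mul rg (rD j h rh); have r2 := regular_mul rh (rD j g rg).
    apply: peq_trans (mh_add hg r1 r2) _.
    by apply: peqD; apply: (mh_mul hg) => //; exact: rD. }
have Fw i : peq M (F (w i)) 0.
  rewrite -(subrr (E (w i))); apply: peqB => //.
  rewrite -[X in peq _ _ X](_ : \sum_j pcst (j == i)%:R * E (w j) = _); last first.
    rewrite (bigD1 i) //= eqxx big1 ?addr0 => [|j /negbTE->].
      by apply/funext => k; rewrite pcstM mul1r.
    by apply/funext => k; rewrite pcstM mul0r.
  apply: peq_sum => j _; apply: peqM => //.
  apply: peq_trans (mh_germ hg _ (chart_dual_near j i Oy)) _; first exact: rD.
  exact: (mh_cst hg).
suff main n : (n <= M)%N -> forall f, regular y f -> peq n (F f) 0.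
  move=> k kM; have := main M (leqnn M) f rf0 k kM; rewrite {1}/F pserB => /eqP.
  by rewrite subr_eq0 => /eqP.
elim: n => [//|n IH] nM g rg.
have rg' : regular y (fun u => g u - g y) by apply: regular_sub => //; exact: regular_cst.
have [a ra e] := ch_par hC Oy rg' (subrr _).
have rwc j : regular y (fun u => w j u - w j y) by apply: regular_sub => //; exact: regular_cst.
apply: peq_trans (peq_le nM (peq_sym (mder_sub_cst (g y) hF rg))) _.
apply: peq_trans (peq_le nM (md_germ hF rg' e)) _.
apply: peq_trans (peq_le nM (mder_sum _ hF _)) _.
  by move=> j; exact: regular_mul.
apply: peq_sum0 => j _.
apply: peq_trans (peq_le nM (md_mul hF (ra j) (rwc j))) _.
rewrite -[X in peq _ _ X]addr0; apply: peqD.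
  rewrite -[X in peq _ _ X](mulr0 (ga (a j))); apply: peqM => //.
  by apply: peq_trans (peq_le nM (mder_sub_cst _ hF (rw j))) _; exact: peq_le nM (Fw j).
rewrite -add1n; apply: peq0_mul; last by apply: IH => //; exact: ltnW.
move=> k; rewrite ltnS leqn0 => /eqP->.
by rewrite (mh_loc hg) ?subrr //; exact: leq_trans nM.
Qed.

(** The formal derivative of the series is a derivation along [ga], so [mder_chart] becomes the
    chain rule; in characteristic zero it determines the coefficients recursively. *)
Lemma mhom_recursion y M ga f k : O y -> mhom y M ga -> regular y f -> (k.+1 < M)%N ->
  ga f k.+1 *+ k.+1 = (\sum_j ga (D j f) * pderiv (ga (w j))) k.
Proof.
move=> Oy hg rf kM; have hg' := mhom_le (leqnSn k.+1) (mhom_le kM hg).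
have hE : mder y k.+1 ga (fun f => pderiv (ga f)).
  { split=> [g h rg e|c|g h rg rh|g h rg rh] i ik.
  - by rewrite /pderiv (mh_germ hg rg e) //; exact: leq_trans kM.
  - by rewrite /pderiv (mh_cst hg) ?mul0rn //; exact: leq_trans kM.
  - by rewrite /pderiv (mh_add hg rg rh) ?pserD ?mulrnDl //; exact: leq_trans kM.
  - rewrite -pderivM /pderiv (mh_mul hg rg rh) //; exact: leq_trans kM. }
exact: (mder_chart Oy hg' hE rf).
Qed.

End Homs.

(** * Matrices of power series *)

Section PowerSeriesOrder.
Variable K : fieldType.
Implicit Types (a b : pser K).

Lemma pcst_is_zmod : zmod_morphism (@pcst K).
Proof. by move=> u v; apply/funext => k; rewrite pserB /pcst mulrnBl. Qed.
Lemma pcst_is_monoid : monoid_morphism (@pcst K).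
Proof.
split=> [|u v]; apply/funext => k //.
by rewrite pcstM /pcst mulrnAr.
Qed.
HB.instance Definition _ := GRing.isZmodMorphism.Build K (pser K) (@pcst K) pcst_is_zmod.
HB.instance Definition _ := GRing.isMonoidMorphism.Build K (pser K) (@pcst K) pcst_is_monoid.

Definition pval a : K := a 0%N.
Lemma pval_is_zmod : zmod_morphism pval. Proof. by []. Qed.
Lemma pval_is_monoid : monoid_morphism pval. Proof. by split=> // a b; exact: pserM0. Qed.
HB.instance Definition _ := GRing.isZmodMorphism.Build (pser K) K pval pval_is_zmod.
HB.instance Definition _ := GRing.isMonoidMorphism.Build (pser K) K pval pval_is_monoid.

Definition pX n : pser K := fun k => (k == n)%:R.

Lemma pXM n a k : (pX n * a) k = if (k < n)%N then 0 else a (k - n)%N.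
Proof.
rewrite pserM; case: ltnP => [kn|nk].
  by rewrite big1 // => i _; rewrite /pX ltn_eqF ?mul0r //; exact: leq_trans (ltn_ord i) kn.
have nk' : (n < k.+1)%N by [].
rewrite (bigD1 (Ordinal nk')) //= /pX eqxx mul1r big1 ?addr0 // => i /eqP ni.
by case: eqP => [e|_]; [case: ni; apply: val_inj|rewrite mul0r].
Qed.

Lemma pX_shift n a : peq n a 0 -> a = pX n * pshift n a.
Proof.
move=> h; apply/funext => k; rewrite pXM; case: ltnP => [/h->//|nk].
by rewrite /pshift subnK.
Qed.

Definition pord a n := peq n a 0 /\ a n != 0.

Lemma pord_ex a : a <> 0 -> exists n, pord a n.
Proof.
move=> a0; have ex : exists n, a n != 0.
  apply: contrapT => h; apply: a0; apply/funext => k; apply/eqP/negPn/negP => ak.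
  by apply: h; exists k.
exists (ex_minn ex); case: ex_minnP => n an min; split => // k kn.
by apply/eqP/negPn/negP => /min; rewrite leqNgt kn.
Qed.

Lemma pord_peq a n m : pord a n -> peq m a 0 -> (m <= n)%N.
Proof. by move=> [_ an] h; rewrite leqNgt; apply/negP => /h e; rewrite e eqxx in an. Qed.

Lemma pord_uniq a m n : pord a m -> pord a n -> m = n.
Proof.
by move=> hm hn; apply/eqP; rewrite eqn_leq (pord_peq hn hm.1) (pord_peq hm hn.1).
Qed.

Lemma pordM a b m n : pord a m -> pord b n -> pord (a * b) (m + n).
Proof.
move=> [ha am] [hb bn]; split; first exact: peq0_mul.
rewrite (pX_shift ha) (pX_shift hb) mulrACA pserM.
have -> : pX m * pX n = pX (m + n).
  apply/funext => k; rewrite pXM /pX; case: ltnP => h; first by rewrite ltn_eqF // ltn_addr.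
  by rewrite -[in RHS](subnKC h) eqn_add2l.
rewrite -pserM pXM ltnn subnn pserM0 /pshift !add0n mulf_neq0 //.
Qed.

Lemma pser_mul_eq0 a b : a * b = 0 -> a = 0 \/ b = 0.
Proof.
move=> ab; apply: contrapT => /not_orP[/pord_ex[m ha] /pord_ex[n hb]].
by have [_] := pordM ha hb; rewrite ab eqxx.
Qed.

Lemma pord1 : pord 1 0. Proof. by split; rewrite // oner_neq0. Qed.

Lemma pord_prod (I : Type) (r : seq I) (P : pred I) (F : I -> pser K) (n : I -> nat) :
  (forall i, P i -> pord (F i) (n i)) -> pord (\prod_(i <- r | P i) F i) (\sum_(i <- r | P i) n i).
Proof. by move=> h; elim/big_rec2: _ => [|i x y Pi ih]; [exact: pord1|apply: pordM => //; exact: h]. Qed.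

Lemma pordX a n e : pord a n -> pord (a ^+ e) (n * e).
Proof.
move=> h; elim: e => [|e IH]; first by rewrite muln0; exact: pord1.
by rewrite exprS mulnS; exact: pordM.
Qed.

Lemma peq0_prod (I : Type) (r : seq I) (P : pred I) (F : I -> pser K) (n : I -> nat) :
  (forall i, P i -> peq (n i) (F i) 0) -> peq (\sum_(i <- r | P i) n i) (\prod_(i <- r | P i) F i) 0.
Proof. by move=> h; elim/big_rec2: _ => [|i x y Pi ih] //; apply: peq0_mul => //; exact: h. Qed.

Lemma peq0X a n e : peq n a 0 -> peq (n * e) (a ^+ e) 0.
Proof.
move=> h; elim: e => [|e IH]; first by rewrite muln0.
by rewrite exprS mulnS; exact: peq0_mul.
Qed.

Lemma pser_inv a : a 0%N != 0 -> exists b, a * b = 1.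
Proof.
move=> a0.
pose step (s : seq K) : seq K :=
  rcons s (((size s == 0%N)%:R - \sum_(i < size s) a i.+1 * s`_(size s - i.+1)%N) / a 0%N).
pose s n := iter n step [::]; have sS n : s n.+1 = step (s n) by [].
have ss n : size (s n) = n by elim: n => [//|n IH]; rewrite sS /step size_rcons IH.
have sn n k : (k < n)%N -> (s n)`_k = (s k.+1)`_k.
  elim: n => [//|n IH]; rewrite ltnS leq_eqVlt => /predU1P[->//|kn].
  by rewrite -IH // sS /step nth_rcons ss kn.
have skk k : a 0%N * (s k.+1)`_k = (k == 0%N)%:R - \sum_(i < k) a i.+1 * (s k)`_(k - i.+1)%N.
  by rewrite sS /step nth_rcons !ss ltnn eqxx mulrCA mulfV // mulr1.
exists (fun k => (s k.+1)`_k); apply/funext => k; rewrite pserM big_ord_recl subn0 skk.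
rewrite [X in _ + X](eq_bigr (fun i : 'I_k => a i.+1 * (s k)`_(k - i.+1)%N)) ?subrK // => i _.
by rewrite [in RHS]sn // ltn_subrL; case: k i => [[]|].
Qed.

Lemma pord_pX n : pord (pX n) n.
Proof. by split=> [k kn|]; rewrite /pX ?eqxx ?oner_neq0 // ltn_eqF. Qed.

Lemma pXD m n : pX m * pX n = pX (m + n).
Proof.
apply/funext => k; rewrite pXM /pX; case: ltnP => h; first by rewrite ltn_eqF // ltn_addr.
by rewrite -[in RHS](subnKC h) eqn_add2l.
Qed.

End PowerSeriesOrder.

Section TruncatedModules.
Variables (K : fieldType) (d : nat).
Implicit Types (B C : 'M[pser K]_d).

Definition prow M (A : 'M[K]_(d, M)) i : pser K :=
  fun k => if insub k is Some k' then A i k' else 0.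

Lemma prowE M (A : 'M[K]_(d, M)) i (k : 'I_M) : prow A i k = A i k.
Proof. by rewrite /prow valK. Qed.

(* Right multiplication by [B] from [(K[t]/t^M)^d] to [(K[t]/t^M')^d]. *)
Definition pact M M' B (A : 'M[K]_(d, M)) : 'M[K]_(d, M') :=
  \matrix_(q, k) (\sum_i prow A i * B i q) k.

Lemma prow_pact M M' B (A : 'M[K]_(d, M)) q : peq M' (prow (pact M' B A) q) (\sum_i prow A i * B i q).
Proof. by move=> k kM; rewrite -[k]/(nat_of_ord (Ordinal kM)) prowE mxE. Qed.

Lemma pact_linear M M' B : linear (@pact M M' B).
Proof.
move=> c A A'; apply/matrixP => q k; rewrite !mxE !pser_sum mulr_sumr -big_split.
apply: eq_bigr => i _ /=; rewrite !pserM mulr_sumr -big_split; apply: eq_bigr => l _ /=.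
rewrite mulrA -mulrDl; congr (_ * _).
by rewrite /prow; case: insubP => [l' _ _|_]; rewrite ?mxE // mulr0 addr0.
Qed.
HB.instance Definition _ M M' B :=
  GRing.isLinear.Build K 'M[K]_(d, M) 'M[K]_(d, M') _ (@pact M M' B) (@pact_linear M M' B).

Lemma pact_comp M M' M'' B C (A : 'M[K]_(d, M)) : (M'' <= M')%N ->
  pact M'' C (pact M' B A) = pact M'' (B *m C) A.
Proof.
move=> le; apply/matrixP => q k; rewrite !mxE.
have h : peq M' (\sum_i prow (pact M' B A) i * C i q) (\sum_i (\sum_j prow A j * B j i) * C i q).
  by apply: peq_sum => i _; apply: peqM => //; exact: prow_pact.
rewrite h ?(leq_trans (ltn_ord k)) //; apply: (congr1 (fun a : pser K => a k)).
under eq_bigr do rewrite mulr_suml.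
rewrite exchange_big /=; apply: eq_bigr => j _; rewrite mxE mulr_sumr.
by apply: eq_bigr => i _; rewrite mulrA.
Qed.

Lemma pact1 M (A : 'M[K]_(d, M)) : pact M 1%:M A = A.
Proof.
apply/matrixP => q k; rewrite mxE (bigD1 q) //= mxE eqxx mulr1 big1 ?addr0 ?prowE // => i iq.
by rewrite mxE (negbTE iq) mulr0.
Qed.

(** The same map as a matrix over [K], on the coefficients listed by [mxvec], so that its rank is
    the dimension of the image over [K]. *)
Definition pmx M M' B : 'M[K]_(d * M, d * M') := lin_mx (@pact M M' B).

Lemma pmxM M M' M'' B C : (M'' <= M')%N -> pmx M M' B *m pmx M' M'' C = pmx M M'' (B *m C).
Proof.
move=> le; apply/row_matrixP => i; rewrite row_mul rowE !mul_rV_lin rowE mul_rV_lin /=.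
by rewrite mxvecK pact_comp.
Qed.

Lemma pmx1 M : pmx M M 1%:M = 1%:M.
Proof. by apply/row_matrixP => i; rewrite rowE mul_rV_lin /= pact1 vec_mxK rowE mulmx1. Qed.

Lemma pmx_unit M B C : B *m C = 1%:M -> pmx M M B \in unitmx.
Proof.
move=> e; have := pmxM M B C (leqnn M); rewrite e pmx1 => /mulmx1_unit[].
by [].
Qed.

Definition pdiag i0 n : 'M[pser K]_d := \matrix_(i, j) (if i == j then if i == i0 then pX K n else 1 else 0).

Lemma det_pdiag i0 n : \det (pdiag i0 n) = pX K n.
Proof.
rewrite det_trig; last first.
  by apply/is_trig_mxP => i j ij; rewrite mxE -val_eqE /= ltn_eqF.
rewrite (bigD1 i0) //= mxE !eqxx big1 ?mulr1 // => i /negbTE ii.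
by rewrite mxE eqxx ii.
Qed.

Lemma mul_pdiag B i0 n i j : (B *m pdiag i0 n) i j = if j == i0 then B i j * pX K n else B i j.
Proof.
rewrite mxE (bigD1 j) //= mxE eqxx big1 ?addr0 => [|l lj]; first by case: eqP; rewrite ?mulr1.
by rewrite mxE (negbTE lj) mulr0.
Qed.

(* If the determinant vanishes at [t = 0], a constant column operation makes a
   column divisible by [t]. *)
Lemma pser_peel B : (\det B) 0%N = 0 -> exists (P Q B' : 'M[pser K]_d) i0,
  [/\ P *m Q = 1%:M, B *m P = B' *m pdiag i0 1 & \det P = pcst (pval (\det P))].
Proof.
move=> d0; pose B0 := map_mx (@pval K) B.
have : \det B0 == 0 by rewrite det_map_mx; apply/eqP.
rewrite -det_tr => /det0P[u u0 uB].
have [i0 ui0] : exists i0, u 0 i0 != 0 by move/rV0Pn: u0.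
pose P0 : 'M[K]_d := \matrix_(i, j) (if j == i0 then u 0 i else (i == j)%:R).
have P0u : \det P0 != 0.
  have -> : \det P0 = u 0 i0.
    rewrite (expand_det_row _ i0) (bigD1 i0) //= !mxE eqxx big1 ?addr0; last first.
      by move=> j /negbTE jn; rewrite mxE jn eq_sym jn mul0r.
    rewrite /cofactor -signr_odd oddD addbb expr0 mul1r [X in \det X](_ : _ = 1%:M) ?det1 ?mulr1 //.
    apply/matrixP => i j; rewrite !mxE /= eq_sym (negbTE (neq_lift _ _)).
    by rewrite (inj_eq lift_inj).
  exact: ui0.
have P0U : P0 \in unitmx by rewrite unitmxE unitfE.
pose P := map_mx (@pcst K) P0.
pose B' : 'M[pser K]_d := \matrix_(i, j) if j == i0 then pshift 1 ((B *m P) i j) else (B *m P) i j.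
exists P, (map_mx (@pcst K) (invmx P0)), B', i0; split.
- by rewrite -map_mxM mulmxV // map_mx1.
- apply/matrixP => i j; rewrite mul_pdiag [B' i j]mxE; case: eqP => [ji|//].
  rewrite [RHS]mulrC.
  apply: pX_shift => k; rewrite ltnS leqn0 => /eqP->.
  rewrite pser0; have /matrixP/(_ 0 i) := uB; rewrite !mxE ji => <-.
  rewrite pser_sum; apply: eq_bigr => l _; rewrite !mxE eqxx pserM0 mulrC.
  by rewrite /pcst mulr1n.
- by rewrite det_map_mx /pval /= /pcst eqxx mulr1n.
Qed.

Lemma mxrank_sum_le (I : finType) (P : pred I) m n (F : I -> 'M[K]_(m, n)) :
  (\rank (\sum_(i | P i) F i)%R <= \sum_(i | P i) \rank (F i))%N.
Proof.
apply: (big_rec2 (fun (A : 'M[K]_(m, n)) (r : nat) => (\rank A <= r)%N)) => [|i A r Pi IH].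
  by rewrite mxrank0.
by apply: leq_trans (mxrank_add _ _) _; rewrite leq_add2l.
Qed.

Lemma pmx_rank_unit M B : (\det B) 0%N != 0 -> \rank (pmx M M B) = (d * M)%N.
Proof.
move=> /pser_inv[c cB]; apply: mxrank_unit; apply: (@pmx_unit M B (c *: \adj B)).
by rewrite -scalemxAr mul_mx_adj scale_scalar_mx mulrC cB.
Qed.

Lemma lin_mx_delta M i (k : 'I_M) (f : {linear 'M[K]_(d, M) -> 'M[K]_(d, M)}) :
  (forall A, f A = A i k *: delta_mx i k) -> (\rank (lin_mx f) <= 1)%N.
Proof.
move=> hf; apply: (@leq_trans (\rank (mxvec (delta_mx i k : 'M[K]_(d, M))))); last exact: rank_leq_row.
apply/mxrankS/row_subP => l; rewrite rowE mul_rV_lin hf linearZ /=; exact: scalemx_sub.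
Qed.

Definition mxcoef M i (k : 'I_M) (A : 'M[K]_(d, M)) : 'M[K]_(d, M) := A i k *: delta_mx i k.
Lemma mxcoef_linear M i (k : 'I_M) : linear (mxcoef i k).
Proof. by move=> c A A'; rewrite /mxcoef !mxE scalerDl scalerA. Qed.
HB.instance Definition _ M i (k : 'I_M) :=
  GRing.isLinear.Build K 'M[K]_(d, M) 'M[K]_(d, M) _ (@mxcoef M i k) (@mxcoef_linear M i k).

Lemma mxcoefE M i (k : 'I_M) (A : 'M[K]_(d, M)) q l :
  mxcoef i k A q l = A q l *+ ((q == i) && (l == k)).
Proof. by rewrite /mxcoef !mxE; case: eqP => [->|_]; case: eqP => [->|_] /=; rewrite ?mulr1 ?mulr0. Qed.

Definition pdown M i0 (A : 'M[K]_(d, M)) : 'M[K]_(d, M) :=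
  \matrix_(i, k) if i == i0 then prow A i k.+1 else A i k.
Lemma prow_linear M c (A A' : 'M[K]_(d, M)) i k : prow (c *: A + A') i k = c * prow A i k + prow A' i k.
Proof. by rewrite /prow; case: insubP => [l _ _|_]; rewrite ?mxE // mulr0 addr0. Qed.
Lemma pdown_linear M i0 : linear (@pdown M i0).
Proof. by move=> c A A'; apply/matrixP => i k; rewrite !mxE prow_linear; case: eqP. Qed.
HB.instance Definition _ M i0 :=
  GRing.isLinear.Build K 'M[K]_(d, M) 'M[K]_(d, M) _ (@pdown M i0) (@pdown_linear M i0).

Lemma pact_pdiag M M' i0 (A : 'M[K]_(d, M)) q (k : 'I_M') :
  pact M' (pdiag i0 1) A q k = if q == i0 then (if k == 0%N :> nat then 0 else prow A q k.-1) else prow A q k.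
Proof.
rewrite mxE (bigD1 q) //= mxE eqxx big1 ?addr0 => [|i iq]; last by rewrite mxE (negbTE iq) mulr0.
by case: eqP => _; rewrite ?mulr1 // mulrC pXM ltnS leqn0 subn1.
Qed.

Lemma prow_out M (A : 'M[K]_(d, M)) i k : (M <= k)%N -> prow A i k = 0.
Proof. by move=> Mk; rewrite /prow insubF // ltnNge Mk. Qed.

Lemma pmx_pdiag_rank M i0 : (d * M <= (\rank (pmx M M (pdiag i0 1))).+1)%N.
Proof.
case: M => [|M]; first by apply: (@leq_trans 0); rewrite ?muln0.
rewrite -{1}(mxrank1 K (d * M.+1)) -[X in (_ <= X)%N]addn1.
have -> : 1%:M = pmx M.+1 M.+1 (pdiag i0 1) *m lin_mx (@pdown M.+1 i0) + lin_mx (mxcoef i0 (@ord_max M)).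
  apply/row_matrixP => i; rewrite rowE mulmx1 [RHS]rowE mulmxDr mulmxA !mul_rV_lin /= mxvecK -linearD /=.
  rewrite -[LHS]vec_mxK; congr mxvec; set A := vec_mx _; apply/matrixP => q k.
  rewrite [RHS]mxE mxcoefE [pdown _ _ _ _]mxE; case: (q =P i0) => [->|qi] /=; last first.
    by rewrite mulr0n addr0 pact_pdiag; case: eqP => // _; rewrite prowE.
  case: (k =P ord_max) => [->|km]; first by rewrite prow_out // add0r mulr1n.
  have kM : (k.+1 < M.+1)%N by rewrite ltnS ltn_neqAle -ltnS ltn_ord andbT; apply/eqP => e; apply: km; exact: val_inj.
  by rewrite mulr0n addr0 -[k.+1]/(nat_of_ord (Ordinal kM)) prowE pact_pdiag eqxx /= prowE.
apply: leq_trans (mxrank_add _ _) _; apply: leq_add; first exact: mxrankM_maxl.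
exact: lin_mx_delta.
Qed.

Lemma peel_det B P Q B' i0 : P *m Q = 1%:M -> B *m P = B' *m pdiag i0 1 ->
  \det P = pcst (pval (\det P)) -> exists2 c, c != 0 & \det B * pcst c = pX K 1 * \det B'.
Proof.
move=> PQ e dP; exists (pval (\det P)).
  apply/eqP => z; have /(congr1 (@pval K)) := congr1 determinant PQ.
  by rewrite det_mulmx det1 rmorphM /= z mul0r => /eqP; rewrite eq_sym oner_eq0.
by rewrite -dP -det_mulmx e det_mulmx det_pdiag mulrC.
Qed.

(** The corank is at most the length of the cokernel of [B], which is the order of the determinant.
    Each factor [t] peeled off lowers that order by one and costs at most one dimension. *)
Lemma pmx_rank_ge M n B : pord (\det B) n -> (d * M <= \rank (pmx M M B) + n)%N.
Proof.
elim: n B => [|n IH] B hB; first by rewrite pmx_rank_unit ?addn0 //; exact: hB.2.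
have [P [Q [B' [i0 [PQ e dP]]]]] := pser_peel (hB.1 0%N isT).
have [c c0 ec] := peel_det PQ e dP.
have hB' : pord (\det B') n.
  split=> [k kn|].
    have /(congr1 (fun a : pser K => a k.+1)) := ec; rewrite pXM /= subn1 /= mulrC pcstM.
    by rewrite hB.1 // mulr0 => <-.
  have /(congr1 (fun a : pser K => a n.+1)) := ec; rewrite pXM /= subn1 /= mulrC pcstM => <-.
  by rewrite mulf_neq0 //; exact: hB.2.
have h1 : (\rank (pmx M M B' *m pmx M M (pdiag i0 1)) <= \rank (pmx M M B))%N.
  by rewrite pmxM // -e -(@pmxM M M M) //; exact: mxrankM_maxl.
have h2 := mxrank_mul_min (pmx M M B') (pmx M M (pdiag i0 1)).
have h3 := pmx_pdiag_rank M i0; have h4 := IH _ hB'.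
have ar (a b v D N t : nat) : (t <= a)%N -> (b + v - D <= t)%N -> (D <= v.+1)%N -> (D <= b + N)%N ->
    (D <= a + N.+1)%N by clear; lia.
exact: ar h1 h2 h3 h4.
Qed.

(** The determinant may vanish identically, so only [n] factors are peeled off; each is paid for by
    lowering the modulus by one, whence [n <= M]. *)
Lemma pmx_rank_le M n B : peq n (\det B) 0 -> (n <= M)%N -> (\rank (pmx M M B) + n <= d * M)%N.
Proof.
elim: n M B => [|n IH] M B hB nM; first by rewrite addn0; exact: rank_leq_row.
have [P [Q [B' [i0 [PQ e dP]]]]] := pser_peel (hB 0%N isT).
have [c c0 ec] := peel_det PQ e dP.
have hB' : peq n (\det B') 0.
  move=> k kn; have /(congr1 (fun a : pser K => a k.+1)) := ec.
  by rewrite pXM /= subn1 /= mulrC pcstM hB // mulr0 => <-.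
case: M nM => // M nM.
have -> : pmx M.+1 M.+1 B = pmx M.+1 M.+1 B' *m pmx M.+1 M.+1 (pdiag i0 1) *m pmx M.+1 M.+1 Q.
  by rewrite !pmxM // -e -mulmxA PQ mulmx1.
(* The peeled factor shifts the row [i0], so it passes through the modulus [t^M] except for the top
   coefficients of the other [d - 1] rows. *)
have eT : pmx M.+1 M.+1 (pdiag i0 1) = pmx M.+1 M 1%:M *m pmx M M.+1 (pdiag i0 1) +
    \sum_(i | i != i0) lin_mx (mxcoef i (@ord_max M)).
  apply/row_matrixP => i; rewrite !rowE mulmxDr mulmxA mulmx_sumr !mul_rV_lin /= mxvecK.
  under eq_bigr do rewrite mul_rV_lin.
  rewrite -linear_sum -linearD /=; congr mxvec; set A := vec_mx _; apply/matrixP => q k.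
  rewrite [RHS]mxE summxE !pact_pdiag.
  under eq_bigr do rewrite mxcoefE.
  have hp q' (l : nat) : prow (pact M 1%:M A) q' l = if (l < M)%N then prow A q' l else 0.
    case: ltnP => lM; last exact: prow_out.
    rewrite -[l in LHS]/(nat_of_ord (Ordinal lM)) prowE mxE (bigD1 q') //= mxE eqxx mulr1.
    by rewrite big1 ?addr0 // => j jq; rewrite mxE (negbTE jq) mulr0.
  case: (eqVneq q i0) => [->|qi].
    rewrite big1 ?addr0 => [|j ji]; last by rewrite eq_sym (negbTE ji).
    case: eqP => // /eqP k0; rewrite hp.
    by have := ltn_ord k; rewrite -{1}(prednK (n := k)) ?lt0n // ltnS => ->.
  rewrite (bigD1 q) //= eqxx big1 ?addr0 => [|j /andP[_ jq]]; last by rewrite eq_sym (negbTE jq).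
  rewrite hp; case: (k =P ord_max) => [->|km]; first by rewrite ltnn add0r mulr1n -prowE.
  rewrite mulr0n addr0 ifT // ltn_neqAle -ltnS ltn_ord andbT; apply/eqP => kM; apply: km; exact: val_inj.
apply: (@leq_trans (\rank (pmx M.+1 M.+1 B' *m pmx M.+1 M.+1 (pdiag i0 1)) + n.+1)).
  by rewrite leq_add2r; exact: mxrankM_maxl.
rewrite eT mulmxDr mulmxA pmxM // mulmx1 -[X in pmx _ _ X]mul1mx -(@pmxM M.+1 M M) //.
have h1 : (\rank (pmx M.+1 M 1%:M *m pmx M M B' *m pmx M M.+1 (pdiag i0 1)) <= \rank (pmx M M B'))%N.
  exact: leq_trans (mxrankM_maxl _ _) (mxrankM_maxr _ _).
have h2 : (\rank (pmx M.+1 M.+1 B' *m \sum_(i | i != i0) lin_mx (mxcoef i (@ord_max M)))%R <= d.-1)%N.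
  apply: leq_trans (mxrankM_maxr _ _) _; apply: leq_trans (mxrank_sum_le _ _) _.
  apply: (@leq_trans (\sum_(i | i != i0) 1)%N); first by apply: leq_sum => i _; exact: lin_mx_delta.
  by rewrite sum1_card cardC1 card_ord.
have h3 := IH M B' hB' nM.
have h4 := mxrank_add (pmx M.+1 M 1%:M *m pmx M M B' *m pmx M M.+1 (pdiag i0 1))
  (pmx M.+1 M.+1 B' *m \sum_(i | i != i0) lin_mx (mxcoef i (@ord_max M))).
have d0 : (0 < d)%N by exact: leq_ltn_trans (leq0n _) (ltn_ord i0).
have ar (a b v s N D g F : nat) : (a <= v)%N -> (b <= g.-1)%N -> (v + N <= D)%N -> (s <= a + b)%N ->
    (0 < g)%N -> F = (g + D)%N -> (s + N.+1 <= F)%N by clear; lia.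
exact: ar h1 h2 h3 h4 d0 (mulnS d M).
Qed.

End TruncatedModules.

(** * Arcs on smooth varieties *)

Section ArcConstruction.
Variables (K : numClosedFieldType) (X : variety K).

Lemma pderiv_inj M (a b : pser K) : a 0%N = b 0%N -> peq M (pderiv a) (pderiv b) -> peq M.+1 a b.
Proof.
move=> e h [|k] kM //; have := h k kM; rewrite /pderiv => /eqP.
by rewrite -subr_eq0 -mulrnBl mulrn_eq0 /= subr_eq0 => /eqP.
Qed.

Lemma jet_eq m (j j' : jet X m) : jet_center j = jet_center j' -> jet_coef j = jet_coef j' -> j = j'.
Proof.
case: j j' => [y f h] [y' f' h'] /= e e'; rewrite {}e {}e' in h *.
by congr Jet; exact: Prop_irrelevance.
Qed.

Lemma arc_eq (g g' : formal_arc X) : arc_center g = arc_center g' -> arc_coef g = arc_coef g' -> g = g'.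
Proof.
case: g g' => [y f h] [y' f' h'] /= e e'; rewrite {}e {}e' in h *.
by congr Arc; exact: Prop_irrelevance.
Qed.

Variables (O : set X) (d : nat) (w : 'I_d -> X -> K) (D : 'I_d -> (X -> K) -> X -> K).
Hypothesis hC : chart O w D.

Lemma mhom_unique y M ga ga' : O y -> mhom y M ga -> mhom y M ga' ->
  (forall j, peq M (ga (w j)) (ga' (w j))) -> forall f, regular y f -> peq M (ga f) (ga' f).
Proof.
move=> Oy h h' e; elim: M h h' e => [//|M IH] h h' e f rf.
apply: pderiv_inj; first by rewrite (mh_loc h) ?(mh_loc h').
move=> k kM; rewrite /pderiv (mhom_recursion hC Oy h rf) // (mhom_recursion hC Oy h' rf) //.
apply: peq_sum kM => j _; apply: peqM.
  apply: IH; [exact: mhom_le h|exact: mhom_le h'| |exact: (chart_der_reg hC)].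
  by move=> i; apply: peq_le (e i).
by move=> i iM; rewrite /pderiv e.
Qed.

Variables (y : X) (c : 'I_d -> pser K).
Hypotheses (Oy : O y) (hc : forall j, c j 0%N = w j y).

(** Integrates the chain rule [f' = sum_j (D_j f) c_j'] term by term. Unfolding it [n] times gives
    the coefficients up to order [n]; later ones carry no meaning. *)
Fixpoint arcn n (f : X -> K) : pser K := fun k =>
  if k is k'.+1 then if n is n'.+1 then (\sum_j arcn n' (D j f) * pderiv (c j)) k' / k'.+1%:R else 0
  else f y.

Lemma pderiv_arcn n f : pderiv (arcn n.+1 f) = \sum_j arcn n (D j f) * pderiv (c j).
Proof. by apply/funext => k; rewrite /pderiv -[LHS]mulr_natr /= divfK // pnatr_eq0. Qed.

Lemma arcn_stable n f : peq n.+1 (arcn n f) (arcn n.+1 f).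
Proof.
elim: n f => [|n IH] f; first by move=> [].
apply: pderiv_inj => //; rewrite !pderiv_arcn; apply: peq_sum => j _; exact: peqM.
Qed.

Lemma arcn_mhom n : mhom y n.+1 (arcn n).
Proof.
have rD j f : regular y f -> regular y (D j f) by exact: (chart_der_reg hC).
elim: n => [|n [germ _ cst add mul]].
  { split=> // [f g rf e [|//] _|c' [|//] _|f g rf rg [|//] _|f g rf rg [|//] _] //=.
  - exact: nbhs_singleton e.
  - by rewrite pserM0. }
split=> // [f g rf e|c'|f g rf rg|f g rf rg].
- apply: pderiv_inj; first exact: nbhs_singleton e.
  rewrite !pderiv_arcn; apply: peq_sum => j _; apply: peqM => //; apply: germ; first exact: rD.
  exact: (der_germ (ch_der hC j Oy)).
- apply: pderiv_inj; first by [].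
  rewrite pderiv_arcn; have -> : pderiv (pcst c') = 0 by apply/funext => k; rewrite /pderiv /pcst mulr0n mul0rn.
  apply: peq_sum0 => j _; rewrite -[X in peq _ _ X](mul0r (pderiv (c j))); apply: peqM => //.
  have e := Defs.der_cst (ch_der hC j Oy) c'.
  apply: peq_trans (germ _ _ _ e) _; first exact/rD/regular_cst.
  by apply: peq_trans (cst 0) _ => k _; rewrite /pcst mul0rn.
- apply: pderiv_inj => //; rewrite pderiv_arcn.
  have -> : pderiv (arcn n.+1 f + arcn n.+1 g) = \sum_j (arcn n (D j f) + arcn n (D j g)) * pderiv (c j).
    rewrite (_ : pderiv _ = pderiv (arcn n.+1 f) + pderiv (arcn n.+1 g)); last first.
      by apply/funext => k; rewrite /pderiv !pserD mulrnDl.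
    by rewrite !pderiv_arcn -big_split; apply: eq_bigr => j _; rewrite mulrDl.
  apply: peq_sum => j _; apply: peqM => //.
  have e := Defs.der_add (ch_der hC j Oy) rf rg.
  apply: peq_trans (germ _ _ _ e) _; first by apply: rD; exact: regular_add.
  by apply: add; exact: rD.
- apply: pderiv_inj; first by rewrite pserM0.
  rewrite pderivM !pderiv_arcn; set F := \sum_j _ * _; set G := \sum_j _ * _; set H := \sum_j _ * _.
  apply: (@peq_trans _ _ _ (arcn n f * G + arcn n g * H)); last first.
    by apply: peqD; apply: peqM => //; exact: arcn_stable.
  rewrite /F /G /H !mulr_sumr -big_split; apply: peq_sum => j _ /=.
  rewrite !mulrA -mulrDl; apply: peqM => //.
  have e := Defs.der_mul (ch_der hC j Oy) rf rg.
  apply: peq_trans (germ _ _ _ e) _; first by apply: rD; exact: regular_mul.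
  have r1 := regular_mul rf (rD j g rg); have r2 := regular_mul rg (rD j f rf).
  apply: peq_trans (add _ _ r1 r2) _.
  by apply: peqD; apply: mul => //; exact: rD.
Qed.

Lemma arcn_coord n j : peq n.+1 (arcn n (w j)) (c j).
Proof.
elim: n => [|n _]; first by move=> [|//] _ /=; rewrite hc.
apply: pderiv_inj; first by rewrite /= hc.
rewrite pderiv_arcn -[X in peq _ _ X](_ : \sum_i pcst (i == j)%:R * pderiv (c i) = _); last first.
  rewrite (bigD1 j) //= eqxx big1 ?addr0 => [|i /negbTE->].
    by apply/funext => k; rewrite pcstM mul1r.
  by apply/funext => k; rewrite pcstM mul0r.
have h := arcn_mhom n.
apply: peq_sum => i _; apply: peqM => //.
apply: peq_trans (mh_germ h _ (chart_dual_near hC i j Oy)) _.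
  by apply: (chart_der_reg hC) => //; exact: (ch_reg hC).
exact: (mh_cst h).
Qed.

Lemma arcn_le n n' f : (n <= n')%N -> peq n.+1 (arcn n f) (arcn n' f).
Proof.
move=> /subnKC <-; elim: (n' - n)%N => [|l IH]; first by rewrite addn0.
rewrite addnS; apply: peq_trans IH _; apply: peq_le (@arcn_stable _ f).
by rewrite ltnS leq_addr.
Qed.

(** Arcs in a chart are parametrised by the series of the coordinates, with no condition beyond the
    constant terms [hc]. Every deformation of an arc in a chart below is built from this. *)
Lemma arc_exists : exists g : formal_arc X, arc_center g = y /\ forall j, arc_coef g (w j) = c j.
Proof.
pose phi (f : X -> K) : pser K := fun k => if `[< regular y f >] then arcn k f k else 0.
have E f n : regular y f -> peq n.+1 (phi f) (arcn n f).
  move=> rf k kn; rewrite /phi asboolT //.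
  by have kn' : (k <= n)%N by []; exact: (arcn_le f kn' (ltnSn k)).
have hphi : local_hom xpredT y phi.
  { split.
  - by move=> f k h; rewrite /phi asboolF // => rf; apply: h.
  - move=> f g k rf e; have rg := regular_germ rf e.
    by rewrite (E f k) // (E g k) // (mh_germ (arcn_mhom k) rf e).
  - by move=> f rf; rewrite (E f 0%N).
  - move=> u k _; rewrite (E _ k) //; last exact: regular_cst.
    by rewrite (mh_cst (arcn_mhom k)).
  - move=> f g k rf rg _; rewrite (E _ k) //; last exact: regular_add.
    by rewrite (mh_add (arcn_mhom k)) // pserD (E f k) // (E g k).
  - move=> f g k rf rg _; rewrite (E _ k) //; last exact: regular_mul.
    rewrite (mh_mul (arcn_mhom k)) // -[RHS]/((phi f * phi g) k).
    by apply: peqM (ltnSn k); apply: peq_sym; exact: E. }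
exists (Arc hphi); split => // j; apply/funext => k /=.
by rewrite (E _ k) ?(@arcn_coord k) //; exact: (ch_reg hC).
Qed.

End ArcConstruction.

Section JetLift.
Variables (K : numClosedFieldType) (X : variety K).
Hypothesis smX : smooth X.

Lemma chart_at (y : X) : exists O d (w : 'I_d -> X -> K) D, O y /\ chart O w D.
Proof.
have [d [z pz]] := smX y; have [V [D [Vy h]]] := smooth_chart pz.
by exists V, d, z, D.
Qed.

Lemma truncate_coef m (g : formal_arc X) f k : (k <= m)%N -> jet_coef (truncate m g) f k = arc_coef g f k.
Proof. by move=> km; rewrite /= km. Qed.

Lemma truncate_eqP m (g : formal_arc X) (j : jet X m) : arc_center g = jet_center j ->
  (forall f, regular (arc_center g) f -> peq m.+1 (arc_coef g f) (jet_coef j f)) -> truncate m g = j.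
Proof.
move=> e h; apply: jet_eq => //; apply/funext => f; apply/funext => k /=.
case: ifPn => [km|km]; last by rewrite (lh_default (jet_hom j)) // => -[_]; exact/negP.
have [rf|nrf] := pselect (regular (arc_center g) f); first exact: h.
rewrite (lh_default (arc_hom g)) ?(lh_default (jet_hom j)) // => -[]; rewrite -?e //.
Qed.

Lemma jet_lift m (j : jet X m) : exists g, truncate m g = j.
Proof.
have [O [d [w [D [Oy hC]]]]] := chart_at (jet_center j).
have hj := jet_mhom j.
have [i|g [e ew]] := @arc_exists _ _ _ _ _ _ hC _ (fun i => jet_coef j (w i)) Oy.
  by rewrite (mh_loc hj) //; exact: (ch_reg hC).
exists g; apply: truncate_eqP => // f; rewrite e => rf.
apply: (mhom_unique hC Oy _ hj) rf => [|i]; last by rewrite ew.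
by rewrite -e; exact: arc_mhom.
Qed.

End JetLift.

(** * Locally rational functions and their derivatives *)

Section LocallyRational.
Variables (K : numClosedFieldType) (T : Type) (n : nat) (c : T -> 'I_n -> K) (Phi : set T).
Implicit Types (F G : T -> K) (P Q : mpoly n K).

(** [T] carries no topology here: neighbourhoods of [p] are the sets where a polynomial in the
    coordinates [c] does not vanish, and only points of [Phi] matter. The equality is
    cross-multiplied and required wherever [Q] does not vanish. *)
Definition rat_rep p F P Q := meval (c p) Q != 0 /\
  forall q, Phi q -> meval (c q) Q != 0 -> F q * meval (c q) Q = meval (c q) P.

Definition rat_at p F := exists P Q, rat_rep p F P Q.

Lemma rat_poly p P : rat_at p (fun q => meval (c q) P).
Proof. by exists P, 1; split=> [|q _ _]; rewrite /= meval1 ?oner_neq0 // mulr1. Qed.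

Lemma rat_cst p u : rat_at p (fun=> u).
Proof.
rewrite (_ : (fun=> u) = fun q => meval (c q) (mpolyC n u)); first exact: rat_poly.
by apply/funext => q; rewrite /= mevalC.
Qed.

Lemma rat_local p F G h : meval (c p) h != 0 ->
  (forall q, Phi q -> meval (c q) h != 0 -> F q = G q) -> rat_at p G -> rat_at p F.
Proof.
move=> hp e [P [Q [Qp H]]]; exists (P * h), (Q * h); split; first by rewrite /= mevalM mulf_neq0.
move=> q Pq; rewrite /= !mevalM mulf_eq0 negb_or => /andP[Qq hq].
by rewrite mulrA e // H.
Qed.

Lemma rat_ext p F G : (forall q, Phi q -> F q = G q) -> rat_at p G -> rat_at p F.
Proof. by move=> e; apply: (@rat_local p F G 1) => [|q Pq _]; rewrite ?e //= meval1 oner_neq0. Qed.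

Lemma rat_rep_add p F G P Q P' Q' : rat_rep p F P Q -> rat_rep p G P' Q' ->
  rat_rep p (fun q => F q + G q) (P * Q' + P' * Q) (Q * Q').
Proof.
move=> [Qp H] [Qp' H']; split=> [|q Pq]; rewrite /= mevalM; first by rewrite mulf_neq0.
rewrite mulf_eq0 negb_or => /andP[Qq Qq']; rewrite /= mevalD !mevalM mulrDl -H // -H' // mulrA; congr (_ + _).
by rewrite -mulrA [meval _ Q' * _]mulrC mulrA.
Qed.

Lemma rat_rep_mul p F G P Q P' Q' : rat_rep p F P Q -> rat_rep p G P' Q' ->
  rat_rep p (fun q => F q * G q) (P * P') (Q * Q').
Proof.
move=> [Qp H] [Qp' H']; split=> [|q Pq]; rewrite /= mevalM; first by rewrite mulf_neq0.
by rewrite mulf_eq0 negb_or => /andP[Qq Qq']; rewrite /= mevalM -H // -H' // mulrACA.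
Qed.

Lemma rat_add p F G : rat_at p F -> rat_at p G -> rat_at p (fun q => F q + G q).
Proof. by move=> [P [Q h]] [P' [Q' h']]; exists (P * Q' + P' * Q), (Q * Q'); exact: rat_rep_add. Qed.

Lemma rat_mul p F G : rat_at p F -> rat_at p G -> rat_at p (fun q => F q * G q).
Proof. by move=> [P [Q h]] [P' [Q' h']]; exists (P * P'), (Q * Q'); exact: rat_rep_mul. Qed.

Lemma rat_opp p F : rat_at p F -> rat_at p (fun q => - F q).
Proof.
by move=> h; apply: rat_ext (rat_mul (rat_cst p (-1)) h) => q _; rewrite mulN1r.
Qed.

Lemma rat_sum p (I : Type) (r : seq I) (F : I -> T -> K) : (forall i, rat_at p (F i)) ->
  rat_at p (fun q => \sum_(i <- r) F i q).
Proof.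
move=> h; elim: r => [|i r IH]; first by apply: rat_ext (rat_cst p 0) => q _; rewrite big_nil.
by apply: rat_ext (rat_add (h i) IH) => q _; rewrite big_cons.
Qed.

Lemma rat_neq0 p F : Phi p -> rat_at p F -> F p != 0 -> exists h, meval (c p) h != 0 /\
  forall q, Phi q -> meval (c q) h != 0 -> F q != 0.
Proof.
move=> Pp [P [Q [Qp H]]] Fp; exists (P * Q); split=> [|q Pq]; rewrite /= mevalM.
  by rewrite -(H p) // !mulf_neq0.
by rewrite mulf_eq0 negb_or => /andP[Pq0 Qq]; apply: contraNneq Pq0 => e; rewrite -H // e mul0r.
Qed.

Lemma rat_inv p F : Phi p -> rat_at p F -> F p != 0 -> rat_at p (fun q => (F q)^-1).
Proof.
move=> Pp [P [Q [Qp H]]] Fp; exists (Q * Q), (P * Q); split=> [|q Pq]; rewrite /= mevalM.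
  by rewrite -(H p) // !mulf_neq0.
rewrite mulf_eq0 negb_or => /andP[Pq0 Qq]; rewrite mevalM -(H q) // in Pq0 *.
by rewrite -!mulrA mulKf //; apply: contraNneq Pq0 => ->; rewrite mul0r.
Qed.

Lemma rat_meval p r (F : 'I_r -> T -> K) (H : mpoly r K) : (forall j, rat_at p (F j)) ->
  rat_at p (fun q => meval (F ^~ q) H).
Proof.
move=> h; elim/mpoly_closed_ind: H => [u|l|a b ha hb|a b ha hb].
- by apply: rat_ext (rat_cst p u) => q _; rewrite /= mevalC.
- by apply: rat_ext (h l) => q _; rewrite /= mevalXU.
- by apply: rat_ext (rat_add ha hb) => q _; rewrite /= mevalD.
- by apply: rat_ext (rat_mul ha hb) => q _; rewrite /= mevalM.
Qed.

Variables (p : T) (v : 'I_n -> K).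
Hypothesis Pp : Phi p.

Definition dirpoly P := \sum_l meval (c p) (mderiv l P) * v l.

Hypothesis tan : forall P, (forall q, Phi q -> meval (c q) P = 0) -> dirpoly P = 0.

Lemma dirpolyD P Q : dirpoly (P + Q) = dirpoly P + dirpoly Q.
Proof. by rewrite /dirpoly -big_split; apply: eq_bigr => l _; rewrite mderivD /= mevalD mulrDl. Qed.
Lemma dirpolyB P Q : dirpoly (P - Q) = dirpoly P - dirpoly Q.
Proof. by rewrite /dirpoly -sumrB; apply: eq_bigr => l _; rewrite mderivB /= mevalB mulrBl. Qed.
Lemma dirpolyM P Q : dirpoly (P * Q) = dirpoly P * meval (c p) Q + meval (c p) P * dirpoly Q.
Proof.
rewrite /dirpoly mulr_suml mulr_sumr -big_split; apply: eq_bigr => l _ /=.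
by rewrite mderivM /= mevalD !mevalM mulrDl mulrAC mulrA.
Qed.
Lemma dirpolyC u : dirpoly (mpolyC n u) = 0.
Proof. by rewrite /dirpoly big1 // => l _; rewrite mderivC /= meval0 mul0r. Qed.
Lemma dirpolyX l : dirpoly (mpolyX K (mnm1 l)) = v l.
Proof.
rewrite /dirpoly (bigD1 l) //= mderivX mnmE eqxx /= mnm_subxx mpolyX0 scale1r meval1 mul1r.
by rewrite big1 ?addr0 // => i il; rewrite mderivX mnmE eq_sym (negbTE il) scale0r meval0 mul0r.
Qed.

(** The quotient rule at [p] for some representation. Two representations differ by a polynomial
    relation on [Phi], once multiplied by the denominators, and [v] respects such relations by
    [tan]. *)
Definition dder F : K := xget 0 [set e | exists P Q, rat_rep p F P Q /\
  e = (dirpoly P - F p * dirpoly Q) / meval (c p) Q].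

Lemma dderE F P Q : rat_rep p F P Q -> dder F = (dirpoly P - F p * dirpoly Q) / meval (c p) Q.
Proof.
move=> h; rewrite /dder; case: xgetP => [e -> [P' [Q' [h' ->]]]|/(_ _ (ex_intro _ P (ex_intro _ Q (conj h erefl))))//].
have [[Qp H] [Qp' H']] := (h, h').
have /tan : forall q, Phi q -> meval (c q) (Q * Q' * (P * Q' - P' * Q)) = 0.
  move=> q Pq; rewrite /= !mevalM; have [->|Qq] := eqVneq (meval (c q) Q) 0; first by rewrite !mul0r.
  have [->|Qq'] := eqVneq (meval (c q) Q') 0; first by rewrite mulr0 mul0r.
  by rewrite mevalB !mevalM -(H q) // -(H' q) //; ring.
have z0 : meval (c p) (P * Q' - P' * Q) = 0 by rewrite /= mevalB !mevalM -(H p) // -(H' p) //; ring.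
rewrite dirpolyM z0 mulr0 add0r => /eqP; rewrite /= mevalM mulf_eq0 (negbTE (mulf_neq0 Qp Qp')) /=.
rewrite dirpolyB !dirpolyM -(H p) // -(H' p) // subr_eq0 => /eqP e'.
apply/eqP; rewrite eqr_div // !mulrBl; apply/eqP.
set a := dirpoly P' in e' *; set b := dirpoly P in e' *.
have -> : a * meval (c p) Q = b * meval (c p) Q' + F p * meval (c p) Q * dirpoly Q' - F p * meval (c p) Q' * dirpoly Q.
  by rewrite e'; ring.
by ring.
Qed.

Lemma dder_ext_rep F G P Q : rat_rep p F P Q -> rat_rep p G P Q -> dder F = dder G.
Proof.
move=> h h'; rewrite (dderE h) (dderE h'); have [Qp H] := h; have [_ H'] := h'.
by rewrite (_ : F p = G p) //; apply: (mulIf Qp); rewrite H // H'.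
Qed.

Lemma dder_local F G h : meval (c p) h != 0 ->
  (forall q, Phi q -> meval (c q) h != 0 -> F q = G q) -> rat_at p G -> dder F = dder G.
Proof.
move=> hp e [P [Q [Qp H]]]; apply: (@dder_ext_rep _ _ (P * h) (Q * h)); split.
- by rewrite /= mevalM mulf_neq0.
- by move=> q Pq; rewrite /= !mevalM mulf_eq0 negb_or => /andP[Qq hq]; rewrite mulrA e // H.
- by rewrite /= mevalM mulf_neq0.
- by move=> q Pq; rewrite /= !mevalM mulf_eq0 negb_or => /andP[Qq hq]; rewrite mulrA H.
Qed.

Lemma dder_ext F G : (forall q, Phi q -> F q = G q) -> rat_at p G -> dder F = dder G.
Proof. by move=> e; apply: (@dder_local F G 1) => [|q Pq _]; rewrite ?e //= meval1 oner_neq0. Qed.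

Lemma dder_poly P : dder (fun q => meval (c q) P) = dirpoly P.
Proof.
rewrite (@dderE _ P 1); last by split=> [|q _ _]; rewrite /= meval1 ?oner_neq0 // mulr1.
by rewrite -mpolyC1 dirpolyC mulr0 subr0 /= mevalC divr1.
Qed.

Lemma dder_cst u : dder (fun=> u) = 0.
Proof.
rewrite -(dirpolyC u) -dder_poly; congr dder; apply/funext => q; by rewrite /= mevalC.
Qed.

Lemma dder_coord l : dder (fun q => c q l) = v l.
Proof.
by rewrite -(dirpolyX l) -dder_poly; congr dder; apply/funext => q; rewrite /= mevalXU.
Qed.

Lemma dder_add F G : rat_at p F -> rat_at p G -> dder (fun q => F q + G q) = dder F + dder G.
Proof.
move=> [P [Q h]] [P' [Q' h']]; rewrite (dderE (rat_rep_add h h')) (dderE h) (dderE h').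
have [[Qp H] [Qp' H']] := (h, h').
rewrite dirpolyD !dirpolyM -(H p) // -(H' p) //= mevalM; field.
by rewrite Qp Qp'.
Qed.

Lemma dder_mul F G : rat_at p F -> rat_at p G ->
  dder (fun q => F q * G q) = F p * dder G + G p * dder F.
Proof.
move=> [P [Q h]] [P' [Q' h']]; rewrite (dderE (rat_rep_mul h h')) (dderE h) (dderE h').
have [[Qp H] [Qp' H']] := (h, h').
rewrite !dirpolyM -(H p) // -(H' p) //= mevalM; field.
by rewrite Qp Qp'.
Qed.

Lemma dder_sum (I : Type) (r : seq I) (F : I -> T -> K) : (forall i, rat_at p (F i)) ->
  dder (fun q => \sum_(i <- r) F i q) = \sum_(i <- r) dder (F i).
Proof.
move=> h; elim: r => [|i r IH].
  by rewrite big_nil -[RHS](dder_cst 0); congr dder; apply/funext => q; rewrite big_nil.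
rewrite big_cons -IH -dder_add //; last exact: rat_sum.
by congr dder; apply/funext => q; rewrite big_cons.
Qed.

Lemma dder_meval r (F : 'I_r -> T -> K) (H : mpoly r K) : (forall j, rat_at p (F j)) ->
  dder (fun q => meval (F ^~ q) H) = \sum_j meval (F ^~ p) (mderiv j H) * dder (F j).
Proof.
move=> h; elim/mpoly_closed_ind: H => [u|l|a b ha hb|a b ha hb].
- rewrite big1 => [|j _]; last by rewrite mderivC /= meval0 mul0r.
  by rewrite -(dder_cst u); congr dder; apply/funext => q; rewrite /= mevalC.
- rewrite (bigD1 l) //= mderivX mnmE eqxx /= mnm_subxx mpolyX0 scale1r meval1 mul1r big1 ?addr0.
    by congr dder; apply/funext => q; rewrite /= mevalXU.
  by move=> i il; rewrite mderivX mnmE eq_sym (negbTE il) scale0r meval0 mul0r.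
- rewrite (@dder_ext _ (fun q => meval (F ^~ q) a + meval (F ^~ q) b)); last 2 first.
    { by move=> q _; rewrite /= mevalD. }
    { by apply: rat_add; exact: rat_meval. }
  rewrite dder_add ?ha ?hb; [|exact: rat_meval|exact: rat_meval].
  by rewrite -big_split; apply: eq_bigr => j _; rewrite mderivD /= mevalD mulrDl.
- rewrite (@dder_ext _ (fun q => meval (F ^~ q) a * meval (F ^~ q) b)); last 2 first.
    { by move=> q _; rewrite /= mevalM. }
    { by apply: rat_mul; exact: rat_meval. }
  rewrite dder_mul ?ha ?hb; [|exact: rat_meval|exact: rat_meval].
  rewrite !mulr_sumr -big_split; apply: eq_bigr => j _; rewrite mderivM /= mevalD !mevalM.
  by ring.
Qed.

End LocallyRational.

Section ArcTangent.
Variables (K : numClosedFieldType) (X : variety K) (n : nat) (c : formal_arc X -> 'I_n -> K).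
Variables (Phi : set (formal_arc X)) (M : nat).

(* The coefficients up to order [M] of regular functions are locally rational
   functions of the coordinates [c]. *)
Record arc_coord : Prop := ArcCoord {
  acc_near : forall p (A : set X), Phi p -> nbhs (arc_center p) A -> exists h,
    meval (c p) h != 0 /\ forall q, Phi q -> meval (c q) h != 0 -> A (arc_center q) ;
  acc_rat : forall p f k, Phi p -> regular (arc_center p) f -> (k < M)%N ->
    rat_at c Phi p (fun q => arc_coef q f k) }.

Variables (p : formal_arc X) (v : 'I_n -> K).
Hypotheses (hc : arc_coord) (Pp : Phi p).
Hypothesis tan : forall P, (forall q, Phi q -> meval (c q) P = 0) -> dirpoly c p v P = 0.

Definition arc_der (f : X -> K) : pser K := fun k => dder c Phi p v (fun q => arc_coef q f k).

Lemma arc_der_near f g k : regular (arc_center p) g -> (k < M)%N ->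
  (\forall y \near arc_center p, forall q, Phi q -> arc_center q = y -> arc_coef q f k = arc_coef q g k) ->
  arc_der f k = arc_der g k.
Proof.
move=> rg kM /(acc_near hc Pp)[h [hp H]]; apply: (@dder_local _ _ _ _ _ _ _ Pp tan _ _ h) => //.
  by move=> q Pq hq; exact: (H q Pq hq q Pq erefl).
exact: acc_rat.
Qed.

(** A tangent vector to a family of arcs, applied coefficientwise: the rules for sums and products
    hold for all arcs of [Phi] near [p], so they can be differentiated along [v]. *)
Lemma arc_der_mder : mder (arc_center p) M (arc_coef p) arc_der.
Proof.
split=> [f g rf e|u|f g rf rg|f g rf rg] k kM.
- apply: arc_der_near => //; first exact: regular_germ e.
  have := near_join e; have := regular_near rf; move=> H1 H2; near=> y => q _ qy.
  apply: (lh_germ (arc_hom q)); rewrite qy; [near: y; exact: H1|near: y; exact: H2].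
- rewrite pser0 -(dder_cst Pp tan (u *+ (k == 0%N))); congr dder; apply/funext => q.
  exact: (lh_cst (arc_hom q)).
- rewrite pserD -(dder_add Pp tan); [|exact: acc_rat|exact: acc_rat].
  have := regular_near rf; have := regular_near rg => /[swap] H1 H2.
  have /(acc_near hc Pp)[h [hp H]] : \forall y \near arc_center p, regular y f /\ regular y g.
    by near=> y; split; [near: y; exact: H1|near: y; exact: H2].
  apply: (@dder_local _ _ _ _ _ _ _ Pp tan _ _ h) => // [q Pq hq|].
    by have [r1 r2] := H q Pq hq; exact: (lh_add (arc_hom q)).
  by apply: rat_add; exact: acc_rat.
- pose F q := \sum_(i <- index_iota 0 k.+1) arc_coef q f i * arc_coef q g (k - i)%N.
  have rF i : rat_at c Phi p (fun q => arc_coef q f i * arc_coef q g (k - i)%N *+ (i <= k)%N).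
    case: (leqP i k) => ik; last by apply: rat_ext (rat_cst _ _ _ 0) => q _.
    have kiM : (k - i < M)%N by exact: leq_ltn_trans (leq_subr _ _) kM.
    apply: rat_ext (rat_mul (acc_rat hc Pp rf (leq_ltn_trans ik kM)) (acc_rat hc Pp rg kiM)) => q _.
    by [].
  have := regular_near rf; have := regular_near rg => /[swap] H1 H2.
  have /(acc_near hc Pp)[h [hp H]] : \forall y \near arc_center p, regular y f /\ regular y g.
    by near=> y; split; [near: y; exact: H1|near: y; exact: H2].
  have e : arc_der (fun w => f w * g w) k =
      dder c Phi p v (fun q => \sum_(i < k.+1) arc_coef q f i * arc_coef q g (k - i)%N *+ (i <= k)%N).
    apply: (@dder_local _ _ _ _ _ _ _ Pp tan _ _ h) => // [q Pq hq|].
      have [r1 r2] := H q Pq hq; rewrite (lh_mul (arc_hom q)) //.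
      by apply: eq_bigr => i _; rewrite -ltnS ltn_ord.
    by apply: rat_sum => i; exact: rF.
  rewrite e (dder_sum Pp tan) => [|i]; last exact: rF.
  rewrite pserD !pserM [X in _ + X](reindex_inj rev_ord_inj) -big_split.
  apply: eq_bigr => i _ /=; rewrite -ltnS ltn_ord /= subSS subKn -1?ltnS //.
  have kiM : (k - i < M)%N by exact: leq_ltn_trans (leq_subr _ _) kM.
  have iM : (i < M)%N by apply: leq_ltn_trans kM; rewrite -ltnS.
  by rewrite (dder_mul Pp tan (acc_rat hc Pp rf iM) (acc_rat hc Pp rg kiM)).
Unshelve. all: by end_near. Qed.

End ArcTangent.

Section ArcCoordinates.
Variables (K : numClosedFieldType) (X : variety K).
Local Notation arc := (formal_arc X).

Definition subst_poly N n (i : 'I_N -> 'I_n) (P : mpoly N K) : mpoly n K :=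
  mmap (@mpolyC n K) (fun l => mpolyX K (mnm1 (i l))) P.

Lemma meval_subst N n (i : 'I_N -> 'I_n) (P : mpoly N K) (a : 'I_n -> K) :
  meval a (subst_poly i P) = meval (fun l => a (i l)) P.
Proof.
rewrite /subst_poly (meval_rmorph (phi := meval a)) => [|u /=]; last by rewrite mevalC.
by congr (meval _ P); apply/funext => l /=; rewrite mevalXU.
Qed.

Lemma arc_coef0 (g : arc) f : regular (arc_center g) f -> arc_coef g f 0%N = f (arc_center g).
Proof. exact: (lh_local (arc_hom g)). Qed.

Section CenterCoordinates.
Variables (U : set X) (N : nat) (x : X -> 'I_N -> K) (n : nat) (c : arc -> 'I_n -> K).
Variables (Phi : set arc) (i0 : 'I_N -> 'I_n).
Hypotheses (hx : aff_coord U x) (PU : forall q, Phi q -> U (arc_center q)).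
Hypothesis (ci0 : forall q l, Phi q -> c q (i0 l) = x (arc_center q) l).

Lemma meval_center P q : Phi q -> meval (c q) (subst_poly i0 P) = meval (x (arc_center q)) P.
Proof. by move=> Pq; rewrite meval_subst; congr (meval _ P); apply/funext => l; rewrite ci0. Qed.

Lemma center_near p (A : set X) : Phi p -> nbhs (arc_center p) A -> exists h,
    meval (c p) h != 0 /\ forall q, Phi q -> meval (c q) h != 0 -> A (arc_center q).
Proof.
move=> Pp /(ac_near_set hx (PU Pp))[P [Pp0 H]]; exists (subst_poly i0 P).
split=> [|q Pq]; rewrite meval_center // => hq; apply: H => //; exact: PU.
Qed.

Lemma rat_center p f : Phi p -> regular (arc_center p) f -> rat_at c Phi p (fun q => f (arc_center q)).
Proof.
move=> Pp /(ac_reg hx _ (PU Pp))[P [Q [Qp e]]]; have [h [hp H]] := center_near Pp e.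
exists (subst_poly i0 P * h), (subst_poly i0 Q * h); split.
  by rewrite /= mevalM mulf_neq0 // meval_center.
move=> q Pq; rewrite /= !mevalM !meval_center // mulf_eq0 negb_or => /andP[Qq hq].
by rewrite mulrA H // divfK.
Qed.
End CenterCoordinates.

(** Polynomials in the coordinates have polynomial coefficients. For a fraction [f] with [f * g = a]
    the coefficients of [f] are found recursively, dividing by the constant term of [g]. *)
Lemma arc_coord_aff U N (x : X -> 'I_N -> K) n (c : arc -> 'I_n -> K) Phi M
    (i0 : 'I_N -> 'I_M.+1 -> 'I_n) : aff_coord U x -> (forall q, Phi q -> U (arc_center q)) ->
  (forall q l k, Phi q -> c q (i0 l k) = arc_coef q (x ^~ l) k) -> arc_coord c Phi M.+1.
Proof.
move=> hx PU ci.
have c0 q l : Phi q -> c q (i0 l ord0) = x (arc_center q) l.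
  by move=> Pq; rewrite ci // arc_coef0 //; exact: regular_coord hx (PU q Pq).
split=> [p A|p f k Pp rf kM]; first exact: (center_near hx PU c0).
have rpoly P l : (l < M.+1)%N -> rat_at c Phi p (fun q => arc_coef q (fun y => meval (x y) P) l).
  { elim/mpoly_closed_ind: P l => [u|i|a b ha hb|a b ha hb] l lM.
  - apply: rat_ext (rat_cst _ _ _ (u *+ (l == 0%N))) => q Pq.
    rewrite -(lh_cst (arc_hom q)) //; congr (arc_coef q _ l); apply/funext => y /=; exact: mevalC.
  - rewrite -[l]/(nat_of_ord (Ordinal lM)).
    apply: rat_ext (rat_poly _ _ _ (mpolyX K (mnm1 (i0 i (Ordinal lM))))) => q Pq.
    rewrite /= mevalXU ci //; congr (arc_coef q _ _); apply/funext => y /=; exact: mevalXU.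
  - apply: rat_ext (rat_add (ha l lM) (hb l lM)) => q Pq.
    rewrite -(lh_add (arc_hom q)) //; [|exact: regular_poly hx (PU _ Pq)|exact: regular_poly hx (PU _ Pq)].
    by congr (arc_coef q _ _); apply/funext => y /=; exact: mevalD.
  - pose F i q := arc_coef q (fun y => meval (x y) a) i * arc_coef q (fun y => meval (x y) b) (l - i)%N.
    have rF : rat_at c Phi p (fun q => \sum_(i < l.+1) F i q).
      apply: rat_sum => i; apply: rat_mul; [apply: ha|apply: hb].
        by apply: leq_ltn_trans lM; rewrite -ltnS.
      by apply: leq_ltn_trans lM; exact: leq_subr.
    apply: rat_ext rF => q Pq.
    rewrite -(lh_mul (arc_hom q)) //; [|exact: regular_poly hx (PU _ Pq)|exact: regular_poly hx (PU _ Pq)].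
    by congr (arc_coef q _ _); apply/funext => y /=; exact: mevalM. }
have [P [Q [Qp e]]] := (ac_reg hx _ (PU _ Pp)).1 rf.
pose g y := meval (x y) Q; pose a y := meval (x y) P.
have rg q : Phi q -> regular (arc_center q) g by move=> Pq; exact: regular_poly hx (PU _ Pq).
have ra q : Phi q -> regular (arc_center q) a by move=> Pq; exact: regular_poly hx (PU _ Pq).
have [h [hp H]] : exists h, meval (c p) h != 0 /\ forall q, Phi q -> meval (c q) h != 0 ->
    [/\ regular (arc_center q) f, \forall y \near arc_center q, f y * g y = a y & g (arc_center q) != 0].
  apply: (center_near hx PU c0 Pp (A := fun y => [/\ regular y f, \forall y' \near y, f y' * g y' = a y' & g y != 0])).
  have h1 := near_join e; have h2 := regular_near rf.
  have h3 : \forall y \near arc_center p, g y != 0 by apply: regular_neq0 => //; exact: rg.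
  have h4 := near_join h3.
  near=> y; split; [near: y; exact: h2| |near: y; exact: h3].
  have e1 : \forall y' \near y, f y' = a y' / g y' by near: y; exact: h1.
  have e2 : \forall y' \near y, g y' != 0 by near: y; exact: h4.
  by near=> y'; rewrite (_ : f y' = a y' / g y') ?divfK //; near: y'.
have kM' : (k <= M)%N by [].
move: kM'; clear kM; elim/ltn_ind: k => k IH kM.
pose F q := (arc_coef q a k - \sum_(i < k) arc_coef q f i * arc_coef q g (k - i)%N) / arc_coef q g 0%N.
have rF : rat_at c Phi p F.
  apply: rat_mul; last by apply: rat_inv => //; [exact: rpoly|rewrite arc_coef0 //; exact: rg].
  apply: rat_add; first exact: rpoly.
  apply: rat_opp; apply: rat_sum => i; apply: rat_mul.
    by apply: IH => //; apply: leq_trans kM; exact: ltnW.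
  by apply: rpoly; rewrite ltnS; apply: leq_trans kM; exact: leq_subr.
apply: rat_local hp _ rF => q Pq /(H q Pq)[rfq eq gq].
have rgq := rg q Pq; rewrite /F.
have g0 : arc_coef q g 0%N != 0 by rewrite arc_coef0.
apply: (mulIf g0); rewrite divfK // -(lh_germ (arc_hom q) k (regular_mul rfq rgq) eq).
by rewrite (lh_mul (arc_hom q)) // big_ord_recr /= subnn addrAC subrr add0r.
Unshelve. all: by end_near. Qed.

Section ChartCoordinates.
Variables (U : set X) (N : nat) (x : X -> 'I_N -> K).
Variables (O : set X) (d : nat) (w : 'I_d -> X -> K) (D : 'I_d -> (X -> K) -> X -> K).
Hypotheses (hx : aff_coord U x) (hC : chart O w D).

(** In a chart the affine coordinates enter at the center only: by [mhom_recursion] all higher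
    coefficients are computed from those of the parameters. *)
Lemma arc_coord_chart n (c : arc -> 'I_n -> K) Phi M (i0 : 'I_N -> 'I_n) (i1 : 'I_d -> 'I_M -> 'I_n) :
  (forall q, Phi q -> U (arc_center q) /\ O (arc_center q)) ->
  (forall q l, Phi q -> c q (i0 l) = x (arc_center q) l) ->
  (forall q j k, Phi q -> c q (i1 j k) = arc_coef q (w j) k.+1) -> arc_coord c Phi M.+1.
Proof.
move=> PUO c0 c1; have PU q : Phi q -> U (arc_center q) by move=> /PUO[].
split=> [p A|p f k Pp rf kM]; first exact: (center_near hx PU c0).
have Op : O (arc_center p) by have [] := PUO p Pp.
have hn (g : X -> K) : regular (arc_center p) g -> exists h, meval (c p) h != 0 /\
    forall q, Phi q -> meval (c q) h != 0 -> regular (arc_center q) g.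
  by move=> /regular_near e; exact: (center_near hx PU c0 Pp e).
have rat0 (g : X -> K) : regular (arc_center p) g -> rat_at c Phi p (fun q => arc_coef q g 0%N).
  move=> rg; have [h [hp H]] := hn g rg.
  apply: rat_local hp _ (rat_center hx PU c0 Pp rg) => q Pq hq; apply: arc_coef0; exact: H.
elim/ltn_ind: k f rf kM => -[|k] IH f rf kM; first exact: rat0.
have [h [hp H]] := hn f rf.
pose F q := (\sum_j \sum_(l < k.+1) arc_coef q (D j f) l * (arc_coef q (w j) (k - l).+1 *+ (k - l).+1)) / k.+1%:R.
have rF : rat_at c Phi p F.
  apply: rat_mul; last exact: rat_cst.
  apply: rat_sum => j; apply: rat_sum => l; apply: rat_mul.
    apply: IH => //; first exact: (chart_der_reg hC).
    by apply: leq_ltn_trans kM; rewrite ltnW // ltnS -ltnS.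
  have kl : (k - l < M)%N by apply: leq_ltn_trans (leq_subr _ _) _.
  apply: rat_ext (rat_mul (rat_poly c Phi p (mpolyX K (mnm1 (i1 j (Ordinal kl))))) (rat_cst c Phi p (k - l).+1%:R)) => q Pq.
  by rewrite /= mevalXU c1 // mulr_natr.
apply: rat_local hp _ rF => q Pq hq; have [_ Oq] := PUO q Pq.
have := mhom_recursion hC Oq (arc_mhom q k.+2) (H q Pq hq) (ltnSn _).
rewrite pser_sum -mulr_natr /F => e.
have k0 : k.+1%:R != 0 :> K by rewrite pnatr_eq0.
by apply: (mulIf k0); rewrite divfK // e; apply: eq_bigr => j _; rewrite pserM.
Qed.

Variable M : nat.
Definition chart_index : finType := ('I_N + 'I_d * 'I_M)%type.

(* Coordinates of an arc modulo [t^(M+1)] with center in the chart. *)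
Definition chart_coord (y : X) (b : 'I_d -> pser K) (i : 'I_#|chart_index|) : K :=
  match enum_val i with inl l => x y l | inr (j, k) => b j k.+1 end.

Definition arc_chart_coord (g : arc) := chart_coord (arc_center g) (fun j => arc_coef g (w j)).

Lemma chart_arc_coord Phi : (forall q, Phi q -> U (arc_center q) /\ O (arc_center q)) ->
  arc_coord arc_chart_coord Phi M.+1.
Proof.
move=> PUO; apply: (@arc_coord_chart _ _ _ _ (fun l => enum_rank (inl l : chart_index))
  (fun j k => enum_rank (inr (j, k) : chart_index))) => // [q l|q j k] Pq.
  by rewrite /arc_chart_coord /chart_coord enum_rankK.
by rewrite /arc_chart_coord /chart_coord enum_rankK.
Qed.

End ChartCoordinates.
End ArcCoordinates.

Section ArcTopology.
Variables (K : numClosedFieldType) (X : variety K).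
Local Notation arc := (formal_arc X).

Lemma arc_coord_le n (c : arc -> 'I_n -> K) Phi M M' : (M <= M')%N -> arc_coord c Phi M' -> arc_coord c Phi M.
Proof.
move=> le [h1 h2]; split=> // p f k Pp rf kM; apply: h2 => //; exact: leq_trans le.
Qed.

Lemma jet_open_coord m (A : set (jet X m)) n (c : arc -> 'I_n -> K) Phi p :
  open A -> arc_coord c Phi m.+1 -> Phi p -> A (truncate m p) ->
  exists h, meval (c p) h != 0 /\ forall q, Phi q -> meval (c q) h != 0 -> A (truncate m q).
Proof.
move=> oA hc Pp Ap.
have rjf U F : jet_function U F -> U (arc_center p) -> open U ->
    rat_at c Phi p (fun q => F (truncate m q)).
  { move=> jf Up oU; elim: jf => [u|f k rf|F1 F2 _ h1 _ h2|F1 F2 _ h1 _ h2].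
  - exact: rat_cst.
  - have [km|km] := leqP k m; last first.
      by apply: rat_ext (rat_cst _ _ _ 0) => q _ /=; rewrite leqNgt km.
    by apply: rat_ext (acc_rat hc Pp (rf _ Up) _) => [q _ /=|]; rewrite ?km.
  - exact: rat_add.
  - exact: rat_mul. }
pose good (A : set (jet X m)) := exists h, meval (c p) h != 0 /\
   forall q, Phi q -> meval (c q) h != 0 -> A (truncate m q).
suff : good A by [].
apply: (@subbase_ind _ _ _ _ good (truncate m p) _ _ _ _ A oA Ap).
- by exists 1; rewrite /= meval1 oner_neq0.
- move=> V [U [F [oU jf ->]]] /= [Up Fp].
  have [h1 [hp1 H1]] := acc_near hc Pp (open_nbhs_nbhs (conj oU Up)).
  have [h2 [hp2 H2]] := rat_neq0 Pp (rjf U F jf Up oU) Fp.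
  exists (h1 * h2); split=> [|q Pq]; rewrite /= mevalM; first by rewrite mulf_neq0.
  rewrite mulf_eq0 negb_or => /andP[q1 q2]; split; [exact: H1|exact: H2].
- move=> B C [h1 [hp1 H1]] [h2 [hp2 H2]]; exists (h1 * h2); split=> [|q Pq]; rewrite /= mevalM; first by rewrite mulf_neq0.
  rewrite mulf_eq0 negb_or => /andP[q1 q2]; split; [exact: H1|exact: H2].
- by move=> B C BC [h [hp H]]; exists h; split=> // q Pq hq; apply: BC; exact: H.
Qed.

Lemma arc_open_coord (A : set arc) p : open A -> A p ->
  exists M, forall n (c : arc -> 'I_n -> K) Phi, arc_coord c Phi M -> Phi p ->
  exists h, meval (c p) h != 0 /\ forall q, Phi q -> meval (c q) h != 0 -> A q.
Proof.
move=> oA Ap.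
pose good (A : set arc) := exists M, forall n (c : arc -> 'I_n -> K) Phi, arc_coord c Phi M -> Phi p ->
  exists h, meval (c p) h != 0 /\ forall q, Phi q -> meval (c q) h != 0 -> A q.
suff : good A by [].
apply: (@subbase_ind _ _ _ _ good p _ _ _ _ A oA Ap).
- by exists 0%N => n c Phi _ _; exists 1; rewrite /= meval1 oner_neq0.
- move=> V [m [W [oW ->]]] /= Wp; exists m.+1 => n c Phi hc Pp.
  exact: (jet_open_coord oW hc Pp Wp).
- move=> B C [M1 h1] [M2 h2]; exists (maxn M1 M2) => n c Phi hc Pp.
  have [g1 [gp1 H1]] := h1 n c Phi (arc_coord_le (leq_maxl _ _) hc) Pp.
  have [g2 [gp2 H2]] := h2 n c Phi (arc_coord_le (leq_maxr _ _) hc) Pp.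
  exists (g1 * g2); split=> [|q Pq]; rewrite /= mevalM; first by rewrite mulf_neq0.
  rewrite mulf_eq0 negb_or => /andP[q1 q2]; split; [exact: H1|exact: H2].
- move=> B C BC [M h]; exists M => n c Phi hc Pp; have [g [gp H]] := h n c Phi hc Pp.
  by exists g; split=> // q Pq hq; apply: BC; exact: H.
Qed.

Lemma jet_function_open m (U : set X) (F : jet X m -> K) : open U -> jet_function U F ->
  open [set j | U (jet_center j) /\ F j != 0].
Proof. by move=> oU jF; apply: subbase_open; exists U, F. Qed.

Lemma jet_function_meval m (U : set X) r (F : 'I_r -> jet X m -> K) (H : mpoly r K) :
  (forall i, jet_function U (F i)) -> jet_function U (fun j => meval (F ^~ j) H).
Proof.
move=> h; elim/mpoly_closed_ind: H => [u|l|a b ha hb|a b ha hb].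
- rewrite (_ : (fun j => _) = fun=> u); first exact: jf_cst.
  by apply/funext => j; rewrite /= mevalC.
- rewrite (_ : (fun j => _) = F l); first exact: h.
  by apply/funext => j; rewrite /= mevalXU.
- by rewrite (_ : (fun j => _) = fun j => meval (F ^~ j) a + meval (F ^~ j) b); [exact: jf_add|apply/funext => j; rewrite /= mevalD].
- by rewrite (_ : (fun j => _) = fun j => meval (F ^~ j) a * meval (F ^~ j) b); [exact: jf_mul|apply/funext => j; rewrite /= mevalM].
Qed.

Lemma truncate_open m (W : set (jet X m)) : open W -> open (truncate m @^-1` W).
Proof. by move=> oW; apply: subbase_open; exists m, W. Qed.

Lemma truncate_continuous m : continuous (@truncate K X m).
Proof. by apply/continuousP => W; exact: truncate_open. Qed.

Lemma line_meet n (h1 h2 : mpoly n K) (a b : 'I_n -> K) : meval a h1 != 0 -> meval b h2 != 0 ->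
  exists s, meval (fun i => a i + s * (b i - a i)) h1 != 0 /\
            meval (fun i => a i + s * (b i - a i)) h2 != 0.
Proof.
move=> ha hb; pose l i : {poly K} := (a i)%:P + (b i - a i) *: 'X.
have ev h s : (mmap polyC l h).[s] = meval (fun i => a i + s * (b i - a i)) h.
  rewrite -[_.[s]]/(horner_eval s _) (meval_rmorph (phi := horner_eval s)) => [|u]; last first.
    by rewrite /= /horner_eval hornerC.
  by congr (meval _ h); apply/funext => i; rewrite /= /horner_eval !hornerE mulrC.
have n1 : mmap polyC l h1 != 0.
  apply: contraNneq ha => e; have := ev h1 0; rewrite e horner0 => /esym.
  by under eq_fun do rewrite mul0r addr0; move=> ->.
have n2 : mmap polyC l h2 != 0.
  apply: contraNneq hb => e; have := ev h2 1; rewrite e horner0 => /esym.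
  by under eq_fun do rewrite mul1r addrC subrK; move=> ->.
have [s] := poly_nonroot (mulf_neq0 n1 n2); rewrite hornerM mulf_eq0 negb_or !ev => /andP[s1 s2].
by exists s.
Qed.

Hypothesis smX : smooth X.

(** The fibres of truncation are affine spaces. Two open sets both meet the fibre over some jet of
    [S], and the line joining an arc of each inside that fibre has an arc in both. *)
Lemma truncate_preimage_irreducible m (S : set (jet X m)) : irreducible S ->
  irreducible (truncate m @^-1` S).
Proof.
move=> iS; have [[s Ss] _] := iS.
apply: irreducibleP.
  by have [g e] := jet_lift smX s; exists g; rewrite /= e.
(* Truncation is open: over the jets close to that of an arc [a] of [A], an arc of [A] is obtained
   by freezing the coefficients above order [m] at those of [a]. *)
pose section_open (A : set arc) := exists2 V, open V & [/\ S `&` V !=set0 &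
  forall j, V j -> exists2 b, truncate m b = j & A b].
have sec A : open A -> (truncate m @^-1` S) `&` A !=set0 -> section_open A.
  move=> oA [a [/= Sa Aa]]; have [M HM] := arc_open_coord oA Aa.
  have [U [N [x [hx Ua]]]] := affine_coord_at (arc_center a).
  have [O [d [w [D [Oa hC]]]]] := chart_at smX (arc_center a).
  pose Phi := [set q : arc | U (arc_center q) /\ O (arc_center q)].
  have hc : arc_coord (arc_chart_coord x w (M := M)) Phi M.
    by apply: arc_coord_le (leqnSn M) _; apply: (chart_arc_coord hx hC).
  have [h [ha H]] := HM _ _ Phi hc (conj Ua Oa).
  pose bc (j : jet X m) i : pser K := fun k => if (k <= m)%N then jet_coef j (w i) k else arc_coef a (w i) k.
  pose F (j : jet X m) := meval (fun i : 'I_#|chart_index N d M| => match enum_val i with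
    | inl l => jet_coef j (x ^~ l) 0%N | inr (i', k) => bc j i' k.+1 end) h.
  have oUO : open (U `&` O) by apply: openI; [exact: ac_open hx|exact: ch_open hC].
  have jF : jet_function (U `&` O) F.
    apply: jet_function_meval => i; case: (enum_val i) => [l|[i' k]].
      by apply: (jf_coef m (f := fun y => x y l) 0%N) => y [Uy _]; exact: (regular_coord l hx Uy).
    rewrite /bc; case: (k < m)%N; last exact: jf_cst.
    by apply: (jf_coef m k.+1) => y [_ Oy]; exact: (ch_reg hC i' Oy).
  have xj (j : jet X m) l : U (jet_center j) -> jet_coef j (x ^~ l) 0%N = x (jet_center j) l.
    by move=> Uj; apply: (lh_local (jet_hom j)); exact: regular_coord hx Uj.
  exists [set j | (U `&` O) (jet_center j) /\ F j != 0]; first exact: jet_function_open.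
  split.
    exists (truncate m a); split; [exact: Sa|split=> //].
    rewrite /F (_ : (fun i => _) = arc_chart_coord x w (M := M) a) //; apply/funext => i.
    rewrite /arc_chart_coord /chart_coord; case: (enum_val i) => [l|[i' k]]; first exact: xj.
    by rewrite /bc; case: ifP => // km; exact: truncate_coef.
  move=> j [[Uj Oj] Fj].
  have b0 i : bc j i 0%N = w i (jet_center j).
    by rewrite /bc /=; apply: (lh_local (jet_hom j)); exact: (ch_reg hC i Oj).
  have [b [cb eb]] := arc_exists hC Oj b0.
  exists b.
    apply: truncate_eqP => // f; rewrite cb => rf.
    apply: (mhom_unique hC Oj _ (jet_mhom j)) rf => [|i]; first by rewrite -cb; exact: arc_mhom.
    by rewrite eb => k km; rewrite /bc -ltnS km.
  apply: H; first by rewrite /Phi /= cb.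
  move: Fj; rewrite /F (_ : (fun i => _) = arc_chart_coord x w (M := M) b) //; apply/funext => i.
  rewrite /arc_chart_coord /chart_coord; case: (enum_val i) => [l|[i' k]]; first by rewrite xj ?cb.
  by rewrite eb.
move=> A B oA oB /(sec A oA)[V oV [SV hV]] /(sec B oB)[V' oV' [SV' hV']].
have [j [Sj [/hV[a ea Aa] /hV'[b eb Bb]]]] := irreducible_meet iS oV oV' SV SV'.
have ca : arc_center a = jet_center j by rewrite -ea.
have cb : arc_center b = jet_center j by rewrite -eb.
have [M1 H1] := arc_open_coord oA Aa; have [M2 H2] := arc_open_coord oB Bb.
have [U [N [x [hx Uj]]]] := affine_coord_at (jet_center j).
have [O [d [w [D [Oj hC]]]]] := chart_at smX (jet_center j).
pose Phi := [set q : arc | U (arc_center q) /\ O (arc_center q)]; pose M := maxn M1 M2.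
have hc : arc_coord (arc_chart_coord x w (M := M)) Phi M.
  by apply: arc_coord_le (leqnSn M) _; apply: (chart_arc_coord hx hC).
have Pa : Phi a by rewrite /Phi /= ca.
have Pb : Phi b by rewrite /Phi /= cb.
have [h1 [ha h1P]] := H1 _ _ Phi (arc_coord_le (leq_maxl _ _) hc) Pa.
have [h2 [hb h2P]] := H2 _ _ Phi (arc_coord_le (leq_maxr _ _) hc) Pb.
have [t [t1 t2]] := line_meet ha hb.
pose e i : pser K := arc_ser a (w i) + pcst t * (arc_ser b (w i) - arc_ser a (w i)).
have e0 i : e i 0%N = w i (jet_center j).
  have rw : regular (jet_center j) (w i) := ch_reg hC i Oj.
  by rewrite /e pserD pcstM pserB /arc_ser !arc_coef0 ?ca ?cb // subrr mulr0 addr0.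
have [g [cg eg]] := arc_exists hC Oj e0.
have Pg : Phi g by rewrite /Phi /= cg.
have cE : arc_chart_coord x w (M := M) g = fun i => arc_chart_coord x w (M := M) a i +
    t * (arc_chart_coord x w (M := M) b i - arc_chart_coord x w (M := M) a i).
  apply/funext => i; rewrite /arc_chart_coord /chart_coord ca cb cg.
  case: (enum_val i) => [l|[i' k]]; first by rewrite subrr mulr0 addr0.
  by rewrite eg /e pserD pcstM pserB /arc_ser.
exists g; split; last by split; [apply: h1P|apply: h2P] => //; rewrite cE.
suff e1 : truncate m g = j by rewrite /preimage /= e1.
apply: truncate_eqP => // f; rewrite cg => rf.
apply: (mhom_unique hC Oj _ (jet_mhom j)) rf => [|i]; first by rewrite -cg; exact: arc_mhom.
rewrite eg => k km; rewrite /e pserD pcstM pserB /arc_ser.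
have -> : arc_coef a (w i) k = jet_coef j (w i) k by rewrite -ea truncate_coef.
have -> : arc_coef b (w i) k = jet_coef j (w i) k by rewrite -eb truncate_coef.
by rewrite subrr mulr0 addr0.
Qed.

End ArcTopology.

(** * Germs with vanishing derivatives *)

Section DifferentialIdeal.
Variables (K : numClosedFieldType) (X : variety K).

Lemma derivation_meval (y : X) D n (g : 'I_n -> X -> K) (Q : mpoly n K) : derivation_at y D ->
  (forall j, regular y (g j)) ->
  regular y (fun u => meval (g ^~ u) Q) /\
  D (fun u => meval (g ^~ u) Q) y = \sum_j meval (g ^~ y) (mderiv j Q) * D (g j) y.
Proof.
move=> hD rg; elim/mpoly_closed_ind: Q => [u|l|a b [ra ha] [rb hb]|a b [ra ha] [rb hb]].
- rewrite (_ : (fun u0 => _) = fun=> u); last by apply/funext => u0; rewrite /= mevalC.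
  split; first exact: regular_cst.
  by rewrite (derivation_cst hD) big1 // => j _; rewrite mderivC /= meval0 mul0r.
- rewrite (_ : (fun u0 => _) = g l); last by apply/funext => u0; rewrite /= mevalXU.
  split=> //; rewrite (bigD1 l) //= mderivX mnmE eqxx /= mnm_subxx mpolyX0 scale1r meval1 mul1r.
  by rewrite big1 ?addr0 // => i il; rewrite mderivX mnmE eq_sym (negbTE il) scale0r meval0 mul0r.
- rewrite (_ : (fun u0 => _) = fun u0 => meval (g ^~ u0) a + meval (g ^~ u0) b); last first.
    by apply/funext => u0; rewrite /= mevalD.
  split; first exact: regular_add.
  rewrite (derivation_add hD) // ha hb -big_split; apply: eq_bigr => j _.
  by rewrite mderivD /= mevalD mulrDl.
- rewrite (_ : (fun u0 => _) = fun u0 => meval (g ^~ u0) a * meval (g ^~ u0) b); last first.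
    by apply/funext => u0; rewrite /= mevalM.
  split; first exact: regular_mul.
  rewrite (derivation_mul hD) // ha hb !mulr_sumr -big_split; apply: eq_bigr => j _.
  by rewrite mderivM /= mevalD !mevalM; ring.
Qed.

Lemma zpow_germ (x0 : X) d (z : 'I_d -> X -> K) e f g : zpow x0 z e f ->
  (\forall u \near x0, f u = g u) -> zpow x0 z e g.
Proof.
case: e => [|e]; first exact: regular_germ.
move=> [b [hb h]] fg; exists b; split=> //; near=> u.
by rewrite -(_ : f u = g u); [near: u|near: u].
Unshelve. all: by end_near. Qed.

Lemma zpow_opp (x0 : X) d (z : 'I_d -> X -> K) e f : zpow x0 z e f -> zpow x0 z e (fun u => - f u).
Proof.
elim: e f => [|e IH] f; first exact: regular_opp.
move=> [b [hb h]]; exists (fun j u => - b j u); split=> [j|]; first exact: IH (hb j).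
near=> u; rewrite (_ : f u = \sum_j z j u * b j u); last by near: u.
by rewrite -sumrN; apply: eq_bigr => j _; rewrite mulrN.
Unshelve. all: by end_near. Qed.

(** All derivatives of a germ of [J] vanish at [x0], so its Taylor polynomials are zero and Krull's
    theorem applies. *)
Lemma chart_taylor (x0 : X) d (z : 'I_d -> X -> K) : parameters x0 z ->
  exists V D, [/\ V x0, chart V z D & forall J : set (X -> K),
    (forall f, J f -> regular x0 f /\ f x0 = 0) ->
    (forall f g, J f -> (\forall u \near x0, f u = g u) -> J g) ->
    (forall f g, J f -> regular x0 g -> J (fun u => f u * g u)) ->
    (forall f j, J f -> J (D j f)) -> forall f, J f -> \forall u \near x0, f u = 0].
Proof.
move=> par; have [U [N [x [hx Ux0]]]] := affine_coord_at x0.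
have [a [AP [AQ [O [oO Ox0 gO]]]]] := parameters_good hx Ux0 par.
have [Zs [hZ Z0]] := smooth_max_chain par.
have [V [Vx0 hC]] := chart_of_chain hx Ux0 par oO Ox0 gO hZ Z0.
exists V, (chart_der x z a AP AQ); split=> // J Jr Jg JM JD.
pose D := chart_der x z a AP AQ.
have nZ := near_in_chain hx Ux0 par oO Ox0 gO hZ Z0.
have main e f : J f -> zpow x0 z e f.
  elim: e f => [|e IH] f Jf; first by have [] := Jr f Jf.
  have [rf f0] := Jr f Jf.
  have [Q [g [degQ zg fE]]] := zpow_decomp par e.+1 rf.
  have rg := zpow_regular par zg.
  have rz j : regular x0 (z j) := ch_reg hC j Vx0.
  have dQ j : mderiv j Q = 0.
    have [g' [zg' g'E]] := der_zpow hx par oO Ox0 gO hZ Z0 j zg.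
    have zs : zpow x0 z e (fun u => g' u + - D j f u).
      by apply: zpow_add => //; apply: zpow_opp; apply: IH; exact: JD.
    apply: (taylor_unique hx Ux0 par oO Ox0 gO hZ Z0 _ zs) => [m em|].
      by rewrite mcoeff_deriv degQ ?mul0rn // mdegD mdeg1 addn1.
    have n1 := near_join fE; have n2 := regular_near rg.
    have n3 : \forall u \near x0, forall j, regular u (z j).
      by apply: filter_forall => i; exact: regular_near.
    have n4 : \forall u \near x0, V u := chart_near hC Vx0.
    near=> u => Zu.
    have Vu : V u by near: u.
    have hD := ch_der hC j Vu.
    have ru : regular u g by near: u; exact: n2.
    have rzu i : regular u (z i) by move: i; near: u; exact: n3.
    have [rQ eQ] := derivation_meval Q hD rzu.
    have -> : g' u = D j g u by apply/esym; move: Zu; near: u; exact: g'E.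
    have e1 : \forall w \near u, f w = meval (z ^~ w) Q + g w by near: u; exact: n1.
    have -> : D j f u = D j (fun w => meval (z ^~ w) Q + g w) u.
      apply: (derivation_germ hD _ e1); apply: regular_germ (regular_add rQ ru) _.
      by near=> w; apply/esym; near: w; exact: e1.
    have e2 : D j (fun w => meval (z ^~ w) Q + g w) u = _ := derivation_add hD rQ ru.
    rewrite e2 eQ opprD.
    rewrite (bigD1 j) //= (ch_dual hC) // eqxx mulr1 big1 ?addr0; last first.
      by move=> i ij; rewrite (ch_dual hC) // eq_sym (negbTE ij) mulr0.
    by rewrite /D; ring.
  have Q0 : Q = 0.
    have eQ := mderiv0_const dQ.
    have := nbhs_singleton fE; rewrite f0 (zpow_at0 par zg) addr0 eQ /= mevalC => e'.
    by move: eQ; rewrite -e' mpolyC0.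
  apply: zpow_germ zg _; near=> u; rewrite (_ : f u = meval (z ^~ u) Q + g u); last by near: u.
  by rewrite Q0 /= meval0 add0r.
move=> f Jf; have [rf _] := Jr f Jf.
have [P [Q [Qx e]]] := (ac_reg hx _ Ux0).1 rf.
have rQ : regular x0 (fun u => meval (x u) Q) := regular_poly Q hx Ux0.
have nQ := regular_neq0 rQ Qx.
have JP : J (fun u => meval (x u) P).
  apply: Jg (JM _ _ Jf rQ) _; near=> u.
  rewrite (_ : f u = meval (x u) P / meval (x u) Q); last by near: u.
  by rewrite divfK //; near: u.
have h := zpow_zero hx Ux0 par (fun e => main e _ JP).
near=> u; rewrite (_ : f u = meval (x u) P / meval (x u) Q); last by near: u.
by rewrite (_ : meval (x u) P = 0) ?mul0r //; near: u.
Unshelve. all: by end_near. Qed.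

End DifferentialIdeal.

(** * Moving an arc out of a hypersurface *)

Section Perturbation.
Variables (K : numClosedFieldType) (X : variety K).
Local Notation arc := (formal_arc X).

Lemma line_deriv n (a v : 'I_n -> K) (P : mpoly n K) :
  (forall s, meval (fun i => a i + s * v i) P = 0) -> \sum_l meval a (mderiv l P) * v l = 0.
Proof.
move=> h; pose l i : {poly K} := (a i)%:P + v i *: 'X.
have ev s : (mmap polyC l P).[s] = 0.
  rewrite -[_.[s]]/(horner_eval s _) (meval_rmorph (phi := horner_eval s)) => [|u]; last first.
    by rewrite /= /horner_eval hornerC.
  rewrite -(h s); congr (meval _ P); apply/funext => i; by rewrite /= /horner_eval !hornerE mulrC.
have q0 : mmap polyC l P = 0.
  by apply/eqP; apply: contraT => /poly_nonroot[s]; rewrite ev eqxx.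
have E : (fun q : {poly K} => (q^`()).[0]) (mmap polyC l P) =
    \sum_i meval (fun i => horner_eval 0 (l i)) (mderiv i P) * ((l i)^`()).[0].
  { apply: (@derivation_mmap K n {poly K} (horner_eval 0) polyC l (fun q => (q^`()).[0]) P).
  - by move=> u; rewrite /= /horner_eval hornerC.
  - by move=> u; rewrite derivC hornerC.
  - by move=> f g; rewrite derivD hornerD.
  - by move=> f g; rewrite derivM hornerD !hornerM /horner_eval addrC; congr (_ + _); rewrite mulrC. }
rewrite /= q0 deriv0 horner0 in E; rewrite [RHS]E; apply: eq_bigr => i _.
rewrite /l derivD derivC add0r derivZ derivX hornerZ hornerC mulr1.
by congr (meval _ _ * _); apply/funext => j; rewrite /= /horner_eval hornerD hornerC hornerZ hornerX mulr0 addr0.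
Qed.

Hypothesis smX : smooth X.

(** Otherwise [f] belongs to the set [J] of germs that vanish along every arc with the given
    [m]-jet. Moving these arcs shows that [J] is stable under the derivations, so its elements are
    zero by [chart_taylor]. *)
Lemma arc_perturb (g : arc) m f : regular (arc_center g) f ->
  ~ (\forall u \near arc_center g, f u = 0) ->
  exists2 g', truncate m g' = truncate m g & exists k, arc_coef g' f k != 0.
Proof.
move=> rf nf; apply: contrapT => none; apply: nf.
have [d [z par]] := smX (arc_center g); have [V [D [Vy hC taylor]]] := chart_taylor par.
have [U [N [x [hx Uy]]]] := affine_coord_at (arc_center g).
set y := arc_center g in rf par Vy Uy taylor *.
pose Phi := [set h : arc | truncate m h = truncate m g].
have cPhi h : Phi h -> arc_center h = y by move=> /(congr1 (@jet_center _ _ _)).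
pose J (f : X -> K) := regular y f /\ forall h, Phi h -> arc_ser h f = 0.
apply: (taylor J) => [f' [rf' h]|f' g' [rf' h] e|f' g' [rf' h] rg'|f' j [rf' hf]|].
- split=> //; have /(congr1 (fun a : pser K => a 0%N)) := h g erefl.
  by rewrite /arc_ser arc_coef0.
- have rg' := regular_germ rf' e; split=> // h' Ph'; rewrite -(h h' Ph').
  apply/esym/funext => k; apply: (lh_germ (arc_hom h')); by rewrite cPhi.
- split=> [|h' Ph']; first exact: regular_mul.
  have hm k := mh_mul (arc_mhom h' k.+1) (f := f') (g := g').
  apply/funext => k; rewrite (hm k) ?cPhi //; by rewrite h // mul0r.
- split=> [|h Ph]; first exact: (chart_der_reg hC).
  (* Moving [z j] in the direction [t^(m+1)] keeps the [m]-jet and changes [f'], to first order, by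
     [t^(m+1)] times the series of [D j f']. Coefficient [M] of this change is coefficient [k] of
     that series. *)
  apply/funext => k; pose M := (k + m.+1)%N.
  have mM : (m < M)%N by rewrite /M addnS ltnS leq_addl.
  pose c := arc_chart_coord x z (M := M).
  have hc : arc_coord c Phi M.+1.
    by apply: (chart_arc_coord hx hC) => q /cPhi ->.
  pose i1 (i : 'I_d) (l : 'I_M) := enum_rank (inr (i, l) : chart_index N d M).
  pose v i : K := (i == i1 j (Ordinal mM))%:R.
  have tan P : (forall q, Phi q -> meval (c q) P = 0) -> dirpoly c h v P = 0.
    move=> nP; apply: line_deriv => s.
    pose b i := arc_ser h (z i) + pcst (s * (i == j)%:R) * pX K m.+1.
    have bE i l : b i l = arc_coef h (z i) l + s * ((i == j) && (l == m.+1))%:R.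
      by rewrite /b pserD pcstM /pX -mulnb natrM mulrA.
    have b0 i : b i 0%N = z i y.
      by rewrite bE andbF mulr0 addr0 arc_coef0 cPhi //; exact: (ch_reg hC i Vy).
    have [q [cq eq]] := arc_exists hC Vy b0.
    have Pq : Phi q.
      { rewrite /Phi /= -(_ : truncate m h = truncate m g) //.
      apply: truncate_eqP => [|f1]; first by rewrite cq /= cPhi.
      rewrite cq => rf1; apply: (mhom_unique hC Vy _ _) rf1 => [||i].
      + by rewrite -cq; exact: arc_mhom.
      + have := jet_mhom (truncate m h); by rewrite /= cPhi.
      + move=> l lm; rewrite eq bE truncate_coef // (ltn_eqF lm) andbF mulr0 addr0 //. }
    rewrite -(nP q Pq); congr (meval _ P); apply/funext => i.
    rewrite /c /arc_chart_coord /chart_coord cq cPhi // /v.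
    rewrite -[i in (i == _)%:R]enum_valK (inj_eq enum_rank_inj).
    case: (enum_val i) => [l|[i' l]]; first by rewrite mulr0 addr0.
    by rewrite eq bE.
  have hE := arc_der_mder hc Ph tan.
  have Oh : V (arc_center h) by rewrite cPhi.
  have rh : regular (arc_center h) f' by rewrite cPhi.
  have := mder_chart hC Oh (arc_mhom h M.+1) hE rh.
  move=> /(_ M (ltnSn M)).
  have -> : arc_der c Phi h v f' M = 0.
    rewrite -(dder_cst Ph tan 0); apply: (dder_ext Ph tan); last exact: rat_cst.
    by move=> q Pq; rewrite -[arc_coef _ _ _]/(arc_ser q f' M) hf.
  have Ez i : peq M.+1 (arc_der c Phi h v (z i)) (pcst (i == j)%:R * pX K m.+1).
    move=> l lM; rewrite pcstM /pX.
    case: l lM => [|l] lM.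
      rewrite mulr0 -(dder_cst Ph tan (z i y)); apply: (dder_ext Ph tan); last exact: rat_cst.
      move=> q Pq; rewrite arc_coef0 cPhi //; exact: (ch_reg hC i Vy).
    have lM' : (l < M)%N by [].
    rewrite /arc_der (_ : (fun q => _) = fun q => c q (i1 i (Ordinal lM'))); last first.
      by apply/funext => q; rewrite /c /arc_chart_coord /chart_coord enum_rankK.
    by rewrite (dder_coord Ph tan) /v (inj_eq enum_rank_inj) -natrM mulnb.
  have sE : peq M.+1 (\sum_i arc_ser h (D i f') * arc_der c Phi h v (z i)) (arc_ser h (D j f') * pX K m.+1).
    apply: (@peq_trans _ _ _ (\sum_i arc_ser h (D i f') * (pcst (i == j)%:R * pX K m.+1))).
      by apply: peq_sum => i _; exact: peqM.
    rewrite (bigD1 j) //= eqxx big1 ?addr0; first by rewrite rmorph1 mul1r.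
    by move=> i /negbTE->; rewrite rmorph0 mul0r mulr0.
  rewrite sE // mulrC pXM ltnNge leq_addl /= /M addnK => <-.
  by [].
- split=> // h Ph; apply: contrapT => h0; apply: none; exists h => //.
  apply: contrapT => nk; apply: h0; apply/funext => k; apply/eqP/negPn/negP => hk.
  by apply: nk; exists k.
Qed.

End Perturbation.

(** * Contact loci and cylinders *)

Section PushForward.
Variables (K : numClosedFieldType) (X X' : variety K) (mu : X' -> X).
Hypothesis hmu : morphism_on setT mu.

Lemma morphism_near y (P : set X) : nbhs (mu y) P -> \forall u \near y, P (mu u).
Proof. by move=> h; have [c _] := hmu (x := y) I; exact: (c P h). Qed.

Lemma morphism_regular y f : regular (mu y) f -> regular y (f \o mu).
Proof. by have [_ h] := hmu (x := y) I; exact: h. Qed.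

Definition push_coef (g : formal_arc X') (f : X -> K) (k : nat) : K :=
  if `[< regular (mu (arc_center g)) f >] then arc_coef g (f \o mu) k else 0.

Lemma push_hom (g : formal_arc X') : local_hom xpredT (mu (arc_center g)) (push_coef g).
Proof.
have hg := arc_hom g; have R := @morphism_regular (arc_center g).
split.
- by move=> f k h; rewrite /push_coef asboolF // => rf; exact: h.
- move=> f h k rf e; have rh := regular_germ rf e.
  rewrite /push_coef !asboolT //; apply: (lh_germ hg); first exact: R.
  exact: (morphism_near e).
- by move=> f rf; rewrite /push_coef asboolT // (lh_local hg) //; exact: R.
- move=> u k _; rewrite /push_coef asboolT; last exact: regular_cst.
  exact: (lh_cst hg).
- move=> f h k rf rh _; rewrite /push_coef !asboolT //; last exact: regular_add.
  by apply: (lh_add hg) => //; exact: R.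
- move=> f h k rf rh _; rewrite /push_coef !asboolT //; last exact: regular_mul.
  by rewrite (lh_mul hg (R f rf) (R h rh)).
Qed.

Definition push (g : formal_arc X') : formal_arc X := Arc (push_hom g).

Lemma push_ser g f : regular (mu (arc_center g)) f -> arc_ser (push g) f = arc_ser g (f \o mu).
Proof. by move=> rf; apply/funext => k; rewrite /arc_ser /= /push_coef asboolT. Qed.

Lemma push_jet_function m (U : set X) (F : jet X m -> K) : jet_function U F ->
  exists2 F' : jet X' m -> K, jet_function (mu @^-1` U) F' &
    forall g, U (mu (arc_center g)) -> F' (truncate m g) = F (truncate m (push g)).
Proof.
elim=> [u|f k rf|F1 F2 _ [G1 j1 e1] _ [G2 j2 e2]|F1 F2 _ [G1 j1 e1] _ [G2 j2 e2]].
- by exists (fun=> u) => //; exact: jf_cst.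
- exists (fun j => jet_coef j (f \o mu) k).
    by apply: (jf_coef m k) => y /= Uy; apply: morphism_regular; exact: rf.
  by move=> g Ug /=; case: ifP => // _; rewrite /push_coef asboolT //; exact: rf.
- by exists (fun j => G1 j + G2 j) => [|g Ug]; [exact: jf_add|rewrite e1 ?e2].
- by exists (fun j => G1 j * G2 j) => [|g Ug]; [exact: jf_mul|rewrite e1 ?e2].
Qed.

Lemma preimage_open (U : set X) : open U -> open (mu @^-1` U).
Proof.
move=> oU; rewrite openE => y Uy; apply: morphism_near; exact: open_nbhs_nbhs.
Qed.

Lemma push_continuous : continuous push.
Proof.
move=> p A; rewrite nbhsE => -[B [oB Bp] BA].
suff [V [oV Vp VB]] : exists V, [/\ open V, V p & V `<=` push @^-1` B].
  by apply: filterS (fun q Vq => BA _ (VB q Vq)) _; exact: open_nbhs_nbhs.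
pose good (B : set (formal_arc X)) := exists V, [/\ open V, V p & V `<=` push @^-1` B].
apply: (@subbase_ind _ _ _ _ good (push p) _ _ _ _ B oB Bp).
- by exists setT; split=> //; exact: openT.
- move=> W0 [m [W [oW ->]]] /= Wp.
  pose good' (W : set (jet X m)) := exists V, [/\ open V, V p & V `<=` push @^-1` (truncate m @^-1` W)].
  apply: (@subbase_ind _ _ _ _ good' (truncate m (push p)) _ _ _ _ W oW Wp).
  + by exists setT; split=> //; exact: openT.
  + move=> W1 [U [F [oU jF ->]]] /= [Up Fp].
    have [F' jF' eF] := push_jet_function jF.
    exists (truncate m @^-1` [set j | (mu @^-1` U) (jet_center j) /\ F' j != 0]); split.
    * by apply: truncate_open; apply: jet_function_open => //; exact: preimage_open.
    * by split=> //; rewrite eF.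
    * by move=> q [/= Uq Fq]; split=> //; rewrite -eF.
  + move=> B1 B2 [V1 [o1 p1 s1]] [V2 [o2 p2 s2]]; exists (V1 `&` V2); split=> //; first exact: openI.
    by move=> q [/s1 q1 /s2 q2]; split.
  + by move=> B1 B2 B12 [V [oV Vp s]]; exists V; split=> // q /s; exact: B12.
- move=> B1 B2 [V1 [o1 p1 s1]] [V2 [o2 p2 s2]]; exists (V1 `&` V2); split=> //; first exact: openI.
  by move=> q [/s1 q1 /s2 q2]; split.
- by move=> B1 B2 B12 [V [oV Vp s]]; exists V; split=> // q /s; exact: B12.
Qed.

End PushForward.

Section Contact.
Variables (K : numClosedFieldType) (X : variety K).
Local Notation arc := (formal_arc X).
Implicit Types (Y : subscheme X) (g : arc).

Lemma coherent_near Y y f : ideal Y y f -> \forall u \near y, regular u f /\ ideal Y u f.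
Proof.
move=> Yf; have [n [b hb]] := ideal_coherent Y y.
have [_ e] := nbhs_singleton hb; move: Yf; rewrite e => -[r [a [h [ah fE]]]].
have n1 : \forall u \near y, forall i, regular u (a i).
  by apply: filter_forall => i; apply: regular_near; have [] := ah i.
have n2 := near_join fE.
near=> u; have [rb eu] : (forall i, regular u (b i)) /\ ideal Y u = germ_span u (range b) by near: u.
have ra : forall i, regular u (a i) by near: u.
have fu : \forall w \near u, f w = \sum_i a i w * h i w by near: u.
have rh i : regular u (h i) by have [_ [l _ <-]] := ah i; exact: rb.
split; last by rewrite eu; exists r, a, h; split=> // i; split=> //; have [] := ah i.
apply: regular_germ (_ : regular u (fun w => \sum_i a i w * h i w)) _.
  by apply: regular_sum => i _; exact: regular_mul.
by near=> w; apply/esym; near: w.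
Unshelve. all: by end_near. Qed.

Lemma ideal_regular Y y f : ideal Y y f -> regular y f.
Proof. by move=> /coherent_near/nbhs_singleton[]. Qed.

Definition jet_contact Y e : set (jet X e) :=
  [set j | exists2 f, ideal Y (jet_center j) f & jet_coef j f e != 0].
Arguments jet_contact Y e _ : clear implicits.

Lemma jet_contact_open Y e : open (jet_contact Y e).
Proof.
rewrite openE => j [f Yf fe].
have [V [oV Vj hV]] := near_open (coherent_near Yf).
apply: (@filterS _ _ _ [set j' | V (jet_center j') /\ jet_coef j' f e != 0]).
  by move=> j' [/hV[rf Yf'] fe']; exists f.
apply: open_nbhs_nbhs; split; last by split.
by apply: jet_function_open => //; apply: (jf_coef e e) => u /hV[].
Qed.

Definition contact_open Y e : set arc :=
  [set g | exists2 f, ideal Y (arc_center g) f & arc_coef g f e != 0].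

Lemma contact_openE Y e : contact_open Y e = truncate e @^-1` jet_contact Y e.
Proof. by apply/seteqP; split=> g [f Yf fe]; exists f => //; move: fe; rewrite /= leqnn. Qed.

Lemma contact_open_open Y e : open (contact_open Y e).
Proof. by rewrite contact_openE; apply: truncate_open; exact: jet_contact_open. Qed.

Lemma arc_orderE g Y e : arc_order g Y e <-> contact_open Y e g /\ forall k, (k < e)%N -> ~ contact_open Y k g.
Proof.
split=> [[h1 h2]|[h2 h1]].
  by split=> [|k ke [f Yf]]; [exact: h2|rewrite (h1 f k Yf ke) eqxx].
split; last exact: h2.
by move=> f k Yf ke; apply/eqP/negPn/negP => fk; apply: (h1 k ke); exists f.
Qed.

Lemma arc_order_uniq g Y e e' : arc_order g Y e -> arc_order g Y e' -> e = e'.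
Proof.
move=> /arc_orderE[h1 h2] /arc_orderE[h1' h2']; case: (ltngtP e e') => //.
  by move=> /h2'.
by move=> /h2.
Qed.

Lemma closedC_open (T : topologicalType) (A : set T) : open A -> closed (~` A).
Proof. by move=> oA; rewrite closedC. Qed.

Lemma constructible_open_closed (T : topologicalType) (A F : set T) : open A -> closed F ->
  constructible (A `&` F).
Proof.
move=> oA cF; exists 1%N, (fun=> A), (fun=> F); split=> //.
by apply/seteqP; split=> [x h|x [_ _ h]]; [exists ord0|].
Qed.

Lemma constructible_setI (T : topologicalType) (S A F : set T) : constructible S -> open A -> closed F ->
  constructible (S `&` (A `&` F)).
Proof.
move=> [n [U [G [hUG ->]]]] oA cF; exists n, (fun i => U i `&` A), (fun i => G i `&` F); split.
  by move=> i; have [oU cG] := hUG i; split; [exact: openI|exact: closedI].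
rewrite setI_bigcupl; apply: eq_bigcupr => i _.
by apply/seteqP; split=> x /= => [[[? ?] [? ?]]|[[? ?] [? ?]]].
Qed.

Lemma constructible_preimage (T T' : topologicalType) (f : T -> T') (S : set T') : continuous f ->
  constructible S -> constructible (f @^-1` S).
Proof.
move=> cf [n [U [F [hUF ->]]]]; exists n, (fun i => f @^-1` U i), (fun i => f @^-1` F i); split.
  move=> i; have [oU cF] := hUF i; split; first by apply: open_comp => // x _; exact: cf.
  by apply: closed_comp => // x _; exact: cf.
by rewrite preimage_bigcup.
Qed.

Lemma trunc_jet_hom l m (j : jet X m) : (l <= m)%N ->
  local_hom (fun k => (k <= l)%N) (jet_center j) (fun f k => if (k <= l)%N then jet_coef j f k else 0).
Proof.
case: j => x phi [dflt germ loc cst add mul] /= lm; split.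
- move=> f k H; case: ifP => // kl; apply: dflt => -[rf _]; exact: H.
- by move=> f h k rf fh; case: ifP => // _; exact: germ.
- exact: loc.
- by move=> c k kl; rewrite kl cst //; exact: leq_trans lm.
- by move=> f h k rf rh kl; rewrite kl add //; exact: leq_trans lm.
- move=> f h k rf rh kl; rewrite kl mul //; last exact: leq_trans lm.
  apply: eq_bigr => i _.
  by rewrite (leq_trans _ kl) 1?(leq_trans (leq_subr _ _) kl) // -ltnS.
Qed.

Definition trunc_jet l m (lm : (l <= m)%N) (j : jet X m) : jet X l := Jet (trunc_jet_hom j lm).

Lemma trunc_jet_truncate l m (lm : (l <= m)%N) g : trunc_jet lm (truncate m g) = truncate l g.
Proof.
apply: jet_eq => //=; apply/funext => f; apply/funext => k.
by case: ifP => // kl; rewrite (leq_trans kl lm).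
Qed.

Lemma trunc_jet_continuous l m (lm : (l <= m)%N) : continuous (trunc_jet lm).
Proof.
move=> p A; rewrite nbhsE => -[B [oB Bp] BA].
pose good (B : set (jet X l)) := exists V, [/\ open V, V p & V `<=` trunc_jet lm @^-1` B].
suff [V [oV Vp VB]] : good B.
  by apply: filterS (fun q Vq => BA _ (VB q Vq)) _; exact: open_nbhs_nbhs.
have jF (U : set X) (F : jet X l -> K) : jet_function U F -> jet_function U (F \o trunc_jet lm).
  { elim=> [u|f k rf|F1 F2 _ h1 _ h2|F1 F2 _ h1 _ h2].
  + exact: jf_cst.
  + rewrite /comp /=; case: (k <= l)%N; last exact: jf_cst.
    exact: jf_coef.
  + exact: jf_add h1 h2.
  + exact: jf_mul h1 h2. }
apply: (@subbase_ind _ _ _ _ good (trunc_jet lm p) _ _ _ _ B oB Bp).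
- by exists setT; split=> //; exact: openT.
- move=> W0 [U [F [oU jF0 ->]]] /= [Up Fp].
  exists [set j | U (jet_center j) /\ (F \o trunc_jet lm) j != 0]; split=> //.
  by apply: jet_function_open => //; exact: jF.
- move=> B1 B2 [V1 [o1 p1 s1]] [V2 [o2 p2 s2]]; exists (V1 `&` V2); split=> //; first exact: openI.
  by move=> q [/s1 q1 /s2 q2]; split.
- by move=> B1 B2 B12 [V [oV Vp s]]; exists V; split=> // q /s; exact: B12.
Qed.

Lemma cylinder_setI (C : set arc) l (A F : set (jet X l)) : cylinder C -> open A -> closed F ->
  cylinder (C `&` truncate l @^-1` (A `&` F)).
Proof.
move=> [m [S [cS ->]]] oA cF; pose n := maxn m l.
exists n, ((trunc_jet (leq_maxl m l) @^-1` S) `&`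
  ((trunc_jet (leq_maxr m l) @^-1` A) `&` (trunc_jet (leq_maxr m l) @^-1` F))); split.
  { apply: constructible_setI.
  - by apply: constructible_preimage => //; exact: trunc_jet_continuous.
  - by apply: open_comp => // x _; exact: trunc_jet_continuous.
  - by apply: closed_comp => // x _; exact: trunc_jet_continuous. }
by apply/seteqP; split=> g /=; rewrite !trunc_jet_truncate.
Qed.

End Contact.
Arguments jet_contact {K X} Y e _.

(** * Lifting arcs along a projective morphism *)

Section Bihomogeneous.
Variable K : numClosedFieldType.

Lemma mmap_comp N n (R : comNzRingType) (i : {rmorphism K -> R}) (X : 'I_n -> R)
    (g : 'I_N -> mpoly n K) (P : mpoly N K) :
  mmap i X (mmap (@mpolyC n K) g P) = mmap i (fun l => mmap i X (g l)) P.
Proof.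
elim/mpoly_closed_ind: P => [c|l|a b ha hb|a b ha hb].
- by rewrite !mmapC.
- by rewrite !mmapX !mmap1U.
- by rewrite !mmap_add ha hb.
- by rewrite !mmap_mul ha hb.
Qed.

Lemma mmap_subst N n (R : comNzRingType) (i : {rmorphism K -> R}) (X : 'I_n -> R)
    (j : 'I_N -> 'I_n) (P : mpoly N K) :
  mmap i X (subst_poly j P) = mmap i (fun l => X (j l)) P.
Proof.
rewrite mmap_comp; congr (mmap _ _ P); apply/funext => l.
by rewrite mmapX mmap1U.
Qed.

Lemma mmap_sub N (R : comNzRingType) (i : {rmorphism K -> R}) (X : 'I_N -> R) (a b : mpoly N K) :
  mmap i X (a - b) = mmap i X a - mmap i X b.
Proof.
have h : mmap i X b + mmap i X (a - b) = mmap i X a by rewrite -mmap_add addrC subrK.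
by rewrite -h addrAC subrr add0r.
Qed.

Definition vcat (R : Type) N n (u : 'I_N -> R) (v : 'I_n -> R) (i : 'I_(N + n)) : R :=
  match split i with inl l => u l | inr j => v j end.

Lemma vcatl (R : Type) N n (u : 'I_N -> R) (v : 'I_n -> R) l : vcat u v (lshift n l) = u l.
Proof. by rewrite /vcat -/(unsplit (inl l)) unsplitK. Qed.
Lemma vcatr (R : Type) N n (u : 'I_N -> R) (v : 'I_n -> R) l : vcat u v (rshift N l) = v l.
Proof. by rewrite /vcat -/(unsplit (inr l)) unsplitK. Qed.

Variables N n : nat.
Implicit Types (F G H : mpoly (N + n) K) (u : 'I_N -> K) (v : 'I_n -> K).
Implicit Types (xi : 'I_N -> pser K) (a : 'I_n -> pser K).

Definition kev u v F := meval (vcat u v) F.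
Definition pev xi a F : pser K := mmap (@pcst K) (vcat xi a) F.

(** Homogeneity in the last [n] variables, expressed by the two evaluations, over [K] and over
    [K[[t]]], to which it is applied. *)
Definition homog e F := (forall u v l, kev u (fun i => l * v i) F = l ^+ e * kev u v F) /\
  (forall xi a l, pev xi (fun i => l * a i) F = l ^+ e * pev xi a F).

Lemma kevM u v F G : kev u v (F * G) = kev u v F * kev u v G. Proof. exact: mevalM. Qed.
Lemma kevB u v F G : kev u v (F - G) = kev u v F - kev u v G. Proof. exact: mevalB. Qed.
Lemma kevD u v F G : kev u v (F + G) = kev u v F + kev u v G. Proof. exact: mevalD. Qed.
Lemma pevM xi a F G : pev xi a (F * G) = pev xi a F * pev xi a G. Proof. exact: mmap_mul. Qed.
Lemma pevD xi a F G : pev xi a (F + G) = pev xi a F + pev xi a G. Proof. exact: mmap_add. Qed.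
Lemma pevB xi a F G : pev xi a (F - G) = pev xi a F - pev xi a G. Proof. exact: mmap_sub. Qed.

Lemma pev0 xi a F : pev xi a F 0%N = kev (fun l => xi l 0%N) (fun j => a j 0%N) F.
Proof.
have := @meval_rmorph K (N + n) (pser K) (@pval K) (@pcst K) (vcat xi a) F (fun c => erefl).
rewrite /pev /kev -[X in X = _]/(mmap (@pcst K) (vcat xi a) F 0%N) => ->.
by congr (meval _ F); apply/funext => i; rewrite /vcat; case: split.
Qed.

Lemma homogM e e' F G : homog e F -> homog e' G -> homog (e + e') (F * G).
Proof.
move=> [h1 h2] [h1' h2']; split=> [u v l|xi a l].
  by rewrite !kevM h1 h1' exprD mulrACA.
by rewrite !pevM h2 h2' exprD mulrACA.
Qed.

Lemma homogB e F G : homog e F -> homog e G -> homog e (F - G).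
Proof.
move=> [h1 h2] [h1' h2']; split=> [u v l|xi a l].
  by rewrite !kevB h1 h1' mulrBr.
by rewrite !pevB h2 h2' mulrBr.
Qed.

Lemma homogD e F G : homog e F -> homog e G -> homog e (F + G).
Proof.
move=> [h1 h2] [h1' h2']; split=> [u v l|xi a l].
  by rewrite !kevD h1 h1' mulrDr.
by rewrite !pevD h2 h2' mulrDr.
Qed.

Definition xlift (A : mpoly N K) : mpoly (N + n) K := subst_poly (lshift n) A.

Lemma kev_xlift u v A : kev u v (xlift A) = meval u A.
Proof. by rewrite /kev meval_subst; congr (meval _ A); apply/funext => l; rewrite vcatl. Qed.
Lemma pev_xlift xi a A : pev xi a (xlift A) = mmap (@pcst K) xi A.
Proof. by rewrite /pev mmap_subst; congr (mmap _ _ A); apply/funext => l; rewrite vcatl. Qed.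

Lemma homog_xlift A : homog 0 (xlift A).
Proof. by split=> [u v l|xi a l]; rewrite ?kev_xlift ?pev_xlift expr0 mul1r. Qed.

Definition vlift (A : mpoly n K) : mpoly (N + n) K := subst_poly (@rshift N n) A.

Lemma kev_vlift u v A : kev u v (vlift A) = meval v A.
Proof. by rewrite /kev meval_subst; congr (meval _ A); apply/funext => l; rewrite vcatr. Qed.
Lemma pev_vlift xi a A : pev xi a (vlift A) = mmap (@pcst K) a A.
Proof. by rewrite /pev mmap_subst; congr (mmap _ _ A); apply/funext => l; rewrite vcatr. Qed.

Lemma homog_monomial (m : multinom n) : homog (mdeg m) (vlift (mpolyX K m)).
Proof.
have e (R : comNzRingType) (l : R) (a : 'I_n -> R) :
    \prod_i (l * a i) ^+ m i = l ^+ mdeg m * \prod_i a i ^+ m i.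
  rewrite mdegE -prodrXr -big_split; apply: eq_bigr => i _; exact: exprMn.
by split=> [u v l|xi a l]; rewrite ?kev_vlift ?pev_vlift ?mevalX ?mmapX; exact: e.
Qed.

Lemma homog_sum (I : Type) (r : seq I) (P : pred I) (F : I -> mpoly (N + n) K) e :
  (forall i, P i -> homog e (F i)) -> homog e (\sum_(i <- r | P i) F i).
Proof.
move=> h; apply: (big_ind (homog e)) => //; last exact: homogD.
by split=> [u v l|xi a l]; rewrite /kev /pev ?raddf0 ?meval0 ?mulr0.
Qed.

End Bihomogeneous.

Section FormsAsPolynomials.
Variables (K : numClosedFieldType) (X : variety K) (n : nat).
Variables (U : set X) (N : nat) (x : X -> 'I_N -> K).
Hypothesis hx : aff_coord U x.

Lemma common_denominator (I : finType) (y : X) (c : I -> X -> K) : U y -> (forall i, regular y (c i)) ->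
  exists (A : I -> mpoly N K) B, meval (x y) B != 0 /\
    \forall u \near y, forall i, c i u * meval (x u) B = meval (x u) (A i).
Proof.
move=> Uy rc.
have /choice[p hp] : forall i, exists p : mpoly N K * mpoly N K, meval (x y) p.2 != 0 /\
    \forall u \near y, c i u = meval (x u) p.1 / meval (x u) p.2.
  by move=> i; have [P [Q [Qy e]]] := (ac_reg hx _ Uy).1 (rc i); exists (P, Q).
pose B := \prod_i (p i).2.
have By : meval (x y) B != 0.
  by rewrite /B rmorph_prod; apply/prodf_neq0 => i _; have [] := hp i.
exists (fun i => (p i).1 * \prod_(j | j != i) (p j).2), B; split=> //.
have n1 : \forall u \near y, forall i, c i u = meval (x u) (p i).1 / meval (x u) (p i).2.
  by apply: filter_forall => i; have [] := hp i.
have n2 := ac_near hx Uy By.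
near=> u => i; have -> : c i u = meval (x u) (p i).1 / meval (x u) (p i).2 by move: i; near: u.
have : meval (x u) B != 0 by near: u; apply: filterS n2 => ? [].
rewrite /B (bigD1 i) //= !mevalM mulf_eq0 negb_or => /andP[pu _].
by rewrite mulrA divfK.
Unshelve. all: by end_near. Qed.

(** Clearing the denominators of its finitely many coefficients turns a form over [X] into one
    polynomial in affine coordinates and homogeneous variables, which can be evaluated along an
    arc. *)
Lemma form_polynomial (y : X) (V : set X) e (P : X -> mpoly n.+1 K) : U y -> V y -> form_on V e P ->
  exists (F : mpoly (N + n.+1) K) (B : mpoly N K), [/\ meval (x y) B != 0, homog e F &
    \forall u \near y, V u -> forall v, meval v (P u) * meval (x u) B = kev (x u) v F].
Proof.
move=> Uy Vy fP.
pose c (m : bmultinom n.+1 e.+1) u := mcoeff (bmnm m) (P u).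
have [m|A [B [By hB]]] := common_denominator (c := c) Uy; first by have [] := fP y Vy (bmnm m).
exists (\sum_(m | mdeg (bmnm m) == e) xlift n.+1 (A m) * vlift N (mpolyX K (bmnm m))), B; split=> //.
  apply: homog_sum => m /eqP em.
  by have := homogM (homog_xlift n.+1 (A m)) (homog_monomial K N (bmnm m)); rewrite em add0n.
near=> u => Vu v.
have sP : (msize (P u) <= e.+1)%N.
  rewrite mmeasureE; apply/bigmax_leqP_seq => m; rewrite mcoeff_msupp => mP _.
  by have [em _] := fP u Vu m; exact: eq_leq (congr1 S (em mP)).
rewrite {1}(mpolywE sP) raddf_sum mulr_suml.
rewrite /kev raddf_sum [RHS]big_mkcond; apply: eq_bigr => m _ /=.
rewrite mevalZ mulrAC.
case: ifP => [_|/eqP em].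
  have -> : mcoeff (bmnm m) (P u) * meval (x u) B = meval (x u) (A m) by move: m; near: u.
  by rewrite -/(kev (x u) v _) kevM kev_xlift kev_vlift.
have -> : mcoeff (bmnm m) (P u) = 0.
  by apply/eqP/negPn/negP => mP; have [/(_ mP) //] := fP u Vu (bmnm m).
by rewrite !mul0r.
Unshelve. all: by end_near. Qed.

End FormsAsPolynomials.

Section ProjectiveTopology.
Variables (K : numClosedFieldType) (X : variety K) (n : nat).
Variables (U : set X) (N : nat) (x : X -> 'I_N -> K).
Hypothesis hx : aff_coord U x.

Lemma pcoord_line (p : pspace X n) (v : 'rV[K]_n.+1) : pline p = <[v]>%VS ->
  exists2 k, k != 0 & forall i, pcoord p i = k * v 0 i.
Proof.
move=> e; have := memv_pick (pline p); rewrite {2}e => /vlineP[k ek].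
exists k => [|i]; last by rewrite /pcoord ek mxE.
apply/eqP => k0; have /eqP : vpick (pline p) = 0 by rewrite ek k0 scale0r.
by rewrite vpick0 => /eqP p0; have := pline_dim1 p; rewrite p0 dimv0.
Qed.

Definition kpt (p : pspace X n) := kev (x (pbase p)) (pcoord p).

Lemma pspace_nbhs (A : set (pspace X n)) p : open A -> A p -> U (pbase p) ->
  exists e F, [/\ homog e F, kpt p F != 0 & forall q, U (pbase q) -> kpt q F != 0 -> A q].
Proof.
move=> oA Ap Up.
pose good (A : set (pspace X n)) := exists e F, [/\ homog e F, kpt p F != 0 &
  forall q, U (pbase q) -> kpt q F != 0 -> A q].
apply: (@subbase_ind _ _ _ _ good p _ _ _ _ A oA Ap).
- exists 0%N, (xlift n.+1 1); split=> //; first exact: homog_xlift.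
  by rewrite /kpt kev_xlift meval1 oner_neq0.
- move=> V [W [e [P [oW fP ->]]]] /= [Wp Pp].
  have [F [B [Bp hF eF]]] := form_polynomial hx Up Wp fP.
  have [k [kp hk]] := ac_near_set hx Up (filterI (open_nbhs_nbhs (conj oW Wp)) eF).
  exists e, (xlift n.+1 k * F); split.
  + by rewrite -[e]add0n; apply: homogM => //; exact: homog_xlift.
  + rewrite /kpt kevM kev_xlift mulf_neq0 //.
    by have [_ /(_ Wp (pcoord p)) <-] := hk _ Up kp; rewrite mulf_neq0.
  + move=> q Uq; rewrite /kpt kevM kev_xlift mulf_eq0 negb_or => /andP[kq Fq].
    have [Wq /(_ Wq (pcoord q)) E] := hk _ Uq kq; split=> //.
    by move: Fq; rewrite -E mulf_eq0 negb_or => /andP[].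
- move=> B C [e1 [F1 [h1 p1 H1]]] [e2 [F2 [h2 p2 H2]]]; exists (e1 + e2)%N, (F1 * F2); split.
  + exact: homogM.
  + by rewrite /kpt kevM mulf_neq0.
  + move=> q Uq; rewrite /kpt kevM mulf_eq0 negb_or => /andP[q1 q2]; split; [exact: H1|exact: H2].
- move=> B C BC [e [F [hF Fp H]]]; exists e, F; split=> // q Uq Fq; apply: BC; exact: H.
Qed.

End ProjectiveTopology.

(** * The valuative criterion for a closed subset of projective space *)

Section Lifting.
Variables (K : numClosedFieldType) (X X' : variety K) (mu : X' -> X).
Variables (U : set X) (N : nat) (x : X -> 'I_N -> K) (V : set X) (n : nat).
Variables (s : 'I_n.+1 -> X' -> K) (f : X' -> proj_space X n).
Hypotheses (hmu : morphism_on setT mu) (hx : aff_coord U x) (oV : open V).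
Hypothesis hf : forall y, V (mu y) -> pbase (f y) = mu y /\ pline (f y) = <[\row_i s i y]>%VS.
Hypothesis him : closed_immersion (Y := proj_space X n) (mu @^-1` V) [set p | V (pbase p)] f.
Variables (P : 'I_n.+1 -> mpoly N K) (h : mpoly N K) (i0 : 'I_n.+1).
Hypothesis hR : forall u, U u -> meval (x u) h != 0 -> exists y l,
  [/\ mu y = u, V u, l != 0 & forall i, meval (x u) (P i) = l * s i y].
Variable g : formal_arc X.
Local Notation y0 := (arc_center g).
Hypotheses (Uy : U y0) (Vy : V y0).
Local Notation xi := (fun l => arc_ser g (x ^~ l)).
Local Notation gev := (mmap (@pcst K) xi).
Hypotheses (gh : gev h <> 0) (gP : gev (P i0) <> 0).

Lemma arc_ser_poly F : arc_ser g (fun u => meval (x u) F) = gev F.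
Proof.
have ra (G : mpoly N K) : regular y0 (fun u => meval (x u) G) by exact: regular_poly hx Uy.
elim/mpoly_closed_ind: F => [c|l|a b ha hb|a b ha hb].
- rewrite mmapC (_ : (fun u => _) = fun=> c); last by apply/funext => u; exact: mevalC.
  by apply/funext => k; rewrite /arc_ser (lh_cst (arc_hom g)).
- by rewrite mmapX mmap1U; congr (arc_ser g _); apply/funext => u; exact: mevalXU.
- rewrite mmap_add -ha -hb; apply/funext => k.
  rewrite /arc_ser pserD -(lh_add (arc_hom g)) //; congr (arc_coef g _ k).
  by apply/funext => u; exact: mevalD.
- rewrite mmap_mul -ha -hb; apply/funext => k.
  rewrite pserM /arc_ser -(lh_mul (arc_hom g)) //; congr (arc_coef g _ k).
  by apply/funext => u; exact: mevalM.
Qed.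

Lemma gev_null F : (forall u, U u -> meval (x u) F = 0) -> gev F = 0.
Proof.
move=> nF; rewrite -arc_ser_poly; apply/funext => k; rewrite /arc_ser.
rewrite -(lh_germ (arc_hom g) k (regular_cst y0 0)) ?(lh_cst (arc_hom g)) ?mul0rn //.
have nU : \forall u \near y0, U u by apply: open_nbhs_nbhs; split=> //; exact: ac_open hx.
by near=> u; rewrite nF //; near: u.
Unshelve. all: by end_near. Qed.

Lemma xi0 : (fun l => xi l 0%N) = x y0.
Proof. by apply/funext => l; rewrite /arc_ser arc_coef0 //; exact: regular_coord hx Uy. Qed.

Variables (o : nat) (a : 'I_n.+1 -> pser K) (i1 : 'I_n.+1).
Hypotheses (Pa : forall i, gev (P i) = pX K o * a i) (a1 : a i1 0%N != 0).

(** By [hR] the point with homogeneous coordinates [P i] lies on the image of [X'] wherever [h] does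
    not vanish. So [h] times the form at [P] is zero on [U]; along the arc [g] the factor [h] and
    the power of [t] cancel, which leaves the form at [a]. *)
Lemma pev_null e F : homog e F ->
  (forall y, U (mu y) -> V (mu y) -> kev (x (mu y)) (s ^~ y) F = 0) -> pev xi a F = 0.
Proof.
move=> [hk hp] nF.
pose F1 := h * mmap (@mpolyC N K) (vcat (fun l => mpolyX K (mnm1 l)) P) F.
have : gev F1 = 0.
  apply: gev_null => u Uu; rewrite /F1 mevalM.
  have [->|hu] := eqVneq (meval (x u) h) 0; first by rewrite mul0r.
  have [y [l [my Vu l0 Pu]]] := hR Uu hu.
  rewrite (meval_rmorph (phi := meval (x u))) => [|c /=]; last by rewrite mevalC.
  rewrite (_ : (fun _ => _) = vcat (x u) (fun i => l * s i y)).
    by rewrite -/(kev _ _ F) hk -my nF ?my // !mulr0.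
  apply/funext => i; rewrite /vcat; case: split => [j|j] /=; [exact: mevalXU|exact: Pu].
rewrite /F1 mmap_mul => /pser_mul_eq0[//|].
rewrite mmap_comp (_ : (fun _ => _) = vcat xi (fun i => pX K o * a i)); last first.
  apply/funext => i; rewrite /vcat; case: split => [j|j] /=; first by rewrite mmapX mmap1U.
  exact: Pa.
rewrite -/(pev _ _ F) hp => /pser_mul_eq0[e0|//].
by have [_] := pordX e (pord_pX K o); rewrite e0 eqxx.
Qed.

Lemma kpt_section y F e : homog e F -> V (mu y) ->
  exists2 k, k != 0 & kpt x (f y) F = k * kev (x (mu y)) (s ^~ y) F.
Proof.
move=> [hk _] Vmy; have [eb el] := hf Vmy; have [k k0 ek] := pcoord_line el.
exists (k ^+ e); first by rewrite expf_neq0.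
rewrite /kpt eb -hk; congr (kev _ _ F); apply/funext => i; rewrite ek mxE //.
Qed.

(** The point over [y0] with coordinates [a i 0] is the limit of the lifted arc at [t = 0]. It lies
    on the image of [X'] because this image is closed and every form vanishing on it vanishes at the
    limit. *)
Lemma limit_point : exists y, mu y = y0 /\ exists2 k, k != 0 & forall i, s i y = k * a i 0%N.
Proof.
pose v : 'rV[K]_n.+1 := \row_i a i 0%N.
have v0 : v != 0 by apply/eqP => /rowP/(_ i1); rewrite !mxE => /eqP; rewrite (negbTE a1).
have dv : \dim <[v]>%VS = 1%N by rewrite dim_vline v0.
pose p0 : pspace X n := PSpace y0 dv.
have [[_ oW _] inj cont clo _] := him.
have [[y Vmy fy]|np] := pselect ((f @` (mu @^-1` V)) p0).
  have [eb el] := hf Vmy; have my : mu y = y0 by rewrite -eb fy.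
  exists y; split=> //; have := el; rewrite fy /= => evl.
  have : \row_i s i y \in <[v]>%VS by rewrite evl memv_line.
  move=> /vlineP[k ek]; exists k => [|i]; last by move/rowP/(_ i): ek; rewrite !mxE.
  apply/eqP => k0; move: ek; rewrite k0 scale0r => e0.
  by have := dv; rewrite evl e0 dim_vline eqxx.
have [_ /(_ p0)] : rel_closed [set p : proj_space X n | V (pbase p)] (f @` (mu @^-1` V)).
  by apply: clo; split=> // y [].
move=> H; have nc : ~ closure (f @` (mu @^-1` V)) p0 by move=> c; apply: np; apply: H; split.
have [A [oA Ap nA]] : exists A : set (proj_space X n), [/\ open A, A p0 & forall q, A q -> ~ (f @` (mu @^-1` V)) q].
  exists (~` closure (f @` (mu @^-1` V))); split=> //; first by rewrite openC; exact: closed_closure.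
  by move=> q nq fq; apply: nq; exact: subset_closure.
have [e [F [hF Fp FA]]] := pspace_nbhs hx oA Ap Uy.
have : pev xi a F = 0.
  apply: (pev_null hF) => y Umy Vmy; have [k k0 ek] := kpt_section hF Vmy.
  apply/eqP/negPn/negP => nz; have [eb _] := hf Vmy.
  apply: (nA (f y)); last by exists y.
  by apply: FA; [rewrite eb|rewrite ek mulf_neq0].
move=> /(congr1 (fun b : pser K => b 0%N)); rewrite pev0 xi0 => z.
have [k k0 ek] := pcoord_line (erefl : pline p0 = <[v]>%VS).
move: Fp; rewrite /kpt /= (_ : pcoord p0 = fun i => k * a i 0%N); last first.
  by apply/funext => i; rewrite ek mxE.
by have [hk _] := hF; rewrite hk z mulr0 eqxx.
Qed.

Variables (y : X') (kk : K).
Hypotheses (my : mu y = y0) (kk0 : kk != 0) (sy : forall i, s i y = kk * a i 0%N).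

(** A form [H] that vanishes on the image outside the given neighbourhood, but not at the limit
    point, turns a local relation into a global one; its series is non-zero and cancels. *)
Lemma pev_null_near e F : homog e F ->
  (\forall u \near y, kev (x (mu u)) (s ^~ u) F = 0) -> pev xi a F = 0.
Proof.
move=> hF nF; have [A [oA Ay hA]] := near_open nF.
have [[oV' _ _] inj cont clo _] := him.
pose B := (mu @^-1` V) `&` ~` A.
have [_ cB] : rel_closed [set p : proj_space X n | V (pbase p)] (f @` B).
  apply: clo; split=> [u []//|u [cu Vu]]; split=> // Au.
  by have [w [[_ nAw] Aw]] := cu A (open_nbhs_nbhs (conj oA Au)).
have Vmy : V (mu y) by rewrite my.
have [eb el] := hf Vmy.
have nB : ~ (f @` B) (f y).
  by move=> [w [Vw nAw] e1]; apply: nAw; rewrite (inj w y Vw Vmy e1).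
have nc : ~ closure (f @` B) (f y) by move=> c; apply: nB; apply: cB; split=> //=; rewrite eb.
have oC : open (~` closure (f @` B)) by rewrite openC; exact: closed_closure.
have Uf : U (pbase (f y)) by rewrite eb my.
have [e' [H [hH Hp HA]]] := pspace_nbhs hx oC nc Uf.
have FH : pev xi a (F * H) = 0.
  apply: pev_null (homogM hF hH) _ => u Umu Vmu; rewrite kevM.
  have [Au|nAu] := pselect (A u); first by rewrite hA // mul0r.
  have [k k0 ek] := kpt_section hH Vmu; have [ebu _] := hf Vmu.
  suff -> : kev (x (mu u)) (s ^~ u) H = 0 by rewrite mulr0.
  apply/eqP/negPn/negP => nz; apply: (HA (f u)); first by rewrite ebu.
    by rewrite ek mulf_neq0.
  by apply: subset_closure; exists u.
move: FH; rewrite pevM => /pser_mul_eq0[//|] /(congr1 (fun b : pser K => b 0%N)).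
rewrite pev0 xi0 => z; have [k k0 ek] := kpt_section hH Vmy; move: Hp; rewrite ek my.
have [hk _] := hH; rewrite (_ : s ^~ y = fun i => kk * a i 0%N); last by apply/funext => i; rewrite sy.
by rewrite hk z !mulr0 eqxx.
Qed.

Definition frac_rep (b : X' -> K) e F G := [/\ homog e F, homog e G,
  kev (x y0) (s ^~ y) G != 0 &
  \forall u \near y, b u * kev (x (mu u)) (s ^~ u) G = kev (x (mu u)) (s ^~ u) F].

Lemma frac_rep_unit b e F G : frac_rep b e F G -> pev xi a G 0%N != 0.
Proof.
move=> [_ [hk _] Gy _]; apply: contraNneq Gy; rewrite pev0 xi0 => z.
by rewrite (_ : s ^~ y = fun i => kk * a i 0%N) ?hk ?z ?mulr0 //; apply/funext => i; rewrite sy.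
Qed.

(** The value along the lifted arc of a fraction [F / G] of forms, written without division; regular
    functions on [X'] are locally such fractions because [f] is a closed immersion. *)
Definition lift_val (b : X' -> K) (r : pser K) :=
  exists e F G, frac_rep b e F G /\ pev xi a G * r = pev xi a F.

Lemma frac_rep_exists b : regular y b -> exists e F G, frac_rep b e F G.
Proof.
have [[oV' _ _] inj cont clo reg] := him; have Vmy : V (mu y) by rewrite my.
move=> /(reg y b Vmy).1[hh [W [e [PP [QQ [[oW Wp fP fQ] Qp eh]]]]] eb].
have [ebase el] := hf Vmy; move: Wp; rewrite ebase my => Wy.
have [F [B [By hF eF]]] := form_polynomial hx Uy Wy fP.
have [G [C [Cy hG eG]]] := form_polynomial hx Uy Wy fQ.
have nV : \forall u \near y, V (mu u) by apply: morphism_near => //; rewrite my; exact: open_nbhs_nbhs.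
have nW : \forall u \near y, W (mu u) by apply: morphism_near => //; rewrite my; exact: open_nbhs_nbhs.
have nF : \forall u \near y, W (mu u) -> forall v, meval v (PP (mu u)) * meval (x (mu u)) B = kev (x (mu u)) v F.
  by apply: (morphism_near hmu (P := fun z => W z -> forall v, meval v (PP z) * meval (x z) B = kev (x z) v F)); rewrite my.
have nG : \forall u \near y, W (mu u) -> forall v, meval v (QQ (mu u)) * meval (x (mu u)) C = kev (x (mu u)) v G.
  by apply: (morphism_near hmu (P := fun z => W z -> forall v, meval v (QQ z) * meval (x z) C = kev (x z) v G)); rewrite my.
have nh : \forall u \near y, hh (f u) = form_eval PP (f u) / form_eval QQ (f u) by exact: (cont y Vmy _ eh).
have hG1 : homog e (G * xlift n.+1 B) by rewrite -[e]addn0; apply: homogM => //; exact: homog_xlift.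
have hF1 : homog e (F * xlift n.+1 C) by rewrite -[e]addn0; apply: homogM => //; exact: homog_xlift.
have nB : \forall u \near y, meval (x (mu u)) B != 0.
  by apply: (morphism_near hmu (P := fun z => meval (x z) B != 0)); rewrite my; apply: filterS (ac_near hx Uy By) => ? [].
have nC : \forall u \near y, meval (x (mu u)) C != 0.
  by apply: (morphism_near hmu (P := fun z => meval (x z) C != 0)); rewrite my; apply: filterS (ac_near hx Uy Cy) => ? [].
have key u : V (mu u) -> form_eval QQ (f u) != 0 -> meval (x (mu u)) B != 0 -> meval (x (mu u)) C != 0 ->
  (forall v, meval v (PP (mu u)) * meval (x (mu u)) B = kev (x (mu u)) v F) ->
  (forall v, meval v (QQ (mu u)) * meval (x (mu u)) C = kev (x (mu u)) v G) ->
  kev (x (mu u)) (s ^~ u) (G * xlift n.+1 B) != 0 /\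
  form_eval PP (f u) / form_eval QQ (f u) * kev (x (mu u)) (s ^~ u) (G * xlift n.+1 B) =
    kev (x (mu u)) (s ^~ u) (F * xlift n.+1 C).
{ move=> Vu Qu Bu Cu hPu hQu; have [ebu elu] := hf Vu; have [k k0 ek] := pcoord_line elu.
  have ec : pcoord (f u) = fun i => k * s i u by apply/funext => i; rewrite ek mxE.
  have [hkF _] := hF; have [hkG _] := hG.
  have eP : form_eval PP (f u) * meval (x (mu u)) B = k ^+ e * kev (x (mu u)) (s ^~ u) F.
    by rewrite /form_eval ebu hPu ec hkF.
  have eQ : form_eval QQ (f u) * meval (x (mu u)) C = k ^+ e * kev (x (mu u)) (s ^~ u) G.
    by rewrite /form_eval ebu hQu ec hkG.
  have ke : k ^+ e != 0 by rewrite expf_neq0.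
  have Gu : kev (x (mu u)) (s ^~ u) G != 0.
    by apply: contraTneq (mulf_neq0 Qu Cu) => G0; rewrite eQ G0 mulr0 eqxx.
  rewrite !kevM !kev_xlift; split; first by rewrite mulf_neq0.
  apply: (mulfI ke); rewrite !mulrA -eP; apply: (mulfI Qu).
  have -> : form_eval QQ (f u) * (k ^+ e * form_eval PP (f u) / form_eval QQ (f u) *
      kev (x (mu u)) (s ^~ u) G * meval (x (mu u)) B) =
      k ^+ e * kev (x (mu u)) (s ^~ u) G * (form_eval PP (f u) * meval (x (mu u)) B).
    by field.
  by rewrite -eQ; ring. }
have nQ : \forall u \near y, form_eval QQ (f u) != 0.
  have oQ : open [set p : pspace X n | W (pbase p) /\ form_eval QQ p != 0].
    by apply: subbase_open; exists W, e, QQ.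
  have Qy : [set p : pspace X n | W (pbase p) /\ form_eval QQ p != 0] (f y).
    by split=> //; rewrite ebase my.
  have H : \forall u \near y, [set p : pspace X n | W (pbase p) /\ form_eval QQ p != 0] (f u).
    exact: cont y Vmy _ (open_nbhs_nbhs (conj oQ Qy)).
  by apply: filterS H => u [].
exists e, (F * xlift n.+1 C), (G * xlift n.+1 B); split=> //.
  { have Wmy : W (mu y) by rewrite my.
  have [] := key y Vmy Qp; rewrite my //.
  - by have := nbhs_singleton nF Wmy; rewrite my.
  - by have := nbhs_singleton nG Wmy; rewrite my. }
near=> u.
have Wu : W (mu u) by near: u.
have bE : b u = hh (f u) by near: u.
have hE : hh (f u) = form_eval PP (f u) / form_eval QQ (f u) by near: u.
rewrite bE hE; apply: (key u _ _ _ _ _ _).2; try by near: u.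
- by move: Wu; near: u.
- by move: Wu; near: u.
Unshelve. all: by end_near. Qed.

Lemma lift_val_exists b : regular y b -> exists r, lift_val b r.
Proof.
move=> /frac_rep_exists[e [F [G hr]]]; have [c cG] := pser_inv (frac_rep_unit hr).
by exists (c * pev xi a F), e, F, G; split=> //; rewrite mulrA cG mul1r.
Qed.

Lemma lift_val_uniq b b' r r' : (\forall u \near y, b u = b' u) -> lift_val b r -> lift_val b' r' -> r = r'.
Proof.
move=> bb [e [F [G [hr er]]]] [e' [F' [G' [hr' er']]]].
have [hF hG _ nb] := hr; have [hF' hG' _ nb'] := hr'.
have : pev xi a (F * G' - F' * G) = 0.
  apply: (@pev_null_near (e + e')).
    by apply: homogB; [exact: homogM|rewrite addnC; exact: homogM].
  near=> u; rewrite kevB !kevM.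
  have <- : b u * kev (x (mu u)) (s ^~ u) G = kev (x (mu u)) (s ^~ u) F by near: u.
  have <- : b' u * kev (x (mu u)) (s ^~ u) G' = kev (x (mu u)) (s ^~ u) F' by near: u.
  have <- : b u = b' u by near: u.
  by ring.
rewrite pevB !pevM -er -er' => E.
have {}E : pev xi a G * (pev xi a G' * (r - r')) = 0 by rewrite -[RHS]E; ring.
have nz e1 F1 G1 b1 : frac_rep b1 e1 F1 G1 -> pev xi a G1 <> 0.
  by move=> /frac_rep_unit/eqP H; move=> z; apply: H; rewrite z.
have [/(nz _ _ _ _ hr)//|] := pser_mul_eq0 E.
by move=> /pser_mul_eq0[/(nz _ _ _ _ hr')//|/eqP]; rewrite subr_eq0 => /eqP.
Unshelve. all: by end_near. Qed.

Lemma lift_val_cst c : lift_val (fun=> c) (pcst c).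
Proof.
exists 0%N, (xlift n.+1 (mpolyC N c)), (xlift n.+1 (mpolyC N 1)); split; last first.
  by rewrite !pev_xlift !mmapC; apply/funext => k; rewrite /= pcstM mul1r.
split; [exact: homog_xlift|exact: homog_xlift|by rewrite kev_xlift mevalC oner_neq0|].
by near=> u; rewrite !kev_xlift !mevalC mulr1.
Unshelve. all: by end_near. Qed.

Lemma lift_val_add b b' r r' : lift_val b r -> lift_val b' r' -> lift_val (fun u => b u + b' u) (r + r').
Proof.
move=> [e [F [G [[hF hG Gy nb] er]]]] [e' [F' [G' [[hF' hG' Gy' nb'] er']]]].
exists (e + e')%N, (F * G' + F' * G), (G * G'); split.
  split; [by apply: homogD; [exact: homogM|rewrite addnC; exact: homogM]|exact: homogM|by rewrite kevM mulf_neq0|].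
  near=> u; rewrite kevD !kevM.
  have <- : b u * kev (x (mu u)) (s ^~ u) G = kev (x (mu u)) (s ^~ u) F by near: u.
  have <- : b' u * kev (x (mu u)) (s ^~ u) G' = kev (x (mu u)) (s ^~ u) F' by near: u.
  by ring.
by rewrite pevD !pevM -er -er'; ring.
Unshelve. all: by end_near. Qed.

Lemma lift_val_mul b b' r r' : lift_val b r -> lift_val b' r' -> lift_val (fun u => b u * b' u) (r * r').
Proof.
move=> [e [F [G [[hF hG Gy nb] er]]]] [e' [F' [G' [[hF' hG' Gy' nb'] er']]]].
exists (e + e')%N, (F * F'), (G * G'); split.
  split; [exact: homogM|exact: homogM|by rewrite kevM mulf_neq0|].
  near=> u; rewrite !kevM.
  have <- : b u * kev (x (mu u)) (s ^~ u) G = kev (x (mu u)) (s ^~ u) F by near: u.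
  have <- : b' u * kev (x (mu u)) (s ^~ u) G' = kev (x (mu u)) (s ^~ u) F' by near: u.
  by ring.
by rewrite !pevM -er -er'; ring.
Unshelve. all: by end_near. Qed.

Lemma lift_val0 b r : lift_val b r -> r 0%N = b y.
Proof.
move=> [e [F [G [hr /(congr1 (fun c : pser K => c 0%N))]]]]; rewrite pserM0 => E.
have [[hF _] [hG _] Gy /nbhs_singleton bE] := hr.
have G0 := frac_rep_unit hr; rewrite !pev0 xi0 in E G0 *.
have es : s ^~ y = fun i => kk * a i 0%N by apply/funext => i; rewrite sy.
have ke : kk ^+ e != 0 by rewrite expf_neq0.
move: bE; rewrite my es hF hG => bE; apply: (mulfI G0); rewrite E; apply: (mulfI ke).
by rewrite -bE; ring.
Qed.

Lemma lift_val_pull f0 : regular y0 f0 -> lift_val (f0 \o mu) (arc_ser g f0).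
Proof.
move=> rf; have [A [B [By e]]] := (ac_reg hx _ Uy).1 rf.
have rB : regular y0 (fun u => meval (x u) B) := regular_poly B hx Uy.
have nB := regular_neq0 rB By.
exists 0%N, (xlift n.+1 A), (xlift n.+1 B); split.
  split; [exact: homog_xlift|exact: homog_xlift|by rewrite kev_xlift|].
  have : \forall u \near y0, f0 u * meval (x u) B = meval (x u) A.
    near=> u; have -> : f0 u = meval (x u) A / meval (x u) B by near: u.
    by rewrite divfK //; near: u.
  by rewrite -my => /(morphism_near hmu); apply: filterS => u; rewrite !kev_xlift.
rewrite !pev_xlift -!arc_ser_poly; apply/funext => k.
rewrite mulrC pserM /arc_ser -(lh_mul (arc_hom g)) //; apply: (lh_germ (arc_hom g)).
  exact: regular_mul.
near=> u; have -> : f0 u = meval (x u) A / meval (x u) B by near: u.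
by rewrite divfK //; near: u.
Unshelve. all: by end_near. Qed.

Lemma arc_lift_at : exists g', push hmu g' = g.
Proof.
have /choice[c hc] : forall b, exists r, regular y b -> lift_val b r.
  move=> b; have [rb|nrb] := pselect (regular y b); last by exists 0.
  by have [r hr] := lift_val_exists rb; exists r.
pose phi (b : X' -> K) : pser K := fun k => if `[< regular y b >] then c b k else 0.
have E b : regular y b -> phi b = c b by move=> rb; apply/funext => k; rewrite /phi asboolT.
have hphi : local_hom xpredT y phi.
  { split.
  - by move=> b k hb; rewrite /phi asboolF // => rb; exact: hb.
  - move=> b b' k rb e; have rb' := regular_germ rb e; rewrite (E b) // (E b') //.
    by rewrite (lift_val_uniq e (hc b rb) (hc b' rb')).
  - by move=> b rb; rewrite (E b) //; exact: lift_val0 (hc b rb).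
  - move=> u k _; have ru := regular_cst y u; rewrite (E _ ru).
    by rewrite (lift_val_uniq _ (hc _ ru) (lift_val_cst u)) //; near=> w.
  - move=> b b' k rb rb' _; have rs := regular_add rb rb'; rewrite (E _ rs) (E b) // (E b') //.
    by rewrite (lift_val_uniq _ (hc _ rs) (lift_val_add (hc b rb) (hc b' rb'))) //; near=> w.
  - move=> b b' k rb rb' _; have rs := regular_mul rb rb'; rewrite (E _ rs) (E b) // (E b') //.
    by rewrite (lift_val_uniq _ (hc _ rs) (lift_val_mul (hc b rb) (hc b' rb'))) //; near=> w. }
exists (Arc hphi); apply: arc_eq => //=; apply/funext => b; apply/funext => k.
rewrite /push_coef /= my; case: asboolP => rb; last first.
  by rewrite (lh_default (arc_hom g)) // => -[].
have rb' : regular y (b \o mu) by apply: morphism_regular => //; rewrite my.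
rewrite (E _ rb') -[RHS]/(arc_ser g b k); congr (_ k).
by apply: (lift_val_uniq _ (hc _ rb') (lift_val_pull rb)); near=> w.
Unshelve. all: by end_near. Qed.

End Lifting.

(** * Arcs and normal crossing divisors *)

Section GenericLift.
Variables (K : numClosedFieldType) (X X' : variety K) (mu : X' -> X).
Hypotheses (iX : irreducible [set: X]) (hmu : morphism_on setT mu).
Hypotheses (proj : projective_morphism mu) (birat : birational_morphism mu).

(** The inverse [nu] followed by the sections expresses the point of projective space over [u] by
    fractions. [b] collects what must not vanish for this, so an arc along which [b] is not
    identically zero satisfies the valuative criterion. *)
Lemma arc_lift (x0 : X) : exists U N (x : X -> 'I_N -> K) V b,
  [/\ aff_coord U x /\ U x0, open V /\ V x0, (exists2 u, U u & meval (x u) b != 0) &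
   forall g, U (arc_center g) -> V (arc_center g) -> arc_ser g (fun u => meval (x u) b) <> 0 ->
     exists g', push hmu g' = g].
Proof.
have [U [N [x [hx Ux]]]] := affine_coord_at x0.
have [_ [sec hsec /(_ x0)[V [n [s [f [[oV Vx] ss hf him]]]]]]] := proj.
have [_ [U0 [V0 [nu [[oU0 dU0 oV0 dV0] hnu hmunu mornu]]]]] := birat.
have oU := ac_open hx.
have [u0 [Uu0 [U0u0 Vu0]]] : exists u, U u /\ U0 u /\ V u.
  have h1 : [set: X] `&` (U `&` V) !=set0.
    by apply: irreducible_meet => //; exists x0.
  have [u [_ [Uu Vu]]] := h1.
  have [u' [[Uu' Vu'] U0u']] : (U `&` V) `&` U0 !=set0.
    by apply: dU0; [exists u|exact: openI].
  by exists u'.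
have [Vnu mnu] := hnu u0 U0u0.
have [e he] := hsec (nu u0).
have [e0 esec] := nbhs_singleton he.
pose c i u := s i (nu u) / e (nu u).
have [cnu rnu] := mornu u0 U0u0.
have rc i : regular u0 (c i).
  by apply: (rnu (fun y => s i y / e y)); apply/esec; apply: ss; rewrite mnu.
have [A [B [Bu hA]]] := common_denominator hx Uu0 rc.
have ne : \forall u \near u0, e (nu u) != 0.
  by apply: (cnu (fun y => e y != 0)); apply: filterS he => y [].
have nU0 : \forall u \near u0, U0 u by exact: open_nbhs_nbhs.
have nV : \forall u \near u0, V u by exact: open_nbhs_nbhs.
have [k [ku hk]] := ac_near_set hx Uu0 (filterI (filterI hA ne) (filterI nU0 nV)).
have [i0 si0] : exists i, s i (nu u0) != 0.
  apply: contrapT => none; have Vm : V (mu (nu u0)) by rewrite mnu.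
  have [_ el] := hf _ Vm; have := pline_dim1 (f (nu u0)).
  rewrite el (_ : \row_i s i (nu u0) = 0) ?dim_vline ?eqxx //.
  apply/rowP => i; rewrite !mxE; apply/eqP/negPn/negP => si; apply: none; by exists i.
exists U, N, x, V, (k * B * A i0); split=> //.
  exists u0 => //; rewrite !mevalM !mulf_neq0 //.
  rewrite -(nbhs_singleton hA i0) !mulf_neq0 // invr_neq0 //; exact: nbhs_singleton ne.
move=> g Ug Vg; rewrite (arc_ser_poly hx Ug) !mmap_mul => nz.
have nkB : mmap (@pcst K) (fun l => arc_ser g (x ^~ l)) (k * B) <> 0.
  by rewrite mmap_mul => z; apply: nz; rewrite z mul0r.
have nA : mmap (@pcst K) (fun l => arc_ser g (x ^~ l)) (A i0) <> 0.
  by move=> z; apply: nz; rewrite z mulr0.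
have hR u : U u -> meval (x u) (k * B) != 0 -> exists y l,
    [/\ mu y = u, V u, l != 0 & forall i, meval (x u) (A i) = l * s i y].
  move=> Uu; rewrite mevalM mulf_eq0 negb_or => /andP[ku' Bu'].
  have [[hAu eu] [U0u Vu]] := hk u Uu ku'.
  exists (nu u), (meval (x u) B / e (nu u)); split=> //; first by have [] := hnu u U0u.
    by rewrite mulf_neq0 // invr_neq0.
  by move=> i; rewrite -hAu /c; ring.
(* [o] is the least order of the homogeneous coordinates [A i] along [g]; dividing all of them by
   [t^o] gives series that do not vanish simultaneously at [t = 0]. *)
have ex : exists o, [exists i, mmap (@pcst K) (fun l => arc_ser g (x ^~ l)) (A i) o != 0].
  by have [o [_ ho]] := pord_ex nA; exists o; apply/existsP; exists i0.
have [o /existsP[i1 hi1] omin] := ex_minnP ex.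
pose a i := pshift o (mmap (@pcst K) (fun l => arc_ser g (x ^~ l)) (A i)).
have Pa i : mmap (@pcst K) (fun l => arc_ser g (x ^~ l)) (A i) = pX K o * a i.
  apply: pX_shift => l lo; apply/eqP/negPn/negP => nl.
  have : (o <= l)%N by apply: omin; apply/existsP; exists i.
  by rewrite leqNgt lo.
have a1 : a i1 0%N != 0 by rewrite /a /pshift add0n.
have hf' y : V (mu y) -> pbase (f y) = mu y /\ pline (f y) = <[\row_i s i y]>%VS by exact: hf.
have [y [my [kk kk0 sy]]] := limit_point hx hf' him hR Ug Vg nkB Pa a1.
exact: (arc_lift_at hmu hx oV hf' him hR Ug Vg nkB Pa my kk0 sy).
Qed.

End GenericLift.

Section ArcSeries.
Variables (K : numClosedFieldType) (X : variety K) (g : formal_arc X).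
Local Notation y := (arc_center g).
Local Notation ser := (arc_ser g).

Lemma peq_all (a b : pser K) : (forall M, peq M a b) -> a = b.
Proof. by move=> h; apply/funext => k; exact: h (ltnSn k). Qed.

Lemma ser_germ f h : regular y f -> (\forall u \near y, f u = h u) -> ser f = ser h.
Proof. by move=> rf e; apply: peq_all => M; exact: (mh_germ (arc_mhom g M)). Qed.
Lemma ser_add f h : regular y f -> regular y h -> ser (fun u => f u + h u) = ser f + ser h.
Proof. by move=> rf rh; apply: peq_all => M; exact: (mh_add (arc_mhom g M)). Qed.
Lemma ser_mul f h : regular y f -> regular y h -> ser (fun u => f u * h u) = ser f * ser h.
Proof. by move=> rf rh; apply: peq_all => M; exact: (mh_mul (arc_mhom g M)). Qed.
Lemma ser_cst c : ser (fun=> c) = pcst c.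
Proof. by apply: peq_all => M; exact: (mh_cst (arc_mhom g M)). Qed.
Lemma ser_sum (I : Type) (r : seq I) (f : I -> X -> K) : (forall i, regular y (f i)) ->
  ser (fun u => \sum_(i <- r) f i u) = \sum_(i <- r) ser (f i).
Proof. by move=> rf; apply: peq_all => M; exact: (mhom_sum _ (arc_mhom g M)). Qed.
Lemma ser_prod (I : Type) (r : seq I) (f : I -> X -> K) : (forall i, regular y (f i)) ->
  ser (fun u => \prod_(i <- r) f i u) = \prod_(i <- r) ser (f i).
Proof. by move=> rf; apply: peq_all => M; exact: (mhom_prod _ (arc_mhom g M)). Qed.
Lemma ser_exp f n : regular y f -> ser (fun u => f u ^+ n) = ser f ^+ n.
Proof.
move=> rf; elim: n => [|n IH]; first by rewrite (_ : (fun u => _) = fun=> 1) // ser_cst; apply/funext.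
rewrite exprS -IH -ser_mul //; last exact: regular_exp.
by congr ser; apply/funext => u; rewrite exprS.
Qed.
Lemma ser0 f : regular y f -> ser f 0%N = f y.
Proof. exact: arc_coef0. Qed.
Lemma ser_det d (F : 'I_d -> 'I_d -> X -> K) : (forall i j, regular y (F i j)) ->
  ser (fun u => \det (\matrix_(i, j) F i j u)) = \det (\matrix_(i, j) ser (F i j)).
Proof.
move=> rF; rewrite /determinant.
have rp (s : 'S_d) : regular y (fun u => \prod_i F i (s i) u) by apply: regular_prod => i _; exact: rF.
rewrite (_ : (fun u => _) = fun u => \sum_(s : 'S_d) (-1) ^+ s * \prod_i F i (s i) u); last first.
  apply/funext => u; apply: eq_bigr => s _; congr (_ * _); by apply: eq_bigr => i _; rewrite mxE.
rewrite ser_sum => [|s]; last by apply: regular_mul => //; exact: regular_cst.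
apply: eq_bigr => s _; rewrite ser_mul //; last exact: regular_cst.
rewrite ser_cst ser_prod => [|i]; last exact: rF.
congr (_ * _); first by rewrite rmorph_sign.
by apply: eq_bigr => i _; rewrite mxE.
Qed.

Lemma derivation_mder M D : derivation_at y D -> mder y M ser (fun f => ser (D f)).
Proof.
move=> hD; have rD f : regular y f -> regular y (D f) by exact: (der_regular hD).
split=> [f h rf e|c|f h rf rh|f h rf rh].
- by rewrite (ser_germ (rD f rf) (der_germ hD rf e)).
- rewrite (ser_germ (rD _ (regular_cst y c)) (Defs.der_cst hD c)) ser_cst => k _.
  by rewrite /pcst mul0rn.
- rewrite (ser_germ (rD _ (regular_add rf rh)) (Defs.der_add hD rf rh)) ser_add //; exact: rD.
- rewrite (ser_germ (rD _ (regular_mul rf rh)) (Defs.der_mul hD rf rh)).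
  have r1 := regular_mul rf (rD h rh); have r2 := regular_mul rh (rD f rf).
  by rewrite ser_add // !ser_mul //; exact: rD.
Qed.

End ArcSeries.

Section LocalEquations.
Variables (K : numClosedFieldType) (X : variety K).

Lemma germ_span1 (y : X) h f : germ_span y [set h] f <->
  exists2 a, regular y a & \forall u \near y, f u = a u * h u.
Proof.
split=> [[n [a [b [hab e]]]]|[a ra e]].
  exists (fun u => \sum_i a i u); first by apply: regular_sum => i _; have [] := hab i.
  apply: filterS e => u ->; rewrite mulr_suml; apply: eq_bigr => i _.
  by have [_ ->] := hab i.
exists 1%N, (fun=> a), (fun=> h); split=> //.
by apply: filterS e => u ->; rewrite big_ord1.
Qed.

Lemma local_equation_vanish (y : X) D h : local_equation y D h -> \forall u \near y, D u -> h u = 0.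
Proof.
move=> [rh H]; apply/(H h rh)/germ_span1; exists (fun=> 1); first exact: regular_cst.
by apply: nearW => u; rewrite mul1r.
Qed.

Lemma local_equation_div (y : X) D h f : local_equation y D h -> regular y f ->
  (\forall u \near y, D u -> f u = 0) -> exists2 a, regular y a & \forall u \near y, f u = a u * h u.
Proof. by move=> [_ H] rf /(H f rf)/germ_span1. Qed.

Lemma local_equation_out (y : X) D : closed D -> ~ D y -> local_equation y D (fun=> 1).
Proof.
move=> cD nDy; split=> [|f rf]; first exact: regular_cst.
split=> [_|_].
  by apply/germ_span1; exists f => //; apply: nearW => u; rewrite mulr1.
have oD : open (~` D) by rewrite openC.
have : \forall u \near y, (~` D) u by exact: open_nbhs_nbhs.
by apply: filterS => u nDu Du.
Qed.

Lemma snc_equations N (E : 'I_N -> set X) (y : X) : snc_divisor E ->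
  exists d (z : 'I_d -> X -> K) (j : 'I_N -> 'I_d) h, [/\ parameters y z,
    forall i i', E i y -> E i' y -> j i = j i' -> i = i',
    forall i, local_equation y (E i) (h i) &
    (forall i, E i y -> h i = z (j i)) /\ (forall i, ~ E i y -> h i = fun=> 1)].
Proof.
move=> [hE /(_ y)[d [z [j [pz inj leq]]]]].
exists d, z, j, (fun i => if `[< E i y >] then z (j i) else fun=> 1); split=> //.
  move=> i; case: asboolP => Ei; first exact: leq.
  by apply: local_equation_out => //; have [] := hE i.
by split=> i Ei; [rewrite asboolT|rewrite asboolF].
Qed.

Variables (g : formal_arc X) (N : nat) (E : 'I_N -> set X).
Local Notation y := (arc_center g).

Lemma local_equation_ser D h h' : local_equation y D h -> local_equation y D h' ->
  exists c, arc_ser g h' = c * arc_ser g h.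
Proof.
move=> hh hh'; have rh' : regular y h' by have [] := hh'.
have [a ra e] := local_equation_div hh rh' (local_equation_vanish hh').
exists (arc_ser g a); rewrite (ser_germ rh' e) ser_mul //; by have [] := hh.
Qed.

Variable h : 'I_N -> X -> K.
Hypothesis hh : forall i, local_equation y (E i) (h i).

(** The restriction to the arc of an equation of the divisor [sum_i r_i E_i]. *)
Definition eqn_ser (r : 'I_N -> nat) : pser K := \prod_i arc_ser g (h i) ^+ r i.

Lemma eqn_reg (h' : 'I_N -> X -> K) r : (forall i, local_equation y (E i) (h' i)) ->
  regular y (fun u => \prod_i h' i u ^+ r i).
Proof. by move=> hh'; apply: regular_prod => i _; apply: regular_exp; have [] := hh' i. Qed.

Lemma eqn_serE (h' : 'I_N -> X -> K) r : (forall i, local_equation y (E i) (h' i)) ->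
  arc_ser g (fun u => \prod_i h' i u ^+ r i) = \prod_i arc_ser g (h' i) ^+ r i.
Proof.
move=> hh'; rewrite ser_prod => [|i]; last by apply: regular_exp; have [] := hh' i.
by apply: eq_bigr => i _; rewrite ser_exp //; have [] := hh' i.
Qed.

Lemma divisor_ideal_ser r f : divisor_ideal E r y f -> exists c, arc_ser g f = c * eqn_ser r.
Proof.
move=> [h' hh' /germ_span1[a ra e]].
have /choice[c hc] : forall i, exists c, arc_ser g (h' i) = c * arc_ser g (h i).
  by move=> i; exact: local_equation_ser.
exists (arc_ser g a * \prod_i c i ^+ r i).
have rp := eqn_reg r hh'.
rewrite -(ser_germ (regular_mul ra rp) _); last by apply: filterS e => u ->.
rewrite ser_mul // eqn_serE // -mulrA /eqn_ser -big_split; congr (_ * _).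
by apply: eq_bigr => i _; rewrite hc exprMn.
Qed.

Lemma divisor_ideal_eqn r : divisor_ideal E r y (fun u => \prod_i h i u ^+ r i).
Proof.
exists h => //; apply/germ_span1; exists (fun=> 1); first exact: regular_cst.
by apply: nearW => u; rewrite mul1r.
Qed.

End LocalEquations.

Section PushOrder.
Variables (K : numClosedFieldType) (X X' : variety K) (mu : X' -> X).
Hypothesis hmu : morphism_on setT mu.
Variables (g : formal_arc X') (N : nat) (E : 'I_N -> set X') (h : 'I_N -> X' -> K).
Local Notation y := (arc_center g).
Hypothesis hh : forall i, local_equation y (E i) (h i).

Lemma push_ideal_peq (Y : subscheme X) r k : pullback_ideal mu Y y = divisor_ideal E r y ->
  (forall f, ideal Y (mu y) f -> peq k (arc_ser (push hmu g) f) 0) <-> peq k (eqn_ser g h r) 0.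
Proof.
move=> eI; split=> [H|H f Yf].
  have : pullback_ideal mu Y y (fun u => \prod_i h i u ^+ r i) by rewrite eI; exact: divisor_ideal_eqn.
  move=> [n [a [b [hab e]]]]; rewrite /eqn_ser -(eqn_serE (g := g) r hh).
  have rb i : regular y (b i).
    by have [_ [f Yf <-]] := hab i; apply: (morphism_regular hmu); exact: ideal_regular Yf.
  rewrite (ser_germ (eqn_reg r hh) e) ser_sum => [|i]; last by apply: regular_mul => //; have [] := hab i.
  apply: peq_sum0 => i _; have [ra [f Yf fb]] := hab i.
  rewrite ser_mul // -[X in peq _ _ X](mulr0 (arc_ser g (a i))); apply: peqM => //.
  by rewrite -fb -push_ser; [exact: H|exact: ideal_regular Yf].
have : divisor_ideal E r y (f \o mu).
  rewrite -eI; exists 1%N, (fun=> fun=> 1), (fun=> f \o mu); split.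
    by move=> _; split; [exact: regular_cst|exists f].
  by apply: nearW => u; rewrite big_ord1 mul1r.
move=> /(divisor_ideal_ser hh)[c ec]; rewrite push_ser; last exact: ideal_regular Yf.
by rewrite ec -[X in peq _ _ X](mulr0 c); exact: peqM.
Qed.

Lemma push_order (Y : subscheme X) r e : pullback_ideal mu Y y = divisor_ideal E r y ->
  arc_order (push hmu g) Y e <-> pord (eqn_ser g h r) e.
Proof.
move=> eI; split=> [[H1 [f Yf fe]]|[H1 H2]].
  have he : peq e (eqn_ser g h r) 0 by apply/(push_ideal_peq e eI) => f' Yf' k ke; exact: H1.
  split=> //; apply/eqP => z; move/eqP: fe; apply.
  have : peq e.+1 (eqn_ser g h r) 0 by move=> k; rewrite ltnS leq_eqVlt => /predU1P[->|/he].
  by move=> /(push_ideal_peq e.+1 eI)/(_ f Yf)/(_ e (ltnSn e)).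
split=> [f k Yf ke|]; first by have /(push_ideal_peq e eI)/(_ f Yf)/(_ k ke) := H1.
apply: contrapT => none; move/eqP: H2; apply.
have /(push_ideal_peq e.+1 eI)/(_ e (ltnSn e)) : forall f, ideal Y (mu y) f -> peq e.+1 (arc_ser (push hmu g) f) 0.
  move=> f Yf k; rewrite ltnS leq_eqVlt => /predU1P[->|ke].
    by apply/eqP/negPn/negP => fe; apply: none; exists f.
  by have /(push_ideal_peq e eI)/(_ f Yf)/(_ k ke) := H1.
by [].
Qed.

Lemma push_mder M F : mder y M (arc_ser g) F ->
  mder (mu y) M (arc_ser (push hmu g)) (fun f => F (f \o mu)).
Proof.
have R f : regular (mu y) f -> regular y (f \o mu) by exact: morphism_regular.
move=> [germ cst add mul]; split=> [f f' rf e|c|f f' rf rf'|f f' rf rf'].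
- by apply: germ; [exact: R|exact: (morphism_near hmu e)].
- exact: (cst c).
- exact: add (R f rf) (R f' rf').
- by rewrite !push_ser //; exact: mul (R f rf) (R f' rf').
Qed.

Variables (d : nat) (O' : set X') (w' : 'I_d -> X' -> K) (D' : 'I_d -> (X' -> K) -> X' -> K).
Variables (O : set X) (w : 'I_d -> X -> K) (D : 'I_d -> (X -> K) -> X -> K).
Hypotheses (hC' : chart O' w' D') (hC : chart O w D) (O'y : O' y) (Oy : O (mu y)).

Definition jacobian : 'M[pser K]_d := \matrix_(i, j) arc_ser g (D' i (w j \o mu)).

(** The matrix in [relative_canonical] uses other coordinates on both sides. By the chain rule the
    change of coordinates multiplies it by [M1] and [M3], which are invertible at [t = 0], so the
    determinant changes by a unit only. *)
Lemma jacobian_order k : relative_canonical mu E k ->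
  exists2 c : pser K, c 0%N != 0 & \det jacobian = c * eqn_ser g h k.
Proof.
move=> /(_ y)[d0 [z [w0 [D0 [pz pw hD0 dual eI]]]]].
have [V' [Dz [V'y hCz]]] := smooth_chart pz; have [V [Dw [Vy hCw]]] := smooth_chart pw.
have ed : d0 = d.
  by apply/eqP; rewrite eqn_leq (chart_dim_le hCz hC' V'y O'y) (chart_dim_le hC' hCz O'y V'y).
move: z w0 D0 pz pw hD0 dual eI Dz hCz Dw hCw; rewrite {d0}ed => z w0 D0 pz pw hD0 dual eI Dz hCz Dw hCw.
have R f : regular (mu y) f -> regular y (f \o mu) by exact: morphism_regular.
have expand (O1 : set X') (v : 'I_d -> X' -> K) Dv Dn f : chart O1 v Dv -> O1 y -> derivation_at y Dn ->
    regular y f -> arc_ser g (Dn f) = \sum_l arc_ser g (Dv l f) * arc_ser g (Dn (v l)).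
  move=> hv O1y hDn rf; apply: peq_all => M.
  exact: (mder_chart hv O1y (arc_mhom g M) (derivation_mder M hDn) rf).
have dualser (O1 : set X') (v : 'I_d -> X' -> K) Dv i j : chart O1 v Dv -> O1 y ->
    arc_ser g (Dv i (v j)) = pcst (i == j)%:R.
  move=> hv O1y; rewrite -(ser_cst g); apply: ser_germ; last exact: (chart_dual_near hv).
  by apply: (chart_der_reg hv) => //; exact: (ch_reg hv).
have rz l : regular y (z l) := ch_reg hCz l V'y.
pose M1 := \matrix_(i, l) arc_ser g (D' i (z l)).
pose M1' := \matrix_(l, j) arc_ser g (Dz l (w' j)).
pose M2 := \matrix_(l, q) arc_ser g (D0 l (w0 q \o mu)).
pose M3 := \matrix_(q, j) arc_ser (push hmu g) (Dw q (w j)).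
pose M3' := \matrix_(j, q) arc_ser (push hmu g) (D j (w0 q)).
have eDz l f : regular y f -> arc_ser g (D0 l f) = arc_ser g (Dz l f).
  move=> rf; rewrite (expand _ _ _ _ _ hCz V'y (hD0 l) rf) (bigD1 l) //= big1 ?addr0.
    rewrite (ser_germ _ (dual l l)) ?ser_cst ?eqxx ?rmorph1 ?mulr1 //.
    by apply: (der_regular (hD0 l)).
  move=> i /negbTE il; rewrite (ser_germ _ (dual l i)); last exact: (der_regular (hD0 l)).
  by rewrite ser_cst eq_sym il rmorph0 mulr0.
have eJ : jacobian = M1 *m M2 *m M3.
  apply/matrixP => i j; rewrite mxE.
  have rw : regular (mu y) (w j) := ch_reg hC j Oy.
  have -> : arc_ser g (D' i (w j \o mu)) =
      \sum_q arc_ser (push hmu g) (Dw q (w j)) * arc_ser g (D' i (w0 q \o mu)).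
    apply: peq_all => M.
    have hE := push_mder (derivation_mder M (ch_der hC' i O'y)).
    exact: (mder_chart hCw Vy (arc_mhom (push hmu g) M) hE rw).
  rewrite mxE; apply: eq_bigr => q _; rewrite [M3 q j]mxE mulrC; congr (_ * _).
  have rwq : regular y (w0 q \o mu) by apply: R; exact: (ch_reg hCw q Vy).
  rewrite (expand _ _ _ _ _ hCz V'y (ch_der hC' i O'y) rwq) mxE; apply: eq_bigr => l _.
  by rewrite !mxE eDz // mulrC.
have pcst_bool (e : bool) : pcst e%:R = e%:R :> pser K by case: e; rewrite ?rmorph0 ?rmorph1.
have u1 : M1 *m M1' = 1%:M.
  apply/matrixP => i j; rewrite !mxE -pcst_bool -(dualser _ _ _ i j hC' O'y).
  rewrite (expand _ _ _ _ _ hCz V'y (ch_der hC' i O'y) (ch_reg hC' j O'y)).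
  by apply: eq_bigr => l _; rewrite !mxE mulrC.
have u3 : M3' *m M3 = 1%:M.
  apply/matrixP => i j; rewrite !mxE -pcst_bool.
  have rwj : regular (mu y) (w j) := ch_reg hC j Oy.
  have e1 : arc_ser (push hmu g) (D i (w j)) = \sum_q arc_ser (push hmu g) (Dw q (w j)) * arc_ser (push hmu g) (D i (w0 q)).
    apply: peq_all => M.
    have hDi : derivation_at (arc_center (push hmu g)) (D i) := ch_der hC i Oy.
    exact: (mder_chart hCw Vy (arc_mhom (push hmu g) M) (derivation_mder M hDi) rwj).
  transitivity (arc_ser (push hmu g) (D i (w j))).
    by rewrite e1; apply: eq_bigr => q _; rewrite !mxE mulrC.
  rewrite -[RHS](ser_cst (push hmu g)); apply: ser_germ; last exact: (chart_dual_near hC i j Oy).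
  exact: (chart_der_reg hC).
have unit0 (A B : 'M[pser K]_d) : A *m B = 1%:M -> (\det A) 0%N != 0 /\ (\det B) 0%N != 0.
  move=> /(congr1 determinant); rewrite det_mulmx det1 => /(congr1 (fun a : pser K => a 0%N)).
  rewrite pserM0 => e; split; apply/eqP => z0; move/eqP: e; rewrite z0 ?mul0r ?mulr0 eq_sym oner_eq0 //.
have rJ0 i j : regular y (D0 i (w0 j \o mu)).
  by apply: (der_regular (hD0 i)); apply: R; exact: (ch_reg hCw j Vy).
have rJ : regular y (fun u => \det (\matrix_(i, j) D0 i (w0 j \o mu) u)).
  by apply: regular_det => i j; under eq_fun do rewrite mxE.
have eM2 : arc_ser g (fun u => \det (\matrix_(i, j) D0 i (w0 j \o mu) u)) = \det M2 by exact: ser_det.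
have [b eb] : exists b, \det M2 = b * eqn_ser g h k.
  rewrite -eM2; apply: (divisor_ideal_ser hh); rewrite eI; apply/germ_span1.
  by exists (fun=> 1); [exact: regular_cst|apply: nearW => u; rewrite mul1r].
have [a ea] : exists a, eqn_ser g h k = a * \det M2.
  have : divisor_ideal E k y (fun u => \prod_i h i u ^+ k i) by exact: divisor_ideal_eqn.
  rewrite eI => /germ_span1[a ra e]; exists (arc_ser g a).
  by rewrite /eqn_ser -(eqn_serE k hh) (ser_germ (eqn_reg k hh) e) ser_mul // eM2.
have [d1 _] := unit0 _ _ u1; have [_ d3] := unit0 _ _ u3.
rewrite eJ !det_mulmx eb.
(* If the equation vanishes along the arc, both sides are zero and any unit will do; otherwise the
   two divisibilities show that [b] is a unit. *)
have [z0|nz] := pselect (eqn_ser g h k = 0).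
  by exists 1; [exact: oner_neq0|rewrite z0 !mulr0 mul0r].
have ab : a * b = 1.
  have : (a * b - 1) * eqn_ser g h k = 0 by rewrite mulrBl mul1r -mulrA -eb -ea subrr.
  by move=> /pser_mul_eq0[/eqP|//]; rewrite subr_eq0 => /eqP.
exists (\det M1 * b * \det M3); last by ring.
rewrite !pserM0 !mulf_neq0 //; apply/eqP => b0.
by have /(congr1 (fun c : pser K => c 0%N))/eqP := ab; rewrite pserM0 b0 mulr0 eq_sym oner_eq0.
Qed.

End PushOrder.

(** * The dimension of a cylinder *)

Section TangentBound.
Variables (K : numClosedFieldType) (X X' : variety K) (mu : X' -> X).
Hypotheses (hmu : morphism_on setT mu).
Variables (N' : nat) (E : 'I_N' -> set X') (k : 'I_N' -> nat).
Hypotheses (snc : snc_divisor E) (rcan : relative_canonical mu E k).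
Variables (U : set X) (N : nat) (x : X -> 'I_N -> K).
Variables (O : set X) (d : nat) (w : 'I_d -> X -> K) (D : 'I_d -> (X -> K) -> X -> K).
Hypotheses (hx : aff_coord U x) (hC : chart O w D).
Variables (U' : set X') (L : nat) (x' : X' -> 'I_L -> K).
Hypothesis hx' : aff_coord U' x'.
Variables (nu : 'I_N' -> nat) (T : set (formal_arc X')) (M : nat).
Hypothesis TU' : forall q, T q -> U' (arc_center q).
Hypothesis TU : forall q, T q -> U (mu (arc_center q)) /\ O (mu (arc_center q)).
Hypothesis Tnu : forall q l h, T q -> local_equation (arc_center q) (E l) h ->
  peq (nu l) (arc_ser q h) 0.
Hypothesis nuM : (\sum_l nu l * (k l).+1 <= M.+1)%N.
Local Notation cc := (arc_chart_coord x w (M := M)).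
Local Notation cdim := #|chart_index N d M|.

(** The coordinates of the image are listed among those of the lift, so that functions of the image
    are polynomials in them. *)
Definition lift_coord (q : formal_arc X') : 'I_(#|{: 'I_L * 'I_M.+1}| + cdim) -> K :=
  vcat (fun i : 'I_#|{: 'I_L * 'I_M.+1}| => arc_coef q (x' ^~ (enum_val i).1) (enum_val i).2)
       (cc (push hmu q)).

Lemma lift_arc_coord Phi : (forall q, Phi q -> U' (arc_center q)) -> arc_coord lift_coord Phi M.+1.
Proof.
move=> PU; apply: (@arc_coord_aff _ _ U' L x' _ _ _ _
  (fun l i => lshift cdim (enum_rank ((l, i) : 'I_L * 'I_M.+1))) hx' PU) => q l i Pq.
by rewrite /lift_coord vcatl enum_rankK.
Qed.

(** [T] need not be irreducible; a minimal relatively closed subset on which the functions stay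
    independent has a prime ideal, and [tangent_frame] applies to it. *)
Lemma prime_part n (Gp : 'I_n -> mpoly cdim K) :
  alg_indep T (fun i q => meval (cc (push hmu q)) (Gp i)) ->
  exists (Phi : set (formal_arc X')) p (v : 'I_n -> 'I_(#|{: 'I_L * 'I_M.+1}| + cdim) -> K),
  [/\ Phi `<=` T, Phi p,
    forall i P, (forall q, Phi q -> meval (lift_coord q) P = 0) -> dirpoly lift_coord p (v i) P = 0 &
    forall i j, dirpoly lift_coord p (v i) (vlift _ (Gp j)) = (i == j)%:R].
Proof.
move=> hG; pose F0 := lift_coord @` T; pose G j := vlift #|{: 'I_L * 'I_M.+1}| (Gp j).
have GE q j : meval (lift_coord q) (G j) = meval (cc (push hmu q)) (Gp j) by exact: kev_vlift.
pose C := [set F | zclosed F0 F /\ alg_indep F (fun j p => meval p (G j))].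
have [||F [zF iF] Fmin] := @zclosed_minimal _ _ F0 C.
{ exists F0; split; first by split=> // p Fp _.
  move=> H hH; apply: hG => q Tq; rewrite -(hH (lift_coord q)); last by exists q.
  by congr (meval _ H); apply/funext => j; rewrite GE. }
{ by move=> F []. }
have prF := @poly_prime_minimal _ _ _ G F0 F zF iF (fun F' zF' iF' le => Fmin F' (conj zF' iF') le).
have [p [v [Fp tan dual]]] := tangent_frame prF iF.
have [FF0 _] := zF; have [q0 Tq0 eq0] := FF0 p Fp.
exists [set q | T q /\ F (lift_coord q)], q0, v; split.
- by move=> q [].
- by split=> //; rewrite eq0.
- move=> i P nP; rewrite /dirpoly eq0; apply: tan => q Fq; have [q1 Tq1 e1] := FF0 q Fq.
  by rewrite -e1; apply: nP; split=> //; rewrite e1.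
- by move=> i j; rewrite /dirpoly eq0; exact: dual.
Qed.

Lemma tangent_bound n (Gp : 'I_n -> mpoly cdim K) :
  alg_indep T (fun i q => meval (cc (push hmu q)) (Gp i)) ->
  (n + \sum_l nu l * (k l).+1 <= d * M.+1)%N.
Proof.
move=> /prime_part[Phi [p [v [PT Pp tan dual]]]].
have hc : arc_coord lift_coord Phi M.+1 by apply: lift_arc_coord => q /PT; exact: TU'.
have Tp := PT p Pp; have [Uy Oy] := TU Tp.
pose Ei i := arc_der lift_coord Phi p (v i).
have hE i : mder (arc_center p) M.+1 (arc_ser p) (Ei i) := arc_der_mder hc Pp (tan i).
have [d0 [z [j [h [pz injj hh [hin hout]]]]]] := snc_equations (arc_center p) snc.
have [V' [D' [V'y hC']]] := smooth_chart pz.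
have ed : d0 = d.
  have [d1 [z1 [w1 [D1 [pz1 pw1 _ _ _]]]]] := rcan (arc_center p).
  have [V1 [Dz1 [V1y hC1]]] := smooth_chart pz1; have [V2 [Dw1 [V2y hC2]]] := smooth_chart pw1.
  apply/eqP; rewrite eqn_leq (leq_trans (chart_dim_le hC' hC1 V'y V1y) (chart_dim_le hC2 hC V2y Oy)).
  exact: leq_trans (chart_dim_le hC hC2 Oy V2y) (chart_dim_le hC1 hC' V1y V'y).
move: z j pz injj hin D' hC'; rewrite {d0}ed => z j pz injj hin D' hC'.
pose A l := `[< E l (arc_center p) >].
have AP l : A l -> E l (arc_center p) by move/asboolP.
(* Off [E l] the chosen equation is 1, so [Tnu] leaves only order 0. *)
have nA l : ~~ A l -> nu l = 0%N.
  move=> /asboolPn nE; have := Tnu Tp (hh l); rewrite (hout l nE) ser_cst => H.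
  by apply/eqP; rewrite -leqn0 leqNgt; apply/negP => /H/eqP; rewrite /pcst /= mulr1n pser0 oner_eq0.
(* The orders are transferred from components to parameters: by normal crossings at most one
   component through the center belongs to each [z l], so the sum has at most one term. *)
pose nu' (l : 'I_d) := (\sum_(l' | A l' && (j l' == l)) nu l')%N.
have nu'E l' : A l' -> nu' (j l') = nu l'.
  move=> Al; rewrite /nu' (bigD1 l') ?Al ?eqxx //= big1 ?addn0 // => i /andP[/andP[Ai /eqP ji] il].
  by rewrite (injj i l' (AP i Ai) (AP l' Al) ji) eqxx in il.
have snu' : (\sum_l nu' l = \sum_l nu l)%N.
  rewrite /nu' (exchange_big_dep A) /=; last by move=> l i _ /andP[].
  rewrite [RHS](bigID A) /= [X in (_ + X)%N]big1 ?addn0 => [|i /nA->] //.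
  apply: eq_bigr => i Ai; rewrite (bigD1 (j i)) ?Ai ?eqxx //= big1 ?addn0 // => l /andP[h1 h2].
  by move: h1 h2; rewrite ?Ai /= => /eqP ->; rewrite eqxx.
have nu'M l : (nu' l <= M.+1)%N.
  apply: leq_trans nuM; apply: leq_trans (_ : (\sum_l nu l <= _)%N); last first.
    by apply: leq_sum => i _; rewrite leq_pmulr.
  by rewrite -snu' (bigD1 l) //= leq_addr.
(* Tangent vectors respect the contact orders with the components of E. *)
have Ez i l : peq (nu' l) (Ei i (z l)) 0.
  have [[l' /andP[Al /eqP jl]]|none] := pselect (exists l', A l' && (j l' == l)); last first.
    rewrite /nu' big1 // => l' Hl'; by case: none; exists l'.
  rewrite -jl nu'E // => e ek; have El := AP l' Al.
  have lz := hh l'; rewrite (hin l' El) in lz; have [rz _] := lz.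
  have eM : (e < M.+1)%N by apply: leq_trans ek _; rewrite -(nu'E l' Al).
  have n1 := regular_near rz; have n2 := near_join (local_equation_vanish lz).
  have [g [gp H]] := acc_near hc Pp (filterI n1 n2).
  rewrite pser0 -(dder_cst Pp (tan i) 0); apply: (dder_local Pp (tan i) gp); last exact: rat_cst.
  move=> q Pq gq; have [rq vq] := H q Pq gq.
  have [dq [zq [jq [hq [_ _ hhq _]]]]] := snc_equations (arc_center q) snc.
  have [a ra ea] := local_equation_div (hhq l') rq vq.
  have rhq : regular (arc_center q) (hq l') by have [] := hhq l'.
  rewrite -[LHS]/(arc_ser q (z (j l')) e) (ser_germ rq ea) ser_mul //.
  have : peq (nu l') (arc_ser q a * arc_ser q (hq l')) (arc_ser q a * 0).
    by apply: peqM => //; apply: Tnu => //; exact: PT.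
  by move=> /(_ e ek) ->; rewrite mulr0.
pose J := jacobian mu p D' w.
(* The component of a tangent vector along [z l] is divisible by [t^(nu' l)]. Moving these powers
   into the rows of the Jacobian matrix gives [B] and adds [sum_l nu_l] to the order of the
   determinant. *)
pose B : 'M[pser K]_d := \matrix_(l, q) (pX K (nu' l) * J l q).
pose Y i : 'M[K]_(d, M.+1) := \matrix_(q, e) Ei i (w q \o mu) e.
pose xs i : 'M[K]_(d, M.+1) := \matrix_(l, e) pshift (nu' l) (Ei i (z l)) e.
have rw q : regular (arc_center p) (w q \o mu).
  by apply: (morphism_regular hmu); exact: (ch_reg hC q Oy).
have YE i : Y i = pact M.+1 B (xs i).
  apply/matrixP => q e; rewrite !mxE.
  rewrite (mder_chart hC' V'y (arc_mhom p M.+1) (hE i) (rw q)) //.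
  apply: peq_sum (ltn_ord e) => l _; rewrite /B /J !mxE mulrA mulrC; apply: peqM => //.
  move=> e1 e1M; rewrite mulrC.
  have [lt|ge] := ltnP e1 (nu' l); first by rewrite Ez // pXM lt.
  rewrite pXM ltnNge ge /=.
  have e2 : (e1 - nu' l < M.+1)%N by apply: leq_ltn_trans e1M; exact: leq_subr.
  by rewrite -[(e1 - nu' l)%N]/(nat_of_ord (Ordinal e2)) prowE mxE /pshift /= subnK.
have detB : \det B = (\prod_l pX K (nu' l)) * \det J.
  have -> : B = diag_mx (\row_l pX K (nu' l)) *m J.
    by apply/matrixP => a b; rewrite mul_diag_mx !mxE.
  by rewrite det_mulmx det_diag; congr (_ * _); apply: eq_bigr => l _; rewrite mxE.
have detB0 : peq (\sum_l nu l * (k l).+1) (\det B) 0.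
  rewrite detB; have [c _ ->] := jacobian_order hmu hh hC' hC V'y Oy rcan.
  have -> : (\sum_l nu l * (k l).+1 = \sum_l nu' l + \sum_l nu l * k l)%N.
    by rewrite snu' -big_split; apply: eq_bigr => l _; rewrite mulnS.
  apply: peq0_mul.
    by apply: peq0_prod => l _ e el; rewrite /pX ltn_eqF.
  rewrite -[X in peq _ _ X](mulr0 c); apply: peqM => //.
  by apply: peq0_prod => l _; apply: peq0X; exact: Tnu.
have rank := pmx_rank_le detB0 nuM.
pose YM : 'M[K]_(n, d * M.+1) := \matrix_i mxvec (Y i).
have YB : (YM <= pmx M.+1 M.+1 B)%MS.
  apply/row_subP => i; rewrite rowK YE; apply/submxP; exists (mxvec (xs i)).
  by rewrite mul_vec_lin.
(* A vanishing combination of the [Y i] kills all functions pulled back from [X] up to order [M], in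
   particular the coordinates of the image, on which the functions [Gp] dual to the vectors
   depend. *)
have free : row_free YM.
  apply/row_freeP; have : kermx YM = 0; last first.
    move=> /eqP; rewrite kermx_eq0 => /row_freeP[R eR]; by exists R.
  apply/eqP/rowV0P => u /sub_kermxP uY; apply/rowP => i0; rewrite mxE.
  have Yz q e : (e < M.+1)%N -> \sum_i u 0 i * Ei i (w q \o mu) e = 0.
    move=> eM; have /(congr1 vec_mx)/matrixP/(_ q (Ordinal eM)) : mxvec (\sum_i u 0 i *: Y i) = 0.
      transitivity (u *m YM); last exact: uY.
      rewrite mulmx_sum_row linear_sum; apply: eq_bigr => i _.
      by rewrite rowK linearZ.
    rewrite mxvecK linear0 mxE summxE => e0; rewrite -[RHS]e0; apply: eq_bigr => i _.
    by rewrite !mxE.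
  have pullz f e : regular (mu (arc_center p)) f -> (e < M.+1)%N ->
      \sum_i u 0 i * Ei i (f \o mu) e = 0.
    move=> rf eM; have hP i := mder_chart hC Oy (arc_mhom (push hmu p) M.+1) (push_mder hmu (hE i)) rf.
    rewrite (eq_bigr (fun i => \sum_q \sum_(l < e.+1) arc_ser (push hmu p) (D q f) l *
       (u 0 i * Ei i (w q \o mu) (e - l)%N))) => [|i _]; last first.
      rewrite (hP i e eM) pser_sum mulr_sumr; apply: eq_bigr => q _.
      by rewrite pserM mulr_sumr; apply: eq_bigr => l _; rewrite mulrCA.
    rewrite exchange_big big1 // => q _; rewrite exchange_big big1 // => l _.
    by rewrite -mulr_sumr Yz ?mulr0 //; apply: leq_ltn_trans eM; exact: leq_subr.
  have -> : u 0 i0 = \sum_i u 0 i * dirpoly lift_coord p (v i) (vlift _ (Gp i0)).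
    by rewrite (bigD1 i0) //= dual eqxx mulr1 big1 ?addr0 // => i ii; rewrite dual (negbTE ii) mulr0.
  pose Fa (a : 'I_cdim) q := cc (push hmu q) a.
  have rFa a : rat_at lift_coord Phi p (Fa a).
    apply: rat_ext (rat_poly _ _ _ (mpolyX K (mnm1 (rshift #|{: 'I_L * 'I_M.+1}| a)))) => q _.
    by rewrite mevalXU /lift_coord vcatr.
  have dG i : dirpoly lift_coord p (v i) (vlift _ (Gp i0)) =
      \sum_a meval (Fa ^~ p) (mderiv a (Gp i0)) * dder lift_coord Phi p (v i) (Fa a).
    rewrite -(dder_poly Pp (tan i)) -(dder_meval Pp (tan i) (Gp i0) rFa).
    congr dder; apply/funext => q; exact: kev_vlift.
  have dFa a : exists f e, [/\ regular (mu (arc_center p)) f, (e < M.+1)%N &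
      forall i, dder lift_coord Phi p (v i) (Fa a) = Ei i (f \o mu) e].
    case ea : (enum_val a) => [l|[jj e]].
      exists (x ^~ l), 0%N; split=> //; first exact: regular_coord hx Uy.
      move=> i'; apply: (dder_ext Pp (tan i')).
        move=> q Pq; have [Uq Oq] := TU (PT q Pq).
        rewrite /Fa /arc_chart_coord /chart_coord ea arc_coef0 //.
        by apply: (morphism_regular hmu); exact: regular_coord hx Uq.
      apply: (acc_rat hc Pp) => //; apply: (morphism_regular hmu); exact: regular_coord hx Uy.
    have eM : (e.+1 < M.+1)%N by rewrite ltnS.
    exists (w jj), e.+1; split=> //; first exact: (ch_reg hC jj Oy).
    move=> i'; apply: (dder_ext Pp (tan i')); last exact: (acc_rat hc Pp (rw jj) eM).
    move=> q Pq; have [Uq Oq] := TU (PT q Pq).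
    rewrite /Fa /arc_chart_coord /chart_coord ea -[LHS]/(arc_ser (push hmu q) (w jj) e.+1).
    by rewrite push_ser //; exact: (ch_reg hC jj Oq).
  under eq_bigr do rewrite dG mulr_sumr.
  rewrite exchange_big big1 // => a _.
  under eq_bigr do rewrite mulrCA.
  rewrite -mulr_sumr; have [f [e [rf eM de]]] := dFa a.
  under eq_bigr do rewrite de.
  by rewrite pullz // mulr0.
have := mxrankS YB; rewrite (eqP (_ : row_free YM)) // => le.
by apply: leq_trans rank; rewrite leq_add2r.
Qed.

End TangentBound.

Section IndependenceOnArcs.
Variables (K : numClosedFieldType) (X : variety K).
Local Notation arc := (formal_arc X).

Lemma alg_indep_sub (T : Type) (A B : set T) n (G : 'I_n -> T -> K) : A `<=` B ->
  alg_indep A G -> alg_indep B G.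
Proof. by move=> AB h H hH; apply: h => p /AB; exact: hH. Qed.

(** Relations on the finitely many pieces would multiply to a relation on the union. *)
Lemma alg_indep_cover (T : Type) (I : finType) (A : I -> set T) n (G : 'I_n -> T -> K) :
  alg_indep (\bigcup_i A i) G -> exists i, alg_indep (A i) G.
Proof.
move=> h; apply: contrapT => none.
have /choice[H hH] : forall i, exists H : mpoly n K, H != 0 /\ forall p, A i p -> meval (G ^~ p) H = 0.
  move=> i; apply: contrapT => nH; apply: none; exists i => H hH; apply/eqP/negPn/negP => H0.
  by apply: nH; exists H.
have : \prod_i H i = 0.
  apply: h => p [i _ Aip]; rewrite (bigD1 i) //= mevalM (proj2 (hH i)) ?mul0r //.
by move/eqP; apply/negP/prodf_neq0 => i _; have [] := hH i.
Qed.

(** On a fibre of truncation all relevant coefficients are constant, so the empty coordinate system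
    serves there, and its only non-empty principal open set is the whole fibre. *)
Lemma arc_open_truncate (A : set arc) p : open A -> A p ->
  exists l, forall q, truncate l q = truncate l p -> A q.
Proof.
move=> oA Ap; have [l hl] := arc_open_coord oA Ap; exists l => q eq.
pose Phi := [set q : arc | truncate l q = truncate l p].
have ce q1 q2 : Phi q1 -> Phi q2 -> arc_center q1 = arc_center q2.
  by move=> e1 e2; have /(congr1 (@jet_center _ _ _)) : truncate l q1 = truncate l q2 by rewrite e1 e2.
pose c (q : arc) (i : 'I_0) : K := 0.
have hc : arc_coord c Phi l.
  split=> [p1 B P1 nB|p1 f k P1 rf kl].
    exists 1; rewrite meval1 oner_neq0; split=> // q1 Pq1 _; rewrite (ce q1 p1) //.
    exact: nbhs_singleton nB.
  apply: rat_ext (rat_cst _ _ _ (arc_coef p1 f k)) => q1 Pq1.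
  have kl' : (k <= l)%N by exact: ltnW.
  by rewrite -!(truncate_coef _ _ kl') P1 Pq1.
have [h [hp H]] := hl 0%N c Phi hc erefl.
by apply: H => //; rewrite (_ : c q = c p).
Qed.

Lemma truncate_le l m (p q : arc) : (l <= m)%N -> truncate m p = truncate m q -> truncate l p = truncate l q.
Proof. by move=> lm e; rewrite -!(trunc_jet_truncate lm) e. Qed.

Section InChart.
Variables (U : set X) (N : nat) (x : X -> 'I_N -> K).
Variables (O : set X) (d : nat) (w : 'I_d -> X -> K) (D : 'I_d -> (X -> K) -> X -> K).
Hypotheses (hx : aff_coord U x) (hC : chart O w D).

Definition over_chart : set arc := [set g | U (arc_center g) /\ O (arc_center g)].

Lemma arc_chart_open M (P : mpoly #|chart_index N d M| K) :
  open [set g | over_chart g /\ meval (arc_chart_coord x w (M := M) g) P != 0].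
Proof.
pose F (j : jet X M) := meval (fun i : 'I_#|chart_index N d M| => match enum_val i with
    | inl l => jet_coef j (fun y => x y l) 0%N | inr (i', k) => jet_coef j (w i') k.+1 end) P.
have oUO : open (U `&` O) by apply: openI; [exact: ac_open hx|exact: ch_open hC].
have jF : jet_function (U `&` O) F.
  apply: jet_function_meval => i; case: (enum_val i) => [l|[i' k]].
    by apply: (jf_coef M (f := fun y => x y l) 0%N) => y [Uy _]; exact: (regular_coord l hx Uy).
  by apply: (jf_coef M k.+1) => y [_ Oy]; exact: (ch_reg hC i' Oy).
rewrite (_ : [set g | _] = truncate M @^-1` [set j | (U `&` O) (jet_center j) /\ F j != 0]).
  by apply: truncate_open; exact: jet_function_open.
have e g : over_chart g -> F (truncate M g) = meval (arc_chart_coord x w (M := M) g) P.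
  move=> [Ug Og]; congr (meval _ P); apply/funext => i; rewrite /arc_chart_coord /chart_coord.
  case: (enum_val i) => [l|[i' k]]; last by rewrite truncate_coef.
  by rewrite truncate_coef // arc_coef0 //; exact: (regular_coord l hx Ug).
by apply/seteqP; split=> g [Pg h]; split=> //; [rewrite e|rewrite -e].
Qed.

Lemma over_chart_open : open over_chart.
Proof.
have := arc_chart_open (M := 0) 1; rewrite (_ : [set g | _] = over_chart) //.
apply/seteqP; split=> g; first by case.
by move=> Pg; split=> //; rewrite meval1 oner_neq0.
Qed.

Lemma alg_indep_open M n (G : 'I_n -> mpoly #|chart_index N d M| K) (C W : set arc) :
  irreducible C -> open W -> C `&` over_chart `&` W !=set0 ->
  alg_indep (C `&` over_chart) (fun i g => meval (arc_chart_coord x w g) (G i)) ->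
  alg_indep (C `&` over_chart `&` W) (fun i g => meval (arc_chart_coord x w g) (G i)).
Proof.
move=> iC oW [g0 [[Cg0 Og0] Wg0]] hG H hH; apply: hG => g [Cg Og].
apply/eqP/negPn/negP => nz.
pose P := mmap (@mpolyC #|chart_index N d M| K) G H.
have eP q : meval (arc_chart_coord x w q) P = meval (fun i => meval (arc_chart_coord x w q) (G i)) H.
  by rewrite (meval_rmorph (phi := meval _)) // => u /=; rewrite mevalC.
have [q [Cq [[Oq Pq] Wq]]] := irreducible_meet iC (arc_chart_open P) (openI over_chart_open oW)
  (ex_intro _ g (conj Cg (conj Og (etrans (congr1 (fun t => t != 0) (eP g)) nz))))
  (ex_intro _ g0 (conj Cg0 (conj Og0 Wg0))).
by move: Pq; rewrite eP hH ?eqxx //; case: Wq.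
Qed.

(** The coefficients of the parameters of orders [m + 1] to [m + e] take any values on arcs with a
    given [m]-jet, so they are independent of functions of the jet. This raises the level at which
    the cylinder is measured. *)
Lemma fresh_functions m e n (F : 'I_n -> mpoly #|chart_index N d m| K) (S : set (jet X m)) :
  alg_indep (truncate m @^-1` S `&` over_chart) (fun i g => meval (arc_chart_coord x w g) (F i)) ->
  exists G : 'I_(n + #|{: 'I_d * 'I_e}|) -> mpoly #|chart_index N d (m + e)| K,
    alg_indep (truncate m @^-1` S `&` over_chart) (fun i g => meval (arc_chart_coord x w g) (G i)).
Proof.
move=> hF.
pose emb (i : 'I_#|chart_index N d m|) : 'I_#|chart_index N d (m + e)| :=
  enum_rank (match enum_val i with inl l => inl l | inr (j, k) => inr (j, lshift e k) end : chart_index N d (m + e)).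
pose fr (a : 'I_#|{: 'I_d * 'I_e}|) : 'I_#|chart_index N d (m + e)| :=
  enum_rank (inr ((enum_val a).1, rshift m (enum_val a).2) : chart_index N d (m + e)).
pose G := vcat (fun i => subst_poly emb (F i)) (fun a => mpolyX K (mnm1 (fr a))).
exists G => H hH.
have [//|H0] := eqVneq H 0.
have [v Hv] : exists v, meval v H != 0.
  by apply: contrapT => none; move/eqP: H0; apply; apply: meval_eq0 => v; apply/eqP/negPn/negP => Hv; apply: none; exists v.
(* The fresh variables are set to the values that they have in [v], where [H] is non-zero; this
   reduces [H] to a non-zero relation between the old functions. *)
pose c (i : 'I_(n + #|{: 'I_d * 'I_e}|)) : mpoly n K :=
  match split i with inl i => mpolyX K (mnm1 i) | inr a => mpolyC n (v (rshift n a)) end.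
have evc u : meval u (mmap (@mpolyC n K) c H) = meval (vcat u (fun a => v (rshift n a))) H.
  rewrite (meval_rmorph (phi := meval _)) => [|t /=]; last by rewrite mevalC.
  congr (meval _ H); apply/funext => i; rewrite /= /c /vcat; case: split => a; first exact: mevalXU.
  exact: mevalC.
have : mmap (@mpolyC n K) c H = 0.
  apply: hF => g [Sg [Ug Og]]; rewrite evc.
  pose b j : pser K := fun k => if (k <= m)%N then arc_coef g (w j) k else
    if insub (k - m.+1)%N is Some k' then v (rshift n (enum_rank ((j, k') : 'I_d * 'I_e))) else 0.
  have b0 j : b j 0%N = w j (arc_center g) by rewrite /b /= arc_coef0 //; exact: (ch_reg hC j Og).
  have [q [cq eq]] := arc_exists hC Og b0.
  have tq : truncate m q = truncate m g.
    apply: truncate_eqP => [|f]; first by rewrite cq.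
    rewrite cq => rf; apply: (mhom_unique hC Og _ (jet_mhom (truncate m g))) rf => [|j].
      by rewrite -cq; exact: arc_mhom.
    by move=> k km; rewrite /arc_ser eq truncate_coef // /b -ltnS km.
  rewrite -(hH q); last by split; [rewrite /preimage /= tq|rewrite /over_chart /= cq].
  congr (meval _ H); apply/funext => i; rewrite /G /vcat; case: split => a.
    rewrite meval_subst; congr (meval _ (F a)); apply/funext => i'.
    rewrite /emb /arc_chart_coord /chart_coord enum_rankK; case: (enum_val i') => [l|[j k]]; first by rewrite cq.
    by rewrite eq /b /= ltn_ord.
  rewrite mevalXU /fr /arc_chart_coord /chart_coord enum_rankK eq /b /= ifF; last first.
    by apply/negbTE; rewrite -ltnNge ltnS leq_addr.
  by rewrite subSS addKn valK -surjective_pairing enum_valK.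
move/(congr1 (meval (fun i => v (lshift _ i)))); rewrite evc meval0 => z.
move: Hv; rewrite (_ : v = vcat (fun i => v (lshift #|{: 'I_d * 'I_e}| i)) (fun a => v (rshift n a))) ?z ?eqxx //.
by apply/funext => i; rewrite -[i in LHS]splitK /vcat; case: split.
Qed.

End InChart.

Hypothesis smX : smooth X.

(** The chain is pulled back to arcs, where its members remain irreducible and the coordinates of a
    chart are at hand. All members meet the chart because they contain [j0]. *)
Lemma chain_functions m (S : set (jet X m)) n Zs : irred_chain S n Zs ->
  exists U N (x : X -> 'I_N -> K) O d (w : 'I_d -> X -> K) D (F : 'I_n -> mpoly #|chart_index N d m| K),
  [/\ aff_coord U x, chart O w D, truncate m @^-1` S `&` over_chart U O !=set0 &
      alg_indep (truncate m @^-1` S `&` over_chart U O) (fun i g => meval (arc_chart_coord x w g) (F i))].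
Proof.
move=> [hZ lZ]; have [[[j0 Zj0] _] _] := hZ 0%N (leq0n n).
have [U [N [x [hx Uj]]]] := affine_coord_at (jet_center j0).
have [O [d [w [D [Oj hC]]]]] := chart_at smX (jet_center j0).
have Z0 i : (i <= n)%N -> Zs i j0.
  elim: i => [//|i IH] lin; have [sub _] := lZ i lin; apply: sub; apply: IH; exact: ltnW.
have ZS i : (i <= n)%N -> Zs i `<=` S by move=> /hZ[_ []].
pose cc := arc_chart_coord x w (M := m).
pose T i := truncate m @^-1` (Zs i) `&` over_chart U O.
have [g0 eg0] := jet_lift smX j0.
have T0 i : (i <= n)%N -> T i g0.
  by move=> lin; split; [rewrite /preimage /= eg0; exact: Z0|rewrite /over_chart /=; move: Uj Oj; rewrite -eg0].
have iT i : (i <= n)%N -> irreducible (truncate m @^-1` (Zs i)).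
  by move=> /hZ[iZ _]; exact: truncate_preimage_irreducible.
have /choice[F hF] : forall i, exists P : mpoly #|chart_index N d m| K, (i < n)%N ->
    (forall g, T i g -> meval (cc g) P = 0) /\ exists2 g, T i.+1 g & meval (cc g) P != 0.
  move=> i; have [lin|] := boolP (i < n)%N; last by exists 0.
  have [_ /existsNP[j1 /not_implyP[Zj1 nZj1]]] := lZ i lin.
  have [_ [_ rc]] := hZ i (ltnW lin).
  have nc : ~ closure (Zs i) j1.
    by move=> c; apply: nZj1; apply: rc; split=> //; exact: (ZS i.+1 lin).
  have oc : open (~` closure (Zs i)) by rewrite openC; exact: closed_closure.
  have [g1 eg1] := jet_lift smX j1.
  have [g [Zg [[Ug Og] cg]]] := irreducible_meet (iT i.+1 lin) (over_chart_open hx hC) (truncate_open oc)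
    (ex_intro _ g0 (T0 i.+1 lin)) (ex_intro _ g1 (conj (eq_ind_r (Zs i.+1) Zj1 eg1) (eq_ind_r (~` closure (Zs i)) nc eg1))).
  have hc : arc_coord cc (over_chart U O) m.+1 by exact: (chart_arc_coord hx hC).
  have [P [Pg H]] := jet_open_coord oc hc (conj Ug Og) cg.
  exists P => _; split; last by exists g.
  move=> q [Zq Oq]; apply/eqP/negPn/negP => Pq; apply: (H q Oq Pq); exact: subset_closure.
exists U, N, x, O, d, w, D, (fun i : 'I_n => F i); split=> //.
  by exists g0; have [Z0g Og] := T0 n (leqnn n); split=> //; exact: (ZS n (leqnn n) _ Z0g).
apply: (@alg_indep_sub _ (T n)); first by move=> g [Zg Og]; split=> //; exact: (ZS n (leqnn n) _ Zg).
apply: (@chain_indep K arc [set f | exists P, f = fun g => meval (cc g) P]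
  (fun i g => meval (cc g) (F i)) T n).
- by move=> u; exists (mpolyC _ u); apply/funext => g; rewrite mevalC.
- by move=> _ _ [P ->] [Q ->]; exists (P + Q); apply/funext => g; rewrite mevalD.
- by move=> _ _ [P ->] [Q ->]; exists (P * Q); apply/funext => g; rewrite mevalM.
- move=> i _ _ lin [P ->] [Q ->] PQ; apply: contrapT => /not_orP[/existsNP[p /not_implyP[Tp Pp]] /existsNP[q /not_implyP[Tq Qq]]].
  have [[Zp Op] [Zq Oq]] := (Tp, Tq).
  have [r [Zr [[Or Pr] [_ Qr]]]] := irreducible_meet (iT i lin) (arc_chart_open hx hC P) (arc_chart_open hx hC Q)
    (ex_intro _ p (conj Zp (conj Op (introN eqP Pp)))) (ex_intro _ q (conj Zq (conj Oq (introN eqP Qq)))).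
  by have /eqP := PQ r (conj Zr Or); rewrite mulf_eq0 (negbTE Pr) (negbTE Qr).
- by exists g0; exact: T0.
- by move=> i lin g [Zg Og]; split=> //; have [sub _] := lZ i lin; exact: sub.
- by move=> i lin; exists (F i).
- by move=> i lin p; have [h _] := hF i lin; exact: h.
- by move=> i lin; have [_ h] := hF i lin.
Qed.

End IndependenceOnArcs.

Section CylinderBound.
Variables (K : numClosedFieldType) (X X' : variety K) (mu : X' -> X).
Hypotheses (smX : smooth X) (iX : irreducible [set: X]).
Variables (Y Z : subscheme X) (N' : nat) (E : 'I_N' -> set X') (r s k : 'I_N' -> nat).
Hypothesis hres : log_resolution mu Y Z E r s k.

Let hmu : morphism_on setT mu.
Proof. by have [[_ [h _] _] _ _ _ _] := hres. Qed.

(** Where [r] and [s] both vanish, the arc may lie inside the component; the order is then recorded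
    as 0, which is still a lower bound. The bound by [a + b] leaves finitely many vectors to
    consider. *)
Lemma contact_vector (q : formal_arc X') a b : arc_order (push hmu q) Y a -> arc_order (push hmu q) Z b ->
  exists nu : 'I_N' -> nat, [/\ forall l h, local_equation (arc_center q) (E l) h -> peq (nu l) (arc_ser q h) 0,
    (\sum_l nu l * r l = a)%N, (\sum_l nu l * s l = b)%N & forall l, (nu l <= a + b)%N].
Proof.
have [_ snc eY eZ _] := hres => oY oZ.
have [d [z [j [h [_ _ hh _]]]]] := snc_equations (arc_center q) snc.
have pY := (push_order hmu hh _ (eY _)).1 oY; have pZ := (push_order hmu hh _ (eZ _)).1 oZ.
have nz t c l : pord (eqn_ser q h t) c -> (0 < t l)%N -> arc_ser q (h l) <> 0.
  move=> [_ nc] tl z0; move/eqP: nc; apply; rewrite /eqn_ser (bigD1 l) //= z0.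
  by case: (t l) tl => // t' _; rewrite expr0n /= mul0r.
have /choice[nu hnu] : forall l, exists n, if (0 < r l)%N || (0 < s l)%N then pord (arc_ser q (h l)) n else n = 0%N.
  move=> l; have [/orP[rl|sl]|_] := boolP ((0 < r l)%N || (0 < s l)%N); last by exists 0%N.
    exact: pord_ex (nz _ _ _ pY rl).
  exact: pord_ex (nz _ _ _ pZ sl).
have po t c : (forall l, (0 < t l)%N -> (0 < r l)%N || (0 < s l)%N) -> pord (eqn_ser q h t) c ->
    (\sum_l nu l * t l = c)%N.
  move=> ht hc; apply: pord_uniq hc; apply: pord_prod => l _.
  have [tl|] := ltnP 0 (t l); first by have := hnu l; rewrite ht // => /pordX; exact.
  by rewrite leqn0 => /eqP->; rewrite muln0; exact: pord1.
have eA := po r a (fun l h => introT orP (or_introl h)) pY.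
have eB := po s b (fun l h => introT orP (or_intror h)) pZ.
exists nu; split=> // [l h' lh'|l].
  have [c ->] := local_equation_ser (hh l) lh'.
  have : peq (nu l) (arc_ser q (h l)) 0.
    by have := hnu l; case: ifP => [_ []//|_ ->].
  by move=> hl; rewrite -[X in peq _ _ X](mulr0 c); exact: peqM.
have := hnu l; case: ifP => [rs _|_ ->//].
have [rl|rl] := ltnP 0 (r l).
  apply: leq_trans (leq_addr _ _); rewrite -eA (bigD1 l) //=.
  by apply: leq_trans (leq_addr _ _); rewrite leq_pmulr.
have sl : (0 < s l)%N by move: rs; rewrite ltnNge rl.
apply: leq_trans (leq_addl _ _); rewrite -eB (bigD1 l) //=.
by apply: leq_trans (leq_addr _ _); rewrite leq_pmulr.
Qed.

(** An arc of [C] may lie in the locus where lifting fails. [arc_perturb] moves it out without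
    leaving [C] or [W], since near the arc both conditions depend on a truncation only. *)
Lemma liftable_arc (C W : set (formal_arc X)) m (S : set (jet X m)) : C = truncate m @^-1` S ->
  open W -> C `&` W !=set0 -> exists W2, [/\ open W2, C `&` W `&` W2 !=set0 &
    forall g, W2 g -> exists g', push hmu g' = g].
Proof.
have [[_ proj birat] _ _ _ _] := hres.
move=> eC oW [g0 [Cg0 Wg0]].
have [U [N [x [V [b [[hx Ux] [oV Vx] [u Uu bu] lift]]]]]] := arc_lift iX hmu proj birat (arc_center g0).
have rb y : U y -> regular y (fun y => meval (x y) b) by move=> Uy; exact: (regular_poly b hx Uy).
have nb : ~ (\forall y \near arc_center g0, meval (x y) b = 0).
  move=> /near_open[A [oA Ag hA]]; move/eqP: bu; apply.
  apply: (irreducible_identity iX (ac_open hx) oA rb _ _ I Uu) => [|y _ _]; last exact: hA.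
  by exists (arc_center g0).
have [l hl] := arc_open_truncate oW Wg0.
have [g1 e1 [e he]] := arc_perturb smX (maxn l m) (rb _ Ux) nb.
have Wg1 : W g1 by apply: hl; exact: truncate_le (leq_maxl l m) e1.
have Cg1 : C g1 by move: Cg0; rewrite eC /preimage /= (truncate_le (leq_maxr l m) e1).
have c1 : arc_center g1 = arc_center g0 by have /(congr1 (@jet_center _ _ _)) := e1.
exists (truncate e @^-1` [set j | (U `&` V) (jet_center j) /\ jet_coef j (fun y => meval (x y) b) e != 0]); split.
- apply: truncate_open; apply: jet_function_open; first by apply: openI => //; exact: ac_open hx.
  by apply: (jf_coef e e) => y [Uy _]; exact: rb.
- exists g1; split=> //; split; first by rewrite /= c1.
  by rewrite /= leqnn.
- move=> g [[Ug Vg]]; rewrite /= leqnn => ge; apply: lift => // z.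
  by move/eqP: ge; apply; rewrite -[LHS]/(arc_ser g _ e) z.
Qed.

Lemma cylinder_bound m (S : set (jet X m)) W a b n Zs : irreducible (truncate m @^-1` S) -> open W ->
  (truncate m @^-1` S) `&` W !=set0 ->
  (forall g, (truncate m @^-1` S) g -> W g -> arc_order g Y a /\ arc_order g Z b) ->
  irred_chain S n Zs -> exists nu : 'I_N' -> nat, [/\ (\sum_l nu l * r l = a)%N,
    (\sum_l nu l * s l = b)%N & (n + \sum_l nu l * (k l).+1 <= m.+1 * krull_dim [set: X])%N].
Proof.
move=> iC oW CW ord hZ; have [[smX' proj birat] snc eY eZ rcan] := hres.
have [U [N [x [O [d [w [D [F [hx hC ne hF]]]]]]]]] := chain_functions smX hZ.
set C := truncate m @^-1` S in iC CW ord ne hF *.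
have -> : krull_dim [set: X] = d.
  have [g0 [_ [_ Og]]] := ne.
  have [d0 [z pz]] := smX (arc_center g0).
  by rewrite (krull_dim_smooth smX iX pz); exact: chart_parameters_dim iX pz hC.
(* Large enough for the rank estimate with every vector bounded by [a + b]; the [d * e] fresh
   functions offset the growth of the level in the final inequality. *)
pose e := (\sum_l (a + b) * (k l).+1)%N.
have [G hG] := fresh_functions hC e hF.
have [g1 [Cg1 [Wg1 Og1]]] : C `&` (W `&` over_chart U O) !=set0.
  have [g0 [Cg0 Og0]] := ne.
  exact: (irreducible_meet iC oW (over_chart_open hx hC) CW (ex_intro _ g0 (conj Cg0 Og0))).
have [W2 [oW2 [g2 [[Cg2 [Wg2 Og2]] W2g2]] lift]] := liftable_arc (W := W `&` over_chart U O) (erefl C)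
  (openI oW (over_chart_open hx hC)) (ex_intro _ g1 (conj Cg1 (conj Wg1 Og1))).
have hG2 := alg_indep_open hx hC iC (openI oW oW2) (ex_intro _ g2 (conj (conj Cg2 Og2) (conj Wg2 W2g2))) hG.
set B := _ `&` _ in hG2.
have [nn [Uc [affU covU]]] := var_cover X'.
have /choice[Lc hLc] : forall i, exists L (x' : X' -> 'I_L -> K), aff_coord (Uc i) x'.
  by move=> i; exact: affine_open_coord.
(* The lifts fall into finitely many classes, by affine piece of [X'] and contact vector; the
   functions remain independent on one of them. *)
pose T (c : 'I_nn * {ffun 'I_N' -> 'I_(a + b).+1}) := [set q : formal_arc X' |
  [/\ B (push hmu q), Uc c.1 (arc_center q),
     forall l h, local_equation (arc_center q) (E l) h -> peq (c.2 l) (arc_ser q h) 0,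
     (\sum_l c.2 l * r l = a)%N & (\sum_l c.2 l * s l = b)%N]].
have hT : alg_indep (\bigcup_c (push hmu @` T c))
    (fun i g => meval (arc_chart_coord x w (M := m + e) g) (G i)).
  { apply: alg_indep_sub hG2 => g Bg; have [[Cg Og] [Wg W2g]] := Bg.
  have [q eq] := lift g W2g; have [oa ob] := ord g Cg Wg.
  rewrite -eq in oa ob; have [nu [h1 h2 h3 h4]] := contact_vector oa ob.
  have [i Ui] := covU (arc_center q).
  pose nuf : {ffun 'I_N' -> 'I_(a + b).+1} := [ffun l => inord (nu l)].
  have nufE l : nuf l = nu l :> nat by rewrite ffunE inordK // ltnS.
  exists (i, nuf) => //; exists q => //; split=> //=; first by rewrite eq.
  - by move=> l h lh; rewrite nufE; exact: h1.
  - by transitivity (\sum_l nu l * r l)%N => //; apply: eq_bigr => l _; rewrite nufE.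
  - by transitivity (\sum_l nu l * s l)%N => //; apply: eq_bigr => l _; rewrite nufE. }
have [c hc] := alg_indep_cover hT.
have hTc : alg_indep (T c) (fun i q => meval (arc_chart_coord x w (M := m + e) (push hmu q)) (G i)).
  move=> H hH; apply: hc => _ [q Tq <-]; exact: hH.
have [q0 Tq0] : T c !=set0.
  apply: contrapT => none; have z := hTc 1 (fun q Tq => False_ind _ (none (ex_intro _ q Tq))).
  by move/eqP: z; rewrite oner_eq0.
have [_ _ _ sa sb] := Tq0.
exists (fun l => c.2 l : nat); split=> //.
have [x' hx'] := hLc c.1.
have nuM : (\sum_l c.2 l * (k l).+1 <= (m + e).+1)%N.
  apply: leqW; apply: leq_trans (leq_addl _ _); apply: leq_sum => l _.
  by rewrite leq_mul2r /= -ltnS ltn_ord.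
have := @tangent_bound K X X' mu hmu N' E k snc rcan U N x O d w D hx hC (Uc c.1) (Lc c.1) x' hx'
  (fun l => c.2 l : nat) (T c) (m + e) _ _ _ nuM _ G hTc.
have bnd (A B' C' D' E' : nat) : (A + D' * E' + B' <= D' * (C' + E').+1)%N -> (A + B' <= C'.+1 * D')%N.
  by clear; rewrite -addSn mulnDr mulnC; lia.
rewrite card_prod !card_ord => H; apply: (bnd _ _ _ _ e); apply: H.
- by move=> q [].
- by move=> q [[[_ []]]].
- by move=> q l h [_ _ H _ _]; exact: H.
Qed.

End CylinderBound.

(** * Arcs transversal to a divisor *)

Lemma noetherian_generators (R : comNzRingType) (J : set R) : noetherian R -> J 0 ->
  exists s : seq R, (forall x, x \in s -> J x) /\
    forall x, J x -> exists c : nat -> R, x = \sum_(i < size s) c i * s`_i.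
Proof.
move=> hN J0; apply: contrapT => none.
have /choice[f hf] : forall s : seq R, exists x, (forall y, y \in s -> J y) ->
    J x /\ ~ span (nth 0 s) (size s) x.
  move=> s; have [Js|nJs] := pselect (forall y, y \in s -> J y); last by exists 0.
  apply: contrapT => nx; apply: none; exists s; split=> // x Jx; apply: contrapT => nsp.
  by apply: nx; exists x.
pose S n := iter n (fun s => rcons s (f s)) [::]; have SS n : S n.+1 = rcons (S n) (f (S n)) by [].
have sz n : size (S n) = n by elim: n => [//|n IH]; rewrite SS size_rcons IH.
have JS n : forall y, y \in S n -> J y.
  elim: n => [//|n IH] y; rewrite SS mem_rcons inE => /predU1P[->|/IH//].
  by have [] := hf _ IH.
have nS n i : (i < n)%N -> (S n)`_i = f (S i).
  elim: n => [//|n IH]; rewrite ltnS SS nth_rcons sz leq_eqVlt => /predU1P[->|lt].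
    by rewrite ltnn eqxx.
  by rewrite lt IH.
have [n [c ec]] := hN (fun n => f (S n)).
have [_] := hf _ (JS n); apply; exists c; rewrite sz {1}ec.
by apply: eq_bigr => i _; rewrite nS.
Qed.

Section DivisorGeometry.
Variables (K : numClosedFieldType) (X : variety K).
Local Notation arc := (formal_arc X).

Lemma irreducible_avoid (A : set X) (s : seq (set X)) : irreducible A ->
  (forall B, B \in s -> closed B /\ ~ (A `<=` B)) ->
  exists V, [/\ open V, A `&` V !=set0 & forall y, V y -> forall B, B \in s -> ~ B y].
Proof.
move=> iA; elim: s => [_|B s IH hs].
  have [[a Aa] _] := iA; exists setT; split=> //; [exact: openT|by exists a].
have [C Cs|V [oV AV hV]] := IH; first by apply: hs; rewrite inE Cs orbT.
have [cB /existsNP[a /not_implyP[Aa nBa]]] := hs B (mem_head _ _).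
have oB : open (~` B) by rewrite openC.
exists (V `&` ~` B); split; first exact: openI.
  by apply: irreducible_meet => //; exists a.
move=> y [Vy nBy] C; rewrite inE => /predU1P[->//|]; exact: hV.
Qed.

(** Otherwise, near a point of [E i], the parameter of [E i'] would be a multiple of that of [E i],
    and its derivative with respect to itself would be 0 instead of 1. *)
Lemma snc_not_sub N (E : 'I_N -> set X) i i' : snc_divisor E -> i != i' -> ~ (E i `<=` E i').
Proof.
move=> [hE hs] ii sub; have [_ [[y Eiy] _]] := hE i; have Ei'y := sub y Eiy.
have [d [z [j [pz inj leq]]]] := hs y.
have [V [D [Vy hC]]] := smooth_chart pz.
have li := leq i Eiy; have li' := leq i' Ei'y.
have jj : j i != j i' by apply: contraNneq ii => /(inj i i' Eiy Ei'y) ->.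
have rz l : regular y (z l) := ch_reg hC l Vy.
have [|a ra e] := local_equation_div li (rz (j i')) _.
  by apply: filterS (local_equation_vanish li') => u h Eu; apply: h; exact: sub.
have hD := ch_der hC (j i') Vy.
have : D (j i') (z (j i')) y = 0.
  rewrite (derivation_germ hD (rz _) e) (derivation_mul hD ra (rz _)) (ch_dual hC) //.
  by rewrite eq_sym (negbTE jj) mulr0 add0r (nbhs_singleton (local_equation_vanish li) Eiy) mul0r.
by rewrite (ch_dual hC) // eqxx => /eqP; rewrite oner_eq0.
Qed.

(** The polynomials vanishing on [D] form a finitely generated ideal. [h] divides the generators
    near [y0], hence at nearby points it divides every function vanishing on [D]. *)
Lemma local_equation_near (y0 : X) D h : local_equation y0 D h -> \forall y \near y0, local_equation y D h.
Proof.
move=> lh; have [rh _] := lh.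
have [U [N [x [hx Uy0]]]] := affine_coord_at y0.
pose J := [set P : mpoly N K | forall y, U y -> D y -> meval (x y) P = 0].
have [s [sJ Js]] : exists s : seq (mpoly N K), (forall P, P \in s -> J P) /\
    forall P, J P -> exists c : nat -> mpoly N K, P = \sum_(i < size s) c i * s`_i.
  apply: noetherian_generators; first exact: noetherian_mpoly.
  by move=> y _ _; rewrite meval0.
have /choice[a ha] : forall i : 'I_(size s), exists a, regular y0 a /\
    \forall u \near y0, meval (x u) s`_i = a u * h u.
  move=> i; have [|a ra e] := local_equation_div lh (regular_poly s`_i hx Uy0) _; last by exists a.
  have nU : \forall u \near y0, U u by apply: open_nbhs_nbhs; split=> //; exact: ac_open hx.
  by apply: filterS nU => u Uu Du; apply: sJ => //; exact: mem_nth.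
have n1 : \forall u \near y0, forall i, regular u (a i).
  by apply: filter_forall => i; apply: regular_near; have [] := ha i.
have n2 : \forall u \near y0, \forall w \near u, forall i : 'I_(size s), meval (x w) s`_i = a i w * h w.
  by apply: near_join; apply: filter_forall => i; have [] := ha i.
have n3 := near_join (local_equation_vanish lh); have n4 := regular_near rh.
have n5 : \forall u \near y0, U u by apply: open_nbhs_nbhs; split=> //; exact: ac_open hx.
near=> y.
have ra i : regular y (a i) by move: i; near: y.
have ea : \forall w \near y, forall i : 'I_(size s), meval (x w) s`_i = a i w * h w by near: y.
have Uy : U y by near: y.
have hv : \forall w \near y, D w -> h w = 0 by near: y.
split; first by near: y.
move=> f rf; split=> [nf|/germ_span1[b rb e]]; last first.
  near=> w => Dw; rewrite (_ : f w = b w * h w); last by near: w.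
  by rewrite (_ : h w = 0) ?mulr0 //; move: Dw; near: w.
have [A [B [By e]]] := (ac_reg hx _ Uy).1 rf.
have [k [ky hk]] := ac_near_set hx Uy (filterI nf e).
have [q [qy hq]] := ac_near_set hx Uy (regular_neq0 (regular_poly B hx Uy) By).
have JA : J (A * (k * q)).
  move=> u Uu Du; rewrite !mevalM; have [->|ku] := eqVneq (meval (x u) k) 0; first by rewrite mul0r mulr0.
  have [->|qu] := eqVneq (meval (x u) q) 0; first by rewrite !mulr0.
  have [fu0 fE] := hk u Uu ku; have Bu := hq u Uu qu.
  have := fu0 Du; rewrite fE => /eqP; rewrite mulf_eq0 invr_eq0 (negbTE Bu) orbF => /eqP ->.
  by rewrite mul0r.
have [c ec] := Js _ JA.
apply/germ_span1; exists (fun u => (\sum_(i < size s) meval (x u) (c i) * a i u) * (meval (x u) (k * q * B))^-1).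
  apply: regular_mul.
    by apply: regular_sum => i _; apply: regular_mul => //; exact: regular_poly hx Uy.
  by apply: regular_inv; [exact: regular_poly hx Uy|rewrite !mevalM !mulf_neq0].
have nk := regular_neq0 (regular_poly k hx Uy) ky; have nq := regular_neq0 (regular_poly q hx Uy) qy.
have nB := regular_neq0 (regular_poly B hx Uy) By.
near=> u.
have ku : meval (x u) k != 0 by near: u.
have qu : meval (x u) q != 0 by near: u.
have Bu : meval (x u) B != 0 by near: u.
have -> : f u = meval (x u) A / meval (x u) B by near: u.
have eu : forall i : 'I_(size s), meval (x u) s`_i = a i u * h u by near: u.
have S0 : meval (x u) (A * (k * q)) = (\sum_(i < size s) meval (x u) (c i) * a i u) * h u.
  rewrite ec raddf_sum mulr_suml; apply: eq_bigr => i _ /=.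
  by rewrite mevalM eu mulrA.
rewrite !mevalM in S0 *; rewrite mulrAC -S0; field.
by rewrite ku qu Bu.
Unshelve. all: by end_near. Qed.

Hypothesis smX : smooth X.

Lemma center_preimage_irreducible (W : set X) : irreducible W -> irreducible (@arc_center _ _ @^-1` W : set arc).
Proof.
move=> iW.
have exarc y : exists g : arc, arc_center g = y.
  have [O [d [w [D [Oy hC]]]]] := chart_at smX y.
  have [|g [cg _]] := @arc_exists _ _ _ _ _ _ hC y (fun j => pcst (w j y)) Oy; last by exists g.
  by move=> j; rewrite /pcst.
rewrite (_ : _ @^-1` W = truncate 0 @^-1` [set j : jet X 0 | W (jet_center j)]); last by apply/seteqP; split.
apply: (truncate_preimage_irreducible smX); apply: irreducibleP.
  have [[y Wy] _] := iW; have [g cg] := exarc y; exists (truncate 0 g); by rewrite /= cg.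
have nb (A : set (jet X 0)) : open A -> [set j : jet X 0 | W (jet_center j)] `&` A !=set0 ->
    exists V, [/\ open V, W `&` V !=set0 & forall g : arc, V (arc_center g) -> A (truncate 0 g)].
  move=> oA [j [Wj Aj]]; have [p ep] := jet_lift smX j.
  have [U [N [x [hx Uj]]]] := affine_coord_at (jet_center j).
  have cp : arc_center p = jet_center j by rewrite -ep.
  pose Phi := [set q : arc | U (arc_center q)].
  have hc : arc_coord (fun q : arc => x (arc_center q)) Phi 1.
    apply: (@arc_coord_aff _ _ U N x _ _ _ 0 (fun l _ => l) hx) => // q l k Pq.
    by rewrite ord1 arc_coef0 //; exact: regular_coord hx Pq.
  have Pp : Phi p by rewrite /Phi /= cp.
  have Ap : A (truncate 0 p) by rewrite ep.
  have [h [hp H]] := jet_open_coord oA hc Pp Ap.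
  exists [set y | U y /\ meval (x y) h != 0]; split; first exact: ac_openD hx h.
    by exists (jet_center j); split; [exact: Wj|split; [exact: Uj|rewrite -cp]].
  by move=> g [Ug hg]; exact: H.
move=> A B oA oB /(nb A oA)[V1 [o1 m1 h1]] /(nb B oB)[V2 [o2 m2 h2]].
have [y [Wy [V1y V2y]]] := irreducible_meet iW o1 o2 m1 m2; have [g cg] := exarc y.
by exists (truncate 0 g); split; [rewrite /= cg|split; [apply: h1|apply: h2]; rewrite cg].
Qed.

End DivisorGeometry.

Section RationalDeterminant.
Variables (K : numClosedFieldType) (T : Type) (n : nat) (c : T -> 'I_n -> K) (Phi : set T) (p : T).

Lemma rat_prod (I : Type) (r : seq I) (F : I -> T -> K) : (forall i, rat_at c Phi p (F i)) ->
  rat_at c Phi p (fun q => \prod_(i <- r) F i q).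
Proof.
move=> h; elim: r => [|i r IH]; first by apply: rat_ext (rat_cst c Phi p 1) => q _; rewrite big_nil.
by apply: rat_ext (rat_mul (h i) IH) => q _; rewrite big_cons.
Qed.

Lemma rat_det m (F : T -> 'M[K]_m) : (forall i j, rat_at c Phi p (fun q => F q i j)) ->
  rat_at c Phi p (fun q => \det (F q)).
Proof.
move=> h; apply: rat_sum => s; apply: rat_mul; first exact: rat_cst.
by apply: rat_prod => i; exact: h.
Qed.

Lemma rat_mulmx m1 m2 m3 (F : T -> 'M[K]_(m1, m2)) (G : T -> 'M[K]_(m2, m3)) :
  (forall i j, rat_at c Phi p (fun q => F q i j)) -> (forall i j, rat_at c Phi p (fun q => G q i j)) ->
  forall i j, rat_at c Phi p (fun q => (F q *m G q) i j).
Proof.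
move=> hF hG i j; apply: rat_ext (rat_sum _ (fun l => rat_mul (hF i l) (hG l j))) => q _.
by rewrite mxE.
Qed.

End RationalDeterminant.

Lemma rank_factor (K : fieldType) m n (A : 'M[K]_(m, n)) :
  exists (L : 'M[K]_(\rank A, m)) (R : 'M[K]_(n, \rank A)), L *m A *m R = 1%:M.
Proof.
exists (pinvmx (col_base A)), (pinvmx (row_base A)).
have -> : pinvmx (col_base A) *m A *m pinvmx (row_base A) =
    pinvmx (col_base A) *m (col_base A *m row_base A) *m pinvmx (row_base A) by rewrite mulmx_base.
rewrite mulmxA mulVpmx ?col_base_full // mul1mx mulmxVp //.
exact: row_base_free.
Qed.

Lemma closure_setI_sub (T : topologicalType) (A S : set T) : closure (closure A `&` S) `<=` closure A.
Proof.
have h := iffLR (closure_id _) (@closed_closure T A).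
by rewrite [X in _ `<=` X]h; apply: closureS => ? [].
Qed.

Section ContactChain.
Variables (K : numClosedFieldType) (X X' : variety K) (mu : X' -> X).
Hypotheses (hmu : morphism_on setT mu) (smX' : smooth X').
Variables (N' : nat) (E : 'I_N' -> set X') (k : 'I_N' -> nat) (i : 'I_N').
Hypotheses (rcan : relative_canonical mu E k) (clE : forall l, closed (E l)) (iE : irreducible (E i)).
Variables (U : set X) (N : nat) (x : X -> 'I_N -> K).
Variables (O : set X) (d : nat) (w : 'I_d -> X -> K) (D : 'I_d -> (X -> K) -> X -> K).
Hypotheses (hx : aff_coord U x) (hC : chart O w D).
Variables (U' : set X') (L : nat) (x' : X' -> 'I_L -> K).
Variables (V' : set X') (z : 'I_d -> X' -> K) (D' : 'I_d -> (X' -> K) -> X' -> K) (j1 : 'I_d).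
Hypotheses (hx' : aff_coord U' x') (hC' : chart V' z D').
Variables (m : nat).
Local Notation arc := (formal_arc X').
Local Notation n := #|chart_index L d m.+1|.
Local Notation c := (arc_chart_coord x' z (M := m.+1)).
Local Notation cc := (arc_chart_coord x w (M := m)).
(** The coordinates of the image together with the coefficients of orders 0 to [m] of each
    [w p \o mu]; combinations of the latter are the functions whose independence is shown. *)
Definition ext_index : finType := (chart_index N d m + 'I_d * 'I_m.+1)%type.
Definition ext_coord (q : arc) (a : 'I_#|ext_index|) : K :=
  match enum_val a with inl b => cc (push hmu q) (enum_rank b) | inr (p, e) => arc_coef q (w p \o mu) e end.
Variables (beta : mpoly n K) (Pn Qn : 'I_#|ext_index| -> mpoly n K).

(** By [hbeta], [beta] selects arcs through a general point of [E i] that cross it transversally.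
    Being a single polynomial, it makes the set principal open among the arcs centered on [E i]. *)
Definition contact_arcs : set arc := [set q | over_chart U' V' q /\ E i (arc_center q) /\ meval (c q) beta != 0].
Local Notation Phi := contact_arcs.

Hypothesis hbeta : forall y u, U' y -> meval (chart_coord x' (M := m.+1) y u) beta != 0 ->
  [/\ V' y, U (mu y) /\ O (mu y), forall l, l != i -> ~ E l y,
      E i y -> local_equation y (E i) (z j1) & u j1 1%N != 0].
Hypothesis hrep : forall q a, Phi q -> meval (c q) (Qn a) != 0 /\
  ext_coord q a * meval (c q) (Qn a) = meval (c q) (Pn a).
Variable p0 : arc.
Hypothesis Pp0 : Phi p0.

Let PU q : Phi q -> U' (arc_center q). Proof. by move=> [[]]. Qed.
Let PV q : Phi q -> V' (arc_center q). Proof. by move=> [[]]. Qed.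
Let PE q : Phi q -> E i (arc_center q). Proof. by move=> [_ []]. Qed.
Let Pb q : Phi q -> meval (c q) beta != 0. Proof. by move=> [_ []]. Qed.
Let PX q : Phi q -> U (mu (arc_center q)) /\ O (mu (arc_center q)).
Proof. by move=> Pq; have [] := hbeta (PU Pq) (Pb Pq). Qed.
Let Pleq q : Phi q -> local_equation (arc_center q) (E i) (z j1).
Proof. by move=> Pq; have [_ _ _ + _] := hbeta (PU Pq) (Pb Pq); apply; exact: PE. Qed.
Let rw q p : Phi q -> regular (arc_center q) (w p \o mu).
Proof. by move=> Pq; apply: (morphism_regular hmu); have [_ Oq] := PX Pq; exact: (ch_reg hC p Oq). Qed.
Let rz q l : Phi q -> regular (arc_center q) (z l).
Proof. by move=> Pq; exact: (ch_reg hC' l (PV Pq)). Qed.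
Let z0 q : Phi q -> z j1 (arc_center q) = 0.
Proof. by move=> Pq; exact: (nbhs_singleton (local_equation_vanish (Pleq Pq)) (PE Pq)). Qed.

Lemma contact_coord : arc_coord c Phi m.+2.
Proof. by apply: (chart_arc_coord hx' hC') => q Pq; split; [exact: PU|exact: PV]. Qed.

Lemma contact_ord q : Phi q -> pord (arc_ser q (z j1)) 1.
Proof.
move=> Pq; have [_ _ _ _ h1] := hbeta (PU Pq) (Pb Pq); split; last exact: h1.
by move=> e; rewrite ltnS leqn0 => /eqP->; rewrite ser0 ?z0 //; exact: rz.
Qed.

Definition contact_eqn (l : 'I_N') : X' -> K := if l == i then z j1 else fun=> 1.

Lemma contact_eqnP q l : Phi q -> local_equation (arc_center q) (E l) (contact_eqn l).
Proof.
move=> Pq; rewrite /contact_eqn; case: eqP => [->|/eqP li]; first exact: Pleq.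
by apply: local_equation_out => //; have [_ _ h _ _] := hbeta (PU Pq) (Pb Pq); exact: h.
Qed.

Lemma contact_eqn_ord q r : Phi q -> pord (eqn_ser q contact_eqn r) (r i).
Proof.
move=> Pq; rewrite (_ : r i = \sum_l (if l == i then 1 * r l else 0))%N; last first.
  by rewrite -big_mkcond big_pred1_eq mul1n.
apply: pord_prod => l _; rewrite /contact_eqn; case: eqP => _; first exact: pordX (contact_ord Pq).
rewrite ser_cst (_ : pcst 1 = 1) ?expr1n; first exact: pord1.
by apply/funext.
Qed.

Lemma contact_irreducible : irreducible Phi.
Proof.
have -> : Phi = (@arc_center _ _ @^-1` E i : set arc) `&`
    [set g | over_chart U' V' g /\ meval (c g) beta != 0].
  by apply/seteqP; split=> q; [move=> [h1 [h2 h3]]|move=> [h2 [h1 h3]]].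
apply: irreducible_setI_open; first exact: center_preimage_irreducible.
  exact: (arc_chart_open hx' hC').
by exists p0; split; [exact: PE|split; [have [] := Pp0|exact: Pb]].
Qed.

Section Directions.
Variable q : arc.
Hypothesis Pq : Phi q.
Local Notation y := (arc_center q).

(** Functions of the center only see the part of [v] along the affine coordinates, and there [v]
    acts as the derivation [Dn]. *)
Lemma center_dder (v : 'I_n -> K) Dn f : derivation_at y Dn ->
  (forall P, (forall q', Phi q' -> meval (c q') P = 0) -> dirpoly c q v P = 0) ->
  (forall l, v (enum_rank (inl l : chart_index L d m.+1)) = Dn (fun u => x' u l) y) ->
  regular y f -> dder c Phi q v (fun q' => f (arc_center q')) = Dn f y.
Proof.
move=> hD tan vE rf; have Uy := PU Pq.
pose i0 (l : 'I_L) := enum_rank (inl l : chart_index L d m.+1).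
have c0 q' l : Phi q' -> c q' (i0 l) = x' (arc_center q') l.
  by move=> _; rewrite /arc_chart_coord /chart_coord enum_rankK.
have poly P : dder c Phi q v (fun q' => meval (x' (arc_center q')) P) = Dn (fun u => meval (x' u) P) y.
  have rx l : regular y (fun u => x' u l) := regular_coord l hx' Uy.
  have [_ ->] := derivation_meval P hD rx.
  rewrite (@dder_meval _ _ _ _ _ _ v Pq tan _ (fun l q' => x' (arc_center q') l)) => [|l].
    apply: eq_bigr => l _; rewrite -vE -(dder_coord Pq tan); congr (_ * _).
    apply: (dder_ext Pq tan) => [q' Pq'|]; first by rewrite -c0.
    by apply: rat_ext (rat_poly c Phi q (mpolyX K (mnm1 (i0 l)))) => q' Pq'; rewrite mevalXU.
  by apply: rat_ext (rat_poly c Phi q (mpolyX K (mnm1 (i0 l)))) => q' Pq'; rewrite mevalXU c0.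
have [A [B [By e]]] := (ac_reg hx' _ Uy).1 rf.
have rB : regular y (fun u => meval (x' u) B) := regular_poly B hx' Uy.
have rA : regular y (fun u => meval (x' u) A) := regular_poly A hx' Uy.
have nB := regular_neq0 rB By.
have e' : \forall u \near y, f u * meval (x' u) B = meval (x' u) A.
  near=> u; rewrite (_ : f u = meval (x' u) A / meval (x' u) B); last by near: u.
  by rewrite divfK //; near: u.
have ratc (g : X' -> K) : regular y g -> rat_at c Phi q (fun q' => g (arc_center q')).
  by move=> rg; exact: (rat_center hx' PU c0 Pq rg).
have [h [hq H]] := acc_near contact_coord Pq e'.
have E1 : dder c Phi q v (fun q' => f (arc_center q') * meval (x' (arc_center q')) B) =
    dder c Phi q v (fun q' => meval (x' (arc_center q')) A).
  by apply: (dder_local Pq tan hq) => //; exact: ratc _ rA.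
rewrite (dder_mul Pq tan (ratc _ rf) (ratc _ rB)) !poly in E1.
have E2 : Dn (fun u => f u * meval (x' u) B) y = Dn (fun u => meval (x' u) A) y.
  by apply: (derivation_germ hD _ e'); exact: regular_mul.
rewrite (derivation_mul hD rf rB) -E1 in E2.
by apply: (mulfI By); apply: (addrI (f y * Dn (fun u => meval (x' u) B) y)).
Unshelve. all: by end_near. Qed.

(** A deformation of [q] may leave the locus where [beta] is non-zero. The product with [beta]
    vanishes there as well, and [beta] is cancelled at [q]. *)
Lemma dirpoly_beta v P : dirpoly c q v (P * beta) = 0 -> meval (c q) P = 0 -> dirpoly c q v P = 0.
Proof.
move=> h1 h2; move: h1; rewrite dirpolyM h2 mul0r addr0 => /eqP.
by rewrite mulf_eq0 (negbTE (Pb Pq)) orbF => /eqP.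
Qed.

Lemma mkarc y' (b : 'I_d -> pser K) : V' y' -> exists q', arc_center q' = y' /\
  forall l e, arc_coef q' (z l) e.+1 = b l e.+1.
Proof.
move=> Vy'; have [|q' [cq eq]] := @arc_exists _ _ _ _ _ _ hC' y'
  (fun l e => if e is 0 then z l y' else b l e) Vy'; first by [].
by exists q'; split=> // l e; rewrite eq.
Qed.

Lemma fibre_tangent (l : 'I_d) (e : 'I_m.+1) P : (forall q', Phi q' -> meval (c q') P = 0) ->
  dirpoly c q (fun a => (a == enum_rank (inr (l, e) : chart_index L d m.+1))%:R) P = 0.
Proof.
move=> nP; apply: dirpoly_beta; last exact: nP.
apply: line_deriv => s; rewrite mevalM.
have [q' [cq eq]] := mkarc (fun l' => arc_ser q (z l') + pcst (s * (l' == l)%:R) * pX K e.+1) (PV Pq).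
have cE : c q' = fun a => c q a + s * (a == enum_rank (inr (l, e) : chart_index L d m.+1))%:R.
  apply/funext => a; rewrite -[a in a == _]enum_valK (inj_eq enum_rank_inj).
  rewrite /arc_chart_coord /chart_coord cq; case: (enum_val a) => [i'|[l' e']] /=; first by rewrite mulr0 addr0.
  rewrite eq pserD pcstM /pX eqSS -[(inr _ == inr _)]/((l', e') == (l, e)) xpair_eqE -mulrA -natrM mulnb.
  by [].
rewrite -cE; have [->|bq] := eqVneq (meval (c q') beta) 0; first by rewrite mulr0.
rewrite nP ?mul0r //; split; first by rewrite /over_chart /= cq; split; [exact: PU|exact: PV].
by rewrite cq; split=> //; exact: PE.
Qed.

(** Functions vanishing on [E i] are multiples of [z j1], so the derivations [D' l] with [l != j1]
    kill them along [E i]: in these directions the center can be moved without leaving [E i]. *)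
Lemma center_tangent (l : 'I_d) P : l != j1 -> (forall q', Phi q' -> meval (c q') P = 0) ->
  dirpoly c q (fun a => match enum_val a : chart_index L d m.+1 with
    | inl i' => D' l (fun u => x' u i') y | inr _ => 0 end) P = 0.
Proof.
move=> lj nP; apply: dirpoly_beta; last exact: nP.
have Uy := PU Pq; have Vy := PV Pq; have hD := ch_der hC' l Vy.
pose g (a : 'I_n) (u : X') : K := match enum_val a with inl i' => x' u i' | inr (l', e) => arc_coef q (z l') e.+1 end.
have rg a : regular y (g a).
  rewrite /g; case: (enum_val a) => [i'|[l' e]]; [exact: regular_coord hx' Uy|exact: regular_cst].
have [rf ef] := derivation_meval (P * beta) hD rg.
have -> : dirpoly c q (fun a => match enum_val a : chart_index L d m.+1 with
    | inl i' => D' l (fun u => x' u i') y | inr _ => 0 end) (P * beta) = D' l (fun u => meval (g ^~ u) (P * beta)) y.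
  have ec : g ^~ y = c q.
    by apply/funext => a'; rewrite /g /arc_chart_coord /chart_coord; case: (enum_val a') => [|[]].
  rewrite ef ec; apply: eq_bigr => a _; congr (_ * _).
  rewrite /g; case: (enum_val a) => [i'|[l' e]] //; by rewrite (derivation_cst hD).
have nE : \forall u \near y, E i u -> meval (g ^~ u) (P * beta) = 0.
  have nU : \forall u \near y, U' u by apply: open_nbhs_nbhs; split=> //; exact: ac_open hx'.
  have nV := chart_near hC' Vy.
  near=> u => Eu; have Uu : U' u by near: u.
  have Vu : V' u by near: u.
  have [q' [cq eq]] := mkarc (fun l' => arc_ser q (z l')) Vu.
  have -> : g ^~ u = c q'.
    apply/funext => a; rewrite /g /arc_chart_coord /chart_coord cq.
    by case: (enum_val a) => [|[l' e]] //; rewrite eq.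
  rewrite mevalM; have [->|bq] := eqVneq (meval (c q') beta) 0; first by rewrite mulr0.
  by rewrite nP ?mul0r //; split; rewrite /over_chart /= cq.
have [a ra ea] := local_equation_div (Pleq Pq) rf nE.
rewrite (derivation_germ hD rf ea) (derivation_mul hD ra (rz j1 Pq)) (ch_dual hC') //.
by rewrite (negbTE lj) mulr0 z0 // mul0r addr0.
Unshelve. all: by end_near. Qed.

(** The Jacobian matrix with the row of [z j1] multiplied by [t]: the center stays on [E i], so a
    tangent vector moves [z j1] by a multiple of [t]. This factor accounts for the 1 in
    [k i + 1]. *)
Definition contact_mx : 'M[pser K]_d := \matrix_(l, p) (pX K (l == j1) * arc_ser q (D' l (w p \o mu))).

Lemma pact_delta (B : 'M[pser K]_d) l (e : 'I_m.+1) p (e' : 'I_m.+1) :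
  pmx m.+1 m.+1 B (mxvec_index l e) (mxvec_index p e') = (pX K e * B l p) e'.
Proof.
have -> : pmx m.+1 m.+1 B (mxvec_index l e) (mxvec_index p e') = row (mxvec_index l e) (pmx m.+1 m.+1 B) 0 (mxvec_index p e').
  by rewrite [RHS]mxE.
rewrite rowE mul_rV_lin vec_mx_delta mxvecE mxE (bigD1 l) //= big1 ?addr0 => [|i' il].
  apply: (congr1 (fun a : pser K => a e')); congr (_ * _); apply/funext => e2.
  rewrite /prow; case: insubP => [e3 _ <-|]; first by rewrite mxE eqxx.
  by rewrite -leqNgt => me; rewrite /pX gtn_eqF // (leq_trans (ltn_ord e)).
rewrite (_ : prow _ i' = 0) ?mul0r //; apply/funext => e2.
by rewrite /prow; case: insubP => // e3 _ _; rewrite mxE (negbTE il).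
Qed.

Lemma zero_derivation : derivation_at y (fun _ _ => 0 : K).
Proof.
split=> [f _|f g _ _|u|f g _ _|f g _ _]; [exact: regular_cst|by near=> u|by near=> u'| |].
  by near=> u; rewrite addr0.
by near=> u; rewrite !mulr0 addr0.
Unshelve. all: by end_near. Qed.

Lemma contact_tangent_row b : exists v, (forall P, (forall q', Phi q' -> meval (c q') P = 0) -> dirpoly c q v P = 0) /\
  forall p (e : 'I_m.+1), dder c Phi q v (fun q' => arc_coef q' (w p \o mu) e) =
    pmx m.+1 m.+1 contact_mx b (mxvec_index p e).
Proof.
(* The direction is [t^f] in the parameter [z l]. For [f = 0] it moves the center, otherwise the
   coefficient of order [f]; the shift for [j1] excludes moving the center off [E i]. *)
case/mxvec_indexP: b => l e0; pose f := (e0 + (l == j1))%N.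
suff [v [tan hz]] : exists v, (forall P, (forall q', Phi q' -> meval (c q') P = 0) -> dirpoly c q v P = 0) /\
    forall l', peq m.+2 (arc_der c Phi q v (z l')) (pcst (l' == l)%:R * pX K f).
  exists v; split=> // p e.
  have hE := arc_der_mder contact_coord Pq tan.
  have eM : (e < m.+2)%N by apply: leqW.
  rewrite -[LHS]/(arc_der c Phi q v (w p \o mu) e) (mder_chart hC' (PV Pq) (arc_mhom q _) hE (rw p Pq) eM).
  rewrite pact_delta mxE mulrA pXD -/f.
  have -> : pX K f * arc_ser q (D' l (w p \o mu)) =
      \sum_l' arc_ser q (D' l' (w p \o mu)) * (pcst (l' == l)%:R * pX K f).
    rewrite (bigD1 l) //= eqxx rmorph1 mul1r big1 ?addr0 1?mulrC // => l' /negbTE->.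
    by rewrite rmorph0 mul0r mulr0.
  by apply: peq_sum eM => l' _; exact: peqM.
have coefS v l' e : (forall P, (forall q', Phi q' -> meval (c q') P = 0) -> dirpoly c q v P = 0) ->
    arc_der c Phi q v (z l') (nat_of_ord (e : 'I_m.+1)).+1 = v (enum_rank (inr (l', e) : chart_index L d m.+1)).
  move=> tan; rewrite -(dder_coord Pq tan); congr dder; apply/funext => q'.
  by rewrite /arc_chart_coord /chart_coord enum_rankK.
have coef0 v l' Dn : derivation_at y Dn ->
    (forall P, (forall q', Phi q' -> meval (c q') P = 0) -> dirpoly c q v P = 0) ->
    (forall l, v (enum_rank (inl l : chart_index L d m.+1)) = Dn (fun u => x' u l) y) ->
    arc_der c Phi q v (z l') 0%N = Dn (z l') y.
  move=> hD tan vE; rewrite -(center_dder hD tan vE (rz l' Pq)); apply: (dder_ext Pq tan).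
    by move=> q' Pq'; rewrite arc_coef0 //; exact: rz.
  apply: (rat_center hx' PU (i0 := fun l => enum_rank (inl l : chart_index L d m.+1)) _ Pq (rz l' Pq)).
  by move=> q' l2 _; rewrite /arc_chart_coord /chart_coord enum_rankK.
case ef : f => [|e1].
  have lj : l != j1 by move: ef; rewrite /f; case: (l == j1) => //; rewrite addn1.
  pose v (a : 'I_n) := match enum_val a : chart_index L d m.+1 with
    | inl i' => D' l (fun u => x' u i') y | inr _ => 0 end.
  have tan P : (forall q', Phi q' -> meval (c q') P = 0) -> dirpoly c q v P = 0 by exact: center_tangent.
  exists v; split=> // l' [|e] eM; rewrite pcstM /pX.
    rewrite (coef0 v l' (D' l) (ch_der hC' l (PV Pq)) tan) => [|i']; last by rewrite /v enum_rankK.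
    by rewrite (ch_dual hC' l l' (PV Pq)) eqxx mulr1 eq_sym.
  by rewrite -[e]/(nat_of_ord (Ordinal (eM : (e < m.+1)%N))) coefS // /v enum_rankK mulr0.
have e1m : (e1 < m.+1)%N.
  by rewrite -ef /f; have := ltn_ord e0; case: (l == j1) => h; rewrite ?addn1 // addn0 ltnW.
pose v (a : 'I_n) : K := (a == enum_rank (inr (l, Ordinal e1m) : chart_index L d m.+1))%:R.
have tan P : (forall q', Phi q' -> meval (c q') P = 0) -> dirpoly c q v P = 0 by exact: fibre_tangent.
exists v; split=> // l' [|e] eM; rewrite pcstM /pX.
  rewrite (coef0 v l' _ zero_derivation tan) ?mulr0 // => i'.
  by rewrite /v (inj_eq enum_rank_inj).
have eM' : (e < m.+1)%N by [].
rewrite -[e in LHS]/(nat_of_ord (Ordinal eM')) coefS // /v (inj_eq enum_rank_inj).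
by rewrite -[(inr _ == inr _)]/((l', Ordinal eM') == (l, Ordinal e1m)) xpair_eqE -natrM mulnb eqSS.
Qed.

Lemma contact_mx_ord : pord (\det contact_mx) (k i).+1.
Proof.
have [_ Oq] := PX Pq.
have -> : contact_mx = diag_mx (\row_l pX K (l == j1)) *m jacobian mu q D' w.
  by apply/matrixP => l p; rewrite mul_diag_mx !mxE.
have [u u0 eJ] := jacobian_order hmu (fun l => contact_eqnP l Pq) hC' hC (PV Pq) Oq rcan.
rewrite det_mulmx det_diag eJ; apply: (@pordM _ _ _ 1 (k i)).
  have h : pord (\prod_l (\row_l pX K (l == j1)) 0 l) (\sum_(l < d) (l == j1))%N.
    by apply: pord_prod => l _; rewrite mxE; exact: pord_pX.
  by move: h; rewrite -big_mkcond /= big_pred1_eq.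
by apply: (@pordM _ _ _ 0 (k i)); [split|exact: contact_eqn_ord].
Qed.

End Directions.

Definition ext_row (q : arc) : 'rV[K]_(d * m.+1) := mxvec (\matrix_(p, e) arc_coef q (w p \o mu) e).

Lemma ext_row_rat q b : Phi q -> rat_at c Phi q (fun q' => ext_row q' 0 b).
Proof.
move=> Pq; case/mxvec_indexP: b => p e.
apply: rat_ext (acc_rat contact_coord Pq (rw p Pq) (leqW (ltn_ord e))) => q' _.
by rewrite /ext_row mxvecE mxE.
Qed.

(** [R] picks combinations of the coefficients that have, along suitable tangent vectors, an
    invertible matrix of derivatives at [p0]. Irreducibility of the family makes it invertible at
    general arcs, as the Jacobian criterion requires. *)
Lemma contact_indep : exists r (R : 'M[K]_(d * m.+1, r)), (d * m.+1 <= r + (k i).+1)%N /\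
  alg_indep Phi (fun j q => (ext_row q *m R) 0 j).
Proof.
have hr := pmx_rank_ge m.+1 (contact_mx_ord Pp0).
have [Lm [R LR]] := rank_factor (pmx m.+1 m.+1 (contact_mx p0)).
exists (\rank (pmx m.+1 m.+1 (contact_mx p0))), R; split=> //.
pose wq q := Lm *m pmx m.+1 m.+1 (contact_mx q) *m R.
have rg q j : Phi q -> rat_at c Phi q (fun q' => (ext_row q' *m R) 0 j).
  by move=> Pq; apply: rat_mulmx => [a b|a b]; [rewrite ord1; exact: ext_row_rat|exact: rat_cst].
have rpm q b b' : Phi q -> rat_at c Phi q (fun q' => pmx m.+1 m.+1 (contact_mx q') b b').
  move=> Pq; case/mxvec_indexP: b => l e; case/mxvec_indexP: b' => p e'.
  have rD : regular (arc_center q) (D' l (w p \o mu)) by apply: (chart_der_reg hC' _ (PV Pq)); exact: rw.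
  pose f := (e + (l == j1))%N.
  apply: (@rat_ext _ _ _ _ _ _ _ (fun q' => if (e' < f)%N then 0 else arc_coef q' (D' l (w p \o mu)) (e' - f)%N)).
    by move=> q' _; rewrite pact_delta mxE mulrA pXD pXM.
  case: (e' < f)%N; first exact: rat_cst.
  by apply: (acc_rat contact_coord Pq rD); apply: leq_ltn_trans (leq_subr _ _) (leqW (ltn_ord e')).
apply: (@indep_of_tangents _ _ _ _ _ wq); first by exists p0.
- move=> H nH q Pq i'.
  have row0 b : \sum_j meval (fun j => (ext_row q *m R) 0 j) (mderiv j H) * (pmx m.+1 m.+1 (contact_mx q) *m R) b j = 0.
    have [v [tan hv]] := contact_tangent_row Pq b.
    have dg j : dder c Phi q v (fun q' => (ext_row q' *m R) 0 j) = (pmx m.+1 m.+1 (contact_mx q) *m R) b j.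
      have rY b' := ext_row_rat b' Pq.
      have e1 : dder c Phi q v (fun q' => (ext_row q' *m R) 0 j) =
          dder c Phi q v (fun q' => \sum_b' ext_row q' 0 b' * R b' j).
        by congr dder; apply/funext => q'; rewrite mxE.
      rewrite e1 (dder_sum Pq tan) => [|b']; last by apply: rat_mul => //; exact: rat_cst.
      rewrite mxE; apply: eq_bigr => b' _.
      rewrite (dder_mul Pq tan (rY b') (rat_cst _ _ _ _)) (dder_cst Pq tan) mulr0 add0r mulrC; congr (_ * _).
      case/mxvec_indexP: b' rY => p e _; rewrite -hv; congr dder; apply/funext => q'.
      by rewrite /ext_row mxvecE mxE.
    under eq_bigr do rewrite -dg.
    rewrite -(dder_meval Pq tan H (fun j => rg q j Pq)) -(dder_cst Pq tan 0).
    by apply: (dder_ext Pq tan) => [q' Pq'|]; [exact: nH|exact: rat_cst].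
  have -> : \sum_j meval (fun j => (ext_row q *m R) 0 j) (mderiv j H) * wq q i' j =
      \sum_b Lm i' b * \sum_j meval (fun j => (ext_row q *m R) 0 j) (mderiv j H) * (pmx m.+1 m.+1 (contact_mx q) *m R) b j.
    under [RHS]eq_bigr do rewrite mulr_sumr.
    rewrite exchange_big; apply: eq_bigr => j _ /=.
    rewrite /wq -mulmxA [X in _ * X]mxE mulr_sumr; apply: eq_bigr => b _; by rewrite mulrCA.
  by rewrite big1 // => b _; rewrite row0 mulr0.
- move=> H nH q Pq; apply/eqP/negPn/negP => Hq.
  have rH : rat_at c Phi q (fun q' => meval (fun j => (ext_row q' *m R) 0 j) H).
    by apply: (rat_meval (F := fun j q' => (ext_row q' *m R) 0 j)) => j; exact: rg.
  have rdet : rat_at c Phi p0 (fun q' => \det (wq q')).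
    apply: rat_det => a b; apply: rat_mulmx => [a1 b1|a1 b1]; last exact: rat_cst.
    by apply: rat_mulmx => [a2 b2|a2 b2]; [exact: rat_cst|exact: rpm].
  have d0 : \det (wq p0) != 0 by rewrite /wq LR det1 oner_neq0.
  have [h1 [h1q H1]] := rat_neq0 Pq rH Hq; have [h2 [h2q H2]] := rat_neq0 Pp0 rdet d0.
  have [q' [Pq' [[_ a1] [_ a2]]]] := irreducible_meet contact_irreducible (arc_chart_open hx' hC' h1)
    (arc_chart_open hx' hC' h2) (ex_intro _ q (conj Pq (conj Pq.1 h1q))) (ex_intro _ p0 (conj Pp0 (conj Pp0.1 h2q))).
  by have := H1 q' Pq' a1; rewrite nH ?eqxx //; exact: H2.
Qed.

(** On the family the image coordinates are fractions in [c]; listing them separately turns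
    conditions on the image into polynomial ones. *)
Definition full_coord (q : arc) : 'I_(n + #|ext_index|) -> K := vcat (c q) (ext_coord q).

Lemma full_rat q a : Phi q -> rat_at c Phi q (fun q' => full_coord q' a).
Proof.
move=> Pq; rewrite /full_coord /vcat; case: (split a) => b.
  by apply: rat_ext (rat_poly c Phi q (mpolyX K (mnm1 b))) => q' _; rewrite mevalXU.
exists (Pn b), (Qn b); split; first by have [] := hrep b Pq.
by move=> q' Pq' _; have [] := hrep b Pq'.
Qed.

Lemma full_prime : poly_prime (full_coord @` Phi).
Proof.
split; first by exists (full_coord p0), p0.
move=> P Q PQ; apply: contrapT => /not_orP[/existsNP[_ /not_implyP[[q1 Pq1 <-] /eqP h1]]].
move=> /existsNP[_ /not_implyP[[q2 Pq2 <-] /eqP h2]].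
have rP q R : Phi q -> rat_at c Phi q (fun q' => meval (full_coord q') R).
  by move=> Pq; apply: (rat_meval (F := fun a q' => full_coord q' a)) => a; exact: full_rat.
have [g1 [g1q G1]] := rat_neq0 Pq1 (rP q1 P Pq1) h1; have [g2 [g2q G2]] := rat_neq0 Pq2 (rP q2 Q Pq2) h2.
have [q [Pq [[_ a1] [_ a2]]]] := irreducible_meet contact_irreducible (arc_chart_open hx' hC' g1)
  (arc_chart_open hx' hC' g2) (ex_intro _ q1 (conj Pq1 (conj Pq1.1 g1q))) (ex_intro _ q2 (conj Pq2 (conj Pq2.1 g2q))).
have /eqP := PQ (full_coord q) (ex_intro2 _ _ q Pq erefl).
by rewrite mevalM mulf_eq0 (negbTE (G1 q Pq a1)) (negbTE (G2 q Pq a2)).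
Qed.

Lemma full_left q P : meval (full_coord q) (subst_poly (lshift #|ext_index|) P) = meval (c q) P.
Proof. by rewrite meval_subst; congr (meval _ P); apply/funext => a; rewrite /full_coord vcatl. Qed.

(** A point of the closure with [beta] non-zero comes from an arc of the family: its center exists
    because the image of the affine piece is closed, it lies on the closed set [E i], and
    [arc_exists] realises any higher coefficients. *)
Lemma full_zopen : zopen_in (full_coord @` Phi) (subst_poly (lshift #|ext_index|) beta).
Proof.
split=> [_ [q Pq <-]|p np bp]; first by rewrite full_left; exact: Pb.
pose ul a := p (lshift #|ext_index| a).
pose ux l := ul (enum_rank (inl l : chart_index L d m.+1)).
have nul P : (forall q, Phi q -> meval (x' (arc_center q)) P = 0) -> meval ux P = 0.
  move=> nP; have := np (subst_poly (fun l => lshift #|ext_index| (enum_rank (inl l : chart_index L d m.+1))) P).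
  rewrite meval_subst; apply => _ [q Pq <-]; rewrite meval_subst -(nP q Pq); congr (meval _ P).
  by apply/funext => l; rewrite /full_coord vcatl /arc_chart_coord /chart_coord enum_rankK.
have [|y Uy ey] := ac_closed hx' (v := ux).
  by move=> P nP; apply: nul => q Pq; apply: nP; exact: PU.
pose u l : pser K := fun e => if e is e'.+1 then
  (if insub e' is Some e2 then ul (enum_rank (inr (l, e2) : chart_index L d m.+1)) else 0) else z l y.
have eu : chart_coord x' y u = ul.
  apply/funext => a; rewrite /chart_coord -[in RHS](enum_valK a); case: (enum_val a) => [l|[l e]].
    by rewrite ey.
  by rewrite /u valK.
have bu : meval (chart_coord x' (M := m.+1) y u) beta != 0 by move: bp; rewrite meval_subst eu.
have [Vy _ _ _ _] := hbeta Uy bu.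
have Ey : E i y.
  apply: contrapT => nE; have oE : open (~` E i) by rewrite openC; exact: clE.
  have [P [Py hP]] := ac_nbhs hx' Uy oE nE.
  move/eqP: Py; apply; rewrite ey; apply: nul => q Pq; apply/eqP/negPn/negP => hq.
  by apply: (hP _ (PU Pq) hq); exact: PE.
have [q [cq eq]] := mkarc u Vy.
have ecq : c q = ul.
  rewrite -eu; apply/funext => a; rewrite /arc_chart_coord /chart_coord cq.
  by case: (enum_val a) => [//|[l e]]; rewrite eq.
have Pq : Phi q.
  by split; [rewrite /over_chart /= cq|rewrite cq ecq; split=> //; rewrite -eu].
exists q => //; apply/funext => a; rewrite /full_coord.
rewrite -[a in RHS]splitK /vcat; case: (split a) => b /=; first by rewrite ecq.
have [Qb eb] := hrep b Pq; apply: (mulIf Qb); rewrite eb.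
have := np (mpolyX K (mnm1 (rshift n b)) * subst_poly (lshift #|ext_index|) (Qn b) - subst_poly (lshift #|ext_index|) (Pn b)).
rewrite mevalB mevalM mevalXU !meval_subst -/ul -ecq => h; apply/esym/eqP; rewrite -subr_eq0; apply/eqP; apply: h.
move=> _ [q' Pq' <-]; rewrite mevalB mevalM mevalXU !full_left /full_coord vcatr.
by have [_ ->] := hrep b Pq'; rewrite subrr.
Qed.

(** The flag of level sets of the independent functions is mapped to jets of [X]. Strictness
    survives closure, because the [j]-th function is a function of the image jet that is constant on
    one member but not on the preceding one. *)
Lemma contact_chain (S : set (jet X m)) : (forall q, Phi q -> S (truncate m (push hmu q))) ->
  exists r Zs, (d * m.+1 <= r + (k i).+1)%N /\ irred_chain S r Zs.
Proof.
move=> PS; have [r [R [rk ind]]] := contact_indep.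
have /choice[ub hub] : forall b : 'I_(d * m.+1), exists t : 'I_d * 'I_m.+1, mxvec_index t.1 t.2 = b.
  by move=> b; case/mxvec_indexP: b => p e; exists (p, e).
pose Lp j : mpoly (d * m.+1) K := \sum_b mpolyC _ (R b j) * mpolyX K (mnm1 b).
have LpE (f : 'I_(d * m.+1) -> K) j : meval f (Lp j) = \sum_b R b j * f b.
  by rewrite /Lp raddf_sum; apply: eq_bigr => b _ /=; rewrite mevalM mevalC mevalXU.
pose gp j := subst_poly (fun b => rshift n (enum_rank (inr (ub b) : ext_index))) (Lp j).
have gpE q j : meval (full_coord q) (gp j) = \sum_b R b j * arc_coef q (w (ub b).1 \o mu) (ub b).2.
  rewrite meval_subst LpE; apply: eq_bigr => b _; rewrite /full_coord vcatr /ext_coord enum_rankK.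
  by case: (ub b).
have indF : alg_indep (full_coord @` Phi) (fun j p => meval p (gp j)).
  move=> H hH; apply: ind => q Pq; rewrite -(hH (full_coord q)); last by exists q.
  congr (meval _ H); apply/funext => j; rewrite gpE mxE; apply: eq_bigr => b _.
  have e1 : ext_row q 0 b = arc_coef q (w (ub b).1 \o mu) (ub b).2.
    by rewrite /ext_row -[b in LHS]hub mxvecE mxE.
  by rewrite -e1 mulrC.
have [T [T0 hT Tle hc]] := irreducible_flag full_prime full_zopen indF.
pose A j : set (jet X m) := [set t | exists q, [/\ Phi q, T j (full_coord q) & truncate m (push hmu q) = t]].
have Tq j u : (j <= r)%N -> T j u -> exists2 q, Phi q & full_coord q = u by move=> jr; have [_ h] := hT j jr; exact: h.
have pushO q : Phi q -> over_chart U O (push hmu q) by exact: PX.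
have AS j : A j `<=` S by move=> _ [q [Pq _ <-]]; exact: PS.
have iA j : (j <= r)%N -> irreducible (A j).
  move=> jr; have [[[u0 Tu0] prT] _] := hT j jr.
  have nb (O1 : set (jet X m)) : open O1 -> A j `&` O1 !=set0 ->
      exists h, (exists2 u, T j u & meval u h != 0) /\
        forall q, Phi q -> meval (full_coord q) h != 0 -> O1 (truncate m (push hmu q)).
    move=> oO1 [_ [[q [Pq Tjq <-]] Oq]].
    have hcc : arc_coord cc (over_chart U O) m.+1 by exact: (chart_arc_coord hx hC).
    have [h [hq H]] := jet_open_coord oO1 hcc (pushO q Pq) Oq.
    pose h1 := subst_poly (fun b => rshift n (enum_rank (inl (enum_val b) : ext_index))) h.
    have h1E q' : meval (full_coord q') h1 = meval (cc (push hmu q')) h.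
      rewrite meval_subst; congr (meval _ h); apply/funext => b.
      by rewrite /full_coord vcatr /ext_coord enum_rankK enum_valK.
    exists h1; split; first by exists (full_coord q); rewrite ?h1E.
    by move=> q' Pq'; rewrite h1E; apply: H; exact: pushO.
  apply: irreducibleP.
    by have [q Pq eq] := Tq j u0 jr Tu0; exists (truncate m (push hmu q)), q; rewrite eq.
  move=> O1 O2 o1 o2 /(nb O1 o1)[h1 [[u1 T1 n1] H1]] /(nb O2 o2)[h2 [[u2 T2 n2] H2]].
  have [u Tu hu] : exists2 u, T j u & meval u (h1 * h2) != 0.
    apply: contrapT => none; have [|z1|z2] := prT h1 h2.
    { by move=> u Tu; apply/eqP/negPn/negP => nu; apply: none; exists u. }
    { by move/eqP: n1; apply; exact: z1. }
    { by move/eqP: n2; apply; exact: z2. }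
  have [q Pq eq] := Tq j u jr Tu; move: hu; rewrite mevalM mulf_eq0 negb_or -eq => /andP[a1 a2].
  exists (truncate m (push hmu q)); split; first by exists q; rewrite eq.
  by split; [exact: H1|exact: H2].
have Amono j : (j < r)%N -> A j.+1 `<=` A j.
  by move=> jr _ [q [Pq Tjq <-]]; exists q; split=> //; exact: Tle.
have Astrict (j : 'I_r) : ~ (A j `<=` closure (A j.+1)).
  have [u0 [hc1 [u Tu nu]]] := hc j.
  have [q Pq eq] := Tq j u (ltnW (ltn_ord j)) Tu.
  move=> /(_ (truncate m (push hmu q)) (ex_intro _ q (And3 Pq (eq_ind_r (T j) Tu eq) erefl))) cl.
  pose Hp := Lp j - mpolyC _ u0.
  pose f b (t : jet X m) := jet_coef t (w (ub b).1) (ub b).2.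
  have jF : jet_function O (fun t => meval (f ^~ t) Hp).
    by apply: jet_function_meval => b; apply: (jf_coef m) => y Oy; exact: (ch_reg hC).
  have oH := jet_function_open (ch_open hC) jF.
  have fE q' : Phi q' -> meval (f ^~ (truncate m (push hmu q'))) Hp = meval (full_coord q') (gp j) - u0.
    move=> Pq'; rewrite mevalB mevalC LpE gpE; congr (_ - _); apply: eq_bigr => b _; congr (_ * _).
    rewrite /f truncate_coef -1?ltnS // -[LHS]/(arc_ser (push hmu q') (w (ub b).1) (ub b).2) push_ser //.
    by have [_ Oq'] := PX Pq'; exact: (ch_reg hC).
  have [|t [[q' [Pq' Tq' <-]] [_]]] := cl _ (open_nbhs_nbhs (conj oH _)).
    by split; [have [_ Oq] := PX Pq; exact: Oq|rewrite fE // eq subr_eq0].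
  by rewrite fE // hc1 // subrr eqxx.
(* The flag decreases, hence the reversed index; closures are taken relative to [S]. *)
exists r, (fun i0 => closure (A (r - i0)%N) `&` S); split; [exact: rk|split].
- move=> i0 i0r; split.
    apply: irreducible_subclosure (iA (r - i0)%N (leq_subr _ _)) _ _ => [t At|t []//].
    by split; [exact: subset_closure|exact: AS At].
  split; first by move=> t [].
  move=> t [ct St]; split=> //.
  exact: closure_setI_sub ct.
- move=> i0 i0r; have e1 : (r - i0 = (r - i0.+1).+1)%N by rewrite -subSn // subSS.
  have lt : (r - i0.+1 < r)%N by rewrite -e1 leq_subr.
  split=> [t [ct St]|sub].
    by split=> //; move: t ct {St}; apply: closureS; rewrite e1; exact: Amono.
  apply: (Astrict (Ordinal lt)) => t At /=.
  have [] := sub t; last by rewrite e1.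
  by split; [exact: subset_closure|exact: AS At].
Qed.

End ContactChain.

(** * Contact ratios *)

Section CylinderOrders.
Variables (K : numClosedFieldType) (X : variety K).
Hypotheses (smX : smooth X) (iX : irreducible [set: X]).
Local Notation arc := (formal_arc X).
Implicit Types (C : set arc) (Y Z : subscheme X).

Definition generic_order C Y e := exists W : set arc,
  [/\ open W, cylinder (C `&` W), C `&` W !=set0 & forall g, (C `&` W) g -> arc_order g Y e].

(** The least [e] for which [C] meets the open set [contact_open Y e] is the order on the open part
    of [C] inside that set. *)
Lemma generic_order_ex C Y k : cylinder C -> C `&` contact_open Y k !=set0 -> exists e, generic_order C Y e.
Proof.
move=> cC hk; have ex : exists e, `[< C `&` contact_open Y e !=set0 >] by exists k; apply/asboolP.
have [e /asboolP he emin] := ex_minnP ex.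
exists e, (contact_open Y e); split=> //; first exact: contact_open_open.
  rewrite contact_openE -[jet_contact Y e]setIT; apply: cylinder_setI => //; first exact: jet_contact_open.
move=> g [Cg Wg]; apply/arc_orderE; split=> // l le hl.
have : (e <= l)%N by apply: emin; apply/asboolP; exists g.
by rewrite leqNgt le.
Qed.

Lemma generic_orderE C Y e : generic_order C Y e -> generic_order C Y (cylinder_order C Y).
Proof. by move=> he; exact: (xgetPex 0%N (ex_intro _ e he)). Qed.

(** If the stalk at [y] were zero, coherence would make the ideal zero near [y]; by irreducibility
    this neighbourhood meets the open set where a non-zero section of the ideal, defined near some
    other point, does not vanish. *)
Lemma proper_germ Y y : proper_subscheme Y -> exists2 f, ideal Y y f & ~ \forall u \near y, f u = 0.
Proof.
move=> [x [f [Yf nf]]]; apply: contrapT => none.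
have [n [b hb]] := ideal_coherent Y y.
have zb i : \forall u \near y, b i u = 0.
  apply: contrapT => nz; apply: none; exists (b i) => //.
  have [rb ->] := nbhs_singleton hb; exists 1%N, (fun=> fun=> 1), (fun=> b i); split.
    by move=> _; split; [exact: regular_cst|exists i].
  by apply: nearW => u; rewrite big_ord1 mul1r.
have nb : \forall u \near y, forall f', ideal Y u f' -> f' u = 0.
  have z2 : \forall u \near y, forall i, b i u = 0 by apply: filter_forall.
  near=> u => f'; have [rb ->] : (forall i, regular u (b i)) /\ ideal Y u = germ_span u (range b) by near: u.
  move=> [r [a [h [ah /nbhs_singleton ->]]]]; rewrite big1 // => i _.
  have [_ [l _ <-]] := ah i; rewrite (_ : b l u = 0) ?mulr0 //; move: l; near: u; exact: z2.
have [A [oA Ay hA]] := near_open nb.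
have [B [oB Bx hB]] := near_open (coherent_near Yf).
have [v [Bv fv]] : exists v, B v /\ f v != 0.
  apply: contrapT => nv; apply: nf; have nB : \forall u \near x, B u by exact: open_nbhs_nbhs.
  by apply: filterS nB => u Bu; apply/eqP/negPn/negP => fu; apply: nv; exists u.
have oBf : open [set u | B u /\ f u != 0].
  by apply: regular_setD_open => // u /hB[].
have [u [_ [Au [Bu fu]]]] := irreducible_meet iX oA oBf (ex_intro _ y (conj I Ay)) (ex_intro _ v (conj I (conj Bv fv))).
by move/eqP: fu; apply; apply: hA => //; have [_ +] := hB u Bu.
Unshelve. all: by end_near. Qed.

(** [arc_perturb] moves an arc of [C] inside [C] to one along which a section of the ideal is
    non-zero, so [cylinder_order] is a genuine order and not the default value. *)
Lemma generic_order_proper C Y : cylinder C -> C !=set0 -> proper_subscheme Y ->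
  generic_order C Y (cylinder_order C Y).
Proof.
move=> cC [g0 Cg0] pY; have [f Yf nf] := proper_germ (arc_center g0) pY.
have [m [S [_ eC]]] := cC.
have [g1 e1 [k hk]] := arc_perturb smX m (ideal_regular Yf) nf.
have [|e he] := @generic_order_ex C Y k cC; last exact: generic_orderE he.
exists g1; split; first by rewrite eC /preimage /= e1; move: Cg0; rewrite eC.
have c1 : arc_center g1 = arc_center g0 by have /(congr1 (@jet_center _ _ _)) := e1.
by exists f => //; rewrite c1.
Qed.

Lemma chain_exists m (S : set (jet X m)) : S !=set0 -> exists Zs, irred_chain S 0 Zs.
Proof.
move=> [t St]; exists (fun=> closure [set t] `&` S); split=> // i _; split.
  apply: irreducible_subclosure (irreducible_set1 t) _ _ => [_ ->|u []//].
  by split=> //; apply: subset_closure.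
split=> [u []//|u [cu Su]]; split=> //.
exact: closure_setI_sub cu.
Qed.

End CylinderOrders.

Section LowerBound.
Variables (K : numClosedFieldType) (X X' : variety K) (mu : X' -> X).
Hypotheses (smX : smooth X) (iX : irreducible [set: X]).
Variables (Y Z : subscheme X) (N' : nat) (E : 'I_N' -> set X') (r s k : 'I_N' -> nat).
Hypotheses (hres : log_resolution mu Y Z E r s k) (Zp : proper_subscheme Z) (Yp : proper_subscheme Y).
Variables (beta alpha : rat).
Hypothesis adm : forall i, alpha * (r i)%:R - beta * (s i)%:R <= (k i)%:R + 1.
Local Notation arc := (formal_arc X).
Implicit Types C : set arc.

(** The bound on chains makes [krull_dim S] a true maximum; applied to a longest chain it gives the
    inequality for the dimension itself. *)
Lemma krull_dim_cylinder C m (S : set (jet X m)) : cylinder C -> irreducible C -> C = truncate m @^-1` S ->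
  (exists Zs, irred_chain S (krull_dim S) Zs) /\
  (forall n Zs, irred_chain S n Zs -> (n <= krull_dim S)%N) /\
  exists nu : 'I_N' -> nat, [/\ (\sum_l nu l * r l = cylinder_order C Y)%N,
    (\sum_l nu l * s l = cylinder_order C Z)%N &
    (krull_dim S + \sum_l nu l * (k l).+1 <= m.+1 * krull_dim [set: X])%N].
Proof.
move=> cC iC eC; have [C0 _] := iC.
have [W [oW _ CW hW]] := generic_order_proper smX iX cC C0 Yp.
have [W2 [oW2 _ CW2 hW2]] := generic_order_proper smX iX cC C0 Zp.
have bound n Zs : irred_chain S n Zs -> exists nu : 'I_N' -> nat, [/\ (\sum_l nu l * r l = cylinder_order C Y)%N,
    (\sum_l nu l * s l = cylinder_order C Z)%N & (n + \sum_l nu l * (k l).+1 <= m.+1 * krull_dim [set: X])%N].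
  move=> hZ; apply: (cylinder_bound smX iX hres _ (openI oW oW2) _ _ hZ); rewrite -eC //.
    exact: irreducible_meet.
  by move=> g Cg [Wg W2g]; split; [exact: hW|exact: hW2].
have [||[Zs hZ] mx] := @max_natP [set n | exists Zs, irred_chain S n Zs] (m.+1 * krull_dim [set: X]).
{ have [g Cg] := C0; have [|Zs hZ] := @chain_exists _ _ m S; last by exists 0%N, Zs.
  by exists (truncate m g); move: Cg; rewrite eC. }
{ by move=> n [Zs /bound[nu [_ _ h]]]; exact: leq_trans (leq_addr _ _) h. }
split; first by exists Zs.
split; last exact: bound hZ.
by move=> n Zs' hZ'; apply: mx; exists Zs'.
Qed.

(** [codim] is computed from an unspecified presentation of [C]; the bounds on dimensions hold for
    every presentation, so in particular for that one. *)
Lemma codim_presentation C : cylinder C -> exists m (S : set (jet X m)), C = truncate m @^-1` S /\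
  codim C = (m.+1 * krull_dim [set: X])%:Z - (krull_dim S)%:Z.
Proof.
move=> [m [S [cS eC]]].
have [m' [S' [cS' eC' ec]]] := xgetPex (0 : int) (ex_intro (fun c : int => exists m (S : set (jet X m)),
    [/\ constructible S, C = truncate m @^-1` S & c = (m.+1 * krull_dim [set: X])%:Z - (krull_dim S)%:Z])
    _ (ex_intro _ m (ex_intro _ S (And3 cS eC erefl)))).
by exists m', S'.
Qed.

Lemma contact_ratio_ge C : cylinder C -> irreducible C -> (alpha%:E <= contact_ratio Y Z beta C)%E.
Proof.
move=> cC iC; rewrite /contact_ratio; case: eqP => [_|/eqP a0]; first exact: leey.
have [m [S [eC ->]]] := codim_presentation cC.
have [_ [_ [nu [sa sb le]]]] := krull_dim_cylinder cC iC eC.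
rewrite lee_fin ler_pdivlMr ?ltr0n ?lt0n // -lerBlDr -sa -sb !natr_sum !mulr_sumr -sumrB.
apply: (@le_trans _ _ (\sum_l nu l * (k l).+1)%N%:R).
  rewrite natr_sum; apply: ler_sum => l _; rewrite !natrM.
  have -> : alpha * ((nu l)%:R * (r l)%:R) - beta * ((nu l)%:R * (s l)%:R) =
     (nu l)%:R * (alpha * (r l)%:R - beta * (s l)%:R) by ring.
  by apply: ler_wpM2l => //; rewrite -natr1; exact: adm.
rewrite rmorphB /= -!pmulrn lerBrDr -natrD ler_nat addnC //.
Qed.

End LowerBound.

Section Components.
Variables (K : numClosedFieldType) (X : variety K).
Hypotheses (smX : smooth X) (iX : irreducible [set: X]).
Variables (Y : subscheme X) (Yp : proper_subscheme Y) (p : nat).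
Local Notation arc := (formal_arc X).

Lemma contact_locusE : exists A F : set (jet X p), [/\ open A, closed F & contact_locus p Y = truncate p @^-1` (A `&` F)].
Proof.
exists (jet_contact Y p), (\bigcap_(e : 'I_p) ~` (trunc_jet (ltnW (ltn_ord e)) @^-1` jet_contact Y e)); split.
{ exact: jet_contact_open. }
{ apply: closed_bigI => e _; apply: closedC_open; apply: open_comp; last exact: jet_contact_open.
  by move=> j _; exact: trunc_jet_continuous. }
apply/seteqP; split=> g /=.
  move=> /arc_orderE[]; rewrite contact_openE => h1 h2; split=> // e _ /=.
  by rewrite trunc_jet_truncate => h; apply: (h2 e (ltn_ord e)); rewrite contact_openE.
move=> [h1 h2]; apply/arc_orderE; rewrite contact_openE; split=> // e ep.
rewrite contact_openE => h; apply: (h2 (Ordinal ep) I) => /=.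
by rewrite trunc_jet_truncate.
Qed.

(** The contact locus is defined at level [p]. By maximality a component equals the preimage of the
    closure, within that locus, of its truncation. *)
Lemma component_cylinder C : irreducible_component (contact_locus p Y) C -> cylinder C.
Proof.
move=> [iC CD maxC]; have [A [F [oA cF eD]]] := contact_locusE.
pose T := closure (truncate p @` C) `&` (A `&` F).
have iI : irreducible (truncate p @` C).
  by apply: irreducible_image => // g _; exact: truncate_continuous.
have iT : irreducible T.
  apply: irreducible_subclosure iI _ _ => [_ [g Cg <-]|t []//]; split.
    by apply: subset_closure; exists g.
  by have := CD g Cg; rewrite eD.
exists p, T; split.
  rewrite /T setIA [closure _ `&` A]setIC -setIA; apply: constructible_open_closed => //.
  by apply: closedI => //; exact: closed_closure.
apply/esym/maxC; first exact: truncate_preimage_irreducible.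
  move=> g Cg; split; first by apply: subset_closure; exists g.
  by have := CD g Cg; rewrite eD.
by move=> g [_ AF]; rewrite eD.
Qed.

(** Arcs of positive contact order are centered on the zero set of [Y], whose complement [O] is open
    and non-empty. *)
Lemma contact_not_dominate C : (1 <= p)%N -> C `<=` contact_locus p Y -> ~ dominates C.
Proof.
move=> p1 CD dom; pose O := [set u | exists2 f, ideal Y u f & f u != 0].
have oO : open O.
  rewrite openE => u [f Yf fu]; have h1 := coherent_near Yf; have h2 := regular_neq0 (ideal_regular Yf) fu.
  by apply: filterS (filterI h1 h2) => v [[_ Yv] fv]; exists f.
have [u [[f Yf fu] [g Cg cg]]] : O `&` (@arc_center _ _ @` C) !=set0.
  apply: dom => //; have [x [f [Yf nf]]] := Yp.
  apply: contrapT => nO; apply: nf; apply: filterS (coherent_near Yf) => u [_ Yu].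
  by apply/eqP/negPn/negP => fu; apply: nO; exists u, f.
rewrite -cg in Yf fu; have [h _] := CD g Cg.
by move/eqP: fu; apply; rewrite -(h f 0%N Yf p1) arc_coef0 //; exact: ideal_regular Yf.
Qed.

Lemma component_exists (T : set arc) : irreducible T -> T `<=` contact_locus p Y ->
  exists2 C, irreducible_component (contact_locus p Y) C & T `<=` C.
Proof.
move=> iT TD; pose good A := [/\ irreducible A, T `<=` A & A `<=` contact_locus p Y].
have [[t Tt] _] := iT.
have [|A [[A0|gA] maxA]] := @Zorn_bigcup arc [set A | A = set0 \/ good A].
{ move=> F FP tot; have [[B FB gB]|none] := pselect (exists2 B, F B & good B); last first.
    left; apply/seteqP; split=> // g [B FB Bg]; have [B0|gB] := FP B FB; first by rewrite B0 in Bg.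
    by case: none; exists B.
  right; have [iB TB BD] := gB; split; last 2 first.
  { by move=> g /TB Bg; exists B. }
  { by move=> g [B' FB' Bg]; have [B0|[_ _]] := FP B' FB'; [rewrite B0 in Bg|exact]. }
  apply: irreducibleP; first by exists t, B => //; exact: TB.
  move=> O1 O2 o1 o2 [g1 [[B1 F1 Bg1] Og1]] [g2 [[B2 F2 Bg2] Og2]].
  have meet B3 : F B3 -> B3 g1 -> B3 g2 -> \bigcup_(X0 in F) X0 `&` (O1 `&` O2) !=set0.
    move=> F3 h1 h2; have [B0|[i3 _ _]] := FP B3 F3; first by rewrite B0 in h1.
    have [g [Bg Og]] := irreducible_meet i3 o1 o2 (ex_intro _ g1 (conj h1 Og1)) (ex_intro _ g2 (conj h2 Og2)).
    by exists g; split=> //; exists B3.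
  by have [le|le] := tot B1 B2 F1 F2; [apply: (meet B2) => //; exact: le|apply: (meet B1) => //; exact: le]. }
{ case: (maxA T); last by right; split.
  by rewrite A0; split=> // h; have := h t Tt. }
have [iA TA AD] := gA; exists A => //; split=> // B iB AB BD.
apply: contrapT => nBA; case: (maxA B); last by right; split=> //; exact: subset_trans AB.
by split=> // BA; apply: nBA; apply/seteqP.
Qed.

End Components.

Section Attained.
Variables (K : numClosedFieldType) (X X' : variety K) (mu : X' -> X).
Hypotheses (smX : smooth X) (iX : irreducible [set: X]).
Variables (Y Z : subscheme X) (N' : nat) (E : 'I_N' -> set X') (r s k : 'I_N' -> nat).
Hypotheses (hres : log_resolution mu Y Z E r s k) (Zp : proper_subscheme Z) (Yp : proper_subscheme Y).
Local Notation arc := (formal_arc X).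

Lemma lct_attained (beta alpha : rat) : 0 <= alpha ->
  (forall i, alpha * (r i)%:R - beta * (s i)%:R <= (k i)%:R + 1) ->
  (forall a, 0 <= a /\ (forall i, a * (r i)%:R - beta * (s i)%:R <= (k i)%:R + 1) -> a <= alpha) ->
  exists2 i, (0 < r i)%N & (k i)%:R + 1 + beta * (s i)%:R = alpha * (r i)%:R.
Proof.
move=> a0 adm amax; apply: contrapT => none.
pose sl i : rat := (k i)%:R + 1 - (alpha * (r i)%:R - beta * (s i)%:R).
have sl0 i : (0 < r i)%N -> 0 < sl i.
  move=> ri; rewrite lt_def subr_ge0 adm andbT; apply/eqP => e0; apply: none; exists i => //.
  by move/eqP: e0; rewrite subr_eq0 => /eqP ->; rewrite subrK.
(* If every constraint with [r i > 0] were strict, [alpha] could be increased by [S^-1], since each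
   slack [sl i] is at least [r i / S]. The summand 1 keeps [S] positive even when the sum is
   empty. *)
pose S := 1 + \sum_(i | (0 < r i)%N) (r i)%:R / sl i.
have ge0 i : (0 < r i)%N -> 0 <= (r i)%:R / sl i by move=> ri; rewrite divr_ge0 // ltW // sl0.
have S1 : 1 <= S by rewrite lerDl sumr_ge0.
have S0 : 0 < S by exact: lt_le_trans S1.
have : ~~ (alpha + S^-1 <= alpha) by rewrite gerDl -ltNge invr_gt0.
move=> /negP; apply; apply: amax; split=> [|i]; first by rewrite addr_ge0 // invr_ge0 ltW.
have [r0|ri] := posnP (r i); first by have := adm i; rewrite r0 !mulr0.
have : S^-1 * (r i)%:R <= sl i.
  rewrite mulrC ler_pdivrMr // -ler_pdivrMl ?sl0 // mulrC /S (bigD1 i) //= addrCA lerDl.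
  by rewrite addr_ge0 // sumr_ge0 // => l /andP[rl _]; exact: ge0.
by rewrite mulrDl /sl; lra.
Qed.

Lemma canonical_dim (z0 : X') d (z : 'I_d -> X' -> K) V' D' d' O (w : 'I_d' -> X -> K) D :
  V' z0 -> chart V' z D' -> O (mu z0) -> chart O w D -> d = d'.
Proof.
move=> Vz hC' Oz hC; have [_ _ _ _ rcan] := hres.
have [d1 [z1 [w1 [D1 [pz1 pw1 _ _ _]]]]] := rcan z0.
have [V1 [Dz1 [V1y hC1]]] := smooth_chart pz1; have [V2 [Dw1 [V2y hC2]]] := smooth_chart pw1.
apply/eqP; rewrite eqn_leq (leq_trans (chart_dim_le hC' hC1 Vz V1y) (chart_dim_le hC2 hC V2y Oz)).
exact: leq_trans (chart_dim_le hC hC2 Oz V2y) (chart_dim_le hC1 hC' V1y Vz).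
Qed.

(* The images of the arcs on X' that meet E i transversally at a general point of E i. *)
Lemma contact_family i : exists T : set arc, [/\ irreducible T,
  forall g, T g -> arc_order g Y (r i) /\ arc_order g Z (s i) &
  forall m (S : set (jet X m)), (forall g, T g -> S (truncate m g)) ->
    exists n Zs, (krull_dim [set: X] * m.+1 <= n + (k i).+1)%N /\ irred_chain S n Zs].
Proof.
have [[smX' [hmu _] _] snc pY pZ rcan] := hres; have [sncE sncz] := snc.
have clE l : closed (E l) by have [] := sncE l.
have iE : irreducible (E i) by have [] := sncE i.
have [q0 Eq0 nEq0] : exists2 q0, E i q0 & forall l, l != i -> ~ E l q0.
  have [|V [oV [q0 [Eq0 Vq0]] hV]] := @irreducible_avoid _ _ (E i) [seq E l | l <- enum 'I_N' & l != i] iE.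
    by move=> B /mapP[l]; rewrite mem_filter => /andP[li _] ->; split=> //; apply: snc_not_sub snc _; rewrite eq_sym.
  by exists q0 => // l li; apply: hV Vq0 _ _; apply: map_f; rewrite mem_filter li mem_enum.
have [d0 [z [j [pz _ hin]]]] := sncz q0.
have [V' [D' [V'q hC']]] := smooth_chart pz.
have [O [d [w [D [Oq hC]]]]] := chart_at smX (mu q0).
have [U [N [x [hx Uq]]]] := affine_coord_at (mu q0).
have [U' [L [x' [hx' U'q]]]] := affine_coord_at q0.
have ed := canonical_dim V'q hC' Oq hC.
move: z j pz hin D' hC'; rewrite {d0}ed => z j pz hin D' hC'.
have -> : krull_dim [set: X] = d.
  have [d1 [z1 pz1]] := smX (mu q0).
  by rewrite (krull_dim_smooth smX iX pz1) (chart_parameters_dim iX pz1 hC).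
pose good y := [/\ V' y, U (mu y) /\ O (mu y), forall l, l != i -> ~ E l y &
  E i y -> local_equation y (E i) (z (j i))].
have gn : nbhs q0 [set y | good y].
  have cmu : {for q0, continuous mu} by have [] := hmu q0 I.
  have n1 : \forall y \near q0, V' y by exact: open_nbhs_nbhs (conj (ch_open hC') V'q).
  have n2 : \forall y \near q0, U (mu y).
    by apply: cmu; exact: open_nbhs_nbhs (conj (ac_open hx) Uq).
  have n3 : \forall y \near q0, O (mu y).
    by apply: cmu; exact: open_nbhs_nbhs (conj (ch_open hC) Oq).
  have n4 : \forall y \near q0, forall l, l != i -> ~ E l y.
    apply: filter_forall => l; have [->|li] := eqVneq l i; first by apply: nearW.
    have oE : open (~` E l) by rewrite openC; exact: clE.
    have := open_nbhs_nbhs (conj oE (nEq0 l li)); exact: filterS.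
  have n5 := local_equation_near (hin i Eq0).
  by apply: filterS (filterI n1 (filterI n2 (filterI n3 (filterI n4 n5)))) => y [h1 [h2 [h3 [h4 h5]]]].
have [h [hq0 Hh]] := ac_near_set hx' U'q gn.
(* [h] keeps the center where [good] holds, and the second factor is the coefficient of order 1 of
   [z (j i)], non-zero for a transversal arc. The level [m] enters through the index type only, so
   the family is the same at all levels. *)
pose b m : mpoly #|chart_index L d m.+1| K := subst_poly (fun l => enum_rank (inl l : chart_index L d m.+1)) h *
  mpolyX K (mnm1 (enum_rank (inr (j i, ord0) : chart_index L d m.+1))).
have bE m y u : meval (chart_coord x' (M := m.+1) y u) (b m) = meval (x' y) h * u (j i) 1%N.
  rewrite mevalM mevalXU meval_subst /chart_coord enum_rankK; congr (meval _ h * _).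
  by apply/funext => l; rewrite enum_rankK.
have hb m y u : U' y -> meval (chart_coord x' (M := m.+1) y u) (b m) != 0 ->
  [/\ V' y, U (mu y) /\ O (mu y), forall l, l != i -> ~ E l y,
      E i y -> local_equation y (E i) (z (j i)) & u (j i) 1%N != 0].
  by move=> Uy; rewrite bE mulf_eq0 negb_or => /andP[hy u0]; have [] := Hh y Uy hy.
(* The line through [q0] in the direction of [z (j i)], which is a transversal arc. *)
pose c0 l : pser K := fun e => if e is e'.+1 then ((e' == 0%N) && (l == j i))%:R else z l q0.
have [p0 [cp ep]] := arc_exists hC' (c := c0) V'q (fun=> erefl).
have b0 m : meval (arc_chart_coord x' z (M := m.+1) p0) (b m) != 0.
  by rewrite bE cp ep /c0 !eqxx mulr1.
have Pp0 m : contact_arcs E i U' x' V' z (b m) p0.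
  by split; [rewrite /over_chart /= cp|rewrite cp].
pose Phi := contact_arcs E i U' x' V' z (b 0%N).
have eqnP q l (Pq : Phi q) := contact_eqnP clE (hb 0%N) l Pq.
exists (push hmu @` Phi); split.
{ apply: irreducible_image => [|q _]; last exact: push_continuous.
  exact: (contact_irreducible smX' iE hx' hC' (Pp0 0%N)). }
{ move=> _ [q Pq <-].
  by split; apply/(push_order hmu (fun l => eqnP q l Pq)) => //; exact: (contact_eqn_ord hC' (hb 0%N)). }
move=> m S hS; pose W : set (formal_arc X') := [set q | over_chart U' V' q /\ (U (mu (arc_center q)) /\ O (mu (arc_center q)))].
have hc : arc_coord (arc_chart_coord x' z (M := m.+1)) W m.+2 by apply: (chart_arc_coord hx' hC') => q [].
have Wp0 : W p0 by rewrite /W /over_chart /= cp.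
have rw q p : W q -> regular (arc_center q) (w p \o mu).
  by move=> [_ [_ Oy]]; apply: (morphism_regular hmu); exact: (ch_reg hC p Oy).
have rx q l : W q -> regular (mu (arc_center q)) (fun y => x y l).
  by move=> [_ [Uy _]]; exact: regular_coord hx Uy.
have /choice[PQ hPQ] : forall a, exists PQ, rat_rep (arc_chart_coord x' z (M := m.+1)) W p0
    (fun q => ext_coord hmu x w (m := m) q a) PQ.1 PQ.2.
  move=> a; suff [P [Q hP]] : rat_at (arc_chart_coord x' z (M := m.+1)) W p0 (fun q => ext_coord hmu x w (m := m) q a).
    by exists (P, Q).
  rewrite /ext_coord; case: (enum_val a) => [[l|[p e]]|[p e]].
  { apply: rat_ext (acc_rat hc Wp0 (morphism_regular hmu (rx p0 l Wp0)) (ltn0Sn _)) => q Wq.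
    by rewrite /arc_chart_coord /chart_coord enum_rankK arc_coef0 //; apply: (morphism_regular hmu); exact: rx. }
  { apply: rat_ext (acc_rat hc Wp0 (rw p0 p Wp0) (_ : e.+1 < m.+2)%N) => [q Wq|]; last by rewrite ltnS; exact: leqW (ltn_ord e).
    rewrite /arc_chart_coord /chart_coord enum_rankK -[LHS]/(arc_ser (push hmu q) (w p) e.+1) push_ser //.
    by have [_ [_ Oy]] := Wq; exact: (ch_reg hC p Oy). }
  { exact: (acc_rat hc Wp0 (rw p0 p Wp0) (leqW (ltn_ord e))). }
(* At level [m] the family is shrunk so that the image coordinates are fractions with denominators
   that vanish nowhere on it. The smaller family still maps into [S], which is all that a lower
   bound for the dimension of [S] requires. *)
pose b' := b m * \prod_a (PQ a).2.
have b'E v : meval v b' = meval v (b m) * \prod_a meval v (PQ a).2.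
  by rewrite mevalM; congr (_ * _); exact: (rmorph_prod (meval v)).
have b'1 v : meval v b' != 0 -> meval v (b m) != 0 /\ forall a, meval v (PQ a).2 != 0.
  rewrite b'E mulf_eq0 negb_or => /andP[-> nz]; split=> // a.
  by move: nz; apply: contra => /eqP h0; rewrite (bigD1 a) //= h0 mul0r.
have hb' y u (Uy : U' y) (h' : meval (chart_coord x' (M := m.+1) y u) b' != 0) := hb m y u Uy (b'1 _ h').1.
have sub q : contact_arcs E i U' x' V' z b' q -> Phi q.
  move=> [Oq' [Eq /b'1[bq _]]]; split=> //; split=> //.
  by move: bq; rewrite /arc_chart_coord !bE.
have hr q a : contact_arcs E i U' x' V' z b' q -> meval (arc_chart_coord x' z q) (PQ a).2 != 0 /\
    ext_coord hmu x w q a * meval (arc_chart_coord x' z q) (PQ a).2 = meval (arc_chart_coord x' z q) (PQ a).1.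
  move=> Pq; have [[Uq' Vq'] [_ /b'1[bq /(_ a) Qa]]] := Pq; split=> //.
  by have [_] := hPQ a; apply => //; have [_ hU _ _ _] := hb m _ _ Uq' bq; split.
have Pp : contact_arcs E i U' x' V' z b' p0.
  have [h1 [h2 _]] := Pp0 m; split=> //; split=> //; rewrite b'E mulf_neq0 //.
  by apply/prodf_neq0 => a _; have [] := hPQ a.
have cch := contact_chain smX' rcan clE iE hx hC hx' hC' hb' hr Pp.
by apply: cch => q Pq; apply: hS; exists q => //; exact: sub.
Qed.

(** For the component that contains the family, the order along [Z] is at most [s i] by openness of
    [contact_open] and the codimension at most [k i + 1]. Together with the lower bound for all
    cylinders the inequality is enough. *)
Lemma contact_ratio_attained (beta alpha : rat) i : 0 <= beta -> (0 < r i)%N ->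
  (k i)%:R + 1 + beta * (s i)%:R = alpha * (r i)%:R ->
  exists2 C, irreducible_component (contact_locus (r i) Y) C & (contact_ratio Y Z beta C <= alpha%:E)%E.
Proof.
move=> b0 ri al; have [T [iT oT dT]] := contact_family i.
have [|C hC TC] := @component_exists _ _ Y (r i) T iT; first by move=> g /oT[].
exists C => //; have [iC CD _] := hC; have cC := component_cylinder smX hC.
have [C0 _] := iC; have [[t Tt] _] := iT.
have oY : cylinder_order C Y = r i.
  have [W [_ _ [g CWg] hW]] := generic_order_proper smX iX cC C0 Yp.
  by apply: arc_order_uniq (hW g CWg) _; apply: CD; case: CWg.
have oZ : (cylinder_order C Z <= s i)%N.
  have [W [oW _ CW hW]] := generic_order_proper smX iX cC C0 Zp.
  have tZ : C `&` contact_open Z (s i) !=set0.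
    by exists t; split; [exact: TC|have [_ /arc_orderE[]] := oT t Tt].
  have [g [Cg [Wg Zg]]] := irreducible_meet iC oW (contact_open_open Z (s i)) CW tZ.
  have /arc_orderE[_ none] := hW g (conj Cg Wg).
  by rewrite leqNgt; apply/negP => lt; exact: (none _ lt).
rewrite /contact_ratio oY -[_ == 0%N]negbK -lt0n ri /= lee_fin ler_pdivrMr ?ltr0n // -al.
apply: lerD; last by apply: ler_wpM2l; rewrite // ler_nat.
have [m [S [eC ->]]] := codim_presentation cC.
have [_ [mx _]] := krull_dim_cylinder smX iX hres Zp Yp cC iC eC.
have [|n [Zs [le hZ]]] := dT m S; first by move=> g /TC; rewrite eC.
have le2 : (m.+1 * krull_dim [set: X] <= (k i).+1 + krull_dim S)%N.
  by rewrite mulnC (leq_trans le) // addnC leq_add2l (mx n Zs).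
by rewrite rmorphB /= -!pmulrn lerBlDr natr1 -natrD ler_nat.
Qed.

End Attained.

Lemma contact_ratio_minimum (K : numClosedFieldType) (X : variety K) (Y Z : subscheme X) (beta alpha : rat) :
  smooth X -> connected [set: X] -> proper_subscheme Y -> proper_subscheme Z -> 0 <= beta ->
  is_lct Y Z beta alpha ->
  (forall C, cylinder C -> irreducible C -> (alpha%:E <= contact_ratio Y Z beta C)%E) /\
  exists p C, [/\ (1 <= p)%N, irreducible_component (contact_locus p Y) C & contact_ratio Y Z beta C = alpha%:E].
Proof.
move=> smX cX Yp Zp b0 [X' [mu [N [E [r [s [k [hres [[a0 adm] amax]]]]]]]]].
have iX : irreducible [set: X].
  by have [x _] := Yp; apply: connected_irreducible smX cX _; exists x.
have ge C := contact_ratio_ge smX iX hres Zp Yp adm (C := C).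
split=> //; have [i ri al] := lct_attained a0 adm amax.
have [C hC le] := contact_ratio_attained smX iX hres Zp Yp b0 ri al.
exists (r i), C; split=> //; apply/le_anti; rewrite le ge //; last by case: hC.
exact: component_cylinder hC.
Qed.

Theorem corollary3p5 (R : realType) (X : variety R[i])
    (X_smooth : smooth X) (X_connected : connected [set: X])
    (Y Z : subscheme X) (Y_proper : proper_subscheme Y)
    (Z_proper : proper_subscheme Z) (Y_nonempty : zero_locus Y !=set0)
    (beta : rat) (beta_ge0 : 0 <= beta)
    (alpha : rat) (alpha_lct : is_lct Y Z beta alpha) :
  is_minimum
    [set contact_ratio Y Z beta C | C in
      [set C : set (formal_arc X) | [/\ cylinder C, irreducible C & ~ dominates C]]]
    alpha%:E /\
  is_minimum
    [set contact_ratio Y Z beta C | C in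
      [set C : set (formal_arc X) | exists2 p : nat, (1 <= p)%N &
         irreducible_component (contact_locus p Y) C]]
    alpha%:E.
Proof.
have [ge [p [C [p1 hC eC]]]] := contact_ratio_minimum X_smooth X_connected Y_proper Z_proper beta_ge0 alpha_lct.
have [iC CD _] := hC; have cC := component_cylinder X_smooth hC.
split; split.
- exists C => //; split=> //; exact: (contact_not_dominate Y_proper p1 CD).
- by move=> _ [B [cB iB _] <-]; exact: ge.
- by exists C => //; exists p.
- move=> _ [B [q q1 hB] <-]; apply: ge; last by case: hB.
  exact: component_cylinder hB.
Qed.
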